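(* Let $X$, $\mathfrak{X}$, $Y$, $\infty$, $\overline{\infty}$, $\delta$, $d$, $\zeta_d$, $\mathcal{N}_0$, $e^{(1)}_{11}$, $D_*$ be as in the context. Let $D$ be a divisor on $X$ such that $\delta^*(D)=D$, $\deg D=0$ and $\mathrm{Supp}(D)\cap D_*=\emptyset$, and let $\mathcal{L}:=\mathcal{O}_X(D)$, with specialization $\bar{\mathcal{L}}\in\mathrm{Pic}(Y)$. Suppose $WG_\infty(X)=WG_{\overline{\infty}}(Y)$, $WG_\infty(\mathcal{L})=WG_{\overline{\infty}}(\bar{\mathcal{L}})$, $e_{11}^{(1)}\in O_K^*$, $p\equiv1\bmod d$ and $d\ge2g+1$. Then for every $n\in\mathbb{Z}_{>0}$, $$\mathrm{Jac}(X)[p^n]_1\cap(\Theta-\mathcal{L})\subset\{0\}.$$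
   Context: $p$ is a prime, $K$ a finite extension of $\mathbb{Q}_p$, $O_K$ its ring of integers, $\mathbb{F}$ its residue field. $\mathfrak{X}\to\mathrm{Spec}\,O_K$ is smooth projective of relative dimension one with geometrically connected fibers, generic fiber $X$ of genus $g\ge2$, special fiber $Y$, and with a section $\widetilde{\infty}$ whose generic and closed points are $\infty\in X(K)$, $\overline{\infty}\in Y(\mathbb{F})$. $\delta:X\to X$ is an automorphism over $K$ of order $d$ with $\delta(\infty)=\infty$; $\zeta_d:=(t/\delta^*(t))(\infty)$ for any uniformizer $t$ at $\infty$ (when $p\equiv 1\bmod d$ and $d\ge 2g-1$ this is a primitive $d$-th root of unity, lying in $\mathbb{Z}_p$). Trivialization: fix an isomorphism of $O_K$-algebras $\mathcal{N}_0:\hat{\mathcal{O}}_{\mathfrak{X},\overline{\infty}}\cong O_K[[\frac1T]]$ such that the ideal of $\widetilde{\infty}$ corresponds to $(\frac1T)$, chosen so that the automorphism of $\hat{\mathcal O}_{\mathfrak X,\overline\infty}$ induced by $\delta^*$ corresponds to $\sum a_iT^i\mapsto\sum a_i(\zeta_dT)^i$ (such a choice exists). It induces $\hat{\mathcal{O}}_{X,\infty}\cong K[[\frac1T]]$ and an embedding of the function field $K(X)$ in $K((\frac1T))$; let $A\subset K((\frac1T))$ be the image of $H^0(X\setminus\{\infty\},\mathcal{O}_X)$. Gap sequences: for a curve $C$ with rational point $P$ and a degree-$0$ invertible sheaf $\mathcal{M}$ on $C$, $WG_P(\mathcal{M}):=\{n\in\mathbb{Z}_{\ge0} : H^0(C,\mathcal{M}(nP))=H^0(C,\mathcal{M}((n-1)P))\}$,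 and $WG_P(C):=WG_P(\mathcal{O}_C)$. Write $WG_\infty(X)=\{\mu_1<\cdots<\mu_g\}$ (so $\mu_1=1$). There is a decomposition $K((\frac1T))=A\oplus\frac1TK[[\frac1T]]\oplus\bigoplus_{i=1}^gKT^{\mu_i}$, and $e^{(1)}_{ij}\in K$ is defined by $T^{\mu_jp}\in\sum_{i=1}^ge^{(1)}_{ij}T^{\mu_i}+A+\frac1TK[[\frac1T]]$. (When $WG_\infty(X)=WG_{\overline\infty}(Y)$ all $e^{(1)}_{ij}$ lie in $O_K$.) $D_*$ is the set of closed points of $X$ other than $\infty$ whose reduction is $\overline{\infty}$. The specialization $\mathrm{Pic}(X)\to\mathrm{Pic}(Y)$, $\mathcal{L}\mapsto\bar{\mathcal{L}}$, is the composition of $\mathrm{Pic}(X)\cong\mathrm{Pic}(\mathfrak{X})$ with restriction to $Y$. $\mathrm{Jac}(X)$ is the group of isomorphism classes of degree-$0$ invertible sheaves on $X$ (written additively); $\mathrm{Jac}(X)[p^n]_1:=\{\mathcal{P}\in\mathrm{Jac}(X) : p^n\mathcal{P}=0,\ \delta^*\mathcal{P}=\zeta_d\mathcal{P}\}$; $\Theta:=\{\mathcal{P}\in\mathrm{Jac}(X) : H^0(X,\mathcal{P}((g-1)\infty))\ne0\}$; $\Theta-\mathcal{L}:=\{\mathcal{P}\in\mathrm{Jac}(X) : \mathcal{P}\otimes\mathcal{L}\in\Theta\}$. *)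

(* Defs.v *)
From HB Require Import structures.
From mathcomp Require Import all_boot all_order all_algebra all_field.
From mathcomp Require Import boolp classical_sets functions cardinality fsbigop.
From mathcomp Require Import mpoly.
Set Implicit Arguments.
Unset Strict Implicit.
Unset Printing Implicit Defensive.
Import Order.TTheory GRing.Theory Num.Theory.
Local Open Scope classical_set_scope.
Local Open Scope ring_scope.

(** An integral separated scheme with function field F is encoded, after
    Zariski and Chevalley, by the set of its local rings, seen as subrings
    of F: a point is a term x : set F, a scheme is a term C : set (set F), and
    the point x specializes to the point y iff y `<=` x.  The schemes X and Y
    are curves in this sense, and the arithmetic surface is a projective model
    in the sense of Zariski and Samuel (Commutative Algebra II, VI.17); being
    smooth over O_K with connected fibres, it is integral, so that this
    encoding loses no generality. *)

Definition ring_hom_on (R S : nzRingType) (A : set R) (phi : R -> S) : Prop :=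
  [/\ phi 1 = 1,
      forall a b, A a -> A b -> phi (a - b) = phi a - phi b &
      forall a b, A a -> A b -> phi (a * b) = phi a * phi b].

Definition padic_abs (p : nat) (x : rat) : rat :=
  if x == 0 then 0
  else p%:R ^ ((logn p `|denq x|)%:Z - (logn p `|numq x|)%:Z).

(** (Qp, absp) is the completion of Q for the p-adic absolute value; absp
    takes its values in {0} and the powers of p, hence the codomain rat. *)
Record is_padic_field (p : nat) (Qp : fieldType) (absp : Qp -> rat) : Prop := {
  absp_ge0 : forall x, 0 <= absp x;
  absp_eq0 : forall x, absp x = 0 <-> x = 0;
  abspM : forall x y, absp (x * y) = absp x * absp y;
  abspD : forall x y, absp (x + y) <= absp x + absp y;
  absp_rat : forall q : rat, absp (ratr q) = padic_abs p q;
  absp_dense : forall x (eps : rat), 0 < eps ->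
    exists q : rat, absp (x - ratr q) < eps;
  absp_complete : forall u : nat -> Qp,
    (forall eps : rat, 0 < eps -> exists N : nat, forall m n : nat,
       (N <= m)%N -> (N <= n)%N -> absp (u m - u n) < eps) ->
    exists l, forall eps : rat, 0 < eps -> exists N : nat, forall n : nat,
       (N <= n)%N -> absp (u n - l) < eps }.

Definition Zp_of (Qp : fieldType) (absp : Qp -> rat) : set Qp :=
  [set x | absp x <= 1].

Definition integral_closure (k : fieldType) (Z : set k) (K : fieldExtType k)
    : set K :=
  [set x | exists P : {poly k},
     [/\ P \is monic, forall i, Z P`_i & root (map_poly (in_alg K) P) x]].

Arguments integral_closure {k} Z K.

Definition OK_of (Qp : fieldType) (absp : Qp -> rat) (K : fieldExtType Qp)
  : set K := integral_closure (Zp_of absp) K.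
Arguments OK_of {Qp} absp K.

Section LocalRings.
Variable F : fieldType.
Implicit Types (O : set F) (h t : F).

Definition unit_in O h : Prop := [/\ h != 0, O h & O h^-1].

Definition max_ideal O : set F := [set h | O h /\ ~ unit_in O h].

Definition max_ideal_pow O (n : nat) : set F :=
  [set h | exists (m : nat) (c : 'I_m -> F) (a : 'I_m -> 'I_n -> F),
     [/\ forall i, O (c i), forall i j, max_ideal O (a i j) &
         h = \sum_(i < m) c i * \prod_(j < n) a i j]].

Definition uniformizer O t : Prop :=
  t != 0 /\ forall h, max_ideal O h <-> O (h / t).

(** The normalized valuation of the discrete valuation ring O is k at h. *)
Definition has_order O h (k : int) : Prop :=
  exists t, uniformizer O t /\ unit_in O (h / t ^ k).

Definition prime_ideal_in (A P : set F) : Prop :=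
  [/\ P `<=` A, P 0, forall a b, P a -> P b -> P (a + b),
      forall a b, A a -> P b -> P (a * b) &
      ~ P 1 /\ forall a b, A a -> A b -> P (a * b) -> P a \/ P b].

Definition localization (A P : set F) : set F :=
  [set h | exists a b, [/\ A a, A b, ~ P b, b != 0 & h = a / b]].

Definition Spec (A : set F) : set (set F) :=
  [set O | exists2 P, prime_ideal_in A P & O = localization A P].

End LocalRings.

Section Divisors.
Variables (F : fieldType) (C : set (set F)).
Implicit Types (x P : set F) (D : set F -> int).

Definition closed_point x : Prop :=
  C x /\ forall y, C y -> y `<=` x -> y = x.

Definition is_divisor D : Prop :=
  (forall x, D x != 0 -> closed_point x) /\ finite_set [set x | D x != 0].

(** Global sections of the invertible sheaf O_C(D), as a subsheaf of the
    constant sheaf F. *)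
Definition H0 D : set F :=
  [set h | forall x, closed_point x ->
     exists2 t, uniformizer x t & x (h * t ^ D x)].

Definition point_divisor P : set F -> int := fun x => (`[< x = P >] : nat)%:Z.

(** D + nP *)
Definition twist D (n : int) P : set F -> int :=
  fun x => D x + n * point_divisor P x.

(** Isomorphism of O_C(D) and O_C(D'). *)
Definition lin_equiv D D' : Prop :=
  exists2 h : F, h != 0 &
    forall x, closed_point x -> has_order x h (D x - D' x).

(** WG_P(O_C(D)) *)
Definition gap_sequence D P : set nat :=
  [set n | H0 (twist D n%:Z P) = H0 (twist D (n%:Z - 1) P)].

Definition zero_divisor : set F -> int := fun=> 0.

End Divisors.

(** sigma is delta^* on the function field, so that the local ring of delta(x)
    is the inverse image by sigma of that of x. *)
Definition pullback_divisor (F : fieldType) (sigma : F -> F)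
  (D : set F -> int) : set F -> int := fun x => D (sigma @^-1` x).

Section CurveOverField.
Variables (K F : fieldType) (iota : {rmorphism K -> F}) (X : set (set F)).

Definition has_residue_degree (x : set F) (m : nat) : Prop :=
  exists b : 'I_m -> F, (forall i, x (b i)) /\
    forall h, x h -> exists! c : {ffun 'I_m -> K},
      max_ideal x (h - \sum_(i < m) iota (c i) * b i).

Definition residue_degree (x : set F) : nat :=
  xget 0%N [set m | has_residue_degree x m].

Definition degree (D : set F -> int) : int :=
  \sum_(x \in [set x | D x != 0]) D x * (residue_degree x)%:Z.

Definition is_repartition (r : set F -> F) : Prop :=
  finite_set [set x | closed_point X x /\ ~ x (r x)].

(** The dimension of H^1(X, O_X) is g.  The flasque resolution
    0 -> O_X -> F -> \bigoplus_x F / O_x -> 0 (skyscrapers at closed points)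
    identifies H^1(X, O_X) with the cokernel of F -> \bigoplus_x F / O_x. *)
Definition has_genus (g : nat) : Prop :=
  exists b : 'I_g -> set F -> F, (forall i, is_repartition (b i)) /\
    forall r, is_repartition r -> exists! c : {ffun 'I_g -> K},
      exists h : F, forall x, closed_point X x ->
        x (r x - \sum_(i < g) iota (c i) * b i x - h).

Definition is_automorphism (sigma : {rmorphism F -> F}) : Prop :=
  [/\ bijective sigma, forall c, sigma (iota c) = iota c &
      forall x, X x <-> X (sigma @^-1` x)].

Definition Theta (g : nat) (oo : set F) (P : set F -> int) : Prop :=
  [/\ is_divisor X P, degree P = 0 &
      exists2 h, h != 0 & H0 X (twist P (g%:Z - 1) oo) h].

(** zeta is a p-adic integer; it acts on p^n-torsion through its class z
    modulo p^n. *)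
Definition Jac_ptorsion1 (OK : set K) (p n : nat) (sigma : {rmorphism F -> F})
    (zeta : K) (P : set F -> int) : Prop :=
  [/\ is_divisor X P, degree P = 0,
      lin_equiv X (fun x => (p ^ n)%N%:Z * P x) (@zero_divisor F) &
      exists2 z : int, OK ((zeta - z%:~R) / p%:R ^+ n) &
        lin_equiv X (pullback_divisor sigma P) (fun x => z * P x)].

End CurveOverField.

Definition has_order_aut (F : fieldType) (sigma : F -> F) (d : nat) : Prop :=
  [/\ (0 < d)%N, iter d sigma =1 id &
      forall k, (0 < k < d)%N -> ~ (iter k sigma =1 id)].

(** The model is the closed integral subscheme of the projective space of
    dimension r over OK whose generic point has homogeneous coordinates f. *)

Section Model.
Variables (K F : fieldType) (OK : set K) (iota : {rmorphism K -> F}).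
Variables (r : nat) (f : 'I_r.+1 -> F).

Definition poly_over : set {mpoly K[r.+1]} := [set P | forall m, OK P@_m].

Definition eval (i : 'I_r.+1) (P : {mpoly K[r.+1]}) : F :=
  mmap iota (fun j => f j / f i) P.

Definition chart_ring (i : 'I_r.+1) : set F := (eval i) @` poly_over.

Definition chart_ideal (i : 'I_r.+1) : set {mpoly K[r.+1]} :=
  [set P | poly_over P /\ eval i P = 0].

Definition chart (i : 'I_r.+1) : set (set F) :=
  [set x | f i != 0 /\ Spec (chart_ring i) x].

Definition model : set (set F) := [set x | exists i, chart i x].

Definition is_function_field : Prop :=
  (exists i, f i != 0) /\ forall i, f i != 0 -> forall h : F,
    exists a b, [/\ chart_ring i a, chart_ring i b, b != 0 & h = a / b].

(** Jacobian criterion (Bosch, Luetkebohmert and Raynaud, Neron Models, 2.2)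
    for the closed immersion of a chart in affine space of dimension r.+1:
    near x the ideal is generated by r elements, whose differentials are
    linearly independent at x. *)
Definition smooth_dim1_at (i : 'I_r.+1) (x : set F) : Prop :=
  exists G : 'I_r -> {mpoly K[r.+1]},
  [/\ forall k, chart_ideal i (G k),
      forall H, chart_ideal i H -> exists s (c : 'I_r -> {mpoly K[r.+1]}),
        [/\ poly_over s, unit_in x (eval i s), forall k, poly_over (c k) &
            s * H = \sum_(k < r) c k * G k] &
      exists j0 : 'I_r.+1,
        unit_in x (\det (\matrix_(k < r, l < r)
                            eval i ((G k)^`M(lift j0 l))))].

Definition smooth_dim1 : Prop :=
  forall i x, chart i x -> smooth_dim1_at i x.

(** The closed subset of projective space over Omega underlying the fibre of
    the model at the geometric point phi : OK -> Omega. *)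
Definition geometric_fiber (Omega : closedFieldType) (phi : K -> Omega)
    : set ('I_r.+1 -> Omega) :=
  [set v | (exists i, v i != 0) /\
     forall (P : {mpoly K[r.+1]}) n, poly_over P -> P \is n.-homog ->
       mmap iota f P = 0 -> mmap phi v P = 0].

Definition hom_zeros (Omega : closedFieldType) (S : set {mpoly Omega[r.+1]})
    : set ('I_r.+1 -> Omega) :=
  [set v | forall P n, S P -> P \is n.-homog -> P.@[v] = 0].

Definition zariski_connected (Omega : closedFieldType)
    (V : set ('I_r.+1 -> Omega)) : Prop :=
  V !=set0 /\
  forall S1 S2 : set {mpoly Omega[r.+1]},
    V `<=` hom_zeros S1 `|` hom_zeros S2 ->
    V `&` hom_zeros S1 `&` hom_zeros S2 = set0 ->
    V `<=` hom_zeros S1 \/ V `<=` hom_zeros S2.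

Definition geometrically_connected_fibers : Prop :=
  forall (Omega : closedFieldType) (phi : K -> Omega),
    ring_hom_on OK phi -> zariski_connected (geometric_fiber phi).

Definition is_smooth_projective_curve : Prop :=
  [/\ is_function_field, smooth_dim1 & geometrically_connected_fibers].

Definition generic_fiber : set (set F) :=
  [set x | model x /\ forall c, x (iota c)].

Definition special_points : set (set F) :=
  [set x | model x /\
     forall c, OK c -> (max_ideal OK c <-> max_ideal x (iota c))].

Definition is_special_generic_point (eta : set F) : Prop :=
  special_points eta /\ forall y, special_points y -> y `<=` eta.

(** FY is the function field of the special fibre, as the residue field of its
    generic point eta by means of rho : eta -> FY. *)
Definition is_residue_field (eta : set F) (FY : fieldType) (rho : F -> FY)
    : Prop :=
  [/\ ring_hom_on eta rho, rho @` eta = setT &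
      forall h, eta h -> (rho h = 0 <-> max_ideal eta h)].

(** As the special fibre is reduced, its local ring at y is the image of y in
    the residue field of eta. *)
Definition special_fiber (FY : fieldType) (rho : F -> FY) : set (set FY) :=
  [set z | exists2 y, special_points y & z = rho @` y].

(** A section Spec OK -> model with generic point ooX and closed point ooY. *)
Definition is_section (ooX ooY : set F) : Prop :=
  [/\ generic_fiber ooX, special_points ooY, ooY `<=` ooX,
      forall h, ooX h -> exists c, max_ideal ooX (h - iota c) &
      forall h c, ooY h -> max_ideal ooX (h - iota c) ->
        OK c /\ (unit_in ooY h <-> unit_in OK c)].

(** The divisor DY on the special fibre Y represents the restriction to Y of
    the invertible sheaf of the model which extends O_X(D): at every closed
    point y of Y, DY is cut out by the reduction of a local equation h at y of
    the closure of D. *)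
Definition specializes (eta : set F) (FY : fieldType) (rho : F -> FY)
    (D : set F -> int) (DY : set FY -> int) : Prop :=
  is_divisor (special_fiber rho) DY /\
  forall y, special_points y -> closed_point (special_fiber rho) (rho @` y) ->
    exists h, [/\ unit_in eta h,
      forall x, closed_point generic_fiber x -> y `<=` x -> has_order x h (D x)
      & has_order (rho @` y) (rho h) (DY (rho @` y))].

(** The set D_*. *)
Definition residue_disk (ooX ooY : set F) : set (set F) :=
  [set x | [/\ closed_point generic_fiber x, x <> ooX & ooY `<=` x]].

(** H^0 of the complement of ooX in X. *)
Definition affine_ring (ooX : set F) : set F :=
  [set h | forall x, closed_point generic_fiber x -> x <> ooX -> x h].

End Model.

(** Laurent series in 1/T are functions mapping i to the coefficient of T^i *)

Section Laurent.
Variables (K F : fieldType) (OK : set K) (iota : {rmorphism K -> F}).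

Definition degT_le (s : int -> K) (M : int) : Prop := forall i, M < i -> s i = 0.

Definition is_laurent (s : int -> K) : Prop := exists M, degT_le s M.

Definition is_laurent_product (s t u : int -> K) : Prop :=
  forall M N : int, degT_le s M -> degT_le t N ->
    degT_le u (M + N) /\
    forall n : nat, u (M + N - n%:Z) =
      \sum_(i < n.+1) s (M - i%:Z) * t (N - (n - i)%N%:Z).

(** E is a morphism of K-algebras from F to K((1/T)). *)
Definition is_laurent_embedding (E : F -> int -> K) : Prop :=
  [/\ forall h, is_laurent (E h),
      forall c i, E (iota c) i = if i == 0 then c else 0,
      forall a b i, E (a + b) i = E a i + E b i &
      forall a b, is_laurent_product (E a) (E b) (E (a * b))].

Definition integral_series : set (int -> K) :=
  [set s | degT_le s 0 /\ forall i, OK (s i)].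

(** The n-th power of the maximal ideal (m, 1/T) of OK[[1/T]]. *)
Definition series_max_pow (n : nat) : set (int -> K) :=
  [set s | integral_series s /\
     forall i : nat, (i < n)%N -> max_ideal_pow OK (n - i) (s (- i%:Z))].

(** The restriction of E to the local ring y factors through an isomorphism
    from the completion of y to OK[[1/T]]. *)
Definition is_completion (y : set F) (E : F -> int -> K) : Prop :=
  [/\ forall h, y h -> integral_series (E h),
      forall n h, y h -> (max_ideal_pow y n h <-> series_max_pow n (E h)) &
      forall n s, integral_series s ->
        exists2 h, y h & series_max_pow n (fun i => s i - E h i)].

(** E is the embedding of the function field in K((1/T)) induced by an
    admissible trivialization; E and the trivialization determine each other,
    since F is the fraction field of ooY. *)
Definition is_trivialization (ooX ooY : set F) (sigma : F -> F) (zeta : K)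
    (E : F -> int -> K) : Prop :=
  [/\ is_laurent_embedding E, is_completion ooY E,
      forall h, ooY h -> (max_ideal ooX h <-> E h 0 = 0) &
      forall h, ooY h ->
        ooY (sigma h) /\ forall i, E (sigma h) i = zeta ^ i * E h i].

(** T^(p mu_j) is congruent to the sum of the e_ij T^(mu_i) modulo the sum of
    (the image by E of) A and (1/T) K[[1/T]]. *)
Definition is_e1_matrix (A : set F) (E : F -> int -> K) (p g : nat)
    (mu : 'I_g -> nat) (e : 'M[K]_g) : Prop :=
  forall j, exists2 a, A a & forall k : nat,
    (k == mu j * p)%N%:R =
    \sum_(i < g) e i j * (k == mu i)%:R + E a k%:Z.

End Laurent.

Definition enumerates (W : set nat) (g : nat) (mu : 'I_g -> nat) : Prop :=
  (forall i j : 'I_g, (i < j)%N -> (mu i < mu j)%N) /\ range mu = W.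

(* Main.v *)
From HB Require Import structures.
Require Import Defs.
From mathcomp Require Import all_boot all_order all_algebra all_field.
From mathcomp Require Import boolp classical_sets functions cardinality fsbigop.
From mathcomp Require Import mpoly finmap ring zify.
Set Implicit Arguments.
Unset Strict Implicit.
Unset Printing Implicit Defensive.
Import Order.TTheory GRing.Theory Num.Theory.
Local Open Scope classical_set_scope.
Local Open Scope ring_scope.

(** Write p^n P = div f.  The eigenvalue condition makes the reduction of f a
    p^n-th power: a pole of order i of the error term would force d | i + 1,
    whereas counting sections bounds i by 2g - 1.  So P reduces to 0 and, up to
    a function, has a local equation t at the section with t = exp (x T) modulo
    x^(2g), the coordinates other than x being smaller by the eigenvalue
    condition.  If x vanishes to every order, P is trivial by completeness.
    Otherwise scaling T by x turns a section of P + D + (g-1) oo into a nonzero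
    polynomial of degree < g vanishing at the g gaps of D, all less than p. *)

(** * Subrings of a field, local rings, discrete valuation rings *)

Section Subrings.
Variable F : fieldType.
Implicit Types (A O : set F) (a b h t u : F) (k l : int).

(** Write A0 for the functions regular off oo and integral on the special fibre, R for the local
    ring at the closed point of the section, and Om for the union of the T^N R. A class with trivial
    reduction is seen through a local equation t in Om, up to factors from A0 and R. Equality of the
    gap sequences of the two fibres gives Om = A0 + R + sum of OK T^(mu i): these are the
    coordinates of the class. As sigma multiplies T^(mu i) by zeta^(mu i), and every gap is less
    than 2g while d > 2g, only mu i = 1 is compatible with the eigenvalue zeta. Since d divides p -
    1, also p > 2g, so that exp truncated at degree 2g is integral and distinct gaps stay distinct
    modulo p. The genus is the only cohomological input. Dimensions are encoded by sets of pole
    orders at oo: the index of such a set, missing n >= 0 minus present n < 0, plays the part of an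
    Euler characteristic, and completeness of OK replaces semicontinuity between the fibres. The
    bound 2g - 1 reflects that differentials have degree 2g - 2; it is obtained by counting
    combinations of p-th powers. *)

Record subring A : Prop := Subring {
  sr1 : A 1;
  srB : forall a b, A a -> A b -> A (a - b);
  srM : forall a b, A a -> A b -> A (a * b) }.

Section Theory.
Variable A : set F.
Hypothesis sA : subring A.
Lemma sr0 : A 0. Proof. by rewrite -(subrr 1); exact: srB (sr1 sA) (sr1 sA). Qed.
Lemma srN a : A a -> A (- a).
Proof. by move=> Aa; rewrite -sub0r; apply: srB => //; apply: sr0. Qed.
Lemma srD a b : A a -> A b -> A (a + b).
Proof. by move=> Aa Ab; rewrite -[b]opprK; apply: srB => //; apply: srN. Qed.
Lemma sr_sum (I : Type) (r : seq I) (P : pred I) (G : I -> F) :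
  (forall i, P i -> A (G i)) -> A (\sum_(i <- r | P i) G i).
Proof.
by move=> AG; elim/big_rec: _ => [|i x Pi Ax]; [exact: sr0 | apply: srD; auto].
Qed.
Lemma sr_prod (I : Type) (r : seq I) (P : pred I) (G : I -> F) :
  (forall i, P i -> A (G i)) -> A (\prod_(i <- r | P i) G i).
Proof.
by move=> AG; elim/big_rec: _ => [|i x Pi Ax]; [exact: sr1 | apply: srM; auto].
Qed.
Lemma srX a n : A a -> A (a ^+ n).
Proof.
by move=> Aa; elim: n => [|n IH]; [exact: sr1 | rewrite exprS; apply: srM].
Qed.
Lemma srMn a n : A a -> A (a *+ n).
Proof.
by move=> Aa; elim: n => [|n IH]; [exact: sr0 | rewrite mulrS; apply: srD].
Qed.
Lemma sr_nat n : A n%:R. Proof. by apply: srMn; apply: sr1. Qed.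
Lemma sr_int (n : int) : A n%:~R.
Proof. by case: n => n; rewrite ?NegzE ?mulrNz; [|apply: srN]; exact: sr_nat. Qed.

Lemma unit1 : unit_in A 1.
Proof. by split; rewrite ?oner_neq0 ?invr1 //; apply: sr1. Qed.
Lemma unitM a b : unit_in A a -> unit_in A b -> unit_in A (a * b).
Proof.
case=> a0 Aa Aa' [b0 Ab Ab']; split; first by rewrite mulf_neq0.
  exact: srM.
by rewrite invfM; apply: srM.
Qed.
Lemma unitV a : unit_in A a -> unit_in A a^-1.
Proof. by case=> a0 Aa Aa'; split; rewrite ?invr_eq0 ?invrK. Qed.
Lemma unitX a n : unit_in A a -> unit_in A (a ^+ n).
Proof.
by move=> ua; elim: n => [|n IH]; [exact: unit1 | rewrite exprS; exact: unitM].
Qed.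
Lemma unitXz a k : unit_in A a -> unit_in A (a ^ k).
Proof.
move=> ua; case: k => n; first exact: unitX.
by rewrite NegzE; apply: unitV; apply: unitX.
Qed.
Lemma unitN a : unit_in A a -> unit_in A (- a).
Proof.
case=> a0 Aa Aa'; split; first by rewrite oppr_eq0.
  exact: srN.
by rewrite invrN; apply: srN.
Qed.
Lemma unit_or_max a : A a -> unit_in A a \/ max_ideal A a.
Proof. by move=> Aa; have [u|u] := EM (unit_in A a); [left|right]. Qed.
Lemma unit_divl a b : A a -> A b -> unit_in A (a * b) -> unit_in A a.
Proof.
move=> Aa Ab [ab0 _ Aab']; move: (ab0); rewrite mulf_eq0 negb_or => /andP[a0 b0].
split=> //; have -> : a^-1 = b * (a * b)^-1 by field; rewrite b0.
exact: srM.
Qed.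
Lemma maxMr a b : max_ideal A a -> A b -> max_ideal A (a * b).
Proof.
move=> [Aa ua] Ab; split; first exact: srM.
by move=> /(unit_divl Aa Ab).
Qed.
Lemma maxMl a b : A a -> max_ideal A b -> max_ideal A (a * b).
Proof. by move=> Aa mb; rewrite mulrC; apply: maxMr. Qed.
Lemma max0 : max_ideal A 0.
Proof. by split; [exact: sr0 | case; rewrite eqxx]. Qed.
Lemma not_max1 : ~ max_ideal A 1. Proof. by case=> _; apply; exact: unit1. Qed.
Lemma unit_not_max a : unit_in A a -> ~ max_ideal A a. Proof. by move=> u []. Qed.
Lemma max_unit_mul a b : unit_in A b -> max_ideal A (a * b) -> max_ideal A a.
Proof.
move=> ub m; have [b0 Ab Ab'] := ub.
by have := maxMr m Ab'; rewrite mulfK.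
Qed.
Lemma max_prod a b : A a -> A b -> max_ideal A (a * b) ->
  max_ideal A a \/ max_ideal A b.
Proof.
move=> Aa Ab [_ uab]; have [ua|?] := unit_or_max Aa; last by left.
by have [ub|?] := unit_or_max Ab; [case: uab; apply: unitM | right].
Qed.
Lemma max_exp a n : A a -> max_ideal A (a ^+ n) -> max_ideal A a.
Proof.
move=> Aa; elim: n => [/not_max1 //|n IH]; rewrite exprS => m.
by have [//|/IH] := max_prod Aa (srX n Aa) m.
Qed.
End Theory.

(** Additivity of the non-units is the whole content of locality for a subring of a field:
    [max_ideal O] is then an ideal, hence the only maximal one. *)
Record is_local O : Prop := IsLocal {
  local_sr :> subring O;
  maxD : forall a b, max_ideal O a -> max_ideal O b -> max_ideal O (a + b) }.

Section Local.
Variable O : set F.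
Hypothesis lO : is_local O.
Let sO : subring O := lO.
Lemma maxN a : max_ideal O a -> max_ideal O (- a).
Proof.
by move=> m; rewrite -mulN1r; apply: maxMl => //; apply: srN => //; apply: sr1.
Qed.
Lemma maxB a b : max_ideal O a -> max_ideal O b -> max_ideal O (a - b).
Proof. by move=> ma mb; apply: maxD => //; apply: maxN. Qed.
Lemma max_sum (I : Type) (r : seq I) (P : pred I) (G : I -> F) :
  (forall i, P i -> max_ideal O (G i)) -> max_ideal O (\sum_(i <- r | P i) G i).
Proof.
move=> AG; elim/big_rec: _ => [|i x Pi Ax]; first exact: max0.
by apply: maxD; auto.
Qed.
Lemma unitDmax a b : unit_in O a -> max_ideal O b -> unit_in O (a + b).
Proof.
move=> ua mb; have [_ Oa _] := ua; have [Ob _] := mb.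
have [//|m] := unit_or_max (srD sO Oa Ob).
by have := maxB m mb; rewrite addrK => /unit_not_max.
Qed.
Lemma unit1B a : max_ideal O a -> unit_in O (1 - a).
Proof. by move=> m; apply: unitDmax; [exact: unit1 | exact: maxN]. Qed.
Lemma unit_congr a b : unit_in O a -> max_ideal O (a - b) -> unit_in O b.
Proof. by move=> u m; rewrite -[b](subKr a) ; apply: unitDmax => //; apply: maxN. Qed.
End Local.

Record dvr O : Prop := Dvr {
  dvr_local :> is_local O;
  dvr_unif : exists t, uniformizer O t;
  dvr_ord : forall h, h != 0 -> exists k, has_order O h k }.

Definition ordv O h : int := xget 0 [set k | has_order O h k].
(** The guard gives 0 infinite valuation, although [ordv O 0] is 0 by default. *)
Definition vge O k h := h != 0 -> k <= ordv O h.

Lemma unif_unit O t t' : is_local O -> uniformizer O t -> uniformizer O t' ->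
  unit_in O (t / t').
Proof.
move=> lO [t0 ut] [t'0 ut']; split; first by rewrite mulf_neq0 ?invr_eq0.
  by apply/ut'/ut; rewrite divff //; exact: sr1 lO.
by rewrite invf_div; apply/ut/ut'; rewrite divff //; exact: sr1 lO.
Qed.

Lemma unif_max O t : is_local O -> uniformizer O t -> max_ideal O t.
Proof. by move=> lO [t0 ut]; apply/ut; rewrite divff //; exact: sr1 lO. Qed.

Section DvrTheory.
Variable O : set F.
Hypothesis dO : dvr O.
Let lO : is_local O := dO.
Let sO : subring O := lO.

Lemma has_orderE t h k : uniformizer O t -> has_order O h k ->
  unit_in O (h / t ^ k).
Proof.
move=> ut [t' [ut' u]].
have -> : h / t ^ k = h / t' ^ k * (t' / t) ^ k.
  have [t'0 _] := ut'. by rewrite expfzMl exprz_inv -invr_expz mulrA divfK ?expfz_neq0.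
apply: unitM => //; apply: unitXz => //; exact: unif_unit.
Qed.

Lemma unit_expz t k : uniformizer O t -> unit_in O (t ^ k) -> k = 0.
Proof.
move=> ut; have mt := unif_max lO ut.
have pos (n : nat) : unit_in O (t ^+ n.+1) -> False.
  rewrite exprS => u. apply: (unit_not_max u). apply: maxMr => //. apply: srX => //. by case: mt.
case: k => [[|n]|n] //; first by move/pos.
by rewrite NegzE => /(unitV); rewrite invrK => /pos.
Qed.

Lemma has_order_uniq h k l : has_order O h k -> has_order O h l -> k = l.
Proof.
move=> [t [ut u]] /(has_orderE ut) u'; have [t0 _] := ut.
have [ht0 _ _] := u; have h0 : h != 0.
  by apply: contraNneq ht0 => ->; rewrite mul0r.
apply/eqP; rewrite -subr_eq0; apply/eqP; apply: (unit_expz ut).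
have -> : t ^ (k - l) = (h / t ^ l) / (h / t ^ k).
  rewrite expfzDr // -invr_expz; field. by rewrite h0 !expfz_neq0.
by apply: unitM => //; apply: unitV.
Qed.

Lemma has_order_neq0 h k : has_order O h k -> h != 0.
Proof. by move=> [t [_ [+ _ _]]]; apply: contraNneq => ->; rewrite mul0r. Qed.

Lemma ordvP h : h != 0 -> has_order O h (ordv O h).
Proof.
by move=> h0; have [k hk] := dvr_ord dO h0; rewrite /ordv; exact: (@xgetI _ _ [set k | has_order O h k] k hk).
Qed.
Lemma ordvE h k : has_order O h k -> ordv O h = k.
Proof.
by move=> hk; apply: (has_order_uniq (ordvP (has_order_neq0 hk)) hk).
Qed.

Lemma has_orderM h h' k l : has_order O h k -> has_order O h' l ->
  has_order O (h * h') (k + l).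
Proof.
move=> hk [t [ut u]]; exists t; split => //; have [t0 _] := ut.
rewrite expfzDr // invfM mulrACA; apply: unitM => //; exact: has_orderE.
Qed.
Lemma has_orderV h k : has_order O h k -> has_order O h^-1 (- k).
Proof.
move=> [t [ut u]]; exists t; split => //.
by rewrite -invr_expz -invfM; apply: unitV.
Qed.
Lemma has_order_unit h : unit_in O h <-> has_order O h 0.
Proof.
have [t ut] := dvr_unif dO; split=> [u|/(has_orderE ut)].
  by exists t; split => //; rewrite divr1.
by rewrite divr1.
Qed.
Lemma ordvM h h' : h != 0 -> h' != 0 -> ordv O (h * h') = ordv O h + ordv O h'.
Proof.
by move=> h0 h'0; apply: ordvE; apply: has_orderM; apply: ordvP.
Qed.
Lemma ordvV h : h != 0 -> ordv O h^-1 = - ordv O h.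
Proof. by move=> h0; apply: ordvE; apply/has_orderV/ordvP. Qed.
Lemma ordv_div h h' : h != 0 -> h' != 0 -> ordv O (h / h') = ordv O h - ordv O h'.
Proof. by move=> h0 h'0; rewrite ordvM ?invr_eq0 // ordvV. Qed.
Lemma ordv_unit h : unit_in O h -> ordv O h = 0.
Proof. by move/has_order_unit/ordvE. Qed.
Lemma ordv1 : ordv O 1 = 0. Proof. by apply/ordv_unit/unit1. Qed.
Lemma ordvX h n : h != 0 -> ordv O (h ^+ n) = ordv O h *+ n.
Proof.
move=> h0; elim: n => [|n IH]; first by rewrite ordv1.
by rewrite exprS ordvM ?expf_neq0 // IH mulrS.
Qed.
Lemma ordvXz h k : h != 0 -> ordv O (h ^ k) = k * ordv O h.
Proof.
move=> h0; case: k => n.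
  by rewrite ordvX // -mulr_natl natz.
rewrite NegzE ordvV ?expf_neq0 // ordvX // -mulr_natl natz; lia.
Qed.
Lemma ordv_unif t : uniformizer O t -> ordv O t = 1.
Proof.
move=> ut; apply: ordvE; exists t; split => //; have [t0 _] := ut.
by rewrite divff //; apply: unit1.
Qed.
Lemma ordv_ge0 h : O h <-> vge O 0 h.
Proof.
have [t ut] := dvr_unif dO; have mt := unif_max lO ut; have [t0 _] := ut.
(* A unit times a negative power of t cannot lie in O, since t would then be invertible there. *)
have key (n : nat) u : unit_in O u -> O (u * t ^- n.+1) -> False.
  case=> u0 Ou Ou' H; apply: (@unit_not_max O t _ mt). split => //; first by case: mt.
  have -> : t^-1 = u * t ^- n.+1 * u^-1 * t ^+ n.
    rewrite exprS; field; by rewrite u0 expf_neq0.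
  apply: srM; [exact: sO | apply: srM => // |]. by apply: srX; case: mt.
have [->|h0] := eqVneq h 0.
  by split=> [_|_]; [rewrite /vge eqxx | exact: sr0].
have hk := ordvP h0; have u := has_orderE ut hk.
have E : h = (h / t ^ ordv O h) * t ^ ordv O h by rewrite divfK ?expfz_neq0.
split=> [Oh _|/(_ h0)].
  case ek: (ordv O h) => [n|n] //; rewrite ek in u E; exfalso. rewrite NegzE -exprnN in E u.
  by apply: (key n _ u); rewrite -E.
case ek: (ordv O h) => [n|n] // _; rewrite ek in u E; rewrite E.
have [_ Ou _] := u; apply: srM => //.
by apply: srX; case: mt.
Qed.
Lemma vgeD k h h' : vge O k h -> vge O k h' -> vge O k (h + h').
Proof.
have [t ut] := dvr_unif dO; have [t0 _] := ut.
have eqv h1 : vge O k h1 <-> O (h1 / t ^ k).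
  have tk : t ^ k != 0 by rewrite expfz_neq0. rewrite ordv_ge0 /vge mulf_eq0 invr_eq0 negb_or tk andbT.
  split=> H h0; have := H h0; rewrite ordv_div // ordvXz // (ordv_unif ut) mulr1;
    by rewrite subr_ge0.
by move=> /eqv H /eqv H'; apply/eqv; rewrite mulrDl; apply: srD.
Qed.
Lemma vgeM k l h h' : vge O k h -> vge O l h' -> vge O (k + l) (h * h').
Proof.
move=> H H'; rewrite /vge mulf_eq0 negb_or => /andP[h0 h'0].
by rewrite ordvM //; apply: lerD; [apply: H|apply: H'].
Qed.
Lemma vge0 k : vge O k 0. Proof. by rewrite /vge eqxx. Qed.
Lemma vge_ordv h : vge O (ordv O h) h. Proof. by []. Qed.
Lemma ordvN h : ordv O (- h) = ordv O h.
Proof.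
have [->|h0] := eqVneq h 0; first by rewrite oppr0.
rewrite -mulN1r ordvM ?oppr_eq0 ?oner_eq0 // ordv_unit ?add0r //.
by apply: unitN => //; apply: unit1.
Qed.
Lemma vgeN k h : vge O k h -> vge O k (- h).
Proof. by rewrite /vge oppr_eq0 ordvN. Qed.
Lemma vgeB k h h' : vge O k h -> vge O k h' -> vge O k (h - h').
Proof. by move=> H H'; apply: vgeD => //; apply: vgeN. Qed.
Lemma vge_le k l h : l <= k -> vge O k h -> vge O l h.
Proof. by move=> lk H /H; apply: le_trans. Qed.
Lemma vge_sum k (I : Type) (r : seq I) (P : pred I) (G : I -> F) :
  (forall i, P i -> vge O k (G i)) -> vge O k (\sum_(i <- r | P i) G i).
Proof.
move=> AG; elim/big_rec: _ => [|i x Pi Ax]; first exact: vge0.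
by apply: vgeD; auto.
Qed.
Lemma ordv_max h : max_ideal O h <-> vge O 1 h.
Proof.
split=> [[Oh nu] h0|H].
  have := (ordv_ge0 h).1 Oh h0; rewrite le_eqVlt => /orP[/eqP e|] //.
  by case: nu; apply/has_order_unit; rewrite e; apply: ordvP.
split; first by apply/ordv_ge0; apply: vge_le H.
by move=> u; have [h0 _ _] := u; have := H h0; rewrite ordv_unit.
Qed.
Lemma unit_ordv h : h != 0 -> ordv O h = 0 -> unit_in O h.
Proof. by move=> h0 e; apply/has_order_unit; rewrite -e; apply: ordvP. Qed.
Lemma ordvD_lt h h' : h != 0 -> vge O (ordv O h + 1) h' ->
  h + h' != 0 /\ ordv O (h + h') = ordv O h.
Proof.
move=> h0 H; have nz : h + h' != 0.
  apply/eqP => /eqP; rewrite addr_eq0 => /eqP e; move: h0 H. by rewrite e ordvN oppr_eq0 => h'0 /(_ h'0); lia.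
split=> //; apply/eqP; rewrite eq_le; apply/andP; split; last first.
  by apply: (@vgeD (ordv O h) h h') => //; apply: vge_le H; lia.
rewrite leNgt; apply/negP => lt.
have : vge O (ordv O h + 1) (h + h' - h') by apply: vgeB => // _; lia.
by rewrite addrK => /(_ h0); lia.
Qed.
Lemma valuation_ring h : h != 0 -> O h \/ O h^-1.
Proof.
move=> h0; have [le|lt] := lerP 0 (ordv O h); [left|right]; apply/ordv_ge0 => // _.
by rewrite ordvV; lia.
Qed.
Lemma dvr_integral h (n : nat) : (0 < n)%N -> O (h ^+ n) -> O h.
Proof.
move=> n0 /ordv_ge0 H; apply/ordv_ge0 => h0; have := H (expf_neq0 n h0).
by rewrite ordvX // pmulrn_lge0.
Qed.
End DvrTheory.
End Subrings.

(** * Automation of ring membership *)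

Ltac in_local A k := match goal with
  | H : is_local A |- _ => k H
  | H : dvr A |- _ => let H' := constr:(dvr_local H) in k H'
  end.
Ltac in_ring A k := match goal with
  | H : subring A |- _ => k H
  | _ => in_local A ltac:(fun H => let H' := constr:(local_sr H) in k H')
  end.
(** [in_local], [in_ring] and [mem_leaf] are hooks: they are redefined by [::=] once the rings of
    the surface are fixed, so that [mem] also knows these. *)
Ltac mem_leaf := fail.
Ltac mem := first [ done | progress intros; mem | match goal with
  | |- max_ideal ?A (?x * ?y) => in_ring A ltac:(fun H => first [apply: (maxMr H); mem | apply: (maxMl H); mem])
  | |- max_ideal ?A (- ?x) => in_local A ltac:(fun H => apply: (maxN H); mem)
  | |- max_ideal ?A (?x - ?y) => in_local A ltac:(fun H => apply: (maxB H); mem)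
  | |- max_ideal ?A (?x + ?y) => in_local A ltac:(fun H => apply: (maxD H); mem)
  | |- max_ideal ?A (\sum_(_ <- _ | _) _) => in_local A ltac:(fun H => apply: (max_sum H); mem)
  | |- max_ideal ?A 0 => in_ring A ltac:(fun H => exact: (max0 H))
  | |- unit_in ?A ?x^-1 => apply: unitV; mem
  | |- unit_in ?A (?x * ?y) => in_ring A ltac:(fun H => apply: (unitM H); mem)
  | |- unit_in ?A (?x ^+ ?n) => in_ring A ltac:(fun H => apply: (unitX H); mem)
  | |- unit_in ?A 1 => in_ring A ltac:(fun H => exact: (unit1 H))
  | |- ?A (?x * ?y) => in_ring A ltac:(fun H => apply: (srM H); mem)
  | |- ?A (?x ^+ ?n) => in_ring A ltac:(fun H => apply: (srX n H); mem)
  | |- ?A (- ?x) => in_ring A ltac:(fun H => apply: (srN H); mem)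
  | |- ?A (?x - ?y) => in_ring A ltac:(fun H => apply: (srB H); mem)
  | |- ?A (?x + ?y) => in_ring A ltac:(fun H => apply: (srD H); mem)
  | |- ?A (\sum_(_ <- _ | _) _) => in_ring A ltac:(fun H => apply: (sr_sum H); mem)
  | |- ?A ?x%:~R => in_ring A ltac:(fun H => exact: (sr_int H))
  | |- ?A ?x%:R => in_ring A ltac:(fun H => exact: (sr_nat H))
  | |- ?A 1 => in_ring A ltac:(fun H => exact: (sr1 H))
  | |- ?A 0 => in_ring A ltac:(fun H => exact: (sr0 H))
  | H : unit_in ?A ?x |- ?A ?x => by case: H
  | H : unit_in ?A ?x |- ?A ?x^-1 => by case: H
  | H : max_ideal ?A ?x |- ?A ?x => by case: H
  end | mem_leaf; mem ].

(** * Noetherian rings, Krull's theorem, Nakayama's lemma *)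

Section Noeth.
Variable F : fieldType.
Implicit Types (A O I J : set F) (a b h t u g s : F).

Definition span_lt A (a : nat -> F) (n : nat) : set F :=
  [set z | exists2 c : nat -> F, (forall i, A (c i)) & z = \sum_(i < n) c i * a i].

(** The ascending chain condition in terms of sequences: some term lies in the ideal generated by
    the earlier ones. In this form it passes to quotients and localizations by lifting sequences. *)
Definition noeth A := forall a : nat -> F, (forall i, A (a i)) ->
  exists n, span_lt A a n (a n).

Record ideal A I : Prop := Ideal {
  id_sub : forall a, I a -> A a;
  id0 : I 0;
  idD : forall a b, I a -> I b -> I (a + b);
  idM : forall a b, A a -> I b -> I (a * b) }.

Lemma id_sum A I (n : nat) (G : 'I_n -> F) : ideal A I ->
  (forall i, I (G i)) -> I (\sum_(i < n) G i).
Proof.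
move=> iI H; elim/big_rec: _ => [|i x _ Ix]; [exact: id0 iI | exact: (idD iI)].
Qed.

(** Without a maximal member, dependent choice produces a strictly ascending chain in [Fam]; one new
    element from each step is a sequence contradicting [noeth]. *)
Lemma noeth_max A (Fam : set (set F)) I0 : noeth A ->
  (forall I, Fam I -> ideal A I) -> Fam I0 ->
  exists I, [/\ Fam I, I0 `<=` I & forall J, Fam J -> I `<=` J -> J `<=` I].
Proof.
move=> nA idF F0; apply: contrapT => noM.
pose T := {I : set F | Fam I /\ I0 `<=` I}.
pose R (X Y : T) := sval X `<=` sval Y /\ exists2 a, sval Y a & ~ sval X a.
have step (X : T) : {Y : T | R X Y}.
  apply: cid; case: X => I [FI I0I]. apply: contrapT => H; apply: noM; exists I; split=> // J FJ IJ a Ja.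
  apply: contrapT => nIa; apply: H. have pJ : Fam J /\ I0 `<=` J by split => //; apply: subset_trans IJ.
  by exists (exist _ J pJ); split=> //=; exists a.
have [f [_ fR]] := dependent_choice step (exist _ I0 (conj F0 (@subset_refl _ I0))).
have [a aP] : {a : nat -> F & forall n, sval (f n.+1) (a n) /\ ~ sval (f n) (a n)}.
  apply: (@choice _ _ (fun n a => sval (f n.+1) a /\ ~ sval (f n) a)) => n.
    by have [_ [a]] := fR n; exists a.
have mono n m : (n <= m)%N -> sval (f n) `<=` sval (f m).
  elim: m => [|m IH]; first by rewrite leqn0 => /eqP->. rewrite leq_eqVlt => /orP[/eqP->//|]; rewrite ltnS => /IH H.
  by apply: subset_trans H _; case: (fR m).
have idf n : ideal A (sval (f n)) by apply: idF; case: (svalP (f n)).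
have [n [c Ac e]] := nA a (fun i => id_sub (idf i.+1) (proj1 (aP i))).
have [_] := aP n; apply; rewrite e; apply: (id_sum (idf n)) => i.
by apply: (idM (idf n)) => //; apply: (mono i.+1); case: (aP i).
Qed.

Definition idgen A I b : set F := [set z | exists i r, [/\ I i, A r & z = i + r * b]].
Lemma ideal_gen A I b : subring A -> ideal A I -> A b -> ideal A (idgen A I b).
Proof.
move=> sA iI Ab; split.
- move=> _ [i [r [Ii Ar ->]]]; apply: srD => //; first exact: id_sub iI _ Ii.
  by mem.
- by exists 0, 0; split; [exact: id0 iI | mem| rewrite mul0r addr0].
- move=> _ _ [i [r [Ii Ar ->]]] [i' [r' [Ii' Ar' ->]]].
  exists (i + i'), (r + r'); split; [exact: (idD iI)|mem|ring].
- move=> a _ Aa [i [r [Ii Ar ->]]]; exists (a * i), (a * r).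
  by split; [exact: (idM iI)|mem|ring].
Qed.
Lemma idgenl A I b : subring A -> I `<=` idgen A I b.
Proof. by move=> sA i Ii; exists i, 0; split => //; [exact: sr0|rewrite mul0r addr0]. Qed.
Lemma idgenr A I b : subring A -> ideal A I -> idgen A I b b.
Proof.
by move=> sA iI; exists 0, 1; split; [exact: id0 iI|exact: sr1|rewrite mul1r add0r].
Qed.

(* Krull: an ideal maximal among those containing no power of s is prime. *)
Lemma prime_avoid A I s : subring A -> noeth A -> ideal A I -> A s ->
  (forall n, ~ I (s ^+ n)) ->
  exists P, [/\ prime_ideal_in A P, I `<=` P, ~ P s &
    forall J, ideal A J -> P `<=` J -> (forall n, ~ J (s ^+ n)) -> J `<=` P].
Proof.
move=> sA nA iI As Is.
have [P [[iP Ps] IP maxP]] := @noeth_max A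
  [set J | ideal A J /\ forall n, ~ J (s ^+ n)] I nA (fun J H => proj1 H) (conj iI Is).
(* By maximality, adjoining to P an element outside P brings in a power of s; primality follows by
   multiplying two such relations. *)
have out b : A b -> ~ P b -> exists n, idgen A P b (s ^+ n).
  move=> Ab nPb; apply: contrapT => H; apply: nPb. apply: (maxP (idgen A P b)); last exact: idgenr; last exact: idgenl.
  split=> [|n Hn]; [exact: ideal_gen | by apply: H; exists n].
exists P; split=> //; last 1 first.
- by move=> J iJ PJ Js; apply: maxP.
- split.
  + exact: id_sub iP.
  + exact: id0 iP.
  + exact: idD iP.
  + exact: idM iP.
  + split=> [P1|a b Aa Ab Pab]; first by apply: (Ps 0%N).
    apply: contrapT => /not_orP[nPa nPb]. have [n [i [r [Pi Ar en]]]] := out a Aa nPa.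
    have [m [j [q [Pj Aq em]]]] := out b Ab nPb. apply: (Ps (n + m)%N); rewrite exprD en em.
    have -> : (i + r * a) * (j + q * b) = (j + q * b) * i + r * a * j + r * q * (a * b).
      by ring.
    have Aj : A (j + q * b) by rewrite -em; apply: srX. apply: (idD iP); first apply: (idD iP); apply: (idM iP) ; mem.
- by move=> Ps1; apply: (Ps 1%N).
Qed.

(** Quantifying over the ideals J that contain N0 and the products m v stands for the ideal N0 + m
    N. Take N1 maximal between N0 and N among the ideals not containing N: then N = N1 + O h for any
    h of N outside N1, so h = i + c h with i in N1 and c a non-unit, and 1 - c is invertible. *)
Lemma nakayama O N N0 : is_local O -> noeth O -> ideal O N -> ideal O N0 -> N0 `<=` N ->
  (forall J, ideal O J -> N0 `<=` J ->
     (forall m v, max_ideal O m -> N v -> J (m * v)) -> N `<=` J) ->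
  N `<=` N0.
Proof.
move=> lO nO iN iN0 N0N H; apply: contrapT => nsub.
have [N1 [[iN1 N1N nN1] N01 maxN1]] := @noeth_max O
  [set J | [/\ ideal O J, J `<=` N & ~ (N `<=` J)]] N0 nO
  (fun J HJ => let: And3 H _ _ := HJ in H) (And3 iN0 N0N nsub).
have [h Nh nN1h] : exists2 h, N h & ~ N1 h.
  apply: contrapT => E; apply: nN1 => h Nh; apply: contrapT => ?. by apply: E; exists h.
have Oh := id_sub iN Nh.
have gen v : N v -> idgen O N1 h v.
  apply: contrapT => /not_implyP [Nv nv]; apply: nN1h.
  apply: (maxN1 (idgen O N1 h)); last exact: (idgenr _ lO); last exact: idgenl _ lO.
  split; [exact: (ideal_gen lO)| |by move=> /(_ v Nv)].
  move=> _ [i [r [/N1N Ni Or ->]]]; apply: (idD iN) => //; exact: (idM iN).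
pose J : set F := [set z | exists i c, [/\ N1 i, max_ideal O c & z = i + c * h]].
have iJ : ideal O J.
  split.
  - move=> _ [i [c [/N1N/(id_sub iN) Oi [Oc _] ->]]]; apply: (srD lO) => //.
    by mem.
  - by exists 0, 0; split; [exact: id0 iN1|mem|rewrite mul0r addr0].
  - move=> _ _ [i [c [Ni mc ->]]] [i' [c' [Ni' mc' ->]]].
    by exists (i + i'), (c + c'); split; [exact: (idD iN1)|mem|ring].
  - move=> a _ Oa [i [c [Ni mc ->]]]; exists (a * i), (a * c).
    by split; [exact: (idM iN1)|mem|ring].
have [] := H J iJ _ _ h Nh.
- by move=> z /N01 Nz; exists z, 0; split=> //; [mem|rewrite mul0r addr0].
- move=> m v mm /gen [i [r [Ni Or ->]]]; exists (m * i), (m * r); split; last by ring.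
    by apply: (idM iN1); case: mm.
  by mem.
move=> i [c [Ni mc e]]; apply: nN1h.
have [c0 _ Oc] := unit1B lO mc.
rewrite -[h](mulfK c0) mulrC; apply: (idM iN1) => //.
by have -> : h * (1 - c) = i by rewrite mulrBr mulr1 {1}e mulrC addrK.
Qed.

(** If all h / t^n were in O, a relation expressing h / t^n through the earlier quotients would read
    (h / t^n) (1 - c) = 0 with c in the maximal ideal. *)
Lemma noeth_dvr O : is_local O -> noeth O -> (exists t, uniformizer O t) ->
  (forall h, exists a b, [/\ O a, O b, b != 0 & h = a / b]) -> dvr O.
Proof.
move=> lO nO [t ut] frac; split=> //; first by exists t.
have mt := unif_max lO ut; have [t0 ut'] := ut; have [Ot _] := mt.
have ordO h : O h -> h != 0 -> exists n : nat, unit_in O (h / t ^+ n).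
  move=> Oh h0; apply: contrapT => H. have Oht n : O (h / t ^+ n).
    elim: n => [|n IH]; first by rewrite divr1. rewrite exprS invfM mulrCA mulrC; apply/ut'; have [u|//] := unit_or_max IH.
    by case: H; exists n.
  have [n [c Oc e]] := nO _ Oht. have : h / t ^+ n * (1 - \sum_(i < n) c i * t ^+ (n - i)) = 0.
    rewrite mulrBr mulr1 mulr_sumr {1}e -sumrB big1 // => i _.
    have -> : t ^+ n = t ^+ (n - i) * t ^+ i by rewrite -exprD subnK // ltnW. by field; rewrite !expf_neq0.
  move/eqP; rewrite !mulf_eq0 invr_eq0 expf_eq0 (negPf h0) (negPf t0) andbF /=.
  have [/negPf-> //] : unit_in O (1 - \sum_(i < n) c i * t ^+ (n - i)).
  apply: unit1B => //; apply: max_sum => // i _; apply: (maxMl lO) => //. have : (0 < n - i)%N by rewrite subn_gt0.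
  by case: (n - i)%N => // k _; rewrite exprS; apply: (maxMr lO) => //; apply: (srX lO).
move=> h h0; have [a [b [Oa Ob b0 e]]] := frac h.
have a0 : a != 0 by apply: contraNneq h0 => a0; rewrite e a0 mul0r.
have [n un] := ordO a Oa a0; have [m um] := ordO b Ob b0.
exists (n%:Z - m%:Z), t; split=> //.
have -> : h / t ^ (n%:Z - m%:Z) = (a / t ^+ n) / (b / t ^+ m).
  by rewrite e expfzDr // -invr_expz -!exprnP; field; rewrite b0 !expf_neq0.
by mem.
Qed.

End Noeth.

(** * Hilbert's basis theorem for rings of finite type *)

Section Hilbert.
Variable F : fieldType.
Implicit Types (A : set F) (p q : {poly F}).

Definition pover A p := forall i, A p`_i.

Section PO.
Variable A : set F.
Hypothesis sA : subring A.
Lemma pover0 : pover A 0. Proof. by move=> i; rewrite coef0; exact: sr0. Qed.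
Lemma poverC a : A a -> pover A a%:P.
Proof. by move=> Aa i; rewrite coefC; case: eqP => // _; exact: sr0. Qed.
Lemma poverX : pover A 'X.
Proof. by move=> i; rewrite coefX; exact: sr_nat. Qed.
Lemma poverB p q : pover A p -> pover A q -> pover A (p - q).
Proof. by move=> Ap Aq i; rewrite coefB; apply: srB. Qed.
Lemma poverD p q : pover A p -> pover A q -> pover A (p + q).
Proof. by move=> Ap Aq i; rewrite coefD; apply: srD. Qed.
Lemma poverM p q : pover A p -> pover A q -> pover A (p * q).
Proof. by move=> Ap Aq i; rewrite coefM; apply: sr_sum => // j _; apply: srM. Qed.
Lemma pover1 : pover A 1. Proof. by apply: poverC; exact: sr1. Qed.
Lemma poverXn n : pover A 'X^n.
Proof. by move=> i; rewrite coefXn; exact: sr_nat. Qed.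
Lemma pover_horner p a : pover A p -> A a -> A p.[a].
Proof.
move=> Ap Aa; rewrite horner_coef; apply: sr_sum => // i _.
by apply: srM => //; apply: srX.
Qed.
End PO.

(** The ring A[g]; folding [adj] over a list gives the algebras of finite type. *)
Definition adj A g : set F := [set z | exists2 p, pover A p & z = p.[g]].

Lemma adj_sub A g B : subring B -> A `<=` B -> B g -> adj A g `<=` B.
Proof. by move=> sB AB Bg _ [p Ap ->]; apply: pover_horner => // i; apply: AB. Qed.

Lemma adj_subring A g : subring A -> subring (adj A g).
Proof.
move=> sA; split.
- by exists 1; [exact: pover1|rewrite hornerC].
- by move=> _ _ [p Ap ->] [q Aq ->]; exists (p - q); [exact: poverB|rewrite hornerD hornerN].
- by move=> _ _ [p Ap ->] [q Aq ->]; exists (p * q); [exact: poverM|rewrite hornerM].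
Qed.
Lemma adjl A g : subring A -> A `<=` adj A g.
Proof. by move=> sA a Aa; exists a%:P; [exact: poverC|rewrite hornerC]. Qed.
Lemma adjr A g : subring A -> adj A g g.
Proof. by move=> sA; exists 'X; [exact: poverX|rewrite hornerX]. Qed.

Definition pspan A (l : seq {poly F}) : set {poly F} :=
  [set p | exists2 c : nat -> {poly F}, (forall i, pover A (c i)) &
     p = \sum_(i < size l) c i * l`_i].

(** The usual argument in A[X], adapted to sequences: [U] is the ideal of the polynomials whose
    value at g lies in the span of finitely many z i. Generators of [U] all lie in one [I N], hence
    so does a lift of z N. *)
Theorem hilbert_basis A g : subring A -> noeth A -> noeth (adj A g).
Proof.
move=> sA nA z Az; have sB := adj_subring g sA.
pose I n : set {poly F} := [set p | pover A p /\ span_lt (adj A g) z n p.[g]].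
pose U : set {poly F} := [set p | exists n, I n p].
have ImonoS n m : (n <= m)%N -> I n `<=` I m.
  move=> nm p [Ap [c Bc e]]; split=> //. exists (fun i => if (i < n)%N then c i else 0).
    by move=> i; case: ifP => // _; mem.
  rewrite e (big_ord_widen_cond _ xpredT (fun i => c i * z i) nm) big_mkcond /=.
  by apply: eq_bigr => i _; case: ifP => // _; rewrite mul0r.
have IB n p q : I n p -> I n q -> I n (p - q).
  move=> [Ap [c Bc e]] [Aq [c' Bc' e']]; split; first exact: poverB.
  exists (fun i => c i - c' i); first by move=> i; apply: srB.
  by rewrite hornerD hornerN e e' -sumrB; apply: eq_bigr => i _; rewrite mulrBl.
have IM n p q : pover A q -> I n p -> I n (q * p).
  move=> Aq [Ap [c Bc e]]; split; first exact: poverM.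
  exists (fun i => q.[g] * c i); first by move=> i; apply: srM => //; exists q.
  by rewrite hornerM e mulr_sumr; apply: eq_bigr => i _; rewrite mulrA.
have I0 n : I n 0.
  split; first exact: pover0. exists (fun=> 0); first by move=> _; mem. by rewrite hornerC big1 // => i _; rewrite mul0r.
have UB p q : U p -> U q -> U (p - q).
  move=> [n In] [m Im]; exists (maxn n m); apply: IB.
    by apply: ImonoS In; rewrite leq_maxl.
  by apply: ImonoS Im; rewrite leq_maxr.
have UM p q : pover A q -> U p -> U (q * p) by move=> Aq [n In]; exists n; apply: IM.
have Usum (k : nat) (G : 'I_k -> {poly F}) : (forall i, U (G i)) -> U (\sum_i G i).
  move=> UG; elim/big_rec: _ => [|i x _ Ux]; first by exists 0%N.
  rewrite -[G i + x]opprK opprD -sub0r; apply: (UB); first by exists 0%N.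
  by apply: (UB) => //; rewrite -sub0r; apply: UB => //; exists 0%N.
(* U is finitely generated: extend a list by elements of minimal size. *)
pose next (l : seq {poly F}) p := [/\ U p, ~ pspan A l p &
  forall q, U q -> ~ pspan A l q -> (size p <= size q)%N].
have nextP l : U `<=` pspan A l \/ exists p, next l p.
  have [?|nsub] := EM (U `<=` pspan A l); [by left|right].
  have ex : exists n, `[<exists p, [/\ U p, ~ pspan A l p & size p = n]>].
    apply: contrapT => H; apply: nsub => p Up; apply: contrapT => np. by apply: H; exists (size p); apply/asboolP; exists p.
  case: (ex_minnP ex) => m /asboolP[p [Up np sp]] min. exists p; split=> // q Uq nq; rewrite sp; apply: min; apply/asboolP.
  by exists q.
have [l Ul] : exists l, (forall p, p \in l -> U p) /\ U `<=` pspan A l.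
  apply: contrapT => H. have [nx nxP] : {nx : seq {poly F} -> {poly F} & forall l,
      (forall p, p \in l -> U p) -> next l (nx l)}.
    apply: (@choice _ _ (fun l p => (forall p, p \in l -> U p) -> next l p)) => l.
    have [Ul|/existsNP[p np]] := EM (forall p, p \in l -> U p).
      have [sub|[p np]] := nextP l; last by exists p. by case: H; exists l.
    by exists 0 => /(_ p).
  pose ls := fix ls n := if n is n'.+1 then rcons (ls n') (nx (ls n')) else [::]. have lsU n p : p \in ls n -> U p.
    elim: n p => [|n IH] p //=; rewrite mem_rcons => /orP[/eqP->|/IH//]. by case: (nxP (ls n) IH).
  pose hh n := nx (ls n). have sls n : size (ls n) = n by elim: n => //= n IH; rewrite size_rcons IH.
  have nls n i : (i < n)%N -> (ls n)`_i = hh i.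
    elim: n => // n IH; rewrite ltnS leq_eqVlt /= nth_rcons sls.
    by case/orP=> [/eqP->|lt]; [rewrite ltnn eqxx | rewrite lt IH].
  have hP n : next (ls n) (hh n) by apply: nxP; apply: lsU. have hU n : U (hh n) by case: (hP n).
  have hA n : pover A (hh n) by have [m []] := hU n. have [m [c Ac e]] := nA (fun n => lead_coef (hh n)) (fun n => hA n _).
  have mono i : (i <= m)%N -> (size (hh i) <= size (hh m))%N.
    move=> im; case: (hP i) => _ _; apply => //. case: (hP m) => _ + _; apply: contra_not => -[d Ad ed].
    exists (fun j => if (j < i)%N then d j else 0).
      by move=> j; case: ifP => // _; exact: pover0.
    rewrite ed !sls (big_ord_widen_cond m xpredT (fun j => d j * (ls i)`_j)) //.
    rewrite big_mkcond /=; apply: eq_bigr => j _; case: ifP; last by rewrite mul0r. by move=> ji; rewrite !nls.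
  (* The relation among the leading coefficients, with each hh i shifted to the size of hh m: the
     difference hh m - q is smaller than hh m, against the minimality in [next]. *)
  pose q := \sum_(i < m) (c i)%:P * 'X^(size (hh m) - size (hh i)) * hh i.
  have npm : ~ pspan A (ls m) (hh m) by case: (hP m). have qspan : pspan A (ls m) q.
    exists (fun i => (c i)%:P * 'X^(size (hh m) - size (hh i))).
      by move=> i; apply: poverM => //; [exact: poverC|exact: poverXn].
    by rewrite sls; apply: eq_bigr => i _; rewrite nls.
  have Uq : U q.
    apply: Usum => i; apply: UM => //; apply: poverM => //; [exact: poverC|exact: poverXn].
  have nspan : ~ pspan A (ls m) (hh m - q).
    apply: contra_not npm => -[d Ad ed]; case: qspan => d' Ad' ed'.
    exists (fun i => d i + d' i); first by move=> i; apply: poverD. rewrite -[LHS](subrK q) ed [X in _ + X]ed' -big_split.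
    by apply: eq_bigr => i _; rewrite mulrDl.
  have hm0 : hh m != 0.
    apply/eqP => h0; apply: npm; rewrite h0; exists (fun=> 0).
      by move=> _; exact: pover0.
    by rewrite big1 // => i _; rewrite mul0r.
  have sq : (size q <= size (hh m))%N.
    apply: (leq_trans (size_sum _ _ _)); apply/bigmax_leqP => i _. have im := mono i (ltnW (ltn_ord i)).
    rewrite -mulrA mul_polyC; apply: (leq_trans (size_scale_leq _ _)).
    have [->|hi0] := eqVneq (hh i) 0; first by rewrite mulr0 size_poly0. by rewrite mulrC size_mulXn // subnK.
  case: (hP m) => _ _ /(_ _ (UB _ _ (hU m) Uq) nspan). rewrite leqNgt => /negP; apply.
  have szm : (0 < size (hh m))%N by rewrite size_poly_gt0.
  rewrite -(prednK szm); apply/leq_sizeP => j; rewrite leq_eqVlt coefB. case/orP=> [/eqP<-|]; last first.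
    rewrite prednK // => jm; rewrite !nth_default ?subrr //. exact: leq_trans jm.
  apply/eqP; rewrite subr_eq0 -/(lead_coef _) e; apply/eqP.
  rewrite coef_sum; apply: eq_bigr => i _; rewrite -mulrA coefCM; congr (_ * _). have im := mono i (ltnW (ltn_ord i)).
  have [hi0|hi0] := eqVneq (hh i) 0; first by rewrite hi0 mulr0 lead_coef0 coef0.
  have szi : (0 < size (hh i))%N by rewrite size_poly_gt0. rewrite coefXnM ifF; last by apply/negbTE; rewrite -leqNgt; lia.
  by rewrite /lead_coef; congr (_`_ _); lia.
case: Ul => lU Ul.
have [N NP] : exists N, forall p, p \in l -> I N p.
  elim: l lU {Ul} => [|p l IH] lU; first by exists 0%N. have [N NP] := IH (fun q ql => lU q (mem_behead (s := p :: l) ql)).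
  have [m pm] := lU p (mem_head _ _); exists (maxn N m) => q. rewrite inE => /orP[/eqP->|/NP qN].
    by apply: (ImonoS m) pm; rewrite leq_maxr.
  by apply: (ImonoS N) qN; rewrite leq_maxl.
have [p Ap ep] := Az N.
have : U p.
  exists N.+1; split=> //; exists (fun i => (i == N)%:R); first by move=> i; mem.
  rewrite big_ord_recr /= eqxx mul1r big1 ?add0r //. by move=> i _; rewrite (ltn_eqF (ltn_ord i)) mul0r.
case/Ul => c Ac ec; exists N.
have : I N p.
  rewrite ec; elim/big_rec: _ => [//|i x _ Ix]. rewrite -[x]opprK -[- x]sub0r; apply: (IB); last exact: IB.
  by apply: IM => //; apply: NP; apply: mem_nth.
by case=> _; rewrite ep.
Qed.

Lemma noeth_adjs A (l : seq F) : subring A -> noeth A ->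
  subring (foldl adj A l) /\ noeth (foldl adj A l).
Proof.
elim: l A => [|g l IH] A sA nA //=.
by apply: IH; [exact: adj_subring|exact: hilbert_basis].
Qed.

Lemma foldl_adj_min A (l : seq F) B : subring B -> A `<=` B ->
  (forall g, g \in l -> B g) -> foldl adj A l `<=` B.
Proof.
elim: l A => [|g l IH] A sB AB lB //=.
apply: IH => //; first by apply: adj_sub => //; apply: lB; exact: mem_head.
by move=> h hl; apply: lB; rewrite inE hl orbT.
Qed.
Lemma foldl_adj_base A (l : seq F) : subring A -> A `<=` foldl adj A l.
Proof.
elim: l A => [|g l IH] A sA //=; apply: subset_trans (IH _ (adj_subring g sA)).
exact: adjl.
Qed.
Lemma foldl_adj_gen A (l : seq F) g : subring A -> g \in l -> foldl adj A l g.
Proof.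
elim: l A => [|g' l IH] A sA //=; rewrite inE => /orP[/eqP->|]; last first.
  by apply: IH; exact: adj_subring.
by apply: foldl_adj_base; [exact: adj_subring|exact: adjr].
Qed.

(** A relation among the numerators becomes one among the fractions after rescaling its coefficients
    by the denominators. *)
Lemma noeth_localization A P : subring A -> noeth A -> prime_ideal_in A P ->
  noeth (localization A P).
Proof.
move=> sA nA pP z zL.
have [x xP] := choice zL; have [y yP] := choice xP.
have [n [c Ac e]] := nA x (fun i => let: And5 H _ _ _ _ := yP i in H).
have Lc i : A i -> localization A P i.
  move=> Ai; exists i, 1; split=> //; [mem|by case: pP => _ _ _ _ []|exact: oner_neq0|by rewrite divr1].
exists n, (fun i => c i * y i / y n).
  move=> i; have [_ Ayi _ _ _] := yP i; have [_ Ayn nPn yn0 _] := yP n.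
  by exists (c i * y i), (y n); split => //; apply: srM.
have [_ Ayn _ yn0 ->] := yP n; rewrite e mulr_suml; apply: eq_bigr => i _.
by have [_ _ _ yi0 ->] := yP i; field; rewrite yi0.
Qed.
End Hilbert.

(** * Subrings as ring types *)

Record srng (F : fieldType) := Srng { srset :> set F; srngP : subring srset }.

Section SubringType.
Variables (F : fieldType) (S : srng F).
Definition srpred : {pred F} := fun x => `[< srset S x >].
Lemma srpredE x : (x \in srpred) = `[< srset S x >]. Proof. by []. Qed.
Fact srpred_closed : subring_closed srpred.
Proof.
have sS := srngP S; split=> [|x y|x y]; rewrite !srpredE.
- by apply/asboolP; mem.
- by move=> /asboolP Sx /asboolP Sy; apply/asboolP; mem.
- by move=> /asboolP Sx /asboolP Sy; apply/asboolP; mem.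
Qed.
HB.instance Definition _ := GRing.isSubringClosed.Build F srpred srpred_closed.
Record srT := SrT { srval :> F; _ : srval \in srpred }.
HB.instance Definition _ := [isSub for srval].
HB.instance Definition _ := [Choice of srT by <:].
HB.instance Definition _ := [SubChoice_isSubComNzRing of srT by <:].
Lemma srvalP (x : srT) : srset S (srval x).
Proof. by apply/asboolP; rewrite -srpredE; case: x. Qed.
Lemma srT_ex x : srset S x -> exists y : srT, srval y = x.
Proof.
move=> Sx; have Sx' : x \in srpred by exact/asboolP.
by exists (SrT Sx').
Qed.
Lemma srval_inj : injective srval. Proof. exact: val_inj. Qed.
Lemma srval0 : srval 0 = 0. Proof. exact: (rmorph0 (val : srT -> F)). Qed.
Lemma srval1 : srval 1 = 1. Proof. exact: (rmorph1 (val : srT -> F)). Qed.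
Lemma srvalD x y : srval (x + y) = srval x + srval y.
Proof. exact: (rmorphD (val : srT -> F)). Qed.
Lemma srvalB x y : srval (x - y) = srval x - srval y.
Proof. exact: (rmorphB (val : srT -> F)). Qed.
Lemma srvalM x y : srval (x * y) = srval x * srval y.
Proof. exact: (rmorphM (val : srT -> F)). Qed.
Fact srval_zmod : zmod_morphism srval. Proof. exact: srvalB. Qed.
Fact srval_monoid : monoid_morphism srval.
Proof. by split; [exact: srval1 | exact: srvalM]. Qed.
HB.instance Definition _ := GRing.isZmodMorphism.Build srT F srval srval_zmod.
HB.instance Definition _ := GRing.isMonoidMorphism.Build srT F srval srval_monoid.
Lemma pover_lift (p : {poly F}) : pover S p -> exists q : {poly srT}, p = map_poly srval q.
Proof.
move=> Sp; have [c cP] := choice (fun i => srT_ex (Sp i)).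
exists (\poly_(i < size p) c i); apply/polyP => i.
rewrite coef_map_id0 // coef_poly; case: ltnP => [_|le]; first mem.
by rewrite nth_default //.
Qed.
End SubringType.

(** * Integral elements *)

Section Integral.
Variable F : fieldType.
Implicit Types (A B : set F) (x y z g : F) (p q : {poly F}).

Definition integral A z := exists p, [/\ p \is monic, pover A p & root p z].

Lemma integralE (S : srng F) z : integral S z <-> integralOver (@srval F S) z.
Proof.
split=> [[p [mp Sp rp]]|[p mp rp]].
  have [q e] := pover_lift Sp; exists q; last by rewrite -e.
  apply/eqP; apply: (@srval_inj _ S); rewrite srval1 -(monicP mp) e.
  by rewrite /lead_coef size_map_inj_poly ?coef_map_id0 ?srval0 //; exact: srval_inj.
exists (map_poly (@srval F S) p); split=> //; last first.
  by move=> i; rewrite coef_map; apply: srvalP.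
have l1 : srval (lead_coef p) != 0.
  by rewrite (monicP mp) oner_eq0.
by rewrite monicE lead_coef_map_eq // srval1.
Qed.

Section Closure.
Variable A : set F.
Hypothesis sA : subring A.
Let S := Srng sA.
Lemma int_id z : A z -> integral A z.
Proof.
move=> Az; exists ('X - z%:P); rewrite monicXsubC root_XsubC; split=> //.
by apply: poverB => //; [exact: poverX|exact: poverC].
Qed.
Lemma intB x y : integral A x -> integral A y -> integral A (x - y).
Proof. by move=> /(integralE S) ix /(integralE S) iy; apply/(integralE S)/integral_sub. Qed.
Lemma intM x y : integral A x -> integral A y -> integral A (x * y).
Proof. by move=> /(integralE S) ix /(integralE S) iy; apply/(integralE S)/integral_mul. Qed.
Lemma int_subring : subring (integral A).
Proof. by split; [apply: int_id; exact: sr1|exact: intB|exact: intM]. Qed.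
Lemma int_trans B z : B `<=` integral A -> integral B z -> integral A z.
Proof.
move=> BA [p [mp Bp rp]]; apply/(integralE S)/(integral_root_monic mp rp).
by move=> _ /(nthP 0)[i _ <-]; apply/integralE/BA.
Qed.
(** Multiplying the monic equation of b^-1 by the power of b one below its degree isolates b^-1. *)
Lemma int_inv_mem b : A b -> b != 0 -> integral A b^-1 -> A b^-1.
Proof.
move=> Ab b0 [p [mp Ap]]; rewrite rootE horner_coef => /eqP.
have sp : (0 < size p)%N by rewrite size_poly_gt0 monic_neq0.
case es : size sp => [|n] // _; rewrite big_ord_recr /=.
have -> : p`_n = 1 by have := monicP mp; rewrite /lead_coef es.
case: n es => [|n] es.
  by rewrite big_ord0 mulr1 add0r => /eqP; rewrite oner_eq0.
move/(congr1 (fun z => z * b ^+ n)); rewrite mul0r mulrDl mul1r exprS -mulrA.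
rewrite -exprMn mulVf // expr1n mulr1 mulr_suml => /eqP.
rewrite addrC addr_eq0 => /eqP->; apply: srN => //; apply: sr_sum => // i _.
have -> : p`_i * b^-1 ^+ i * b ^+ n = p`_i * b ^+ (n - i).
  have -> : b ^+ n = b ^+ (n - i) * b ^+ i by rewrite -exprD subnK // -ltnS. by rewrite exprVn; field; rewrite expf_neq0.
by apply: srM => //; exact: srX.
Qed.
End Closure.

Lemma int_mono A B z : A `<=` B -> integral A z -> integral B z.
Proof. by move=> AB [p [? Ap ?]]; exists p; split=> // i; apply: AB. Qed.

(** Multiplying p(z) = 0 by l^(deg p - 1), l the leading coefficient, makes it a monic equation of l
    z. *)
Lemma int_lead A (p : {poly F}) z : subring A ->
  pover A p -> p != 0 -> root p z -> integral A (lead_coef p * z).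
Proof.
move=> sA Ap p0 rp; set l := lead_coef p; set m := (size p).-1.
have em : size p = m.+1 by rewrite prednK // size_poly_gt0.
have m0 : (0 < m)%N.
  rewrite lt0n; apply/eqP => m0; rewrite m0 in em. have /size1_polyC e : (size p <= 1)%N by rewrite em.
  by move: rp p0; rewrite e rootC polyC_eq0 => ->.
pose q := \poly_(i < m.+1) (if i == m then 1 else p`_i * l ^+ (m - i.+1)).
have cq i : q`_i = if (i <= m)%N then (if i == m then 1 else p`_i * l ^+ (m - i.+1)) else 0.
  by rewrite coef_poly.
have sq : size q = m.+1 by rewrite size_poly_eq // eqxx oner_eq0.
exists q; split.
- by rewrite monicE /lead_coef sq cq leqnn eqxx.
- move=> i; rewrite cq; case: ifP => _; last mem.
  case: eqP => _; first mem. by apply: srM => //; apply: (srX sA); exact: Ap.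
- rewrite rootE horner_coef sq; move: rp; rewrite rootE horner_coef em => /eqP rp.
  have : l ^+ m.-1 * \sum_(i < m.+1) p`_i * z ^+ i = 0 by rewrite rp mulr0.
  rewrite mulr_sumr => /eqP; congr (_ == _); apply: eq_bigr => i _.
  rewrite cq -ltnS ltn_ord exprMn; case: eqP => [->|/eqP im].
    have -> : p`_m = l by []. by rewrite mul1r mulrA -exprSr prednK.
  have lt : (i < m)%N by have := ltn_ord i; rewrite ltnS leq_eqVlt (negPf im). have -> : m.-1 = (m - i.+1 + i)%N by lia.
  by rewrite exprD; ring.
Qed.

(** Induction on the degree m. By [int_lead] the product l z is in A. If l or l z is a unit the
    claim follows; otherwise the leading term is folded into (l z) X^(m-1), which changes the
    remaining coefficients by non-units only, so that a unit coefficient survives. *)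
Lemma seidenberg A z p (i0 : nat) : is_local A -> (forall x, integral A x -> A x) ->
  pover A p -> root p z -> unit_in A p`_i0 -> A z \/ A z^-1.
Proof.
move=> lA icA Ap; have [n le] := ubnP (size p).
elim: n p le i0 Ap => // n IH p le i0 Ap rp u0.
have pn0 : p != 0 by apply: contraPneq u0 => ->; rewrite coef0 => -[]; rewrite eqxx.
have sp2 : (1 < size p)%N.
  rewrite ltnNge; apply/negP => sp1; move: rp; rewrite (size1_polyC sp1) rootC.
  by move=> e; rewrite (size1_polyC sp1) polyC_eq0 e in pn0.
set l := lead_coef p; set m := (size p).-1.
have l0 : l != 0 by rewrite lead_coef_eq0.
have em : size p = m.+1 by rewrite prednK // ltnW.
have m0 : (0 < m)%N by rewrite -ltnS -em.
have Alz : A (l * z) by apply: icA; exact: int_lead lA Ap pn0 rp.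
have [ul|ml] := unit_or_max (Ap m : A l).
  left; have -> : z = l * z * l^-1 by field. by mem.
have [ulz|mlz] := unit_or_max Alz.
  right; have [lz0 _ Alz'] := ulz. have z0 : z != 0 by apply: contraNneq lz0 => ->; rewrite mulr0.
  have -> : z^-1 = l * (l * z)^-1 by field; rewrite z0. by mem.
pose q := take_poly m p + (l * z) *: 'X^(m.-1).
have cq i : q`_i = if (i < m)%N then p`_i + (l * z) * (i == m.-1)%:R else 0.
  rewrite coefD coef_take_poly coefZ coefXn; case: ltnP => // mi.
  by rewrite add0r (_ : (i == m.-1) = false) ?mulr0 //; apply/negbTE; lia.
have sq : (size q <= m)%N by apply/leq_sizeP => j mj; rewrite cq ltnNge mj.
apply: (IH q _ i0); first by lia.
- move=> i; rewrite cq; case: ifP => _; last mem.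
  by mem.
- rewrite rootE hornerD hornerZ hornerXn.
  have e : p = take_poly m p + l *: 'X^m.
    apply/polyP => i; rewrite coefD coef_take_poly coefZ coefXn.
    case: ltngtP => [im|im|->]; rewrite ?mulr0 ?addr0 ?mulr1 ?add0r //. by rewrite nth_default // em.
  move: rp; rewrite rootE {1}e hornerD hornerZ hornerXn. by rewrite -mulrA -exprS prednK.
- rewrite cq; case: ifP => im.
    apply: unitDmax => //; apply: (maxMr lA) ; mem.
  have : (i0 <= m)%N.
    rewrite -ltnS -em ltnNge; apply/negP => le0. by case: u0; rewrite nth_default // eqxx.
  rewrite leq_eqVlt im orbF => /eqP ei0; exfalso. by apply: (unit_not_max u0); rewrite ei0.
Qed.
End Integral.

(** * Zariski's lemma *)

Section Zariski.
Variable k : fieldType.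
Implicit Types (A R : set k) (x y z g : k).

Lemma inv_adj_common R g z : subring R -> adj R g^-1 z -> g != 0 -> R g ->
  exists2 N : nat, R (z * g ^+ N) & True.
Proof.
move=> sR [p Rp ->] g0 Rg; exists (size p) => //.
rewrite horner_coef mulr_suml; apply: sr_sum => // i _.
rewrite -mulrA exprVn; apply: srM => //.
have -> : g ^+ size p = g ^+ i * g ^+ (size p - i) by rewrite -exprD subnKC // ltnW.
by rewrite mulKf ?expf_neq0 //; apply: srX.
Qed.

(** Munshi's proof of Zariski's lemma. The ring R is arbitrary so that the induction can pass from R
    to R[x]; the price is one inverted element g. *)
Lemma munshi (l : seq k) R : subring R -> (forall z, foldl (@adj k) R l z) ->
  exists g, [/\ R g, g != 0 & forall z, integral (adj R g^-1) z].
Proof.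
elim: l R => [|x l IH] R sR /= all.
  exists 1; split; [mem|exact: oner_neq0|move=> z]. by apply: int_id; [exact: adj_subring|apply: adjl].
have sR' := adj_subring x sR.
have [g' [Rg' g'0 int']] := IH _ sR' all.
have sR'' := adj_subring g'^-1 sR'.
have [G RG eG] := Rg'.
have [q [Rq q0 rq]] : exists q, [/\ pover R q, q != 0 & root q x].
  (* If x were transcendental over R, B = 1 + X G would divide a power G^N, hence (X G)^N, which is
     (-1)^N modulo B; but B is not constant. *)
  pose b := 1 + x * g'; pose B := 1 + 'X * G. have RB : pover R B.
    by apply: poverD => //; [exact: pover1|apply: poverM => //; exact: poverX].
  have G0 : G != 0 by apply: contraNneq g'0 => G0; rewrite eG G0 horner0. have sB : (1 < size B)%N.
    rewrite /B addrC mulrC size_polyDl; first by rewrite size_mulX // ltnS size_poly_gt0.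
    by rewrite size_poly1 size_mulX // ltnS size_poly_gt0.
  have B0 : B != 0 by rewrite -size_poly_gt0 ltnW. have eB : B.[x] = b by rewrite !hornerE -eG.
  have [b0|bn0] := eqVneq b 0; first by exists B; split=> //; rewrite rootE eB b0. apply: contrapT => nalg.
  have trans p : pover R p -> p.[x] = 0 -> p = 0.
    by move=> Rp /eqP ex; apply/eqP; apply: contrapT => /negP p0; apply: nalg; exists p.
  have R'b : adj R x b by exists B. have := int_inv_mem sR'' (adjl _ sR' R'b) bn0 (int' _).
  case/(inv_adj_common sR')=> // N [C RC eC] _. have id0 : G ^+ N - B * C = 0.
    apply: trans.
      apply: poverB => //; last exact: poverM. by elim: N {eC} => [|N IHN]; rewrite ?exprS; [exact: pover1|exact: poverM].
    by rewrite hornerD hornerN hornerM horner_exp -eG eB -eC mulVKf // subrr.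
  have /eqP := id0; rewrite subr_eq0 => /eqP eGN. have := subrXX ('X * G) (-1) N; rewrite opprK [_ + 1]addrC -/B.
  set H := \sum_(_ < _) _ => e1. have : B * ('X^N * C - H) = (-1) ^+ N.
    by rewrite mulrBr -e1 mulrCA -eGN exprMn; ring.
  move/(congr1 (fun p : {poly k} => size p)). have [->|H0] := eqVneq ('X^N * C - H) 0.
    rewrite mulr0 size_poly0 => /esym/eqP; rewrite size_poly_eq0. by rewrite expf_eq0 oppr_eq0 oner_eq0 andbF.
  have -> : size ((-1) ^+ N : {poly k}) = 1%N.
    by rewrite -signr_odd; case: odd; rewrite ?expr0 ?size_polyN size_poly1.
  rewrite (size_mul B0 H0); move: sB H0; rewrite -size_poly_gt0.
  have E (u v : nat) : (1 < u -> 0 < v -> (u + v).-1 = 1 -> False)%N by lia. exact: E.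
pose r := lead_coef q.
have r0 : r != 0 by rewrite lead_coef_eq0.
have Rr : R r by apply: Rq.
have sRr := adj_subring r^-1 sR.
have intx : integral (adj R r^-1) x.
  exists (r^-1 *: q); split; last by rewrite rootE hornerZ (eqP rq) mulr0.
    by rewrite monicE lead_coefZ mulVf.
  by move=> i; rewrite coefZ; apply: srM => //; [exact: adjr|exact: adjl].
have intR' : adj R x `<=` integral (adj R r^-1).
  apply: adj_sub => //; first exact: int_subring. by move=> z Rz; apply: int_id => //; exact: adjl.
have [P [mP RP rP]] := intR' _ Rg'.
(* Dividing out the powers of X leaves an equation of g' with nonzero constant coefficient, which
   expresses g'^-1 as a polynomial in g' once that coefficient is inverted. *)
have [P' [RP' P'0 rP']] : exists P', [/\ pover (adj R r^-1) P', P'`_0 != 0 & root P' g'].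
  have Pn0 := monic_neq0 mP. have ex : exists j, P`_j != 0 by exists (size P).-1; rewrite lead_coef_eq0.
  case: (ex_minnP ex) => j Pj0 min; exists (drop_poly j P); split.
  - by move=> i; rewrite coef_drop_poly.
  - by rewrite coef_drop_poly.
  have : (take_poly j P + drop_poly j P * 'X^j).[g'] = 0 by rewrite poly_take_drop; apply/eqP. have -> : take_poly j P = 0.
    apply/polyP => i; rewrite coef_take_poly coef0; case: ltnP => // ij.
    by apply/eqP; apply: contraTT ij => /min; rewrite -leqNgt.
  rewrite add0r hornerM hornerXn => /eqP; rewrite mulf_eq0 expf_eq0 (negPf g'0) andbF orbF. by [].
have [N Rs _] := inv_adj_common sR (RP' 0%N) r0 Rr.
set s := P'`_0 * r ^+ N in Rs.
have s0 : s != 0 by rewrite mulf_neq0 ?expf_neq0.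
(* Inverting r, the leading coefficient of q, makes x integral; inverting s inverts the constant
   coefficient of P', cleared of denominators by r^N. *)
pose g := r * s; exists g; split; [exact: srM|by rewrite mulf_neq0|].
have sRg := adj_subring g^-1 sR.
have Rgr : adj R g^-1 r^-1.
  have -> : r^-1 = s * g^-1 by rewrite /g; field; rewrite s0. by apply: srM => //; [exact: adjl|exact: adjr].
have RrRg : adj R r^-1 `<=` adj R g^-1 by apply: adj_sub => //; exact: adjl.
have Rgc : adj R g^-1 (P'`_0)^-1.
  have -> : (P'`_0)^-1 = r ^+ N.+1 * g^-1.
    by rewrite /g /s exprS; field; rewrite P'0 expf_neq0.
  by apply: srM => //; [apply: adjl => //; exact: srX|exact: adjr].
have intg' : integral (adj R g^-1) g'^-1.
  have eP : P' = drop_poly 1 P' * 'X + (P'`_0)%:P.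
    apply/polyP => i; rewrite coefD coefMX coefC coef_drop_poly. by case: i => [|i]; rewrite ?add0r // addr0 addn1.
  have : (drop_poly 1 P').[g'] * g' = - P'`_0.
    by move: rP'; rewrite rootE eP !hornerE addr_eq0 => /eqP; rewrite -eP.
  move=> e2; have -> : g'^-1 = - (P'`_0)^-1 * (drop_poly 1 P').[g'].
    have -> : (drop_poly 1 P').[g'] = - P'`_0 / g' by rewrite -e2 mulfK. by field; rewrite g'0.
  apply: intM => //; first by apply: int_id => //; apply: srN. apply: pover_horner; first exact: int_subring.
    by move=> i; apply: int_id => //; apply: RrRg; rewrite coef_drop_poly.
  by apply: int_mono (intR' _ Rg').
move=> z; apply: int_trans (int' z) => //.
apply: adj_sub => //; first exact: int_subring.
by move=> y /intR'; apply: int_mono.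
Qed.

Lemma zariski (l : seq k) R : subring R -> (forall z, R z -> R z^-1) ->
  (forall z, foldl (@adj k) R l z) -> forall z, integral R z.
Proof.
move=> sR Rinv /(munshi sR) [g [Rg g0 H]] z; apply: int_mono (H z).
by apply: adj_sub => //; exact: Rinv.
Qed.
End Zariski.

(** * Residue fields and Frobenius *)

Section ResidueField.
Variable F : fieldType.
Variables (O : set F) (lO : is_local O).
Let S := Srng lO.
Definition rfI : {pred srT S} := fun x => `[< max_ideal O (srval x) >].
Fact rfI_closed : idealr_closed rfI.
Proof.
split.
- by apply/asboolP; rewrite srval0; apply: max0 lO.
- by apply/negP => /asboolP; rewrite srval1; apply: not_max1 lO.
move=> a u v /asboolP mu /asboolP mv; apply/asboolP.
by rewrite srvalD; apply: maxD => //; apply: (maxMl lO) => //; exact: srvalP a.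
Qed.
HB.instance Definition _ := isIdealr.Build _ rfI rfI_closed.
Definition rfT := {ideal_quot rfI}.
HB.instance Definition _ := GRing.ComNzRing.on rfT.
Definition rfpi (x : srT S) : rfT := (\pi_({ideal_quot rfI}) x)%qT.
Lemma rfpiB x y : rfpi (x - y) = rfpi x - rfpi y.
Proof. by rewrite /rfpi rmorphB. Qed.
Lemma rfpiM x y : rfpi (x * y) = rfpi x * rfpi y.
Proof. by rewrite /rfpi rmorphM. Qed.
Lemma rfpi1 : rfpi 1 = 1. Proof. by rewrite /rfpi rmorph1. Qed.
Lemma rfpi_eq0 x : rfpi x = 0 <-> max_ideal O (srval x).
Proof.
have := Quotient.idealrBE rfI x 0; rewrite subr0 => e.
have -> : (rfpi x = 0) <-> (rfpi x == rfpi 0).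
  by split => [->|/eqP->]; rewrite /rfpi ?rmorph0.
by rewrite -e; split => /asboolP.
Qed.
Lemma rfpi_surj x : exists y, rfpi y = x.
Proof. by exists (repr x); rewrite /rfpi reprK. Qed.
Lemma rf_inv_ex (x : rfT) : exists y : rfT, (x != 0 -> y * x = 1) /\ (x = 0 -> y = 0).
Proof.
have [->|x0] := eqVneq x 0; first by exists 0; split=> // /negP[]; exact/eqP.
have [z ez] := rfpi_surj x.
have [u|m] := @unit_or_max _ O _ (srvalP z).
  have [v0 _ Ov] := u; have [y ey] := @srT_ex _ S _ Ov. exists (rfpi y); split=> [_|xe0]; last by rewrite xe0 eqxx in x0.
  rewrite -ez -rfpiM -rfpi1; congr rfpi; apply: srval_inj. by rewrite srvalM ey mulVf.
by case/negP: x0; rewrite -ez; apply/eqP/rfpi_eq0.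
Qed.
Definition rf_inv := projT1 (choice rf_inv_ex).
Fact rf_mulVf x : x != 0 -> rf_inv x * x = 1.
Proof. by rewrite /rf_inv; case: choice => f fP /=; case: (fP x). Qed.
Fact rf_inv0 : rf_inv 0 = 0.
Proof. by rewrite /rf_inv; case: choice => f fP /=; case: (fP 0) => _ ->. Qed.
HB.instance Definition _ := GRing.ComNzRing_isField.Build rfT rf_mulVf rf_inv0.
End ResidueField.

Lemma residue_field_ex (F : fieldType) (O : set F) : is_local O ->
  exists (k : fieldType) (rho : F -> k), is_residue_field O rho.
Proof.
move=> lO; pose S := Srng lO; pose k : fieldType := rfT lO.
have [rho rhoP] : {rho : F -> k & forall x (z : srT S), srval z = x -> rho x = rfpi z}.
  apply: (@choice _ _ (fun x (y : k) => forall z : srT S, srval z = x -> y = rfpi z)) => x. have [Ox|nOx] := EM (O x).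
    have [z ez] := @srT_ex _ S _ Ox; exists (rfpi z) => z' ez'. by congr rfpi; apply: srval_inj; rewrite ez.
  by exists 0 => z ez; case: nOx; rewrite -ez; exact: srvalP z.
exists k, rho; split.
- split.
  + by rewrite (rhoP 1 1 (srval1 S)) rfpi1.
  + move=> a b /(@srT_ex _ S) [x ex] /(@srT_ex _ S) [y ey].
    by rewrite (rhoP _ _ ex) (rhoP _ _ ey) -rfpiB; apply: rhoP; rewrite srvalB ex ey.
  + move=> a b /(@srT_ex _ S) [x ex] /(@srT_ex _ S) [y ey].
    by rewrite (rhoP _ _ ex) (rhoP _ _ ey) -rfpiM; apply: rhoP; rewrite srvalM ex ey.
- apply/seteqP; split => // x _; have [z <-] := @rfpi_surj _ _ lO x.
  by exists (srval z); [exact: srvalP z|exact: rhoP].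
- move=> h /(@srT_ex _ S) [x ex]; rewrite (rhoP _ _ ex) -ex; exact: rfpi_eq0.
Qed.

(** Additivity of Frobenius modulo an ideal containing p. In [taylor_frob] this ideal need not be
    prime, so passing to a residue field would not do. *)
Lemma frobD (F : fieldType) (A I : set F) (p : nat) (e : nat) (a b : F) :
  subring A -> ideal A I -> prime p -> I p%:R -> A a -> A b ->
  I ((a + b) ^+ (p ^ e) - a ^+ (p ^ e) - b ^+ (p ^ e)).
Proof.
case: p => [|p] //.
move=> sA iI pp Ip; elim: e a b => [|e IH] a b Aa Ab.
  by rewrite -addrA -opprD subrr; exact: id0 iI.
have base x y : A x -> A y -> I ((x + y) ^+ p.+1 - x ^+ p.+1 - y ^+ p.+1).
  move=> Ax Ay; rewrite exprDn big_ord_recl big_ord_recr /=.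
  rewrite subn0 mulr1 mulr1n /bump /= add1n subnn mul1r binn mulr1n. set S := \sum_(i < _) _.
  have -> : x ^+ p.+1 + (S + y ^+ p.+1) - x ^+ p.+1 - y ^+ p.+1 = S by ring. apply: (id_sum iI) => i.
  have /dvdnP[c ->] : (p.+1 %| 'C(p.+1, 1 + i))%N.
    by apply: prime_dvd_bin => //; rewrite /= ltnS.
  rewrite mulrnA -mulr_natr; apply: (idM iI) => //. by apply: srMn => //; apply: srM => //; apply: srX.
rewrite expnSr !exprM.
set u := a ^+ _; set v := b ^+ _; set w := (a + b) ^+ _.
have Au : A u by apply: srX.
have Av : A v by apply: srX.
have Aw : A w by apply: srX => //; apply: srD.
have Iz := IH a b Aa Ab; rewrite -/u -/v -/w in Iz.
have -> : w ^+ p.+1 - u ^+ p.+1 - v ^+ p.+1 =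
  (w ^+ p.+1 - (u + v) ^+ p.+1) + ((u + v) ^+ p.+1 - u ^+ p.+1 - v ^+ p.+1) by ring.
apply: (idD iI); last exact: base.
rewrite subrXX mulrC; apply: (idM iI).
  by apply: sr_sum => // i _; apply: srM => //; apply: srX => //; apply: srD.
by rewrite opprD addrA.
Qed.

(** * The p-adic absolute value and the integers of K *)

Section Padic.
Variables (p : nat) (p_prime : prime p) (Qp : fieldType) (a : Qp -> rat).
Hypothesis HQ : is_padic_field p a.
Let p0 : (0 < p)%N := prime_gt0 p_prime.
Let p1 : (1 < p)%N := prime_gt1 p_prime.
Local Notation P := (p%:R : rat).
Let P0 : 0 < P. Proof. by rewrite ltr0n. Qed.
Let P1 : 1 < P. Proof. by rewrite ltr1n. Qed.
Local Notation Z := (Zp_of a).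

Lemma abs0 : a 0 = 0. Proof. exact/(absp_eq0 HQ). Qed.
Lemma abs_eq0 x : (a x == 0) = (x == 0).
Proof. by apply/eqP/eqP => /(absp_eq0 HQ). Qed.
Lemma abs_gt0 x : x != 0 -> 0 < a x.
Proof. by move=> x0; rewrite lt0r abs_eq0 x0 (absp_ge0 HQ). Qed.
Lemma abs1 : a 1 = 1.
Proof.
have := abspM HQ 1 1; rewrite mulr1 => e.
by apply: (@mulfI _ (a 1)); rewrite ?abs_eq0 ?oner_eq0 // mulr1.
Qed.
Lemma absX x n : a (x ^+ n) = a x ^+ n.
Proof. by elim: n => [|n IH]; rewrite ?expr0 ?abs1 // !exprS (abspM HQ) IH. Qed.
Lemma absN x : a (- x) = a x.
Proof.
have e : a (-1) = 1.
  apply/eqP; rewrite -(@eqrXn2 _ 2) ?(absp_ge0 HQ) // expr1n -absX. by rewrite sqrrN expr1n abs1.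
by rewrite -mulN1r (abspM HQ) e mul1r.
Qed.
Lemma absV x : a x^-1 = (a x)^-1.
Proof.
have [->|x0] := eqVneq x 0; first by rewrite invr0 abs0 invr0.
apply: (@mulfI _ (a x)); rewrite ?abs_eq0 // -(abspM HQ) !mulfV ?abs_eq0 //.
exact: abs1.
Qed.
Lemma abs_nat n : (0 < n)%N -> a n%:R = P ^- (logn p n).
Proof.
move=> n0; rewrite -ratr_nat (absp_rat HQ) /padic_abs.
rewrite pnatr_eq0 eqn0Ngt n0 /= -[n%:R]/(n%:Z%:~R) numq_int denq_int !absz_nat logn1.
by rewrite sub0r exprnN.
Qed.
Lemma abs_nat_le1 n : a n%:R <= 1.
Proof.
case: n => [|n]; first by rewrite abs0.
rewrite abs_nat // invf_le1 ?exprn_gt0 //; apply: exprn_ege1; exact: ltW.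
Qed.
Lemma abs_p : a p%:R = P^-1.
Proof. by rewrite abs_nat // logn_prime // eqxx expr1. Qed.
Lemma abs_nat1 n : ~~ (p %| n)%N -> a n%:R = 1.
Proof.
move=> pn; have n0 : (0 < n)%N by case: n pn => //; rewrite dvdn0.
by rewrite abs_nat // lognE (negPf pn) !andbF expr0.
Qed.

(** By Bernoulli's inequality the powers of u / v > 1 outgrow N + 1, which is the number of terms of
    the binomial expansion in [abs_ultra]. *)
Lemma growth (u v : rat) : 0 <= u -> 0 <= v ->
  (forall N : nat, u ^+ N <= N.+1%:R * v ^+ N) -> u <= v.
Proof.
move=> u0 v0 H; rewrite leNgt; apply/negP => vu.
have [vz|vnz] := eqVneq v 0.
  by have := H 1%N; rewrite vz mulr0 leNgt -vz vu.
have v1 : 0 < v by rewrite lt0r vnz.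
pose e := u / v - 1; have e0 : 0 < e by rewrite subr_gt0 ltr_pdivlMr ?mul1r.
have bern (N : nat) : 1 + N%:R * e <= (u / v) ^+ N.
  have -> : u / v = 1 + e by rewrite /e; ring. elim: N => [|N IH]; first by rewrite mul0r addr0.
  rewrite exprS; apply: le_trans (_ : (1 + e) * (1 + N%:R * e) <= _); last first.
    by rewrite ler_wpM2l // addr_ge0 // ltW.
  rewrite -subr_ge0 -natr1; have -> : (1 + e) * (1 + N%:R * e) - (1 + (N%:R + 1) * e) = N%:R * e ^+ 2 by ring.
  by rewrite mulr_ge0 ?exprn_ge0 // ltW.
(* With N e^2 > 2 the exponent 2 N violates the hypothesis, because (1 + N e)^2 > 2 N + 1. *)
pose N := Num.bound (2 / e ^+ 2); have := archi_boundP (_ : 0 <= 2 / e ^+ 2).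
have -> : 0 <= 2 / e ^+ 2 by rewrite divr_ge0 // exprn_ge0 // ltW.
move=> /(_ isT); rewrite -/N ltr_pdivrMr ?exprn_gt0 // => hN.
have := H (2 * N)%N; rewrite -ler_pdivrMr ?exprn_gt0 // -expr_div_n.
rewrite leNgt => /negP; apply.
rewrite mulnC exprM; apply: lt_le_trans (_ : (1 + N%:R * e) ^+ 2 <= _); last first.
  rewrite ler_pXn2r // ?nnegrE; first by rewrite addr_ge0 // mulr_ge0 // ltW. by rewrite exprn_ge0 // divr_ge0.
have N0 : 0 < N%:R :> rat.
  by [].
have := ltr_pM2l N0 2 (N%:R * e ^+ 2); rewrite hN => /esym h.
rewrite -natr1 natrM -subr_gt0.
have -> : (1 + N%:R * e) ^+ 2 - (N%:R * 2 + 1) = 2 * N%:R * e + (N%:R * (N%:R * e ^+ 2) - N%:R * 2) by ring.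
by rewrite addr_gt0 ?mulr_gt0 // subr_gt0.
Qed.

(** The axioms only give the triangle inequality. As integers have absolute value at most 1,
    expanding (x + y)^N bounds it by (N + 1) m^N. *)
Lemma abs_ultra x y (m : rat) : a x <= m -> a y <= m -> a (x + y) <= m.
Proof.
move=> xm ym; have m0 : 0 <= m by apply: le_trans xm; exact: absp_ge0 HQ _.
apply: growth => // [|N]; first exact: absp_ge0 HQ _.
rewrite -absX exprDn mulr_natl -[X in _ *+ X](card_ord N.+1) -sumr_const.
have asum (r : seq 'I_N.+1) (G : 'I_N.+1 -> Qp) : a (\sum_(i <- r) G i) <= \sum_(i <- r) a (G i).
  elim: r => [|i r IH]; first by rewrite !big_nil abs0.
  by rewrite !big_cons; apply: le_trans (abspD HQ _ _) _; rewrite lerD2l.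
apply: le_trans (asum _ _) _; apply: ler_sum => i _.
rewrite -mulr_natr !(abspM HQ) !absX.
have -> : m ^+ N = m ^+ (N - i) * m ^+ i * 1 by rewrite mulr1 -exprD subnK // -ltnS.
apply: ler_pM; rewrite ?abs_nat_le1 ?mulr_ge0 ?exprn_ge0 ?(absp_ge0 HQ) //.
by apply: ler_pM; rewrite ?exprn_ge0 ?(absp_ge0 HQ) // lerXn2r ?nnegrE ?(absp_ge0 HQ).
Qed.
Lemma abs_ultraB x y (m : rat) : a x <= m -> a y <= m -> a (x - y) <= m.
Proof. by move=> xm ym; apply: abs_ultra => //; rewrite absN. Qed.

Lemma Z_sub : subring Z.
Proof.
split=> [|x y|x y]; rewrite /Zp_of /=; first by rewrite abs1.
  exact: abs_ultraB.
by move=> xl yl; rewrite (abspM HQ) mulr_ile1 // (absp_ge0 HQ).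
Qed.
Lemma p_neq0 : p%:R != 0 :> Qp.
Proof. by rewrite -abs_eq0 abs_p invr_eq0 gt_eqF. Qed.
Lemma Zdiv_p x n : Z (x / p%:R ^+ n) <-> a x <= P ^- n.
Proof.
rewrite /Zp_of /= (abspM HQ) absV absX abs_p exprVn invrK.
by rewrite -ler_pdivlMr ?exprn_gt0 // mul1r.
Qed.
(** A rational q close to x has denominator prime to p, and Bezout inverts this denominator modulo
    p. *)
Lemma Z_digit x : Z x -> exists n : nat, Z ((x - n%:R) / p%:R).
Proof.
move=> Zx; have P'0 : 0 < P^-1 by rewrite invr_gt0.
have [q hq] := absp_dense HQ x P'0.
have aq : a (ratr q) <= 1.
  rewrite -[ratr q](subKr x); apply: abs_ultraB => //; apply: ltW. by apply: lt_trans hq _; rewrite invf_lt1.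
have aint z : a (z%:~R) = a (`|z|%N%:R).
  by case: z => n //; rewrite NegzE absN.
have pd : ~~ (p %| `|denq q|)%N.
  apply/negP => pd; move: aq; rewrite (absp_rat HQ) /padic_abs. have pn : ~~ (p %| `|numq q|)%N.
    apply: contraL (coprime_num_den q) => pn.
    by apply/negP => /(coprime_dvdl pn)/(coprime_dvdr pd); rewrite /coprime gcdnn gtn_eqF.
  case: eqP => [q0|_]; first by move: pn; rewrite q0 dvdn0.
  have -> : logn p `|numq q| = 0%N by rewrite lognE (negPf pn) !andbF. rewrite subr0 -exprnP leNgt => /negP; apply.
  by rewrite exprn_egt1 // -lt0n -pfactor_dvdn // absz_gt0.
have [u [v e]] := Bezoutz (denq q) p.
have cop : gcdz (denq q) p = 1.
  apply/eqP; rewrite eqz_nat -/(coprime _ _) /= coprime_sym. by rewrite prime_coprime.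
rewrite cop in e.
pose n := ((u * numq q) %% p)%Z; exists `|n|%N.
have n0 : 0 <= n by rewrite modz_ge0 // -lt0n.
have -> : (`|n|%N%:R : Qp) = n%:~R by rewrite -[in RHS](gez0_abs n0).
rewrite -[p%:R]expr1; apply/Zdiv_p; rewrite expr1.
have -> : x - n%:~R = (x - ratr q) + (ratr q - n%:~R) by ring.
apply: abs_ultra; first exact: ltW.
have d0 : (denq q)%:~R != 0 :> Qp by rewrite -abs_eq0 aint abs_nat1.
have -> : ratr q - n%:~R = (numq q - n * denq q)%:~R / (denq q)%:~R :> Qp.
  have -> : (numq q - n * denq q)%:~R = (numq q)%:~R - n%:~R * (denq q)%:~R :> Qp.
    by rewrite -intrM -intrB.
  by rewrite mulrBl mulfK.
rewrite (abspM HQ) absV [a (denq q)%:~R]aint abs_nat1 // mulr1.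
have [w ->] : exists w : int, numq q - n * denq q = w * p%:Z.
  exists (numq q * v + (u * numq q %/ p)%Z * denq q).
  have -> : n = u * numq q - (u * numq q %/ p)%Z * p by rewrite [X in X - _](divz_eq _ p); ring.
  have : numq q * (u * denq q + v * p) = numq q by rewrite e mulr1. move=> {1}<-; ring.
rewrite rmorphM /= (abspM HQ) -[X in _ <= X]mul1r.
have -> : a p%:~R = P^-1 by exact: abs_p.
by rewrite ler_pM2r // aint abs_nat_le1.
Qed.
Lemma Zp_max x : a x < 1 -> Z (x / p%:R).
Proof.
move=> ax; have [n Zn] := @Z_digit x (ltW ax); have pn0 := p_neq0.
have an : a n%:R < 1.
  rewrite -[n%:R](subKr x); apply: le_lt_trans (_ : _ <= Num.max (a x) P^-1) _.
    apply: abs_ultraB; first by rewrite le_max lexx. rewrite le_max; apply/orP; right; rewrite -[P]expr1.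
    by apply/Zdiv_p; rewrite expr1.
  by rewrite gt_max ax invf_lt1.
have pn : (p %| n)%N by apply: contraLR an => pn; rewrite abs_nat1 //.
have [c en] := dvdnP pn.
have -> : x / p%:R = (x - n%:R) / p%:R + c%:R by rewrite en; field.
by apply: (srD Z_sub) => //; exact: (sr_nat Z_sub).
Qed.
Lemma Z_val x : Z x \/ Z x^-1.
Proof.
have [le|lt] := lerP (a x) 1; [by left|right].
by rewrite /Zp_of /= absV invf_le1 ?ltW // (lt_trans ltr01).
Qed.
Lemma Z_unit x : a x = 1 -> x != 0 /\ Z x^-1.
Proof.
move=> ax; rewrite /Zp_of /= absV ax; split=> //.
by rewrite -abs_eq0 ax.
Qed.
Lemma Z_notp x : Z x -> ~ Z (x / p%:R) -> x != 0 /\ Z x^-1.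
Proof.
move=> Zx nZ; apply: Z_unit; apply/eqP; rewrite eq_le [a x <= 1]Zx /=.
by rewrite leNgt; apply/negP => /Zp_max.
Qed.
Lemma Z_Vp : ~ Z p%:R^-1.
Proof. by rewrite /Zp_of /= absV abs_p invrK leNgt P1. Qed.

Lemma Z_complete (s : nat -> Qp) :
  (forall N, Z ((s N.+1 - s N) / p%:R ^+ N)) ->
  exists l, forall N, Z ((l - s N) / p%:R ^+ N).
Proof.
move=> H.
have C m n : (m <= n)%N -> a (s n - s m) <= P ^- m.
  move=> /subnK<-; elim: (n - m)%N => [|k IH].
    by rewrite subrr abs0 invr_ge0 exprn_ge0 //.
  rewrite addSn -(subrKA (s (k + m)%N)); apply: abs_ultra => //. have /Zdiv_p/le_trans := H (k + m)%N; apply.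
  by rewrite lef_pV2 ?posrE ?exprn_gt0 // ler_weXn2l ?leq_addl // ltW.
have small (eps : rat) : 0 < eps -> exists N, P ^- N < eps.
  move=> e0; pose N := Num.bound eps^-1; exists N.
  have := archi_boundP (ltW (_ : 0 < eps^-1)); rewrite invr_gt0 => /(_ e0) hN.
  rewrite invf_plt ?posrE ?exprn_gt0 //; apply: lt_le_trans hN _. by rewrite -natrX ler_nat; apply: ltnW; apply: ltn_expl.
have cau : forall eps : rat, 0 < eps -> exists N : nat, forall m n : nat,
       (N <= m)%N -> (N <= n)%N -> a (s m - s n) < eps.
  move=> eps /small[N hN]; exists N => m n Nm Nn; apply: le_lt_trans hN.
  by rewrite -(subrKA (s N)) -[s N - s n]opprB; apply: abs_ultraB; apply: C.
have [l hl] := absp_complete HQ cau.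
exists l => N; apply/Zdiv_p.
have PN0 : 0 < P ^- N by rewrite invr_gt0 exprn_gt0.
have [M hM] := hl _ PN0.
have := hM (maxn M N) (leq_maxl _ _) => hMN.
have -> : l - s N = (s (maxn M N) - s N) - (s (maxn M N) - l) by ring.
by apply: abs_ultraB; [apply: C; exact: leq_maxr|exact: ltW].
Qed.

Section Ext.
Variable K : fieldExtType Qp.
Local Notation ZK := ((fun x : Qp => x%:A : K) @` Z).
Definition OKs : set K := OK_of a K.

Lemma inKM (x y : Qp) : (x * y)%:A = x%:A * y%:A :> K.
Proof. exact: (rmorphM (in_alg K)). Qed.
Lemma inKX (x : Qp) n : (x ^+ n)%:A = x%:A ^+ n :> K.
Proof. exact: (rmorphXn (in_alg K)). Qed.
Lemma inKV (x : Qp) : (x^-1)%:A = (x%:A)^-1 :> K.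
Proof. exact: (fmorphV (in_alg K)). Qed.
Lemma inKB (x y : Qp) : (x - y)%:A = x%:A - y%:A :> K.
Proof. exact: (rmorphB (in_alg K)). Qed.
Lemma inK_nat n : (n%:R : Qp)%:A = n%:R :> K.
Proof. exact: (rmorph_nat (in_alg K)). Qed.
Lemma ZK_sub : subring ZK.
Proof.
have sZ := Z_sub; split.
- by exists 1; [mem|rewrite scale1r].
- move=> _ _ [x Zx <-] [y Zy <-]; exists (x - y); [mem|by rewrite scalerBl].
- move=> _ _ [x Zx <-] [y Zy <-]; exists (x * y); first mem.
  by rewrite -scalerAl mul1r scalerA.
Qed.
Lemma OKsE x : OKs x <-> integral ZK x.
Proof.
split=> [[q [mq Zq rq]]|[q [mq Zq rq]]].
  exists (map_poly (in_alg K) q); split=> //; first by rewrite map_monic. by move=> i; rewrite coef_map; exists q`_i.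
have [c cP] := choice (fun i => let: ex_intro2 u v w := Zq i in
   ex_intro (fun u => Z u /\ u%:A = q`_i) u (conj v w)).
exists (\poly_(i < size q) c i).
have e : map_poly (in_alg K) (\poly_(i < size q) c i) = q.
  apply/polyP => i; rewrite coef_map coef_poly; case: ltnP => [_|le].
    by case: (cP i).
  by rewrite (nth_default _ le); exact: scale0r.
split; last by rewrite e.
  by rewrite -(map_monic (in_alg K)) e.
move=> i; rewrite coef_poly; case: ltnP => _; first by case: (cP i).
exact: sr0 Z_sub.
Qed.
Lemma OK_sub : subring OKs.
Proof.
have [H1 H2 H3] := int_subring ZK_sub.
by split=> [|x y /OKsE ? /OKsE ?|x y /OKsE ? /OKsE ?]; apply/OKsE; auto.
Qed.
Lemma OK_Z z : Z z -> OKs z%:A.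
Proof. by move=> Zz; apply/OKsE/int_id; [exact: ZK_sub|exists z]. Qed.
Lemma OK_int x : integral OKs x -> OKs x.
Proof.
move=> ix; apply/OKsE; apply: (int_trans ZK_sub) ix => y; exact: (OKsE y).1.
Qed.
Lemma OK_Qp z : OKs z%:A -> Z z.
Proof.
case=> q [mq Zq rq]; have [//|Zi] := Z_val z.
have [->|z0] := eqVneq z 0; first exact: sr0 Z_sub.
rewrite -[z]invrK; apply: (int_inv_mem Z_sub) => //; first by rewrite invr_eq0.
by rewrite invrK; exists q; split=> //; rewrite -(fmorph_root (in_alg K)).
Qed.
Lemma Kp0 : p%:R != 0 :> K.
Proof. by rewrite -(rmorph_nat (in_alg K)) fmorph_eq0 p_neq0. Qed.
Lemma alg_poly x : exists2 q : {poly Qp}, q \is monic & root (map_poly (in_alg K) q) x.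
Proof.
have /polyOver1P[q e] := minPolyOver 1%AS x.
exists q; first by rewrite -(map_monic (in_alg K)) -e monic_minPoly.
by rewrite -e root_minPoly.
Qed.
Lemma scale_Z (n : nat) (c : 'I_n -> Qp) : exists N : nat, forall i, Z (c i * p%:R ^+ N).
Proof.
have one (x : Qp) : exists N : nat, Z (x * p%:R ^+ N).
  pose N := Num.bound (a x); exists N; rewrite /Zp_of /= (abspM HQ) absX abs_p exprVn.
  rewrite ler_pdivrMr ?exprn_gt0 // mul1r; apply: le_trans (ltW (archi_boundP (absp_ge0 HQ x))) _.
  by rewrite -natrX ler_nat; apply: ltnW; apply: ltn_expl.
have [N NP] := choice (fun i => one (c i)).
exists (\sum_i N i)%N => i; rewrite (bigD1 i) //= exprD mulrA.
by apply: (srM Z_sub); [mem|apply: (srX Z_sub); exact: sr_nat Z_sub _].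
Qed.
Lemma scale_int x : exists N : nat, OKs (p%:R ^+ N * x).
Proof.
have [q mq rq] := alg_poly x.
have [N ZN] := scale_Z (fun i : 'I_(size q) => q`_i).
have pN0 : p%:R ^+ N != 0 :> K by rewrite expf_neq0 // Kp0.
exists N; pose Q := p%:R ^+ N *: map_poly (in_alg K) q.
have lQ : lead_coef Q = p%:R ^+ N.
  by rewrite lead_coefZ lead_coef_map (monicP mq) rmorph1 mulr1.
apply/OKsE; rewrite -lQ; apply: int_lead; first exact: ZK_sub.
- move=> i; rewrite coefZ coef_map; have [lt|le] := ltnP i (size q).
    exists (q`_i * p%:R ^+ N); first exact: ZN (Ordinal lt). by rewrite inKM inKX inK_nat mulrC.
  rewrite nth_default // -[X in _ * X]/((0 : Qp)%:A) scale0r mulr0; exact: sr0 ZK_sub.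
- by rewrite -lead_coef_eq0 lQ.
- by rewrite rootE hornerZ (eqP rq) mulr0.
Qed.
Lemma OK_sep y : (forall N : nat, OKs (y / p%:R ^+ N)) -> y = 0.
Proof.
move=> H; apply/eqP; apply: contrapT => /negP y0.
have [M OM] := scale_int y^-1.
have := srM OK_sub OM (H M.+1).
have -> : p%:R ^+ M * y^-1 * (y / p%:R ^+ M.+1) = (p%:R^-1 : Qp)%:A :> K.
  rewrite exprS inKV inK_nat; field. by rewrite y0 expf_neq0 ?Kp0.
by move/OK_Qp/Z_Vp.
Qed.
(** Independence of the classes in OK / p OK over Zp / p, without forming the quotients. *)
Definition indep m (e : 'I_m -> K) := forall c : 'I_m -> Qp, (forall i, Z (c i)) ->
  OKs ((\sum_i (c i)%:A * e i) / p%:R) -> forall i, Z (c i / p%:R).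

(** A linear relation, divided by its coefficient of largest absolute value, is integral with one
    coefficient equal to 1. *)
Lemma indep_dim m (e : 'I_m -> K) : indep e -> (m <= \dim {:K})%N.
Proof.
move=> ie; rewrite leqNgt; apply/negP => dm.
have nf : ~ free [tuple e i | i < m].
  move/eqP => f; have := dimvS (subvf <<[tuple e i | i < m]>>). by rewrite f size_tuple leqNgt dm.
have [c [S0 [i ci0]]] : exists c : 'I_m -> Qp, \sum_(i < m) c i *: e i = 0 /\ exists i, c i != 0.
  apply: contrapT => H; apply: nf; apply/vector.freeP => k Sk i; apply: contrapT => /eqP ki.
  apply: H; exists k; split; last by exists i. by rewrite -[RHS]Sk; apply: eq_bigr => j _; rewrite -tnth_nth tnth_mktuple.
have [j _ jmax] : exists2 j : 'I_m, true & forall i, a (c i) <= a (c j).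
  have [j _ hj] := @Order.TotalTheory.arg_maxP _ _ _ i xpredT (fun i => a (c i)) isT. by exists j => // i'; apply: hj.
have cj0 : c j != 0.
  by apply: contraNneq ci0 => cj; have := jmax i; rewrite cj abs0 => h; rewrite -abs_eq0 eq_le h (absp_ge0 HQ).
have := ie (fun i => c i / c j) _ _ j; rewrite mulfV //.
move=> H; apply: Z_Vp; rewrite -[_^-1]mul1r; apply: H.
  by move=> k; rewrite /Zp_of /= (abspM HQ) absV ler_pdivrMr ?abs_gt0 // mul1r.
have -> : \sum_i (c i / c j)%:A * e i = (c j)^-1 *: (\sum_(i < m) c i *: e i).
  rewrite scaler_sumr; apply: eq_bigr => k _. by rewrite -scalerAl mul1r scalerA mulrC.
by rewrite S0 scaler0 mul0r; exact: sr0 OK_sub.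
Qed.

Lemma OK_basis : exists m (e : 'I_m -> K), [/\ forall i, OKs (e i), indep e &
  forall e' : 'I_m.+1 -> K, (forall i, OKs (e' i)) -> ~ indep e'].
Proof.
pose Q m := `[<exists e : 'I_m -> K, (forall i, OKs (e i)) /\ indep e>].
have Q0 : exists m, Q m.
  by exists 0%N; apply/asboolP; exists (fun=> 0); split=> [[]//|c _ _ []].
have ub m : Q m -> (m <= \dim {:K})%N by move/asboolP => [e [_ /indep_dim]].
case: (ex_maxnP Q0 ub) => m /asboolP[e [Oe ie]] mx; exists m, e; split=> // e' Oe' ie'.
have : (m.+1 <= m)%N by apply: mx; apply/asboolP; exists e'.
lia.
Qed.
Lemma OK_sum m (e : 'I_m -> K) (c : 'I_m -> Qp) : (forall i, OKs (e i)) ->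
  (forall i, Z (c i)) -> OKs (\sum_i (c i)%:A * e i).
Proof.
by move=> Oe Zc; apply: (sr_sum OK_sub) => i _; apply: (srM OK_sub) => //; exact: OK_Z.
Qed.

(** A p-adic expansion with digits in the Zp-span of e converges in that span, coordinate by
    coordinate. *)
Lemma OK_series m (e : 'I_m -> K) (c : nat -> 'I_m -> Qp) : (forall i, OKs (e i)) -> (forall N i, Z (c N i)) ->
  exists C : 'I_m -> Qp, (forall i, Z (C i)) /\ forall N, OKs ((\sum_i (C i)%:A * e i -
    \sum_(j < N) p%:R ^+ j * \sum_i (c j i)%:A * e i) / p%:R ^+ N).
Proof.
move=> Oe Zc; pose s i N := \sum_(j < N) p%:R ^+ j * c j i.
have lim i : exists l, forall N, Z ((l - s i N) / p%:R ^+ N).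
  by apply: Z_complete => N; rewrite /s big_ord_recr addrAC subrr add0r mulrC mulKf ?expf_neq0 ?p_neq0.
have [C CP] := choice lim; exists C; split=> [i|N]; first by have := CP i 0%N; rewrite /s big_ord0 subr0 divr1.
have -> : \sum_(j < N) p%:R ^+ j * \sum_i (c j i)%:A * e i = \sum_i (s i N)%:A * e i.
  under eq_bigr do rewrite mulr_sumr. rewrite exchange_big; apply: eq_bigr => i _; rewrite scaler_suml mulr_suml.
  by apply: eq_bigr => j _; rewrite inKM inKX inK_nat mulrA.
have := OK_sum Oe (fun i => CP i N); congr OKs; rewrite -sumrB mulr_suml; apply: eq_bigr => i _.
by rewrite inKM inKB inKV inKX inK_nat -mulrBl mulrAC.
Qed.
(* A maximal family that stays independent modulo p generates OK over Zp. *)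
Lemma OK_gens : exists m (e : 'I_m -> K), [/\ forall i, OKs (e i),
  forall x, OKs x -> exists c : 'I_m -> Qp, (forall i, Z (c i)) /\ x = \sum_i (c i)%:A * e i &
  forall e' : 'I_m.+1 -> K, (forall i, OKs (e' i)) -> ~ indep e'].
Proof.
have [m [e [Oe ie maxe]]] := OK_basis; exists m, e; split=> //.
have modp x : OKs x -> exists c : 'I_m -> Qp, (forall i, Z (c i)) /\
    OKs ((x - \sum_i (c i)%:A * e i) / p%:R).
  move=> Ox. pose e' (i : 'I_m.+1) := if unlift ord_max i is Some j then e j else x.
  have Oe' i : OKs (e' i) by rewrite /e'; case: unliftP.
  have /existsNP[c /not_implyP[Zc /not_implyP[Oc /existsNP[i0 nc]]]] := maxe _ Oe'.
  rewrite big_ord_recr /= {2}/e' unlift_none in Oc.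
  have Ec : \sum_(i < m) (c (widen_ord (leqnSn m) i))%:A * e' (widen_ord (leqnSn m) i) =
            \sum_i (c (lift ord_max i))%:A * e i.
    apply: eq_bigr => i _; have -> : widen_ord (leqnSn m) i = lift ord_max i.
      by apply: val_inj; rewrite /= /bump leqNgt ltn_ord.
    by rewrite /e' liftK.
  rewrite Ec in Oc; set cx := c ord_max in Oc. have ncx : ~ Z (cx / p%:R).
    move=> Zcx; apply: nc; case: (unliftP ord_max i0) => [j ->|->] //. apply: (ie (fun j => c (lift ord_max j))) => //.
    set S := \sum_i _ in Oc *; have -> : S / p%:R = (S + cx%:A * x) / p%:R - (cx / p%:R)%:A * x.
      by rewrite inKM inKV inK_nat; field; rewrite Kp0.
    by apply: (srB OK_sub) => //; apply: (srM OK_sub) => //; exact: OK_Z.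
  have [cx0 Zcx'] := Z_notp (Zc _) ncx. exists (fun i => - (c (lift ord_max i) / cx)); split.
    by move=> i; apply: (srN Z_sub); apply: (srM Z_sub).
  have := srM OK_sub (OK_Z Zcx') Oc.
  set S := \sum_i _; have -> : \sum_i (- (c (lift ord_max i) / cx))%:A * e i = - (cx^-1)%:A * S.
    rewrite mulr_sumr; apply: eq_bigr => i _. by rewrite scaleNr inKM; ring.
  have c0 : cx%:A != 0 :> K by rewrite scaler_eq0 oner_eq0 orbF.
  by move=> H; congr (OKs _): H; rewrite !inKV; field; rewrite Kp0 c0.
move=> x Ox.
(* Digits are chosen for all x at once, with default 0 outside OK, so that the remainders [xs] can
   be defined by recursion. *)
have [cf cfP] := choice (fun x => (let: conj _ h := conj I (fun h : OKs x => modp x h) in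
  match EM (OKs x) with
  | or_introl h => let: ex_intro c d := modp x h in ex_intro (fun c => OKs x -> (forall i, Z (c i)) /\
      OKs ((x - \sum_i (c i)%:A * e i) / p%:R)) c (fun _ => d)
  | or_intror h => ex_intro _ (fun=> 0) (fun h' => False_ind _ (h h'))
  end)).
pose xs := fix xs n := if n is n'.+1 then
  (xs n' - \sum_i (cf (xs n') i)%:A * e i) / p%:R else x.
have Oxs n : OKs (xs n) by elim: n => //= n /cfP [].
have [C [ZC CP]] := OK_series Oe (fun N => proj1 (cfP _ (Oxs N))); exists C; split=> //.
apply/eqP; rewrite -subr_eq0; apply/eqP; apply: OK_sep => N; have pN : p%:R ^+ N != 0 :> K by rewrite expf_neq0 ?Kp0.
have eN : x - \sum_(j < N) p%:R ^+ j * \sum_i (cf (xs j) i)%:A * e i = p%:R ^+ N * xs N.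
  elim: N {pN} => [|N IH]; first by rewrite big_ord0 subr0 mul1r.
  by rewrite big_ord_recr opprD addrA IH /= exprS; field; rewrite Kp0.
have := srB OK_sub (Oxs N) (CP N); congr OKs.
by rewrite -[xs N](mulKf pN) -eN mulrC -mulrBl; congr (_ / _); ring.
Qed.
Lemma OK_complete (x : nat -> K) : (forall N, OKs ((x N.+1 - x N) / p%:R ^+ N)) ->
  exists l, forall N, OKs ((l - x N) / p%:R ^+ N).
Proof.
have [m [e [Oe gen _]]] := OK_gens => H.
have [c cP] := choice (fun N => gen _ (H N)).
have [C [_ CP]] := OK_series Oe (fun N => proj1 (cP N)); exists (x 0%N + \sum_i (C i)%:A * e i) => N.
have -> : x N = x 0%N + \sum_(j < N) p%:R ^+ j * \sum_i (c j i)%:A * e i.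
  elim: N => [|N IH]; first by rewrite big_ord0 addr0.
  rewrite big_ord_recr /=; have [_ <-] := cP N; rewrite addrA -IH mulrC divfK ?expf_neq0 ?Kp0 //; ring.
by rewrite opprD addrACA subrr add0r.
Qed.

Section LocalOK.
(** Instead of being derived from Hensel's lemma, locality is read off a special point of the model,
    by [special_OK_local]. *)
Hypothesis lO : is_local OKs.

Lemma OK_p_max : max_ideal OKs p%:R.
Proof.
split=> [|[_ _]]; first mem.
by rewrite -inK_nat -inKV => /OK_Qp/Z_Vp.
Qed.
(** [seidenberg] applies to the minimal polynomial divided by its coefficient of largest absolute
    value, which becomes the unit coefficient. *)
Lemma OK_val x : OKs x \/ OKs x^-1.
Proof.
have [q mq rq] := alg_poly x.
have s0 : (0 < size q)%N by rewrite size_poly_gt0 monic_neq0.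
have [j _ jmax] := @Order.TotalTheory.arg_maxP _ _ _ (Ordinal s0) xpredT
   (fun i : 'I_(size q) => a q`_i) isT.
have qj0 : q`_j != 0.
  have sl : ((size q).-1 < size q)%N by rewrite ltn_predL. have := jmax (Ordinal sl) isT.
  rewrite /= -lead_coefE (monicP mq) abs1 -abs_eq0. by apply: contraTneq => ->; rewrite -ltNge.
pose jn : nat := nat_of_ord j; pose Q : {poly K} := ((q`_j)^-1)%:A *: map_poly (in_alg K) q.
have S := @seidenberg K OKs x Q jn lO OK_int.
apply: S; rewrite /Q /jn.
- move=> i; rewrite coefZ coef_map -inKM; apply: OK_Z.
  rewrite /Zp_of /= (abspM HQ) absV mulrC ler_pdivrMr ?abs_gt0 // mul1r.
  have [lt|le] := ltnP i (size q); first exact: (jmax (Ordinal lt)). by rewrite nth_default // abs0 (absp_ge0 HQ).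
- by rewrite rootE hornerZ (eqP rq) mulr0.
- rewrite coefZ coef_map -inKM mulVf // scale1r.
  by mem.
Qed.

(** The m + 1 partial products y 0, ..., y m are dependent modulo p, m being the size of a largest
    independent family. At the first index i with unit coefficient the later terms are multiples of
    y i by non-units, so y i, and with it y m, lies in p OK. *)
Lemma OK_prod : exists m : nat, forall x : nat -> K, (forall i, max_ideal OKs (x i)) ->
  OKs ((\prod_(i < m) x i) / p%:R).
Proof.
have [m [e [_ _ maxe]]] := OK_gens; exists m => x mx.
have Ox i : OKs (x i) by case: (mx i).
pose y (j : nat) := \prod_(i < j) x i.
have Oy j : OKs (y j) by apply: (sr_prod OK_sub).
have /existsNP[c /not_implyP[Zc /not_implyP[Oc /existsNP[i0 nc]]]] :=
  maxe (fun i : 'I_m.+1 => y i) (fun i => Oy i).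
have [i nci imin] : exists2 i : 'I_m.+1, ~ Z (c i / p%:R) &
    forall j : 'I_m.+1, (j < i)%N -> Z (c j / p%:R).
  have ex : exists n, `[<exists i : 'I_m.+1, val i = n /\ ~ Z (c i / p%:R)>].
    by exists i0; apply/asboolP; exists i0.
  case: (ex_minnP ex) => n /asboolP[i [ei nci]] nmin; exists i => // j ji.
  apply: contrapT => nj; suff : (n <= j)%N by rewrite leqNgt -ei ji. by apply: nmin; apply/asboolP; exists j.
have [ci0 Zci'] := Z_notp (Zc i) nci.
have yS j k : (j <= k)%N -> exists2 z, y k = y j * z & OKs z /\ ((j < k)%N -> max_ideal OKs z).
  move=> /subnK <-; elim: (k - j)%N => [|n [z e1 [Oz mz]]].
    by exists 1; rewrite ?mulr1 ?add0n ?ltnn //; split; mem.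
  exists (z * x (n + j)%N).
    by rewrite mulrA -e1 /y big_ord_recr.
  split=> [|_]; first mem. by mem.
have [w wP] : {w : 'I_m.+1 -> K & forall j, j != i -> max_ideal OKs (w j) /\
    OKs (((c j)%:A * y j - w j * y i) / p%:R)}.
  apply: (@choice _ _ (fun j wj => j != i -> max_ideal OKs wj /\
    OKs (((c j)%:A * y j - wj * y i) / p%:R))) => j.
  have [ji|ij|eij] := ltngtP j i; last by exists 0; rewrite (val_inj eij) eqxx.
    exists 0 => _; split; first mem. rewrite mul0r subr0. have -> : (c j)%:A * y j / p%:R = (c j / p%:R)%:A * y j.
      by rewrite inKM inKV inK_nat mulrAC.
    by apply: (srM OK_sub) => //; apply/OK_Z/imin.
  have [z ez [_ mz]] := yS i j (ltnW ij). exists ((c j)%:A * z) => _; split.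
    by apply: (maxMl OK_sub); [exact: OK_Z|exact: mz].
  by rewrite ez -mulrA [z * _]mulrC subrr mul0r; mem.
pose u := (c i)%:A + \sum_(j < m.+1 | j != i) w j.
have uu : unit_in OKs u.
  apply: (unitDmax lO); last by apply: (max_sum lO) => j /wP []. split; last by rewrite -inKV; exact: OK_Z.
    by rewrite scaler_eq0 oner_eq0 orbF.
  exact: OK_Z.
have Oyu : OKs (y i * u / p%:R).
  have -> : y i * u / p%:R = (\sum_(j < m.+1) (c j)%:A * y j) / p%:R -
     \sum_(j < m.+1 | j != i) ((c j)%:A * y j - w j * y i) / p%:R.
    rewrite -mulr_suml sumrB -mulr_suml (bigD1 i) //= /u; field; exact: Kp0.
  by apply: (srB OK_sub) => //; apply: (sr_sum OK_sub) => j /wP [].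
have [u0 _ Ou'] := uu.
have [z ez [Oz _]] := yS i m (leq_ord i).
have -> : \prod_(i < m) x i = y i * z by rewrite -ez.
have -> : y i * z / p%:R = y i * u / p%:R * u^-1 * z by field; rewrite Kp0 u0.
by mem.
Qed.

Lemma OK_prod_many : exists m : nat, forall (x : nat -> K) (N : nat),
  (forall i, max_ideal OKs (x i)) -> OKs ((\prod_(i < m * N) x i) / p%:R ^+ N).
Proof.
have [m H] := OK_prod; exists m => x N; elim: N x => [|N IH] x mx.
  by rewrite muln0 big_ord0 divr1; mem.
have e : \prod_(i < m * N.+1) x i = (\prod_(i < m) x i) * \prod_(i < m * N) x (m + i)%N.
  rewrite -(big_mkord xpredT x) (big_cat_nat (n := m)) //= ?mulnS ?leq_addr //.
  rewrite big_mkord; congr (_ * _); rewrite -{1}[m]add0n big_addn addKn big_mkord. by apply: eq_bigr => i _; rewrite addnC.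
have -> : (\prod_(i < m * N.+1) x i) / p%:R ^+ N.+1 =
   (\prod_(i < m) x i) / p%:R * ((\prod_(i < m * N) x (m + i)%N) / p%:R ^+ N).
  by rewrite e exprS; field; rewrite expf_neq0 ?Kp0.
by apply: (srM OK_sub); [exact: H | apply: (IH (fun i => x (m + i)%N))].
Qed.

(** In a valuation ring a bad sequence satisfies x n = y n x (n+1) with y n a non-unit. Then x 0 is
    divisible by arbitrarily long products of non-units, hence by every power of p. *)
Lemma OK_noeth : noeth OKs.
Proof.
move=> x Ox; apply: contrapT => H.
have nsp n : ~ span_lt OKs x n (x n) by move=> h; apply: H; exists n.
have notdiv n b : OKs b -> x n.+1 <> b * x n.
  move=> Ob e; apply: (nsp n.+1); exists (fun i => if i == n then b else 0).
    by move=> i; case: eqP => // _; mem.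
  rewrite big_ord_recr /= eqxx big1 ?add0r // => i _. by rewrite (ltn_eqF (ltn_ord i)) mul0r.
have x0 n : x n != 0.
  apply/eqP => xn; apply: (nsp n); exists (fun=> 0); first by move=> _; mem. by rewrite big1 // => i _; rewrite mul0r.
pose y n := x n / x n.+1.
have my n : max_ideal OKs (y n).
  have nO : ~ OKs (y n)^-1.
    by rewrite invf_div => /(notdiv n); apply; rewrite divfK.
  split; first by case: (OK_val (y n)). by case=> _ _ /nO.
have ex n : x 0%N = (\prod_(i < n) y i) * x n.
  elim: n => [|n IH]; first by rewrite big_ord0 mul1r. by rewrite big_ord_recr -mulrA divfK.
have [m Hm] := OK_prod_many.
have := x0 0%N; rewrite (@OK_sep (x 0%N)) ?eqxx // => N.
rewrite (ex (m * N)%N) mulrAC; apply: (srM OK_sub) => //; exact: Hm.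
Qed.

Lemma OK_frac x : exists u v, [/\ OKs u, OKs v, v != 0 & x = u / v].
Proof.
have [N ON] := scale_int x; exists (p%:R ^+ N * x), (p%:R ^+ N).
have pN0 : p%:R ^+ N != 0 :> K by rewrite expf_neq0 ?Kp0.
split=> //; last by rewrite mulrC mulKf.
by apply: (srX OK_sub); mem.
Qed.

Lemma OK_dvr : dvr OKs.
Proof.
apply: noeth_dvr => //; [exact: OK_noeth| |exact: OK_frac].
pose pr b : set K := [set x | OKs (x / b)].
have prP b : b != 0 -> OKs b -> ideal OKs (pr b).
  move=> b0 Ob; split.
  - by move=> x Ox; rewrite -[x](divfK b0); mem.
  - by rewrite /pr /= mul0r; mem.
  - by move=> x y Ox Oy; rewrite /pr /= mulrDl; mem.
  - by move=> x y Ox Oy; rewrite /pr /= -mulrA; mem.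
(* The uniformizer generates an ideal maximal among the principal ideals of nonzero non-units; p
   provides one to start from. *)
have [I [[b [mb b0 ->]] _ bmax]] := @noeth_max _ OKs
  [set I | exists b, [/\ max_ideal OKs b, b != 0 & I = pr b]] (pr p%:R) OK_noeth
  (fun I h => let: ex_intro b (And3 mb b0 e) := h in eq_ind_r (ideal OKs) (prP b b0 (proj1 mb)) e)
  (ex_intro _ p%:R (And3 OK_p_max Kp0 erefl)).
exists b; split=> // h; split=> [mh|Oh]; last first.
  by rewrite -[h](divfK b0); mem.
have [->|h0] := eqVneq h 0; first by rewrite mul0r; mem.
have [//|Obh] := OK_val (h / b); rewrite invf_div in Obh.
apply: (bmax (pr h)); first by exists h.
  move=> x Ox; rewrite /pr /= in Ox *; have -> : x / h = x / b * (b / h) by field; rewrite h0. by mem.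
by rewrite /pr /= divff; mem.
Qed.

(** Finiteness of the residue field, in the form used later: one power of Frobenius fixes all
    classes. The digits [n] leave finitely many classes, pigeonhole gives each c a period j - i, and
    a factorial is a common multiple of these periods. *)
Lemma OK_residue : exists e : nat, (0 < e)%N /\
  forall c, OKs c -> max_ideal OKs (c ^+ (p ^ e) - c).
Proof.
have [m [e [Oe gen _]]] := OK_gens.
have iI : ideal OKs (max_ideal OKs).
  by split; [move=> ? [] | mem| mem| move=> *; exact: (maxMl OK_sub)].
have mp := OK_p_max.
have dig x : OKs x -> exists n : {ffun 'I_m -> 'I_p}, max_ideal OKs (x - \sum_i (n i)%:R * e i).
  move=> Ox; have [c [Zc ->]] := gen x Ox. have [n nP] := choice (fun i => Z_digit (Zc i)).
  exists [ffun i => Ordinal (ltn_pmod (n i) p0)]. rewrite -sumrB; apply: (max_sum lO) => i _; rewrite ffunE /= -mulrBl.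
  apply: (maxMr OK_sub) => //.
  have -> : (c i)%:A - (n i %% p)%:R = p%:R * (((c i - (n i)%:R) / p%:R)%:A + (n i %/ p)%:R) :> K.
    have en : (n i)%:R = (n i %/ p)%:R * p%:R + (n i %% p)%:R :> K.
      by rewrite -natrM -natrD -divn_eq.
    by rewrite inKM inKB inKV !inK_nat en; field; exact: Kp0.
  apply: (maxMr OK_sub) => //; apply: (srD OK_sub); [exact: OK_Z|mem].
have FX x y k : OKs x -> OKs y -> max_ideal OKs (x ^+ (p ^ k) - y ^+ (p ^ k)) -> max_ideal OKs (x - y).
  move=> Ox Oy mxy; have Oxy := srB OK_sub Ox Oy. apply: (max_exp OK_sub (n := p ^ k) Oxy).
  have := frobD k OK_sub iI p_prime mp Oxy Oy; rewrite subrK => H.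
  have -> : (x - y) ^+ (p ^ k) = (x ^+ (p ^ k) - y ^+ (p ^ k)) - (x ^+ (p ^ k) - (x - y) ^+ (p ^ k) - y ^+ (p ^ k)) by ring.
  by mem.
pose M := #|{ffun 'I_m -> 'I_p}|.
exists (M.+1)`!; split; first exact: fact_gt0.
move=> c Oc.
have [n nP] := choice (fun j : 'I_M.+1 => dig (c ^+ (p ^ j)) (srX OK_sub _ Oc)).
have [i [j [ij eij]]] : exists i j : 'I_M.+1, (i < j)%N /\ n i = n j.
  apply: contrapT => H; have : injective n.
    move=> i j e1; apply/eqP; apply: contrapT => /negP ij; apply: H.
    have [lt|lt|/val_inj e2] := ltngtP i j; [by exists i, j|by exists j, i|by rewrite e2 eqxx in ij].
  by move/leq_card; rewrite card_ord ltnn.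
have m1 : max_ideal OKs (c ^+ (p ^ (j - i)) - c).
  apply: (FX _ _ i) => //; first exact: (srX OK_sub). rewrite -exprM -expnD subnK ?(ltnW ij) //.
  have -> : c ^+ (p ^ j) - c ^+ (p ^ i) = (c ^+ (p ^ j) - \sum_i0 (n j i0)%:R * e i0) -
     (c ^+ (p ^ i) - \sum_i0 (n i i0)%:R * e i0) by rewrite eij; ring.
  by mem.
have m2 k : max_ideal OKs (c ^+ (p ^ ((j - i) * k)) - c).
  elim: k => [|k IH]; first by rewrite muln0 subrr; mem. rewrite mulnS expnD exprM. set u := c ^+ _ in m1 *.
  have -> : u ^+ (p ^ ((j - i) * k)) - c =
     (u ^+ (p ^ ((j - i) * k)) - c ^+ (p ^ ((j - i) * k))) + (c ^+ (p ^ ((j - i) * k)) - c) by ring.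
  apply: maxD => //; rewrite subrXX mulrC; apply: (maxMl OK_sub) => //.
  by apply: (sr_sum OK_sub) => h _; apply: (srM OK_sub); apply: (srX OK_sub) => //; apply: (srX OK_sub).
have /dvdnP[k ->] : (j - i %| (M.+1)`!)%N.
  apply: dvdn_fact; rewrite subn_gt0 ij; have := ltn_ord j; lia.
by rewrite mulnC.
Qed.
End LocalOK.
End Ext.
End Padic.

(** * Localizations, centres and domination *)

Section Localizations.
Variable F : fieldType.
Implicit Types (A P O Z : set F).

Lemma localizationl A P : subring A -> prime_ideal_in A P -> A `<=` localization A P.
Proof.
move=> sA pP a Aa; exists a, 1.
by split; [|mem|case: pP => _ _ _ _ []|exact: oner_neq0|rewrite divr1].
Qed.

Section Loc.
Variables (A P : set F).
Hypotheses (sA : subring A) (pP : prime_ideal_in A P).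
Let L := localization A P.

Lemma prime_notM a b : A a -> A b -> ~ P a -> ~ P b -> ~ P (a * b).
Proof. by move=> Aa Ab na nb; case: pP => _ _ _ _ [_ H] /(H _ _ Aa Ab) []. Qed.
Lemma prime_neq0 a : ~ P a -> a != 0.
Proof. by apply: contra_notN => /eqP->; case: pP. Qed.
Lemma prime_ideal : ideal A P.
Proof. by case: pP => H1 H2 H3 H4 _; split. Qed.

Lemma loc_sub : subring L.
Proof.
split.
- by apply: localizationl ; mem.
- move=> _ _ [a [b [Aa Ab nb b0 ->]]] [c [d [Ac Ad nd d0 ->]]].
  exists (a * d - c * b), (b * d); split.
  + by mem.
  + by mem.
  + exact: prime_notM.
  + by rewrite mulf_neq0.
  + by field; rewrite d0.
- move=> _ _ [a [b [Aa Ab nb b0 ->]]] [c [d [Ac Ad nd d0 ->]]].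
  exists (a * c), (b * d); split; [mem|mem|exact: prime_notM|by rewrite mulf_neq0|]. by field; rewrite d0.
Qed.

Lemma loc_unit b : A b -> ~ P b -> unit_in L b.
Proof.
move=> Ab nb; have b0 := prime_neq0 nb; split=> //; first exact: localizationl.
by exists 1, b; split => //; [mem|rewrite div1r].
Qed.

Lemma loc_max a b : A a -> A b -> ~ P b -> max_ideal L (a / b) <-> P a.
Proof.
move=> Aa Ab nb; have b0 := prime_neq0 nb.
split=> [[_ nu]|Pa].
  apply: contrapT => na; apply: nu. by apply: (unitM loc_sub); [exact: loc_unit|apply: unitV; exact: loc_unit].
split; first by exists a, b; split.
case=> ab0 _ [c [d [Ac Ad nd d0 e]]].
have a0 : a != 0 by apply: contraNneq ab0 => ->; rewrite mul0r.
have eb : b * d = c * a.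
  by rewrite invf_div in e; rewrite -[b](divfK a0) e; field.
apply: (prime_notM Ab Ad nb nd); rewrite eb; exact: (idM prime_ideal).
Qed.
Lemma loc_maxA a : A a -> max_ideal L a <-> P a.
Proof.
move=> Aa; rewrite -{1}[a]divr1; apply: loc_max => //; try mem.
by case: pP => _ _ _ _ [].
Qed.

Lemma loc_local : is_local L.
Proof.
split; first exact: loc_sub.
move=> u v m1 m2; have [[a [b [Aa Ab nb b0 e1]]] _] := m1.
have [[c [d [Ac Ad nd d0 e2]]] _] := m2.
move: m1 m2; rewrite e1 e2 => /(loc_max Aa Ab nb) Pa /(loc_max Ac Ad nd) Pc.
have -> : a / b + c / d = (d * a + b * c) / (b * d) by field; rewrite d0.
apply/loc_max; [|mem|exact: prime_notM|].
  by mem.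
by apply: (idD prime_ideal); apply: (idM prime_ideal).
Qed.
End Loc.

Lemma center_prime A Z : subring A -> is_local Z -> A `<=` Z ->
  prime_ideal_in A [set a | A a /\ max_ideal Z a].
Proof.
move=> sA lZ AZ; split.
- by move=> a [].
- by split; [mem|mem].
- by move=> a b [Aa ma] [Ab mb]; split; [mem|mem].
- by move=> a b Aa [Ab mb]; split; [mem|apply: (maxMl lZ) => //; exact: AZ].
- split=> [[_ /(not_max1 lZ)]//|a b Aa Ab [_ m]].
  by have [ma|mb] := max_prod lZ (AZ _ Aa) (AZ _ Ab) m; [left|right].
Qed.

(** Domination of local rings, the relation through which separatedness is expressed in
    [dom_uniq]. *)
Definition dominates Z y := forall h : F, y h -> Z h /\ (max_ideal y h <-> max_ideal Z h).
End Localizations.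

(** * Frobenius orbits of algebraic elements *)

Section FiniteOrbit.
Variables (k : fieldType) (p e : nat).
Hypotheses (pr : prime p) (pk : p%:R = 0 :> k) (e0 : (0 < e)%N).
Let q := (p ^ e)%N.
Let phi (x : k) := x ^+ q.

Lemma frob_powD (n : nat) (x y : k) : (x + y) ^+ (p ^ n) = x ^+ (p ^ n) + y ^+ (p ^ n).
Proof.
apply: exprDn_pchar; apply/pnatP => [|l lp]; first by rewrite expn_gt0 prime_gt0.
rewrite (Euclid_dvdX p n lp) => /andP[ld _].
by move: ld; rewrite dvdn_prime2 // => /eqP->; rewrite inE pr pk eqxx.
Qed.
Lemma frob_powB (n : nat) (x y : k) : (x - y) ^+ (p ^ n) = x ^+ (p ^ n) - y ^+ (p ^ n).
Proof.
by apply/eqP; rewrite eq_sym subr_eq -frob_powD subrK.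
Qed.
Lemma frob_inj (n : nat) (x y : k) : x ^+ (p ^ n) = y ^+ (p ^ n) -> x = y.
Proof.
move=> H; apply/eqP; rewrite -subr_eq0.
by have /eqP := frob_powB n x y; rewrite H subrr expf_eq0 => /andP[].
Qed.

Lemma root_frob (R : set k) (g : {poly k}) z : pover R g ->
  (forall c, R c -> phi c = c) -> root g z -> root g (phi z).
Proof.
move=> Rg fR /rootP gz; apply/rootP.
have -> : g.[phi z] = phi g.[z].
  rewrite !horner_coef /phi (big_morph _ (frob_powD e) (_ : 0 ^+ q = 0)); last first.
    by rewrite expr0n; case: eqP => // /eqP; rewrite expn_eq0; move: (prime_gt0 pr); case: (p).
  by apply: eq_bigr => i _; have := fR _ (Rg i); rewrite /phi exprMn => ->; rewrite -!exprM mulnC.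
by rewrite gz /phi expr0n; case: eqP => // /eqP; rewrite expn_eq0; move: (prime_gt0 pr); case: (p).
Qed.

(** The orbit of z consists of roots of its equation over the fixed set R, so it repeats, and
    Frobenius is injective. *)
Lemma frob_period (R : set k) z : integral R z -> (forall c, R c -> phi c = c) ->
  exists2 n : nat, (0 < n)%N & z ^+ (p ^ (e * n)) = z.
Proof.
move=> [g [mg Rg gz]] fR.
pose s := mkseq (fun n => z ^+ (p ^ (e * n))) (size g).
have ss : size s = size g by rewrite size_mkseq.
have sr : all (root g) s.
  apply/allP => _ /mapP[n _ ->]; elim: n => [|n IH]; first by rewrite muln0.
  by rewrite mulnS addnC expnD exprM; apply: (root_frob Rg fR).
have nu : ~~ uniq s.
  by apply/negP => us; have := max_poly_roots (monic_neq0 mg) sr us; rewrite ss ltnn.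
have /(uniqPn 0)[i [j [ij js E]]] := nu.
exists (j - i)%N; first by rewrite subn_gt0.
apply: (@frob_inj (e * i)); rewrite -exprM -expnD -mulnDr subnK ?(ltnW ij) //.
by move: E; rewrite ss in js; rewrite !nth_mkseq ?(ltn_trans ij js) // => ->.
Qed.
Lemma frob_iter (z : k) a n : z ^+ (p ^ a) = z -> z ^+ (p ^ (a * n)) = z.
Proof.
move=> H; elim: n => [|n IH]; first by rewrite muln0.
by rewrite mulnS expnD exprM H.
Qed.
End FiniteOrbit.

(** * The index of a set of integers *)

Section Index.
Implicit Types (S : set int) (N : nat) (k : int).

Definition cnt S N : nat := count (fun i : nat => `[< S (i%:Z - N%:Z) >]) (iota 0 (N + N)).
(** k is the number of n >= 0 missing from S minus the number of n < 0 in S. For pole orders it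
    behaves like minus an Euler characteristic: one more dimension lowers k by one. *)
Definition hasidx S k := exists N0 : nat, (forall n, S n -> - N0%:Z <= n) /\
  forall N, (N0 <= N)%N -> (cnt S N)%:Z = N%:Z - k.

Lemma cnt_le S S' N : S `<=` S' -> (cnt S N <= cnt S' N)%N.
Proof.
by move=> sub; apply: sub_count => i /asboolW H; apply: (asboolT (sub _ H)).
Qed.
Lemma hasidx_le S S' k l : S `<=` S' -> hasidx S k -> hasidx S' l -> l <= k.
Proof.
move=> sub [N [_ e]] [M [_ e']].
have := e (maxn N M) (leq_maxl _ _); have := e' (maxn N M) (leq_maxr _ _).
by have := cnt_le (maxn N M) sub; lia.
Qed.
Lemma cnt_add S (z : int) N : ~ S z -> (- N%:Z <= z < N%:Z)%R ->
  cnt (S `|` [set z]) N = (cnt S N).+1.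
Proof.
move=> nS /andP[zl zu].
pose P i := `[< S (i%:Z - N%:Z) >]; pose j := absz (z + N%:Z).
have ej : j%:Z = z + N%:Z by rewrite /j; lia.
have -> : cnt (S `|` [set z]) N = count (predU P (pred1 j)) (iota 0 (N + N)).
  apply: eq_count => i /=; apply/asboolP/orP => [[H|H]|[/asboolW H|/eqP ->]].
  - by left; apply: asboolT H.
  - lia.
  - by left.
  - lia.
have := count_predUI P (pred1 j) (iota 0 (N + N)).
rewrite [X in _ + X = _](_ : _ = 0%N); last first.
  apply/eqP; rewrite -leqn0 leqNgt -has_count; apply/hasP => -[i _ /andP[/asboolW H /eqP ij]].
  by apply: nS; move: H; rewrite ij; congr S; lia.
rewrite (_ : forall m, m + 0%N = m)%R; last by move=> m; rewrite addr0.
move=> ->; rewrite -[cnt S N]/(count P (iota 0 (N + N))).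
by rewrite count_uniq_mem ?iota_uniq // mem_iota add0n (_ : (0 <= j < N + N)%N) //; lia.
Qed.
Lemma hasidx_add S z k : ~ S z -> hasidx S k -> hasidx (S `|` [set z]) (k - 1).
Proof.
move=> nS [N [lb e]]; exists (maxn N `|z|.+1); split.
  by move=> n [/lb|->]; lia.
move=> M le; rewrite cnt_add //; last by lia.
by rewrite -natz -natr1 natz e; lia.
Qed.
Lemma hasidx_del S z k : ~ S z -> hasidx (S `|` [set z]) k -> hasidx S (k + 1).
Proof.
move=> nS [N [lb e]]; exists (maxn N `|z|.+1); split.
  by move=> n Sn; have := lb n (or_introl Sn); lia.
move=> M le; have := e M; rewrite cnt_add //; last by lia.
lia.
Qed.
(** Passing from the window of size M to M + 1 raises the count by exactly one, and nothing can
    enter at the lower end, so M itself is in S. *)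
Lemma hasidx_top S k : hasidx S k -> exists N0 : nat, forall n : int, N0%:Z <= n -> S n.
Proof.
move=> [N [lb e]]; exists N => n Nn; apply: contrapT => nS.
pose M := `|n|%N; have eM : M%:Z = n by rewrite /M; lia.
have e1 := e M _; have e2 := e M.+1 _.
have : cnt S M.+1 = cnt S M.
  rewrite /cnt (_ : M.+1 + M.+1 = 1 + ((M + M) + 1))%N; last by lia. rewrite iotaD iotaD !count_cat /= addn0.
  rewrite (_ : `[< S (0%:Z - M.+1%:Z) >] = false) ?add0n; last first.
    by apply/asboolP => /lb; lia.
  rewrite [X in (_ + X)%N](_ : _ = 0%N) ?addn0; last first.
    rewrite (_ : `[< _ >] = false) //; apply/asboolP => H; apply: nS. by rewrite -eM; move: H; congr S; lia.
  rewrite -[X in iota X]/(1 + 0)%N iotaDl count_map; apply: eq_count => i /=. by congr `[< S _ >]; lia.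
lia.
Qed.
Lemma hasidx_shift S k m : hasidx S k -> hasidx [set n | S (n - m)] (k + m).
Proof.
move=> H; have [N1 top] := hasidx_top H; have [N [lb e]] := H.
pose L := (maxn N N1 + `|m|)%N.
exists (L + `|m|)%N; split; first by move=> n /= /lb; rewrite /L; lia.
have base : forall M : nat, (L <= M)%N -> forall n : int, M%:Z <= n -> S n.
  by move=> M LM n Mn; apply: top; move: LM; rewrite /L; lia.
have cN : (cnt S (maxn N N1))%:Z = (maxn N N1)%:Z - k by apply: e; lia.
move=> M LM; set T := [set n | _].
have big : (cnt T M)%:Z = (cnt S (M + `|m|))%:Z - `|m|%:Z - m.
  rewrite /cnt; case: (lerP 0 m) => m0.
    pose a := `|m|%N. rewrite (_ : M + `|m| + (M + `|m|) = (M + M) + (a + a))%N; last by rewrite /a; lia.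
    rewrite [in RHS]iotaD count_cat. have -> : count (fun i : nat => `[< T (i%:Z - M%:Z) >]) (iota 0 (M + M)) =
              count (fun i : nat => `[< S (i%:Z - (M + a)%:Z) >]) (iota 0 (M + M)).
      by apply: eq_count => i; congr `[< S _ >]; rewrite /a; lia.
    rewrite [count _ (iota _ (a + a))](_ : _ = (a + a)%N); first by rewrite -/a; lia.
    rewrite -[RHS](size_iota (M + M) (a + a)); apply/eqP; rewrite -all_count; apply/allP => i.
    rewrite mem_iota => /andP[mi _]; apply: asboolT; apply: (base (M - a)%N).
      lia.
    lia.
  pose a := `|m|%N. rewrite (_ : M + `|m| + (M + `|m|) = (a + a) + (M + M))%N; last by rewrite /a; lia.
  rewrite [in RHS]iotaD count_cat add0n. rewrite [X in ((X + _)%N)%:Z](_ : _ = 0%N); last first.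
    apply/eqP; rewrite -leqn0 leqNgt -has_count; apply/hasP => -[i].
    by rewrite mem_iota => /andP[_ im] /asboolW /lb; move: LM im; rewrite /L; lia.
  suff -> : count (fun i : nat => `[< T (i%:Z - M%:Z) >]) (iota 0 (M + M)) =
    count (fun i : nat => `[< S (i%:Z - (M + `|m|)%N%:Z) >]) (iota (a + a) (M + M)) by rewrite /a; lia.
  have -> : iota (a + a) (M + M) = iota (a + a + 0) (M + M) by rewrite addn0.
  rewrite iotaDl count_map; apply: eq_count => i /=. by congr `[< S _ >]; rewrite /a; lia.
by rewrite big e; move: LM; rewrite /L; lia.
Qed.
End Index.

(** * Subspaces of functions measured by pole orders *)

Section Echelon.
Variables (F : fieldType) (O C : set F).
Hypotheses (dO : dvr O) (sC : subring C).
Hypothesis CV : forall c, C c -> C c^-1.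
Hypothesis CO : C `<=` O.
Hypothesis Cres : forall h, O h -> exists2 c, C c & max_ideal O (h - c).
Implicit Types (V W : set F) (n : int) (u v w e : F).

(** The pole order. [Cres] says that the point is rational over C, so two functions with the same
    pole order become, after a constant rescaling, equal up to smaller pole order. *)
Definition dg (h : F) : int := - ordv O h.
Definition dle n (h : F) := h != 0 -> dg h <= n.
Record csub V : Prop := Csub {
  cs0 : V 0;
  csB : forall u v, V u -> V v -> V (u - v);
  csZ : forall c v, C c -> V v -> V (c * v) }.
(** As each graded piece has dimension at most one over C, this set carries all the dimensions that
    are compared later. *)
Definition degs V : set int := [set n | exists v, [/\ V v, v != 0 & dg v = n]].

Lemma csN V u : csub V -> V u -> V (- u).
Proof. by move=> sV Vu; rewrite -sub0r; apply: (csB sV) => //; exact: cs0. Qed.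
Lemma csD V u v : csub V -> V u -> V v -> V (u + v).
Proof. by move=> sV Vu Vv; rewrite -[v]opprK; apply: (csB sV) => //; exact: csN. Qed.
Lemma cs_sum V (I : Type) (r : seq I) (P : pred I) (G : I -> F) : csub V ->
  (forall i, P i -> V (G i)) -> V (\sum_(i <- r | P i) G i).
Proof.
by move=> sV VG; elim/big_rec: _ => [|i x Pi Ax]; [exact: cs0 | apply: csD; auto].
Qed.

Lemma C_unit c : C c -> c != 0 -> unit_in O c.
Proof. by move=> Cc c0; split=> //; apply: CO => //; exact: CV. Qed.
Lemma dgM u v : u != 0 -> v != 0 -> dg (u * v) = dg u + dg v.
Proof. by move=> u0 v0; rewrite /dg (ordvM dO) // opprD. Qed.
Lemma dgV u : u != 0 -> dg u^-1 = - dg u.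
Proof. by move=> u0; rewrite /dg (ordvV dO). Qed.
Lemma dgX u (n : nat) : u != 0 -> dg (u ^+ n) = dg u *+ n.
Proof. by move=> u0; rewrite /dg (ordvX dO) // mulNrn. Qed.
Lemma dgXz u (n : int) : u != 0 -> dg (u ^ n) = n * dg u.
Proof. by move=> u0; rewrite /dg (ordvXz dO) // mulrN. Qed.
Lemma dg_unit u : unit_in O u -> dg u = 0.
Proof. by move=> uu; rewrite /dg (ordv_unit dO uu) oppr0. Qed.
Lemma dg1 : dg 1 = 0. Proof. by apply: dg_unit; apply: unit1; exact: dO. Qed.
Lemma dgN u : dg (- u) = dg u.
Proof. by rewrite /dg (ordvN dO). Qed.
Lemma dgZ c u : C c -> c != 0 -> dg (c * u) = dg u.
Proof.
move=> Cc c0; have [->|u0] := eqVneq u 0; first by rewrite mulr0.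
by rewrite dgM // (dg_unit (C_unit Cc c0)) add0r.
Qed.
Lemma dle_vge n h : dle n h <-> vge O (- n) h.
Proof. by split=> H h0; have := H h0; rewrite /dg; lia. Qed.
Lemma dle0 n : dle n 0. Proof. by rewrite /dle eqxx. Qed.
Lemma dleN n u : dle n u -> dle n (- u).
Proof. by rewrite /dle oppr_eq0 dgN. Qed.
Lemma dleD n u v : dle n u -> dle n v -> dle n (u + v).
Proof. by move=> /dle_vge H /dle_vge H'; apply/dle_vge; exact: vgeD. Qed.
Lemma dleB n u v : dle n u -> dle n v -> dle n (u - v).
Proof. by move=> H H'; apply: dleD => //; exact: dleN. Qed.
Lemma dle_le m n u : m <= n -> dle m u -> dle n u.
Proof. by move=> mn H u0; exact: le_trans (H u0) mn. Qed.
Lemma dleZ n c u : C c -> dle n u -> dle n (c * u).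
Proof.
move=> Cc H; rewrite /dle mulf_eq0 negb_or => /andP[c0 u0]; rewrite dgZ //; exact: H.
Qed.
Lemma dleM m n u v : dle m u -> dle n v -> dle (m + n) (u * v).
Proof.
move=> H H'; rewrite /dle mulf_eq0 negb_or => /andP[u0 v0]; rewrite dgM //.
exact: lerD (H u0) (H' v0).
Qed.
Lemma dle_sum n (I : Type) (r : seq I) (P : pred I) (G : I -> F) :
  (forall i, P i -> dle n (G i)) -> dle n (\sum_(i <- r | P i) G i).
Proof.
by move=> H; elim/big_rec: _ => [|i x Pi Ax]; [exact: dle0|apply: dleD; auto].
Qed.
Lemma dle0_O u : dle 0 u <-> O u.
Proof. by rewrite dle_vge oppr0 (ordv_ge0 dO). Qed.
Lemma dgD u v : u != 0 -> dle (dg u - 1) v -> u + v != 0 /\ dg (u + v) = dg u.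
Proof.
move=> u0 /dle_vge H; have [|-> e] := ordvD_lt dO u0 (h' := v); last by rewrite /dg e.
by move: H; rewrite /dg; congr vge; lia.
Qed.
Lemma dgD_neq u v : u != 0 -> v != 0 -> dg u <> dg v ->
  u + v != 0 /\ (dg (u + v) = dg u \/ dg (u + v) = dg v).
Proof.
move=> u0 v0 ne; have [lt|le] := ltP (dg v) (dg u).
  by have [] := @dgD u v u0 (fun=> ltac:(lia)) => -> ->; split; [|left].
have [] := @dgD v u v0 (fun=> ltac:(lia)); rewrite addrC => -> ->; by split; [|right].
Qed.

Lemma lead_red (u v : F) : u != 0 -> v != 0 -> dg u = dg v ->
  exists c, [/\ C c, c != 0 & dle (dg u - 1) (u - c * v)].
Proof.
move=> u0 v0 e; have uuv : unit_in O (u / v).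
  apply: (unit_ordv dO); first by rewrite mulf_neq0 ?invr_eq0. by rewrite (ordv_div dO); move: e; rewrite /dg; lia.
have [_ Ouv _] := uuv; have [c Cc mc] := Cres Ouv.
exists c; split=> //.
  apply/eqP => c0; move: mc; rewrite c0 subr0; exact: unit_not_max.
have -> : u - c * v = (u / v - c) * v by rewrite mulrBl divfK.
have := (ordv_max dO _).1 mc => mc'.
have d1 : dle (- 1) (u / v - c) by apply/dle_vge; rewrite opprK.
by rewrite addrC e; apply: dleM.
Qed.

(** Division by W: the pole order of u is lowered as long as it is a degree of W. The bound b makes
    this stop, since degrees may be unbounded below. *)
Lemma reduce W (b : int) (u : F) : csub W ->
  exists2 w, W w & u - w = 0 \/ (u - w != 0 /\ (dg (u - w) < b \/ ~ degs W (dg (u - w)))).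
Proof.
move=> sW; have [n le] : exists n : nat, dg u < b + n%:Z.
  by exists (`|dg u - b|.+1)%N; lia.
elim: n u le => [|n IH] u le.
  exists 0; first exact: cs0. rewrite subr0; have [->|u0] := eqVneq u 0; [by left|right; split=> //; left]. lia.
have [->|u0] := eqVneq u 0; first by exists 0; [exact: cs0|left; rewrite subr0].
have [[w [Ww w0 ew]]|nd] := EM (degs W (dg u)); last first.
  by exists 0; [exact: cs0|right; rewrite subr0; split=> //; right].
have [c [Cc c0 H]] := lead_red u0 w0 (esym ew).
have [z|nz] := eqVneq (u - c * w) 0.
  by exists (c * w); [exact: csZ|left].
have [|w' Ww' H'] := IH (u - c * w); first by have := H nz; move: le; lia.
exists (c * w + w'); first by apply: csD => //; exact: csZ.
by rewrite opprD addrA.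
Qed.

Lemma csub_eq V W (b : int) : csub V -> csub W -> W `<=` V ->
  (forall n, degs V n -> b <= n) -> degs V `<=` degs W -> V `<=` W.
Proof.
move=> sV sW WV lb sub u Vu; have [w Ww [/eqP|[h0 H]]] := reduce b u sW.
  by rewrite subr_eq0 => /eqP->.
have dV : degs V (dg (u - w)) by exists (u - w); split=> //; apply: csB => //; exact: WV.
by case: H => [lt|]; [exfalso; have := lb _ dV; lia|case; exact: sub].
Qed.

Definition cadj V e : set F := [set z | exists v c, [/\ V v, C c & z = v + c * e]].
Lemma cadj_csub V e : csub V -> csub (cadj V e).
Proof.
move=> sV; split.
- by exists 0, 0; split; [exact: cs0|mem|rewrite mul0r addr0].
- move=> _ _ [v [c [Vv Cc ->]]] [w [c' [Vw Cc' ->]]]; exists (v - w), (c - c').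
  by split; [exact: csB|mem|ring].
- move=> a _ Ca [v [c [Vv Cc ->]]]; exists (a * v), (a * c).
  by split; [exact: csZ|mem|ring].
Qed.
Lemma cadj_l V e : V `<=` cadj V e.
Proof. by move=> v Vv; exists v, 0; split; rewrite ?mul0r ?addr0 //; exact: sr0. Qed.
Lemma cadj_r V e : csub V -> cadj V e e.
Proof. by move=> sV; exists 0, 1; split; rewrite ?mul1r ?add0r //; [exact: cs0|exact: sr1]. Qed.
Lemma cadj_sub V e W : csub W -> V `<=` W -> W e -> cadj V e `<=` W.
Proof.
move=> sW VW We _ [v [c [Vv Cc ->]]]; apply: csD => //; [exact: VW|exact: (csZ sW)].
Qed.

(** The new degree is that of e after reduction by V. One more vector is thus one more degree, which
    is what makes the index a dimension. *)
Lemma cadj_degs V e (b : int) : csub V -> (forall n, degs V n -> b <= n) -> ~ V e ->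
  exists d, ~ degs V d /\ degs (cadj V e) = degs V `|` [set d].
Proof.
move=> sV lb ne.
pose Q (n : nat) := exists v, [/\ V v, e - v != 0 & (dg (e - v) = b - 1 + n%:Z)].
suff [v [Vv ev0 nd]] : exists v, [/\ V v, e - v != 0 & ~ degs V (dg (e - v))].
  exists (dg (e - v)); split=> //; apply/seteqP; split=> [n [z [[u [c [Vu Cc ez]]] z0 <-]]|n].
    have [c0|c0] := eqVneq c 0.
      by left; exists z; split=> //; rewrite ez c0 mul0r addr0.
    have eq1 : z = (u + c * v) + c * (e - v) by rewrite ez; ring. have Vw : V (u + c * v) by apply: csD => //; exact: csZ.
    have cv0 : c * (e - v) != 0 by rewrite mulf_neq0. have [w0|w0] := eqVneq (u + c * v) 0.
      by right; rewrite eq1 w0 add0r dgZ.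
    have ned : dg (u + c * v) <> dg (c * (e - v)).
      by rewrite dgZ // => E; apply: nd; rewrite -E; exists (u + c * v).
    have [_ [E|E]] := dgD_neq w0 cv0 ned; rewrite eq1 E; first by left; exists (u + c * v). by right; rewrite dgZ.
  move=> [[z [Vz z0 <-]]|->]; first by exists z; split=> //; exact: cadj_l.
  exists (e - v); split=> //; apply: (csB (cadj_csub e sV)); first exact: cadj_r. exact: cadj_l.
have [w Ww [/eqP|[h0 [lt|nd]]]] := reduce b e sV.
- by rewrite subr_eq0 => /eqP ew; case: ne; rewrite ew.
- by exists w; split=> // /lb; move: lt; lia.
- by exists w.
Qed.

Lemma cadj_idx V e k : csub V -> hasidx (degs V) k -> ~ V e ->
  hasidx (degs (cadj V e)) (k - 1).
Proof.
move=> sV H ne; have [N [lb _]] := H.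
by have [d [nd ->]] := cadj_degs sV lb ne; exact: hasidx_add.
Qed.

Lemma cadj_idx' V e k : csub V -> hasidx (degs (cadj V e)) k -> ~ V e ->
  hasidx (degs V) (k + 1).
Proof.
move=> sV H ne; have [N [lb _]] := H.
have lb' n : degs V n -> - N%:Z <= n.
  by move=> [v [Vv v0 <-]]; apply: lb; exists v; split=> //; exact: cadj_l.
by have [d [nd ed]] := cadj_degs sV lb' ne; apply: (hasidx_del nd); rewrite -ed.
Qed.

Fixpoint cadjs V (s : seq F) : set F := if s is e :: s' then cadj (cadjs V s') e else V.
Lemma cadjs_csub V s : csub V -> csub (cadjs V s).
Proof. by move=> sV; elim: s => //= e s IH; exact: cadj_csub. Qed.
Lemma cadjs_mem V s z : cadjs V s z -> exists v (c : nat -> F), [/\ V v, forall i, C (c i) &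
  z = v + \sum_(i < size s) c i * s`_i].
Proof.
elim: s z => [|e s IH] z /=.
  by move=> Vz; exists z, (fun=> 0); split=> //; [move=> _; mem|rewrite big_ord0 addr0].
move=> [_ [c0 [/IH [v [c [Vv Cc ->]]] Cc0 ->]]].
exists v, (fun i => if i is j.+1 then c j else c0); split=> //; first by case.
by rewrite big_ord_recl [c0 * e + _]addrC addrA.
Qed.
Lemma cadjs_in V s v (c : nat -> F) : csub V -> V v -> (forall i, C (c i)) ->
  cadjs V s (v + \sum_(i < size s) c i * s`_i).
Proof.
move=> sV; elim: s c => [|e s IH] c Vv Cc /=; first by rewrite big_ord0 addr0.
exists (v + \sum_(i < size s) c i.+1 * s`_i), (c 0%N); split=> //; first exact: (IH (fun i => c i.+1)).
by rewrite big_ord_recl [c 0%N * e + _]addrC addrA.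
Qed.
Lemma cadjs_sub V s W : csub W -> V `<=` W -> (forall e, e \in s -> W e) -> cadjs V s `<=` W.
Proof.
move=> sW VW; elim: s => //= e s IH H; apply: cadj_sub => //; last by apply: H; rewrite inE eqxx.
by apply: IH => x xs; apply: H; rewrite inE xs orbT.
Qed.
Definition cindep V (s : seq F) := forall c : nat -> F, (forall i, C (c i)) ->
  V (\sum_(i < size s) c i * s`_i) -> forall i, (i < size s)%N -> c i = 0.
Lemma cindep_cons V e s : csub V -> cindep V (e :: s) -> cindep V s /\ ~ cadjs V s e.
Proof.
move=> sV ind; split.
  move=> c Cc Vc i lt; apply: (ind (fun i => if i is j.+1 then c j else 0) _ _ i.+1) => //.
    by case=> [|j]; [mem|].
  by rewrite big_ord_recl mul0r add0r.
move=> /cadjs_mem [v [c [Vv Cc ee]]].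
have := ind (fun i => if i is j.+1 then - c j else 1) _ _ 0%N => /= H0.
have : (1 : F) = 0; last by move/eqP; rewrite oner_eq0.
apply: H0 => //; first by case=> [|j]; [mem|apply: srN].
rewrite big_ord_recl /= mul1r {1}ee; under [X in _ + X]eq_bigr do rewrite mulNr.
by rewrite sumrN addrK.
Qed.
Lemma cadjs_idx V s k : csub V -> hasidx (degs V) k -> cindep V s ->
  hasidx (degs (cadjs V s)) (k - (size s)%:Z).
Proof.
move=> sV H; elim: s => [|e s IH] ind; first by rewrite subr0.
have [ind' ne] := cindep_cons sV ind.
have -> : k - (size (e :: s))%:Z = k - (size s)%:Z - 1 by rewrite /=; lia.
by apply: cadj_idx ne; [exact: cadjs_csub|exact: IH].
Qed.
Lemma cadjs_idx' V s k : csub V -> hasidx (degs (cadjs V s)) k -> cindep V s ->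
  hasidx (degs V) (k + (size s)%:Z).
Proof.
move=> sV; elim: s k => [|e s IH] k H ind; first by rewrite addr0.
have [ind' ne] := cindep_cons sV ind.
have -> : k + (size (e :: s))%:Z = k + 1 + (size s)%:Z by rewrite /=; lia.
apply: IH => //; apply: cadj_idx' H ne; exact: cadjs_csub.
Qed.
Lemma cindep_le V W s k l : csub V -> csub W -> V `<=` W -> (forall e, e \in s -> W e) ->
  hasidx (degs V) k -> hasidx (degs W) l -> cindep V s -> l + (size s)%:Z <= k.
Proof.
move=> sV sW VW sW' H H' ind; have := hasidx_le _ (cadjs_idx sV H ind) H'.
rewrite -lerBrDr => le; have : l <= k - (size s)%:Z => //.
apply: le => n [v [Vv v0 <-]]; exists v; split=> //; exact: (cadjs_sub sW VW sW' Vv).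
Qed.
End Echelon.

(** * Sections off a point and gap sequences *)

Section Gaps.
Variables (F : fieldType) (S : set (set F)) (oo : set F).
Hypotheses (Sd : forall x, closed_point S x -> dvr x) (coo : closed_point S oo).
Implicit Types (D : set F -> int).
Let doo := Sd coo.

(** Sections of O(D) with arbitrary poles at oo; the value of D at oo only shifts the admissible
    pole orders, see [H0_twist]. *)
Definition MD D : set F := [set h | forall x, closed_point S x -> x <> oo -> vge x (- D x) h].

Lemma H0E D h : H0 S D h <-> forall x, closed_point S x -> vge x (- D x) h.
Proof.
split=> H x cx; have dx := Sd cx.
  have [t ut xh] := H x cx; have [t0 _] := ut. move=> h0; have := (ordv_ge0 dx _).1 xh.
  rewrite /vge mulf_neq0 ?expfz_neq0 // => /(_ isT). by rewrite ordvM ?expfz_neq0 // ordvXz // (ordv_unif dx ut); lia.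
have [t ut] := dvr_unif dx; have [t0 _] := ut; exists t => //.
apply/(ordv_ge0 dx); rewrite /vge mulf_eq0 negb_or => /andP[h0 _].
have := H x cx h0.
by rewrite ordvM ?expfz_neq0 // ordvXz // (ordv_unif dx ut); lia.
Qed.
Lemma twistE D n x : twist D n oo x = if `[< x = oo >] then D x + n else D x.
Proof. by rewrite /twist /point_divisor; case: asboolP => _ /=; rewrite ?mulr1 ?mulr0 ?addr0. Qed.
Lemma H0_twist D n h : H0 S (twist D n oo) h <-> MD D h /\ dle oo (n + D oo) h.
Proof.
rewrite H0E; split=> [H|[H1 H2] x cx].
  split=> [x cx ne|]; first by have := H x cx; rewrite twistE; case: asboolP.
  by apply/dle_vge; have := H oo coo; rewrite twistE; case: asboolP => // _; congr vge; lia.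
rewrite twistE; case: asboolP => [->|ne]; last exact: H1.
by move/dle_vge: H2; congr vge; lia.
Qed.
Lemma gapE D (n : nat) : gap_sequence S D oo n <-> ~ degs oo (MD D) (n%:Z + D oo).
Proof.
split=> [e [h [Mh h0 dh]]|nd].
  have : H0 S (twist D n%:Z oo) h by apply/H0_twist; split=> // _; rewrite dh.
  rewrite e => /H0_twist [_ /(_ h0)]; rewrite dh; lia.
apply/seteqP; split=> h /H0_twist [Mh dh]; apply/H0_twist; split=> // h0.
  have := dh h0; have : dg oo h <> n%:Z + D oo by move=> E; apply: nd; exists h. lia.
by have := dh h0; lia.
Qed.
Lemma MD_sub (C : set F) D : (forall x, closed_point S x -> forall c, C c -> x c) ->
  csub C (MD D).
Proof.
move=> const_in; split.
- by move=> x cx ne; exact: vge0.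
- by move=> u v Mu Mv x cx ne; apply: vgeB; [exact: Sd|exact: Mu|exact: Mv].
- move=> c v Cc Mv x cx ne; rewrite -[- D x]add0r; apply: vgeM; first exact: Sd.
    by apply/(ordv_ge0 (Sd cx)); exact: const_in Cc.
  exact: Mv.
Qed.
Lemma MDM D D' u v : MD D u -> MD D' v -> MD (fun x => D x + D' x) (u * v).
Proof.
move=> Mu Mv x cx ne; rewrite opprD; apply: vgeM; [exact: Sd|exact: Mu|exact: Mv].
Qed.
Lemma MD0 h : MD (@zero_divisor F) h <-> forall x, closed_point S x -> x <> oo -> x h.
Proof.
by split=> H x cx ne; [apply/(ordv_ge0 (Sd cx)); have := H x cx ne; rewrite oppr0|
  rewrite oppr0; apply/(ordv_ge0 (Sd cx)); exact: H].
Qed.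
(** The B-th power of a function of degree - k < 0, multiplied by one of degree 1 + B k, would have
    degree 1. This stands in for the theorem that a function without poles is constant. *)
Lemma ring_degs_ge0 (A : set F) (B : nat) : subring A -> ~ degs oo A 1 ->
  (forall n : nat, (B <= n)%N -> degs oo A n%:Z) -> forall n, degs oo A n -> 0 <= n.
Proof.
move=> sA n1 big n [h [Ah h0 dh]]; rewrite leNgt; apply/negP => lt; apply: n1.
pose k := absz n; have ek : n = - k%:Z by rewrite /k; lia.
have [u [Au u0 du]] := big (1 + B * k)%N ltac:(rewrite /k; nia).
exists (u * h ^+ B); split; first by apply: srM => //; exact: srX.
  by rewrite mulf_neq0 ?expf_neq0.
by rewrite dgM ?expf_neq0 // dgX // du dh ek; nia.
Qed.
Lemma ring_1gap (A : set F) : subring A -> degs oo A 1 -> forall n : nat, degs oo A n%:Z.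
Proof.
move=> sA [h [Ah h0 dh]] n; exists (h ^+ n); split; first exact: srX.
  by rewrite expf_neq0.
by rewrite dgX // dh; lia.
Qed.
End Gaps.

(** * Riemann's formula on a curve *)

Section Curve.
Variables (K F : fieldType) (iota : {rmorphism K -> F}) (X : set (set F)).
Variables (oo : set F) (g : nat).
Local Notation cl := (closed_point X).
Hypothesis Xd : forall x, cl x -> dvr x.
Hypothesis XK : forall x, cl x -> forall c, x (iota c).
Hypothesis coo : cl oo.
Hypothesis Koo : forall h, oo h -> exists c, max_ideal oo (h - iota c).
Hypothesis Hg : has_genus iota X g.
Hypothesis Alg : forall x h, cl x -> x h ->
  exists P : {poly K}, P \is monic /\ max_ideal x (map_poly iota P).[h].
Variable mu : 'I_g -> nat.
Hypothesis Hmu : enumerates (gap_sequence X (@zero_divisor F) oo) mu.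
Hypothesis g0 : (0 < g)%N.
Let doo := Xd coo.
Let C : set F := range iota.
Local Notation dg := (dg oo).
Local Notation degs := (degs oo).
Local Notation MD := (MD X oo).
Let A : set F := [set h | forall x, cl x -> x <> oo -> x h].

Lemma K_sub : subring C.
Proof.
split; first by exists 1; rewrite ?rmorph1.
- by move=> _ _ [a _ <-] [b _ <-]; exists (a - b); rewrite ?rmorphB.
- by move=> _ _ [a _ <-] [b _ <-]; exists (a * b); rewrite ?rmorphM.
Qed.
Lemma CV c : C c -> C c^-1.
Proof. by move=> [a _ <-]; exists a^-1; rewrite ?fmorphV. Qed.
Lemma Coo : C `<=` oo. Proof. by move=> _ [a _ <-]; exact: XK. Qed.
Lemma Cres h : oo h -> exists2 c, C c & max_ideal oo (h - c).
Proof. by move=> /Koo [c mc]; exists (iota c) => //; exists c. Qed.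
Lemma const_in x : cl x -> forall c, C c -> x c.
Proof. by move=> cx _ [a _ <-]; exact: XK. Qed.
Lemma A_sub : subring A.
Proof.
split.
- by move=> x /Xd dx _; mem.
- by move=> a b Aa Ab x cx ne; apply: (srB (Xd cx)); [exact: Aa|exact: Ab].
- by move=> a b Aa Ab x cx ne; apply: (srM (Xd cx)); [exact: Aa|exact: Ab].
Qed.
Lemma A_MD : A = MD (@zero_divisor F).
Proof. by apply/seteqP; split=> h; [move=> Ah; apply/(MD0 oo Xd)|move/(MD0 oo Xd)]. Qed.
Lemma MDcsub D : csub C (MD D). Proof. by apply: (MD_sub oo Xd); exact: const_in. Qed.
Lemma Acsub : csub C A. Proof. by rewrite A_MD; exact: MDcsub. Qed.
Lemma gapA (n : nat) : degs A n%:Z <-> ~ range mu n.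
Proof. by case: Hmu => _ ->; rewrite (gapE Xd coo) addr0 A_MD notK. Qed.
Lemma mu_inj : injective mu.
Proof.
case: Hmu => mono _ i j e; apply/val_inj; case: (ltngtP i j) => // lt;
  by have := mono _ _ lt; rewrite e ltnn.
Qed.
Let B := (\max_i mu i).+1.
Lemma degsA_big (n : nat) : (B <= n)%N -> degs A n%:Z.
Proof.
move=> le; apply/gapA => -[i _ e]; move: le; rewrite -e ltnNge => /negP; apply.
exact: leq_bigmax.
Qed.
Lemma degsA_n1 : ~ degs A 1.
Proof.
move=> /(ring_1gap Xd coo A_sub) H.
by have /gapA := H (mu (Ordinal g0)); apply; exists (Ordinal g0).
Qed.
Lemma degsA_ge0 n : degs A n -> 0 <= n.
Proof. exact: (ring_degs_ge0 Xd coo A_sub degsA_n1 degsA_big). Qed.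
Lemma idxA : hasidx (degs A) g%:Z.
Proof.
exists B; split=> [n /degsA_ge0|N BN]; first by lia.
rewrite /cnt iotaD count_cat.
rewrite [count _ (seq.iota 0 N)](_ : _ = 0%N); last first.
  apply/eqP; rewrite -leqn0 leqNgt -has_count; apply/hasP => -[i].
  by rewrite mem_iota => /andP[_ im] /asboolW /degsA_ge0; lia.
pose P i := `[< degs A i%:Z >].
have -> : seq.iota (0 + N) N = seq.iota (N + 0) N by rewrite addn0.
rewrite iotaDl count_map (eq_count (a2 := P)); last first.
  by move=> i; congr `[< _ _ >]; lia.
have : count (predC P) (seq.iota 0 N) = g.
  rewrite -size_filter -[RHS]card_ord -(size_codom mu).
  apply: perm_size; apply: uniq_perm; first by rewrite filter_uniq ?iota_uniq.
    by rewrite map_inj_uniq ?enum_uniq //; exact: mu_inj.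
  move=> n; rewrite mem_filter mem_iota /= add0n; apply/idP/idP.
    move=> /andP[/asboolP nd nN]; have : range mu n.
      by apply: contrapT => H; apply: nd; apply/gapA.
    by case=> i _ <-; exact: codom_f.
  move=> /codomP [i ->]; apply/andP; split; last first.
    by apply: leq_trans BN; rewrite ltnS; exact: leq_bigmax.
  by apply/asboolP => /gapA; apply; exists i.
by have := count_predC P (seq.iota 0 N); rewrite size_iota; lia.
Qed.
Lemma A_pos : exists a, [/\ A a, a != 0 & 0 < dg a].
Proof.
by have [a [Aa a0 da]] := degsA_big (leqnn B); exists a; split=> //; rewrite da.
Qed.
Lemma A_trans a (P : {poly K}) : a != 0 -> 0 < dg a -> P != 0 -> (map_poly iota P).[a] != 0.
Proof.
move=> a0 da P0; apply/negP => /eqP ra.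
have a'oo : oo a^-1.
  by apply/(ordv_ge0 doo) => _; rewrite ordvV //; move: da; rewrite /dg; lia.
have : oo a; last first.
  by move=> /(ordv_ge0 doo) /(_ a0); move: da; rewrite /dg; lia.
rewrite -[a]invrK; apply: (int_inv_mem doo) => //; first by rewrite invr_eq0.
rewrite invrK; exists (map_poly iota ((lead_coef P)^-1 *: P)); split.
- by rewrite map_monic monicE lead_coefZ mulVf // lead_coef_eq0.
- by move=> i; rewrite coef_map; exact: XK.
- by rewrite map_polyZ /root hornerZ ra mulr0.
Qed.

(** Vanishing of H^1 off oo. A function a with poles only at oo acts on the g generators of H^1(X,
    O_X) by a matrix M over K. The function [de] = det (a - M) is nonzero, a being transcendental
    over K, and kills these generators off oo. The class of r is [de] times that of r / [de], so it
    vanishes. *)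
Lemma strong_approx r : is_repartition X r -> exists h, forall x, cl x -> x <> oo -> x (r x - h).
Proof.
have [b [rb Hb]] := Hg; have [a [Aa a0 da]] := A_pos.
have [c cP] : {c : 'I_g -> {ffun 'I_g -> K} & forall i, exists h, forall x, cl x -> x <> oo ->
    x (a * b i x - \sum_j iota (c i j) * b j x - h)}.
  apply: (@choice _ _ (fun i (ci : {ffun 'I_g -> K}) => exists h, forall x, cl x -> x <> oo ->
    x (a * b i x - \sum_j iota (ci j) * b j x - h))) => i.
  have rp : is_repartition X (fun x => if `[< x = oo >] then 0 else a * b i x).
    apply: sub_finite_set (rb i) => x [cx nx]; split=> // xb; apply: nx. case: asboolP => [e|ne]; first exact: sr0 (Xd cx).
    by apply: (srM (Xd cx)) => //; exact: Aa.
  have [ci [[h hP] _]] := Hb _ rp. by exists ci, h => x cx ne; have := hP x cx; case: asboolP.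
have [h hP] := choice cP.
pose M : 'M[K]_g := \matrix_(i, j) c i j.
pose Bm : 'M[F]_g := a%:M - map_mx iota M.
have AB i j : A (Bm i j).
  rewrite !mxE; apply: (srB A_sub); first by apply: (srMn A_sub). by move=> x cx _; exact: XK.
have Adet n (m : 'M[F]_n) : (forall i j, A (m i j)) -> A (\det m).
  move=> Am; apply: (sr_sum A_sub) => s _; apply: (srM A_sub); last exact: (sr_prod A_sub).
  by apply: (srX A_sub); apply: (srN A_sub); exact: sr1 A_sub.
have Aadj i j : A ((\adj Bm) i j).
  rewrite mxE; apply: (srM A_sub).
    by apply: (srX A_sub); apply: (srN A_sub); exact: sr1 A_sub.
  by apply: Adet => k l; rewrite !mxE; have := AB (lift j k) (lift i l); rewrite !mxE.
pose de := \det Bm; have Ade : A de by exact: Adet.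
have de0 : de != 0.
  apply/negP => /det0P [v v0 vB]. have : eigenvalue (map_mx iota M) a.
    apply/eigenvalueP; exists v => //; apply/eqP; rewrite -subr_eq0 -opprB oppr_eq0. by rewrite -mul_mx_scalar -mulmxBr vB.
  rewrite eigenvalue_root_char -map_char_poly => /rootP; apply/eqP.
  by apply: A_trans => //; exact: monic_neq0 (char_poly_monic M).
have bP l : exists u, forall x, cl x -> x <> oo -> x (de * b l x - u).
  exists (\sum_i (\adj Bm) l i * h i) => x cx ne; have dx := Xd cx.
  have -> : de * b l x = \sum_i (\adj Bm) l i * (\sum_j Bm i j * b j x).
    under eq_bigr do rewrite mulr_sumr. rewrite exchange_big /= (eq_bigr (fun j => (\adj Bm *m Bm) l j * b j x)).
      rewrite mul_adj_mx (bigD1 l) //= big1 => [|j /negbTE jl]; first by rewrite mxE eqxx addr0.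
      by rewrite mxE eq_sym jl mul0r.
    by move=> j _; rewrite mxE mulr_suml; apply: eq_bigr => k _; rewrite mulrA.
  rewrite -sumrB; apply: (sr_sum dx) => i _; rewrite -mulrBr; apply: (srM dx); first exact: Aadj.
  have := hP i x cx ne; congr (x (_ - _)). under [RHS]eq_bigr do rewrite !mxE mulrBl.
  rewrite sumrB; congr (_ - _); rewrite (bigD1 i) //= eqxx big1 ?addr0 // => j /negbTE ji. by rewrite eq_sym ji mul0r.
have [u uP] := choice bP.
(* Division by [de] may create poles at its zeros; taking 0 wherever r is already integral keeps a
   repartition. *)
move=> rr; have rp : is_repartition X (fun x => if `[< x = oo \/ x (r x) >] then 0 else r x / de).
  apply: sub_finite_set rr => x [cx nx]; split=> // xb; apply: nx.
  by case: asboolP => [e|ne]; [exact: sr0 (Xd cx)|case: ne; right].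
have [ci [[h0 h0P] _]] := Hb _ rp.
exists (de * h0 + \sum_l iota (ci l) * u l) => x cx ne; have dx := Xd cx.
have xde : x de by exact: Ade.
have H : x (de * (if `[< x = oo \/ x (r x) >] then 0 else r x / de) - (de * h0 + \sum_l iota (ci l) * u l)).
  rewrite -[X in x (X - _)](subrK (\sum_l iota (ci l) * (de * b l x))). set E := (if _ then _ else _).
  have -> : de * E - \sum_l iota (ci l) * (de * b l x) + \sum_l iota (ci l) * (de * b l x)
      - (de * h0 + \sum_l iota (ci l) * u l) =
     de * (E - \sum_l iota (ci l) * b l x - h0) + \sum_l iota (ci l) * (de * b l x - u l).
    under [X in _ = _ + X]eq_bigr do rewrite mulrBr.
    rewrite sumrB !mulrBr mulr_sumr; under [X in _ = _ - X - _ + _]eq_bigr do rewrite mulrCA. by ring.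
  apply: (srD dx); first by apply: (srM dx) => //; exact: h0P.
  by apply: (sr_sum dx) => l _; apply: (srM dx); [exact: XK|exact: uP].
move: H; case: asboolP => [[//|xr]|nx]; last by rewrite mulrC divfK.
by rewrite mulr0 sub0r => /(srN dx); rewrite opprK => H; mem.
Qed.

(** By [Alg] some P(a) vanishes at x, with P monic over K; it is not zero because a has a pole and
    is therefore transcendental. *)
Lemma cofac (s : seq (set F)) (n : nat) : (forall x, x \in s -> cl x /\ x <> oo) ->
  exists c, [/\ A c, c != 0 & forall x, x \in s -> vge x n%:Z c].
Proof.
have [a [Aa a0 da]] := A_pos.
elim: s => [|x s IH] Hs; first by exists 1; split; [exact: sr1 A_sub|exact: oner_neq0|].
have [|c [Ac c0 cP]] := IH; first by move=> y ys; apply: Hs; rewrite inE ys orbT.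
have [cx ne] := Hs x (mem_head _ _).
have [P [mP mx]] := Alg cx (Aa x cx ne).
pose u := (map_poly iota P).[a]; have u0 : u != 0 by apply: A_trans => //; exact: monic_neq0.
have Au : A u.
  rewrite /u horner_coef; apply: (sr_sum A_sub) => i _; rewrite coef_map; apply: (srM A_sub).
    by move=> y cy _; exact: XK.
  exact: (srX A_sub).
exists (u ^+ n * c); split; first by apply: (srM A_sub) => //; exact: (srX A_sub).
  by rewrite mulf_neq0 ?expf_neq0.
move=> y; rewrite inE => /orP[/eqP->|ys].
  have dx := Xd cx; rewrite -[n%:Z]addr0; apply: (vgeM dx); last first.
    by apply/(ordv_ge0 dx); exact: Ac.
  move=> _; rewrite ordvX //; have := (ordv_max dx u).1 mx u0; nia.
have [cy ney] : cl y /\ y <> oo by apply: Hs; rewrite inE ys orbT.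
rewrite -[n%:Z]add0r; apply: (vgeM (Xd cy)); last exact: cP.
by apply/(ordv_ge0 (Xd cy)); apply: (srX (Xd cy)); exact: Au.
Qed.

Lemma approx (s : seq (set F)) (u : set F -> F) (n : nat) : (forall x, x \in s -> cl x /\ x <> oo) ->
  exists h, (forall x, x \in s -> vge x n%:Z (h - u x)) /\
     forall x, cl x -> x <> oo -> x \notin s -> x h.
Proof.
move=> Hs; have [c [Ac c0 cP]] := cofac n Hs.
have [|h hP] := @strong_approx (fun x => if x \in s then u x / c else 0).
  apply: sub_finite_set (finite_seq s) => x [cx]; case: ifP => //= _ nx. by case: nx; exact: sr0 (Xd cx).
exists (c * h); split=> [x xs|x cx ne nxs].
  have [cx ne] := Hs x xs; have dx := Xd cx; have := hP x cx ne; rewrite xs => H.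
  have -> : c * h - u x = - (c * (u x / c - h)) by rewrite mulrBr opprB [c * (_ / _)]mulrC divfK.
  apply: (vgeN dx); rewrite -[n%:Z]addr0; apply: (vgeM dx); first exact: cP. exact/(ordv_ge0 dx).
have dx := Xd cx; apply: (srM dx); first exact: Ac.
have := hP x cx ne; rewrite (negbTE nxs) sub0r => /(srN dx).
by rewrite opprK.
Qed.

Local Notation csub := (csub C).
Local Notation cindep := (cindep C).
Local Notation cadjs := (cadjs C).

Lemma Oscale c V : csub V -> c != 0 -> csub [set c * v | v in V].
Proof.
move=> sV c0; split; first by exists 0; [exact: cs0 sV|rewrite mulr0].
- by move=> _ _ [u Vu <-] [v Vv <-]; exists (u - v); [exact: (csB sV)|rewrite mulrBr].
- by move=> a _ Ca [v Vv <-]; exists (a * v); [exact: (csZ sV)|rewrite mulrCA].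
Qed.
Lemma degs_scale c V : c != 0 -> degs [set c * v | v in V] = [set n | degs V (n - dg c)].
Proof.
move=> c0; apply/seteqP; split=> n.
  move=> [_ [[v Vv <-] cv0 <-]]; move: cv0; rewrite mulf_eq0 negb_or => /andP[_ v0].
  by exists v; split=> //; rewrite dgM //; lia.
move=> [v [Vv v0 dv]]; exists (c * v); split; [by exists v|by rewrite mulf_neq0|].
by rewrite dgM //; lia.
Qed.

Definition rindep (x : set F) (s : seq F) := (forall e, e \in s -> x e) /\
  cindep (max_ideal x) s.

(** Let c in A vanish at x. Elements independent in the residue field lift to elements of A
    independent modulo c A, and the index of c A exceeds that of A by the pole order of c. *)
Lemma rindep_bound x : cl x -> x <> oo -> exists n : nat, forall s, rindep x s -> (size s <= n)%N.
Proof.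
move=> cx ne; have dx := Xd cx.
have [|c [Ac c0 cP]] := @cofac [:: x] 1; first by move=> y; rewrite inE => /eqP->.
have mc : max_ideal x c by apply/(ordv_max dx); apply: cP; rewrite inE.
exists (absz (dg c)) => s [xs ind].
have [e eP] : {e : F -> F & forall b, b \in s -> A (e b) /\ max_ideal x (e b - b)}.
  apply: (@choice _ _ (fun b e => b \in s -> A e /\ max_ideal x (e - b))) => b.
  have [bs|nbs] := boolP (b \in s); last by exists 0.
  have [|h [h1 h2]] := @approx [:: x] (fun=> b) 1; first by move=> y; rewrite inE => /eqP->.
  have mh : max_ideal x (h - b) by apply/(ordv_max dx); apply: h1; rewrite inE.
  exists h => _; split=> // y cy ney; have [->|yx] := eqVneq y x.
    by rewrite -[h](subrK b); apply: (srD dx); [case: mh|exact: xs].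
  by apply: h2 => //; rewrite inE.
pose V := [set c * v | v in A].
have VA : V `<=` A by move=> _ [v Av <-]; exact: (srM A_sub).
have iV : hasidx (degs V) (g%:Z + dg c) by rewrite degs_scale //; exact: hasidx_shift idxA.
have indV : cindep V (map e s).
  move=> k Ck [v Av ev] i; rewrite size_map in ev * => lt; apply: ind (lt) => //.
  have -> : \sum_(i0 < size s) k i0 * s`_i0 = c * v -
      \sum_(i0 < size s) k i0 * (e s`_i0 - s`_i0).
    rewrite ev -sumrB; apply: eq_bigr => j _; rewrite (nth_map 0) // -mulrBr; congr (_ * _); ring.
  apply: (maxB dx); first by apply: (maxMr dx) => //; exact: Av.
  apply: (max_sum dx) => j _; apply: (maxMl dx); first exact: const_in cx _ (Ck j).
  by have [] := eP _ (mem_nth 0 (ltn_ord j)).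
have := cindep_le doo K_sub CV Coo Cres (Oscale Acsub c0) Acsub VA _ iV idxA indV.
rewrite size_map => H; suff : g%:Z + (size s)%:Z <= g%:Z + dg c by lia.
by apply: H => b /mapP[b' bs ->]; case: (eP _ bs).
Qed.

Lemma residue_basis x : cl x -> x <> oo -> exists s, rindep x s /\
  forall h, x h -> exists c : nat -> F, (forall i, C (c i)) /\
     max_ideal x (h - \sum_(i < size s) c i * s`_i).
Proof.
move=> cx ne; have dx := Xd cx; have [n bound] := rindep_bound cx ne.
have ex : exists m, `[< exists2 s, rindep x s & size s = m >].
  by exists 0%N; apply/asboolP; exists [::]; split.
have ub m : `[< exists2 s, rindep x s & size s = m >] -> (m <= n)%N.
  by move=> /asboolP [s /bound le <-].
have [m /asboolP [s rs es] mmax] := ex_maxnP ex ub.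
exists s; split=> // h xh; have [xs ind] := rs.
have nind : ~ rindep x (h :: s).
  move=> r'; suff : (m.+1 <= m)%N by rewrite ltnn. by apply: mmax; apply/asboolP; exists (h :: s) => //=; rewrite es.
apply: contrapT => nc; apply: nind; split.
  by move=> e; rewrite inE => /orP[/eqP->|/xs].
move=> c Cc mm; have c00 : c 0%N = 0.
  apply: contrapT => /eqP c0; apply: nc; exists (fun i => - (c 0%N)^-1 * c i.+1); split.
    by move=> i; apply: (srM K_sub) => //; apply: (srN K_sub); exact: CV.
  have -> : h - \sum_(i < size s) - (c 0%N)^-1 * c i.+1 * s`_i =
     (c 0%N)^-1 * (\sum_(i < size (h :: s)) c i * (h :: s)`_i).
    rewrite big_ord_recl /= mulrDr mulrA mulVf // mul1r mulr_sumr -sumrN; congr (_ + _).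
    by apply: eq_bigr => i _; rewrite -mulrA mulNr opprK.
  by apply: (maxMl dx) => //; apply: (const_in cx); exact: CV.
have H := ind (fun i => c i.+1) (fun i => Cc _) _.
move=> [_|i] //.
rewrite ltnS => lt; apply: H lt.
by move: mm; rewrite big_ord_recl c00 mul0r add0r.
Qed.

Lemma iota_C c : C c -> exists k, iota k = c. Proof. by case=> k _ <-; exists k. Qed.

Lemma has_rd x s : cl x -> rindep x s -> (forall h, x h -> exists c : nat -> F, (forall i, C (c i)) /\
     max_ideal x (h - \sum_(i < size s) c i * s`_i)) -> has_residue_degree iota x (size s).
Proof.
move=> cx [xs ind] gen; have dx := Xd cx.
exists (fun i => s`_i); split; first by move=> i; apply: xs; exact: mem_nth.
move=> h xh; have [c [Cc mc]] := gen h xh.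
have [k kP] := choice (fun i => iota_C (Cc i)).
exists [ffun i : 'I_(size s) => k i]; split.
  by under eq_bigr do rewrite ffunE kP.
move=> k' mk'; apply/ffunP => i; rewrite ffunE.
pose kk (j : nat) := if insub j is Some j' then c j - iota (k' j') else 0.
have := ind kk _ _ i (ltn_ord i); rewrite /kk valK => H.
apply: (fmorph_inj iota); apply/eqP; rewrite -subr_eq0 kP; apply/eqP; apply: H.
  move=> j; case: insub => [j'|]; last exact: sr0 K_sub. by apply: (srB K_sub) => //; exists (k' j').
have -> : \sum_(i0 < size s) (if insub (nat_of_ord i0) is Some j' then c i0 - iota (k' j') else 0) * s`_i0
   = (h - \sum_(i < size s) iota (k' i) * s`_i) - (h - \sum_(i < size s) c i * s`_i).
  have -> (u v w : F) : u - v - (u - w) = w - v by ring. by rewrite -sumrB; apply: eq_bigr => j _; rewrite valK mulrBl.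
mem.
Qed.

Lemma rd_has x : cl x -> x <> oo -> has_residue_degree iota x (residue_degree iota x).
Proof.
move=> cx ne; have [s [rs gen]] := residue_basis cx ne.
by apply: (@xgetPex _ 0%N [set m | has_residue_degree iota x m]); exists (size s); exact: has_rd.
Qed.

Lemma has_rd_seq x m : cl x -> has_residue_degree iota x m -> exists s, [/\ size s = m,
  rindep x s & forall h, x h -> exists c : nat -> F, (forall i, C (c i)) /\
     max_ideal x (h - \sum_(i < size s) c i * s`_i)].
Proof.
move=> cx [b [xb bP]]; have dx := Xd cx; exists (codom b).
have ss : size (codom b) = m by rewrite size_codom card_ord.
have sn (i : 'I_m) : (codom b)`_i = b i.
  by rewrite (nth_map i) ?size_enum_ord // nth_ord_enum.
have sumE (c : nat -> F) : \sum_(i < size (codom b)) c i * (codom b)`_i = \sum_(i < m) c i * b i.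
  rewrite -(big_mkord xpredT (fun i => c i * (codom b)`_i)) ss big_mkord. by apply: eq_bigr => i _; rewrite sn.
split=> //; first split.
- by move=> e /codomP [i ->].
- move=> c Cc; rewrite sumE ss => mc i lt.
  have [k kP] := choice (fun i => iota_C (Cc i)). have [c0 [_ u]] := bP 0 (sr0 dx). have e1 : c0 = [ffun=> 0].
    apply: u; rewrite big1; first mem. by move=> j _; rewrite ffunE rmorph0 mul0r.
  have e2 : c0 = [ffun j : 'I_m => k j].
    apply: u; rewrite sub0r; apply: (maxN dx). by under eq_bigr do rewrite ffunE kP.
  have := congr1 (fun w : {ffun 'I_m -> K} => w (Ordinal lt)) (etrans (esym e1) e2).
  by rewrite !ffunE -kP => <-; rewrite rmorph0.
- move=> h xh; have [c [mc _]] := bP h xh.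
  exists (fun j => if insub j is Some j' then iota (c j') else 0); split.
    by move=> i; case: insub => [j|]; [exists (c j)|exact: sr0 K_sub].
  rewrite (sumE (fun j => if insub j is Some j' then iota (c j') else 0)). by under eq_bigr do rewrite valK.
Qed.

Lemma rd_oo : residue_degree iota oo = 1%N.
Proof.
have ex : has_residue_degree iota oo 1.
  apply: (has_rd (s := [:: 1])) => //.
    split; first by move=> e; rewrite inE => /eqP->; mem. move=> c Cc; rewrite big_ord1 /= mulr1 => mc [|//] _.
    apply: contrapT => /eqP c0; apply: unit_not_max _ mc; split=> //; apply: Coo => //; exact: CV.
  move=> h oh; have [c Cc mc] := Cres oh; exists (fun=> c); split=> //. by rewrite big_ord1 mulr1.
have := @xgetPex _ 0%N [set m | has_residue_degree iota oo m] (ex_intro _ _ ex).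
rewrite -/(residue_degree iota oo); set m := residue_degree _ _ => /= /(has_rd_seq coo) [s [<- [xs ind] gen]].
case: s xs ind gen => [|a [|b s]] // xs ind gen.
  have [c [_]] := gen 1 (sr1 doo); rewrite big_ord0 subr0 => /not_max1 []; exact: doo.
exfalso; have [ca Cca ma] := Cres (xs a (mem_head _ _)).
have [cb Ccb mb] : exists2 c, C c & max_ideal oo (b - c).
  by apply: Cres; apply: xs; rewrite !inE eqxx orbT.
have cb0 : cb = 0.
  apply: (ind (fun i => match i with 0 => cb | 1 => - ca | _ => 0 end) _ _ 0%N) => //.
    by case=> [|[|i]] //; [apply: (srN K_sub)|exact: sr0 K_sub].
  rewrite !big_ord_recl /= big1 ?addr0; last by move=> i _; rewrite mul0r.
  have -> : cb * a + - ca * b = cb * (a - ca) - ca * (b - cb) by ring.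
  by apply: (maxB doo); apply: (maxMl doo) => //; exact: Coo.
have : (1 : F) = 0; last by apply/eqP; rewrite oner_eq0.
apply: (ind (fun i => match i with 1 => 1 | _ => 0 end) _ _ 1%N) => //.
  by case=> [|[|i]]; [exact: sr0 K_sub|exact: sr1 K_sub|exact: sr0 K_sub].
rewrite !big_ord_recl /= big1 ?addr0; last by move=> i _; rewrite mul0r.
by rewrite mul0r add0r mul1r -[b]subr0 -cb0.
Qed.

(** The quotient of [MD D'] by [MD D] is the residue field at x: a basis element b is realized by a
    function close to b / t^(D x + 1) at x that satisfies the other conditions of D. *)
Lemma MD_step D D' x (sup : seq (set F)) : cl x -> x <> oo ->
  (forall y, cl y -> y <> oo -> D' y = D y + (`[< y = x >] : nat)%:Z) ->
  (forall y, y \in sup -> cl y /\ y <> oo) ->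
  (forall y, cl y -> y <> oo -> y \notin sup -> D y = 0) ->
  exists s, [/\ size s = residue_degree iota x, cindep (MD D) s & cadjs (MD D) s = MD D'].
Proof.
move=> cx ne DD' Hsup Dsup; have dx := Xd cx.
have [s [<- [xs ind] gen]] := has_rd_seq cx (rd_has cx ne).
have [t ut] := dvr_unif dx; have [t0 _] := ut.
pose tw := t ^ (D x + 1); have tw0 : tw != 0 by rewrite expfz_neq0.
have otw : ordv x tw = D x + 1 by rewrite ordvXz // (ordv_unif dx ut) mulr1.
(* A precision implying the conditions imposed by D at x and at all points of its support. *)
pose n := (\sum_(y <- x :: sup) absz (D y))%N.
have nD y : y \in x :: sup -> - D y <= n%:Z.
  by move=> ys; rewrite /n (big_rem y) //=; lia.
have Hs y : y \in x :: sup -> cl y /\ y <> oo by rewrite inE => /orP[/eqP->|/Hsup].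
have [e eP] := choice (fun b => @approx (x :: sup) (fun y => if y == x then b / tw else 0) n Hs).
have ex b : vge x (- D x) (e b - b / tw).
  have [+ _] := eP b => /(_ x (mem_head _ _)); rewrite eqxx; apply: vge_le. exact: nD (mem_head _ _).
have eo b y : cl y -> y <> oo -> y <> x -> vge y (- D y) (e b).
  move=> cy ney /eqP/negbTE yx; have [ys|nys] := boolP (y \in x :: sup).
    have [+ _] := eP b => /(_ y ys); rewrite yx subr0; apply: vge_le; exact: nD.
  have [_ +] := eP b => /(_ y cy ney nys) /(ordv_ge0 (Xd cy)).
  by rewrite Dsup //; apply: contraNN nys => ys; rewrite inE ys orbT.
have D'x : D' x = D x + 1 by rewrite DD' //; case: asboolP.
have D'o y : cl y -> y <> oo -> y <> x -> D' y = D y.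
  by move=> cy ney yx; rewrite DD' //; case: asboolP => // _; rewrite addr0.
have vtw b : x b -> vge x (- D' x) (b / tw).
  move=> xb; rewrite D'x -[- _]add0r; apply: (vgeM dx); first exact/(ordv_ge0 dx). by move=> _; rewrite ordvV // otw.
have DleD' : MD D `<=` MD D'.
  by move=> h Mh y cy ney; apply: vge_le (Mh y cy ney); rewrite DD' //; lia.
exists (map e s); rewrite size_map; split=> //.
  move=> c Cc Mc i; rewrite size_map => lt; apply: (ind c Cc _ i lt); apply/(ordv_max dx).
  have := Mc x cx ne; rewrite size_map => H. have -> : \sum_(i < size s) c i * s`_i = (\sum_(i < size s) c i * (map e s)`_i -
     \sum_(i < size s) c i * (e s`_i - s`_i / tw)) * tw.
    rewrite -sumrB mulr_suml; apply: eq_bigr => j _; rewrite (nth_map 0) // -mulrBr.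
    by rewrite opprB [e _ + _]addrC subrK mulrA divfK.
  have -> : 1 = - D x + (D x + 1) by ring. apply: (vgeM dx); last by rewrite -otw; exact: vge_ordv.
  apply: vgeB => //; apply: (vge_sum dx) => j _; rewrite -[- D x]add0r.
  by apply: (vgeM dx); [apply/(ordv_ge0 dx); exact: const_in cx _ (Cc j)|exact: ex].
apply/seteqP; split.
  apply: cadjs_sub; [exact: MDcsub|exact: DleD'|move=> _ /mapP[b bs ->] y cy ney].
  have [->|/eqP yx] := eqVneq y x; last by rewrite D'o //; exact: eo.
  rewrite -[e b](subrK (b / tw)); apply: (vgeD dx); last by apply: vtw; exact: xs. by apply: vge_le (ex b); rewrite D'x; lia.
move=> h Mh; have xh : x (h * tw).
  apply/(ordv_ge0 dx); have -> : 0 = - D' x + (D x + 1) by rewrite D'x; ring.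
  by apply: (vgeM dx); [exact: Mh|rewrite -otw; exact: vge_ordv].
have [c [Cc mc]] := gen _ xh.
pose S := \sum_(i < size (map e s)) c i * (map e s)`_i.
rewrite -[h](subrK S); apply: cadjs_in => //; first exact: MDcsub.
move=> y cy ney; have dy := Xd cy; have [yx|/eqP yx] := eqVneq y x; last first.
  apply: (vgeB dy); first by rewrite -D'o //; exact: Mh. apply: (vge_sum dy) => i _; rewrite -[- D y]add0r; apply: (vgeM dy).
    by apply/(ordv_ge0 dy); exact: const_in cy _ (Cc i).
  have lt := ltn_ord i; rewrite [X in (_ < X)%N]size_map in lt. by rewrite (nth_map 0) //; exact: eo.
rewrite yx; have -> : h - S = (h * tw - \sum_(i < size s) c i * s`_i) / tw
     - \sum_(i < size s) c i * (e s`_i - s`_i / tw).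
  rewrite /S size_map mulrBl mulfK // mulr_suml -addrA -opprD -big_split /=; congr (_ - _).
  apply: eq_bigr => i _; rewrite (nth_map 0) //; ring.
apply: (vgeB dx).
  have -> : - D x = 1 + - (D x + 1) by ring. apply: (vgeM dx); first exact/ordv_max. by move=> _; rewrite ordvV // otw.
apply: (vge_sum dx) => i _; rewrite -[- D x]add0r.
by apply: (vgeM dx); [apply/(ordv_ge0 dx); exact: const_in cx _ (Cc i)|exact: ex].
Qed.

Lemma MD_ext D D' : (forall x, cl x -> x <> oo -> D x = D' x) -> MD D = MD D'.
Proof.
by move=> e; apply/seteqP; split=> h Mh x cx ne; [rewrite -e|rewrite e] => //; exact: Mh.
Qed.

(** Riemann-Roch has no dual term here because poles at oo are unrestricted. Induction on the
    support; at each point the multiplicity is reached from 0 in either direction by [MD_step]. *)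
Lemma idxMD (s : seq (set F)) D : uniq s -> (forall x, x \in s -> cl x /\ x <> oo) ->
  (forall x, cl x -> x <> oo -> x \notin s -> D x = 0) ->
  hasidx (degs (MD D)) (g%:Z - \sum_(x <- s) D x * (residue_degree iota x)%:Z).
Proof.
elim: s D => [|x s IH] D.
  move=> _ _ D0; rewrite big_nil subr0 -(@MD_ext (@zero_divisor F)) -?A_MD; first exact: idxA. by move=> x cx ne; rewrite D0.
rewrite cons_uniq => /andP[nxs us] Hs Ds.
have [cx ne] := Hs x (mem_head _ _).
have Hs' y : y \in s -> cl y /\ y <> oo by move=> ys; apply: Hs; rewrite inE ys orbT.
pose Dn (n : int) y := if y == x then n else D y.
have rest n : \sum_(y <- s) Dn n y * (residue_degree iota y)%:Z =
    \sum_(y <- s) D y * (residue_degree iota y)%:Z.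
  by apply: eq_big_seq => y ys; rewrite /Dn; case: eqP ys nxs => // -> ->.
have base : hasidx (degs (MD (Dn 0))) (g%:Z - \sum_(y <- s) D y * (residue_degree iota y)%:Z).
  rewrite -(rest 0); apply: IH => // y cy ney nys; rewrite /Dn; case: eqP => // /eqP yx.
  by apply: Ds => //; rewrite negb_or yx.
have sup n y : cl y -> y <> oo -> y \notin x :: s -> Dn n y = 0.
  by move=> cy ney nys; rewrite /Dn Ds //; case: eqP nys => // ->; rewrite mem_head.
have step n : exists es, [/\ size es = residue_degree iota x, cindep (MD (Dn n)) es &
    cadjs (MD (Dn n)) es = MD (Dn (n + 1))].
  apply: (@MD_step (Dn n) (Dn (n + 1)) x (x :: s)) => //; last exact: sup.
  move=> y cy ney; rewrite /Dn; case: eqP => yx; case: asboolP => //=; by rewrite addr0.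
have main n : hasidx (degs (MD (Dn n)))
   (g%:Z - \sum_(y <- s) D y * (residue_degree iota y)%:Z - n * (residue_degree iota x)%:Z).
  elim/int_rect: n => [|n H|n H]; first by rewrite subr0.
    have [es [ses ind ee]] := step n%:Z. have := cadjs_idx doo K_sub CV Coo Cres (MDcsub _) H ind.
    rewrite ee ses (_ : n%:Z + 1 = n.+1%:Z); last by lia. congr hasidx; rewrite -addn1; ring.
  have [es [ses ind ee]] := step (- n.+1%:Z).
  have := cadjs_idx' doo K_sub CV Coo Cres (MDcsub _) (s := es) _ ind; rewrite ee ses.
  have -> : - n.+1%:Z + 1 = - n%:Z by lia. move=> /(_ _ H); congr hasidx; rewrite -addn1; ring.
rewrite big_cons (@MD_ext D (Dn (D x))); last by move=> y _ _; rewrite /Dn; case: eqP => [->|].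
have := main (D x); congr hasidx; ring.
Qed.

(** In degree 0 the points off oo contribute - D oo. Since [gapE] shifts pole orders by D oo, this
    amounts to index g in terms of gaps. *)
Lemma idx_deg0 D : is_divisor X D -> degree iota D = 0 ->
  hasidx (degs (MD D)) (g%:Z + D oo).
Proof.
move=> [Dcl Dfin] D0; have [s0 es0] := (finite_seqP _).1 Dfin.
pose s := undup s0; have us : uniq s by exact: undup_uniq.
have ms x : (x \in s) = (D x != 0).
  rewrite mem_undup; apply/idP/idP => H.
    by have : [set` s0] x by []; rewrite -es0.
  by have : [set x | D x != 0] x by []; rewrite es0.
have e1 : \sum_(x <- s) D x * (residue_degree iota x)%:Z = 0.
  rewrite -[RHS]D0 /degree; have -> : [set x | D x != 0] = [set` s].
    by apply/seteqP; split=> x /=; rewrite ms.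
  by rewrite fsbig_seq.
pose s' := [seq x <- s | x != oo].
have -> : g%:Z + D oo = g%:Z - \sum_(x <- s') D x * (residue_degree iota x)%:Z.
  congr (_ + _); apply/eqP; rewrite -addr_eq0; apply/eqP; rewrite -[RHS]e1 big_filter.
  rewrite [RHS](bigID (fun x => x != oo)) /= addrC; congr (_ + _); apply/esym. have [os|nos] := boolP (oo \in s).
    rewrite (big_rem oo) //= eqxx rd_oo mulr1 big_seq_cond big1 ?addr0 //.
    by move=> x /andP[]; rewrite mem_rem_uniq // => /andP[/negbTE->].
  move: (nos); rewrite ms negbK => /eqP->; rewrite big_seq_cond big1 // => x /andP[xs].
  by rewrite negbK => /eqP xo; move: nos; rewrite -xo xs.
apply: idxMD; first by rewrite filter_uniq.
  move=> x; rewrite mem_filter => /andP[/eqP ne]; rewrite ms => D0x; split=> //; exact: Dcl.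
by move=> x cx /eqP ne; rewrite mem_filter ne ms negbK => /eqP.
Qed.

End Curve.

(** * Laurent expansions *)

Section LaurentTheory.
Variables (K F : fieldType) (iota : {rmorphism K -> F}) (E : F -> int -> K).
Hypothesis HE : is_laurent_embedding iota E.

Lemma ED a b i : E (a + b) i = E a i + E b i. Proof. by case: HE. Qed.
Lemma EC c i : E (iota c) i = if i == 0 then c else 0. Proof. by case: HE. Qed.
Lemma E0 i : E 0 i = 0. Proof. by rewrite -(rmorph0 iota) EC if_same. Qed.
Lemma E1 i : E 1 i = (i == 0)%:R.
Proof. by rewrite -(rmorph1 iota) EC; case: eqP. Qed.
Lemma EN a i : E (- a) i = - E a i.
Proof. by apply/eqP; rewrite -addr_eq0 -ED addNr E0. Qed.
Lemma EB a b i : E (a - b) i = E a i - E b i. Proof. by rewrite ED EN. Qed.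
Lemma E_sum (I : Type) (s : seq I) (P : pred I) (G : I -> F) i :
  E (\sum_(j <- s | P j) G j) i = \sum_(j <- s | P j) E (G j) i.
Proof. exact: (big_morph (fun h => E h i) (fun a b => ED a b i) (E0 i)). Qed.
Lemma E_mul a b M N n : degT_le (E a) M -> degT_le (E b) N ->
  E (a * b) (M + N - n%:Z) = \sum_(i < n.+1) E a (M - i%:Z) * E b (N - (n - i)%N%:Z).
Proof. by move=> Ha Hb; case: HE => _ _ _ /(_ a b M N Ha Hb) [_]. Qed.
Lemma EM_top a b M N : degT_le (E a) M -> degT_le (E b) N ->
  E (a * b) (M + N) = E a M * E b N.
Proof.
by move=> Ha Hb; have := E_mul 0 Ha Hb; rewrite subr0 big_ord1 !subr0.
Qed.
Lemma EC_le c : degT_le (E (iota c)) 0.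
Proof. by move=> i i0; rewrite EC; case: eqP => // e; move: i0; rewrite e ltxx. Qed.
Lemma degT_leW s M N : M <= N -> @degT_le K s M -> degT_le s N.
Proof. by move=> MN H i Ni; apply: H; exact: le_lt_trans Ni. Qed.
Lemma EZ c h i : E (iota c * h) i = c * E h i.
Proof.
have [M0 HM] : is_laurent (E h) by case: HE.
pose M := M0 + `|i|%:Z + `|M0|%:Z.
have HM' : degT_le (E h) M by apply: degT_leW HM; rewrite /M; lia.
have [n en] : exists n : nat, i = 0 + M - n%:Z by exists (absz (M - i)); rewrite /M; lia.
rewrite en (E_mul n (EC_le c) HM') big_ord_recl /= EC eqxx big1 ?addr0 ?subn0 => [|j _].
  by congr (_ * E h _); lia.
by rewrite EC ?mul0r //; apply/eqP; rewrite lift0; lia.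
Qed.
Lemma E_neq0 h : h != 0 -> exists i, E h i != 0.
Proof.
move=> h0; apply: contrapT => nE.
have H0 i : E h i = 0 by apply/eqP/negP => H; apply: nE; exists i; apply/negP.
have Hh : degT_le (E h) 0 by move=> i _.
have [N HN] : is_laurent (E h^-1) by case: HE.
have := E1 0; rewrite -(mulfV h0) eqxx => e.
have [le|lt] := lerP N 0.
  have HN' : degT_le (E h^-1) 0 by exact: degT_leW HN.
  by have := EM_top Hh HN'; rewrite e H0 mul0r => /eqP; rewrite oner_eq0.
have [n en] : exists n : nat, 0 = 0 + N - n%:Z by exists (absz N); lia.
move: e; rewrite {1}en (E_mul n Hh HN) big1 => [|j _]; last by rewrite H0 mul0r.
by move/esym/eqP; rewrite oner_eq0.
Qed.
Lemma E_top h : h != 0 -> exists n, E h n != 0 /\ degT_le (E h) n.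
Proof.
move=> h0; have [i Ei] := E_neq0 h0; have [M HM] : is_laurent (E h) by case: HE.
have iM : i <= M by rewrite leNgt; apply/negP => /HM e; move: Ei; rewrite e eqxx.
have ex : exists n : nat, E h (M - n%:Z) != 0.
  by exists (absz (M - i)); rewrite (_ : M - _ = i); lia.
have [n En nmin] := ex_minnP ex; exists (M - n%:Z); split=> // j Hj.
have [/HM//|jM] := ltP M j.
apply/eqP; apply: contraT => Ej.
have := nmin (absz (M - j)); rewrite (_ : M - _ = j); last by lia.
lia.
Qed.
End LaurentTheory.

(** At a closed point without uniformizer the condition defining [H0] never holds; all the [H0]
    would be empty and every n would be a gap, whereas the gaps are finite in number. *)
Lemma gap_unif (F : fieldType) (S : set (set F)) D P (g : nat) (mu : 'I_g -> nat) :
  gap_sequence S D P = range mu -> forall x, closed_point S x -> exists t, uniformizer x t.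
Proof.
move=> eg x cx; apply: contrapT => nt.
have e0 D' : H0 S D' = set0.
  by apply/seteqP; split=> // h /(_ x cx) [t ut]; case: nt; exists t.
have : range mu (\max_i mu i).+1 by rewrite -eg /gap_sequence /= !e0.
by move=> [i _ e]; have := leq_bigmax (F := mu) i; rewrite e ltnn.
Qed.

Lemma max_pow1 (F : fieldType) (O : set F) z : is_local O -> max_ideal_pow O 1 z -> max_ideal O z.
Proof.
move=> lO [m [c [a [Oc ma ->]]]]; apply: (max_sum lO) => i _.
by rewrite big_ord1; apply: (maxMl lO).
Qed.

(** * Approximation by p-th powers in characteristic p *)

Section FrobeniusCount.
Variables (F : fieldType) (O C : set F) (p : nat).
Hypotheses (dO : dvr O) (sC : subring C) (CV : forall c, C c -> C c^-1) (CO : C `<=` O).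
Hypothesis Cres : forall h, O h -> exists2 c, C c & max_ideal O (h - c).
Hypotheses (pr : prime p) (pF : p%:R = 0 :> F).
Hypothesis Cp : forall c, C c -> exists2 c', C c' & c'^+ p = c.
Implicit Types (u v w y h : F) (N : nat -> nat).
Local Notation dg := (dg O).
Local Notation dle := (dle O).
Local Notation degs := (degs O).

Lemma frobB x y : (x - y) ^+ p = x ^+ p - y ^+ p.
Proof. by have := frob_powB pr pF 1 x y; rewrite expn1. Qed.
Lemma frobDp x y : (x + y) ^+ p = x ^+ p + y ^+ p.
Proof. by have := frob_powD pr pF 1 x y; rewrite expn1. Qed.
Lemma dgXn h n : h != 0 -> dg (h ^+ n) = n%:Z * dg h.
Proof. exact: (@dgXz F O dO h n%:Z). Qed.
Lemma p_gt0 : (0 < p)%N. Proof. exact: prime_gt0. Qed.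

(** In the application F is the function field of the special fibre, V its ring of functions regular
    off the section, and W j a space of reduced sections whose p-th powers become regular after
    multiplication by u^j. Counting the combinations of the u^j w^p inside V measures how far u is
    from being a p-th power. *)
Variable (g : nat) (V : set F) (W : nat -> set F) (D0 c0 : nat) (u : F).
Hypotheses (sV : csub C V) (V0 : forall n, degs V n -> 0 <= n).
Hypothesis HV : forall (D : nat) (L : seq int), (D0 <= D)%N -> uniq L ->
  (forall n, n \in L -> degs V n /\ n <= D%:Z) -> (size L + g <= D.+1)%N.
Hypothesis sW : forall j, csub C (W j).
Definition cW j e := count (fun n : nat => `[< degs (W j) n%:Z >]) (seq.iota 0 e).
Hypothesis HW : forall j n, (j < p)%N -> (c0 <= n)%N -> (n.+1 <= cW j n.+1 + g)%N.
Hypothesis Wc0 : forall j (n : int), (j < p)%N -> c0%:Z <= n -> degs (W j) n.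
Hypothesis uW : forall j w, (j < p)%N -> W j w -> V (u ^+ j * w ^+ p).

Section Levels.
Variables (y eta : F) (N : nat -> nat) (l0 : nat).
Hypotheses (uy : u = y ^+ p + eta) (l0p : (l0 <= p)%N).
Hypothesis Nc : forall l, (l < l0)%N -> (c0 <= N l)%N.
Hypothesis inj : forall l (X : nat -> F), (l < l0)%N ->
  \sum_(i < l.+1) eta ^+ i * X i ^+ p = 0 -> X l = 0.

(** Elements of V written in powers of eta instead of u: as eta is small, large coefficients X i
    still give small pole orders. The bound e on the top coefficient grows by one at a time in
    [chain]. *)
Definition Hs l (e : int) := [set h | V h /\ exists X : nat -> F,
  [/\ forall i, (i < l)%N -> dle (N i)%:Z (X i), dle e (X l) & h = \sum_(i < l.+1) eta ^+ i * X i ^+ p]].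

Lemma Hs_csub l e : csub C (Hs l e).
Proof.
split.
- split; first exact: cs0 sV.
  exists (fun=> 0); split=> [i _||]; try exact: dle0. by rewrite big1 // => i _; rewrite expr0n gtn_eqF ?mulr0 ?p_gt0.
- move=> a b [Va [X [X1 X2 ea]]] [Vb [Z [Z1 Z2 eb]]]; split; first exact: (csB sV).
  exists (fun i => X i - Z i); split=> [i il||].
  + by apply: (dleB dO); [exact: X1|exact: Z1].
  + exact: dleB.
  + by rewrite ea eb -sumrB; apply: eq_bigr => i _; rewrite frobB mulrBr.
- move=> a h Ca [Va [X [X1 X2 eh]]]; split; first exact: (csZ sV).
  have [b Cb <-] := Cp Ca; exists (fun i => b * X i); split=> [i il||].
  + by apply: (dleZ dO CV CO) => //; exact: X1.
  + exact: (dleZ dO CV CO).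
  + by rewrite eh mulr_sumr; apply: eq_bigr => i _; rewrite exprMn; ring.
Qed.

Definition Bp l := [set h | exists w : nat -> F, h = \sum_(j < l) u ^+ j * w j ^+ p].
Lemma BpD l a b : Bp l a -> Bp l b -> Bp l (a + b).
Proof.
move=> [w ->] [w' ->]; exists (fun i => w i + w' i).
by rewrite -big_split; apply: eq_bigr => i _; rewrite frobDp mulrDr.
Qed.
Lemma BpN l a : Bp l a -> Bp l (- a).
Proof.
move=> [w ->]; exists (fun i => - w i); rewrite -sumrN; apply: eq_bigr => i _.
by rewrite -[- w i]sub0r frobB expr0n gtn_eqF ?p_gt0 // sub0r mulrN.
Qed.
Lemma Bpu l a : Bp l a -> Bp l.+1 (u * a).
Proof.
move=> [w ->]; exists (fun i => if i is i'.+1 then w i' else 0).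
rewrite big_ord_recl expr0n gtn_eqF ?p_gt0 //= mulr0 add0r mulr_sumr.
by apply: eq_bigr => i _; rewrite exprS mulrA.
Qed.
Lemma Bp_le l a : Bp l a -> Bp l.+1 a.
Proof.
move=> [w ->]; exists (fun i => if (i < l)%N then w i else 0).
rewrite big_ord_recr /= ltnn expr0n gtn_eqF ?p_gt0 // mulr0 addr0.
by apply: eq_bigr => i _; rewrite ltn_ord.
Qed.
Lemma Bp_top l x : Bp l.+1 (u ^+ l * x ^+ p).
Proof.
exists (fun i => if i == l then x else 0); rewrite big_ord_recr /= eqxx big1 ?add0r // => i _.
by rewrite ltn_eqF // expr0n gtn_eqF ?p_gt0 ?mulr0.
Qed.
(** [Bp l] is the span of the u^i, i < l, over the p-th powers. Since u - eta is a p-th power, both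
    top terms agree modulo lower powers of u. *)
Lemma Bp_eta l x : Bp l (u ^+ l * x ^+ p - eta ^+ l * x ^+ p).
Proof.
elim: l x => [|l IH] x; first by rewrite subrr; exists (fun=> 0); rewrite big_ord0.
have -> : u ^+ l.+1 * x ^+ p - eta ^+ l.+1 * x ^+ p =
  u * (u ^+ l * x ^+ p - eta ^+ l * x ^+ p) +
  (u ^+ l * (x * y) ^+ p - (u ^+ l * (x * y) ^+ p - eta ^+ l * (x * y) ^+ p)).
  have ey : y ^+ p = u - eta by rewrite uy addrK. by rewrite !exprMn ey !exprS; ring.
apply: BpD; first exact: Bpu.
by apply: BpD; [exact: Bp_top|apply: BpN; apply: Bp_le].
Qed.

(** From the top power of u downwards: the coefficient is reduced modulo W l until its degree is at
    most N l. The part in W l gives an element of V, and the remainder is moved from u^l to eta^l at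
    the cost of lower powers. *)
Lemma Bp_split l h : (l <= l0)%N -> Bp l h -> exists h' (X : nat -> F), [/\ V h',
  forall i, (i < l)%N -> dle (N i)%:Z (X i) & h = h' + \sum_(i < l) eta ^+ i * X i ^+ p].
Proof.
elim: l h => [|l IH] h ll [w eh].
  by exists 0, (fun=> 0); rewrite eh !big_ord0 addr0; split=> //; exact: cs0 sV.
have lp : (l < p)%N by apply: leq_trans l0p.
have [w' Ww' Hw'] := reduce dO Cres 0 (w l) (sW l).
pose x := w l - w'.
have dx : dle (N l)%:Z x.
  case: Hw' => [e|[x0 Hd]]; first by rewrite /x e; exact: dle0. have := Nc ll; rewrite -lez_nat => Nl.
  move=> _; case: Hd => [lt|nd]; first by move: lt; rewrite /x; lia.
  rewrite leNgt; apply/negP => lt; apply: nd; apply: Wc0; rewrite /x in lt; lia.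
have [||h' [X [Vh' X1 eh']]] := IH (h - u ^+ l * w' ^+ p - eta ^+ l * x ^+ p).
- exact: ltnW.
- rewrite eh big_ord_recr /=.
  have -> : \sum_(i < l) u ^+ i * w i ^+ p + u ^+ l * w l ^+ p - u ^+ l * w' ^+ p -
    eta ^+ l * x ^+ p = \sum_(i < l) u ^+ i * w i ^+ p +
    (u ^+ l * x ^+ p - eta ^+ l * x ^+ p) by rewrite frobB; ring.
  by apply: BpD; [exists w|exact: Bp_eta].
exists (h' + u ^+ l * w' ^+ p), (fun i => if i == l then x else X i); split.
- by apply: (csD sV) => //; exact: uW.
- move=> i il; case: eqP => [->//|ne]; apply: X1; lia.
- rewrite big_ord_recr /= eqxx.
  have -> : \sum_(i < l) eta ^+ i * (if i == l :> nat then x else X i) ^+ p =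
    \sum_(i < l) eta ^+ i * X i ^+ p by apply: eq_bigr => i _; rewrite ltn_eqF.
  move: eh' => /(canRL (subrK _)) /(canRL (subrK _)) ->; ring.
Qed.

Lemma new_elt l w : (l < l0)%N -> W l w -> exists2 h, V h & exists X : nat -> F,
  [/\ forall i, (i < l)%N -> dle (N i)%:Z (X i), X l = w & h = \sum_(i < l.+1) eta ^+ i * X i ^+ p].
Proof.
move=> ll Ww; have [h' [X [Vh' X1 e]]] := Bp_split (ltnW ll) (Bp_eta l w).
exists (u ^+ l * w ^+ p - h').
  by apply: (csB sV) => //; apply: uW => //; exact: leq_trans l0p.
exists (fun i => if i == l then w else X i); split=> [i il||]; first by rewrite ltn_eqF //; exact: X1.
  by rewrite eqxx.
rewrite big_ord_recr /= eqxx.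
have -> : \sum_(i < l) eta ^+ i * (if i == l :> nat then w else X i) ^+ p =
    \sum_(i < l) eta ^+ i * X i ^+ p by apply: eq_bigr => i _; rewrite ltn_eqF.
by move: e => /(canRL (subrK _)) ->; ring.
Qed.

(** An element w of W l of degree e yields through [new_elt] an element of V with top coefficient w.
    By [inj] it is outside the previous space, which therefore gains a degree. *)
Lemma chain_step l (e : nat) (L : seq int) : (l < l0)%N -> (e <= N l)%N -> uniq L ->
  (forall n, n \in L -> degs (Hs l (e%:Z - 1)) n) ->
  exists L' : seq int, [/\ uniq L', forall n, n \in L' -> degs (Hs l (e.+1%:Z - 1)) n &
    size L' = (size L + `[< degs (W l) e%:Z >])%N].
Proof.
move=> ll eN uL HL; have eS : e.+1%:Z - 1 = e%:Z by lia.
have mono : Hs l (e%:Z - 1) `<=` Hs l e%:Z.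
  move=> v [Vv [X [X1 X2 ev]]]; split=> //; exists X; split=> //; apply: dle_le _ X2; lia.
rewrite eS; case: asboolP => [[w [Ww w0 dw]]|_]; last first.
  exists L; rewrite addn0; split=> // n /HL [v [Hv v0 dv]]; exists v; split=> //; exact: mono.
have [h Vh [X [X1 Xl eh]]] := new_elt ll Ww.
have nh : ~ Hs l (e%:Z - 1) h.
  move=> [_ [Z [Z1 Z2 eh']]]. have /(@inj l (fun i => X i - Z i) ll) : \sum_(i < l.+1) eta ^+ i * (X i - Z i) ^+ p = 0.
    have e0 := subrr h; rewrite {1}eh eh' -sumrB in e0; rewrite -[RHS]e0. by apply: eq_bigr => i _; rewrite frobB mulrBr.
  move=> /eqP; rewrite subr_eq0 Xl => /eqP wZ. by have := Z2; rewrite -wZ => /(_ w0); rewrite dw; lia.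
have lb n : degs (Hs l (e%:Z - 1)) n -> 0 <= n.
  by move=> [v [[Vv _] v0 dv]]; apply: V0; exists v.
have [d [nd ed]] := cadj_degs dO sC CV CO Cres (Hs_csub l _) lb nh.
have sub : cadj C (Hs l (e%:Z - 1)) h `<=` Hs l e%:Z.
  apply: (cadj_sub (Hs_csub l _) mono); split=> //; exists X; split=> //. by rewrite Xl => _; rewrite dw.
have dsub n : degs (cadj C (Hs l (e%:Z - 1)) h) n -> degs (Hs l e%:Z) n.
  by move=> [v [Hv v0 dv]]; exists v; split=> //; exact: sub.
exists (d :: L); split; last by rewrite addn1.
  by rewrite /= uL andbT; apply/negP => /HL.
by move=> n; rewrite inE => /orP[/eqP->|/HL Hn]; apply: dsub; rewrite ed; [right|left].
Qed.

Lemma chain l (e : nat) : (l < l0)%N -> (e <= (N l).+1)%N -> exists L : seq int,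
  [/\ uniq L, forall n, n \in L -> degs (Hs l (e%:Z - 1)) n &
      size L = (\sum_(i < l) cW i (N i).+1 + cW l e)%N].
Proof.
move: l e; have stp l e (T : nat) : (l < l0)%N -> (e < (N l).+1)%N -> (exists L : seq int,
    [/\ uniq L, forall n, n \in L -> degs (Hs l (e%:Z - 1)) n & size L = (T + cW l e)%N]) ->
  exists L : seq int, [/\ uniq L, forall n, n \in L -> degs (Hs l (e.+1%:Z - 1)) n &
    size L = (T + cW l e.+1)%N].
  move=> ll le [L [uL HL sL]]; have [L' [uL' HL' sL']] := chain_step ll le uL HL.
  exists L'; split=> //; rewrite sL' sL -addnA; congr (_ + _)%N. by rewrite /cW -[e.+1]addn1 iotaD count_cat /= addn0.
elim=> [|l IHl] e ll; elim: e => [|e IHe] le; try by apply: stp => //; apply: IHe; exact: ltnW.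
- by exists [::]; split=> //; rewrite big_ord0.
- have [L [uL HL sL]] := IHl _ (ltnW ll) (leqnn _).
  exists L; split=> //; last by rewrite big_ord_recr /= sL /= addn0.
  move=> n /HL [v [[Vv [X [X1 X2 ev]]] v0 dv]]; exists v; split=> //; split=> //.
  exists (fun i => if i == l.+1 then 0 else X i); split.
  + move=> i il; rewrite ltn_eqF //; have [lt|ge] := ltnP i l; first exact: X1.
    have -> : i = l by lia. by apply: dle_le _ X2; lia.
  + by rewrite eqxx; exact: dle0.
  + rewrite big_ord_recr /= eqxx expr0n gtn_eqF ?p_gt0 // mulr0 addr0 ev.
    by apply: eq_bigr => i _; rewrite ltn_eqF.
Qed.

(** The chain provides at least the sum of the N i + 1 - g distinct degrees of V, all at most D by
    the last hypothesis, whereas V has at most D + 1 - g such degrees. *)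
Lemma level_count (D : nat) : (0 < l0)%N -> (D0 <= D)%N -> eta != 0 ->
  (forall l, (l < l0)%N -> l%:Z * dg eta + p%:Z * (N l)%:Z <= D%:Z) ->
  (\sum_(i < l0) (N i).+1 + g <= D.+1 + l0 * g)%N.
Proof.
case: l0 l0p Nc inj chain => // l l0p' Nc' inj' chain' _ DD eta0 ND.
have [L [uL HL sL]] := chain' _ _ (ltnSn l) (leqnn _).
have := HV DD uL; rewrite sL => /(_ _).
have H1 : (\sum_(i < l.+1) (N i).+1 <= \sum_(i < l.+1) cW i (N i).+1 + l.+1 * g)%N.
  have -> : (l.+1 * g = \sum_(i < l.+1) g)%N by rewrite sum_nat_const card_ord. rewrite -big_split /=.
  by apply: leq_sum => i _; apply: HW; [exact: leq_trans l0p'|exact: Nc'].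
move: H1; rewrite big_ord_recr /= [(\sum_(i < l.+1) cW _ _)%N]big_ord_recr /= => H1 H2.
suff /H2 : forall n, n \in L -> degs V n /\ n <= D%:Z by move: H1; lia.
move=> n /HL [v [[Vv [X [X1 X2 ev]]] v0 dv]]; split; first by exists v.
rewrite -dv; suff : dle D%:Z v by apply.
rewrite ev; apply: (dle_sum dO) => i _.
have Xi : dle (N i)%:Z (X i).
  have [lt|ge] := ltnP i l; first exact: X1. have -> : (i : nat) = l by have := ltn_ord i; lia. by apply: dle_le _ X2; lia.
move=> m0; have x0 : X i != 0.
  by apply: contraNneq m0 => ->; rewrite expr0n gtn_eqF ?mulr0 ?p_gt0.
rewrite dgM ?expf_neq0 // !dgXn //.
have := ND _ (ltn_ord i); have := Xi x0; have := p_gt0.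
by nia.
Qed.
End Levels.

Lemma distinct_sum n (a : nat -> F) :
  (forall i j, (i < j < n)%N -> a i != 0 -> a j != 0 -> dg (a i) <> dg (a j)) ->
  (exists2 i, (i < n)%N & a i != 0) ->
  \sum_(i < n) a i != 0 /\ exists i, [/\ (i < n)%N, a i != 0 & dg (\sum_(i < n) a i) = dg (a i)].
Proof.
elim: n => [|n IH] H [i] // iln ai; rewrite big_ord_recr /=.
have IH' : (exists2 i, (i < n)%N & a i != 0) -> \sum_(i < n) a i != 0 /\
    exists i, [/\ (i < n)%N, a i != 0 & dg (\sum_(i < n) a i) = dg (a i)].
  by apply: IH => i' j' ij; apply: H; lia.
have [an|an] := eqVneq (a n) 0.
  rewrite an addr0; have [|s0 [j [jn aj e]]] := IH'.
    exists i => //; move: iln; rewrite ltnS leq_eqVlt => /orP[/eqP ein|//]. by move: ai; rewrite ein an eqxx.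
  by split=> //; exists j; split=> //; exact: ltnW.
have [s0|s0] := eqVneq (\sum_(i < n) a i) 0.
  by rewrite s0 add0r; split=> //; exists n.
have [|_ [j [jn aj e]]] := IH'.
  apply: contrapT => nex; move/eqP: s0; apply; apply: big1 => k _; apply/eqP.
  by apply: contraT => ak; exfalso; apply: nex; exists (k : nat).
have [|z [e'|e']] := dgD_neq dO s0 an; first by rewrite e; apply: H => //; rewrite jn /=.
  by split=> //; exists j; split; rewrite ?e' //; exact: ltnW.
by split=> //; exists n.
Qed.

(** Pairing l with p - l evaluates the sum of the integer parts of l i / p in [break_bound]. *)
Lemma pdiv_pair (i l : nat) : ~~ (p %| i)%N -> (0 < l < p)%N ->
  ((l * i) %/ p + ((p - l) * i) %/ p = i.-1)%N.
Proof.
move=> npi /andP[l0 lp]; have nl : ~~ (p %| l * i)%N.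
  by rewrite Euclid_dvdM // negb_or npi gtnNdvd.
have e1 := divn_eq (l * i) p; have e2 := divn_eq ((p - l) * i) p.
have r1 : (0 < (l * i) %% p)%N by rewrite lt0n.
have r1' := ltn_pmod (l * i) p_gt0; have r2' := ltn_pmod ((p - l) * i) p_gt0.
have e3 : ((l * i) + (p - l) * i = p * i)%N by rewrite -mulnDl subnKC // ltnW.
have i1 : (0 < i)%N by case: i npi {nl e1 e2 r1 r1' r2' e3} => //; rewrite dvdn0.
set q1 := ((l * i) %/ p)%N in e1 *; set q2 := (((p - l) * i) %/ p)%N in e2 *.
set s1 := ((l * i) %% p)%N in e1 r1 r1'; set s2 := (((p - l) * i) %% p)%N in e2 r2'.
have e4 : ((q1 + q2) * p + (s1 + s2) = i * p)%N by move: e3; rewrite e1 e2; lia.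
have /dvdnP[k ek] : (p %| s1 + s2)%N by rewrite -(dvdn_addr _ (dvdn_mull (q1 + q2) (dvdnn p))) e4 dvdn_mull.
have k0 : (0 < k)%N by case: k ek; lia.
have k2 : (k < 2)%N by rewrite -(ltn_pmul2r p_gt0); lia.
have k1 : k = 1%N by lia.
have : ((q1 + q2).+1 * p = i * p)%N by rewrite -e4 ek k1; lia.
by move/eqP; rewrite eqn_pmul2r ?p_gt0 // => /eqP <-.
Qed.

(** Since i0 - 1 is the order of du at the point, this is the bound 2g - 2 on the zeros of a
    differential, obtained by counting. The integer parts of l i0 / p for l < p sum to
    (p-1)(i0-1)/2, and [level_count] with l0 = p leaves i0 - 1 <= 2g - 2. *)
Lemma break_bound y eta (i0 : nat) : u = y ^+ p + eta -> eta != 0 -> dg eta = - i0%:Z ->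
  ~~ (p %| i0)%N -> (i0 < 2 * g)%N.
Proof.
move=> uy eta0 de npi; have pg := p_gt0.
(* The largest coefficients for which eta^l X^p has pole order at most p c, for every l < p. *)
pose c := maxn c0 D0; pose N l := (c + (l * i0) %/ p)%N.
have inj l (X : nat -> F) : (l < p)%N -> \sum_(i < l.+1) eta ^+ i * X i ^+ p = 0 -> X l = 0.
  move=> lp s0; apply/eqP; apply: contraT => Xl.
  have [||] := @distinct_sum l.+1 (fun i => eta ^+ i * X i ^+ p); last by rewrite s0 eqxx.
    move=> i j /andP[ij jl] ai aj; have [xi xj] : X i != 0 /\ X j != 0.
      by split; [move: ai|move: aj]; apply: contraNneq => ->; rewrite expr0n gtn_eqF ?mulr0.
    rewrite !dgM ?expf_neq0 // !dgXn // de => e. have : (p %| (j - i) * i0)%N.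
      apply/dvdnP; exists (absz (dg (X i) - dg (X j))).
      have : (j - i)%:Z * i0%:Z = (dg (X j) - dg (X i)) * p%:Z by move: e; rewrite -subzn //; lia.
      by move/(congr1 absz); rewrite !abszM distnC.
    by rewrite Euclid_dvdM // (negbTE npi) orbF gtnNdvd //; lia.
  by exists l => //; rewrite mulf_neq0 ?expf_neq0.
have := @level_count y eta N p uy (leqnn _) (fun l _ => leq_trans (leq_maxl _ _) (leq_addr _ _)) inj (p * c)%N pg.
rewrite eta0 => /(_ _ isT); have -> : (D0 <= p * c)%N by rewrite /c; nia.
move=> /(_ isT) /(_ _) H.
have {}H : (\sum_(i < p) (N i).+1 + g <= (p * c).+1 + p * g)%N.
  apply: H => l lp; rewrite /N; have := leq_divM (l * i0) p; nia.
have e1 : (\sum_(i < p) (N i).+1 = p * c.+1 + \sum_(i < p) (i * i0) %/ p)%N.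
  have -> : (p * c.+1 = \sum_(i < p) c.+1)%N by rewrite sum_nat_const card_ord. by rewrite -big_split.
have e2 : (\sum_(i < p) (i * i0) %/ p + \sum_(i < p) (i * i0) %/ p = p.-1 * i0.-1)%N.
  have [q eq] : exists q, p = q.+1 by exists p.-1; lia. have pp := pdiv_pair npi; rewrite eq in pp *.
  rewrite big_ord_recl {2}(reindex_inj rev_ord_inj) -big_split /=.
  rewrite (eq_bigr (fun=> i0.-1)) ?sum_nat_const ?card_ord // => i _. have lq : (0 < i.+1 < q.+1)%N by rewrite /= ltnS.
  rewrite -(pp _ lq); congr (_ + _)%N; rewrite /bump add1n; congr (_ * _ %/ _)%N; have := ltn_ord i; lia.
have i1 : (0 < i0)%N by case: i0 npi {de N inj H e1 e2} => //; rewrite dvdn0.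
have := prime_gt1 pr; nia.
Qed.

(** The p-th powers form a closed set. As eta = u - y^p is no p-th power, 1 and eta are independent
    over p-th powers, and two levels suffice. If eta vanished to order p M, its coefficient could
    reach pole order M without leaving degree p c, which is more than V can hold. *)
Lemma frob_closed : ~ (exists v, u = v ^+ p) ->
  exists I : nat, forall y, dle (- I%:Z) (u - y ^+ p) -> False.
Proof.
move=> nu; have p1 := prime_gt1 pr; pose c := maxn c0 D0; pose M := (p * c + g + c)%N.
exists (p * M)%N => y dy; pose eta := u - y ^+ p; pose N (l : nat) := if l == 0%N then c else M.
have npow v : eta != v ^+ p.
  apply/eqP => ev; apply: nu; exists (y + v); by rewrite frobDp -ev addrC subrK.
have eta0 : eta != 0 by have := npow 0; rewrite expr0n gtn_eqF // p_gt0.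
have inj l (X : nat -> F) : (l < 2)%N -> \sum_(i < l.+1) eta ^+ i * X i ^+ p = 0 -> X l = 0.
  case: l => [|[|//]] _; first by rewrite big_ord1 mul1r => /eqP; rewrite expf_eq0 => /andP[_ /eqP].
  rewrite big_ord_recl big_ord1 /= mul1r expr1 => /eqP s0; apply/eqP; apply: contraT => X1.
  have s0' : X 0%N ^+ p = - (eta * X 1%N ^+ p) by apply/eqP; rewrite -addr_eq0.
  have := npow (- X 0%N / X 1%N); rewrite expr_div_n -[- X _]sub0r frobB expr0n gtn_eqF ?p_gt0 // sub0r.
  by rewrite s0' opprK mulfK ?expf_neq0 // eqxx.
have uy : u = y ^+ p + eta by rewrite addrC subrK.
have := @level_count y eta N 2 uy p1 _ inj (p * c)%N isT.
rewrite eta0 => H.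
have {}H : (\sum_(i < 2) (N i).+1 + g <= (p * c).+1 + 2 * g)%N.
  apply: H => //.
  - by move=> [|l] _; rewrite /N /=; rewrite /M; lia.
  - by rewrite /c; nia.
  - move=> [|[|//]] _; rewrite /N /=; first by lia.
    have := dy eta0; rewrite -/eta; lia.
by move: H; rewrite big_ord_recl big_ord1 /N /=; lia.
Qed.

(** An error of order divisible by p can be improved, since constants are p-th powers, and
    [frob_closed] limits the improvements; they can only stop at an order prime to p. *)
Lemma break_ex : unit_in O u -> ~ (exists v, u = v ^+ p) -> exists y eta (i0 : nat),
  [/\ u = y ^+ p + eta, eta != 0, dg eta = - i0%:Z & ~~ (p %| i0)%N /\ (0 < i0)%N].
Proof.
move=> uu nu; have [I HI] := frob_closed nu; apply: contrapT => nex.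
have [s us] := dvr_unif dO; have s0 : s != 0 by case: us.
have ds (k : nat) : dg (s ^+ k) = - k%:Z by rewrite dgXn // /dg (ordv_unif dO us); lia.
suff [y dy] : exists y, dle (- I.+1%:Z) (u - y ^+ p).
  by apply: (HI y); apply: dle_le _ dy; lia.
elim: I {HI} => [|n [y dy]].
  have [_ Ou _] := uu; have [_ /Cp [c Cc <-] mc] := Cres Ou; exists c.
  by apply/dle_vge; rewrite opprK; exact: (ordv_max dO _).1 mc.
have [e0|e0] := eqVneq (u - y ^+ p) 0; first by case: nu; exists y; apply/eqP; rewrite -subr_eq0 e0.
have [lt|ge] := ltP (dg (u - y ^+ p)) (- n.+1%:Z).
  by exists y => _; lia.
have de : dg (u - y ^+ p) = - n.+1%:Z by have := dy e0; lia.
have [/dvdnP[k ek]|npn] := boolP (p %| n.+1)%N; last first.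
  by case: nex; exists y, (u - y ^+ p), n.+1; split; rewrite // addrC subrK.
have sk0 : s ^+ k ^+ p != 0 by rewrite !expf_neq0.
have [|c [/Cp [b Cb <-] _ dl]] := lead_red dO Cres e0 sk0.
  by rewrite -exprM de ek.
exists (y + b * s ^+ k); rewrite frobDp exprMn opprD addrA.
by apply: dle_le _ dl; rewrite de; lia.
Qed.

Variables (sb : F -> F) (zb : F) (z : nat) (a theta : F).
Hypotheses (sbB : forall x y, sb (x - y) = sb x - sb y) (sbM : forall x y, sb (x * y) = sb x * sb y).
Hypothesis sb_lead : forall h, h != 0 -> max_ideal O (sb h / h - zb ^ dg h).
Hypotheses (Czb : C zb) (zb0 : zb != 0) (zE : z%:R = zb) (Ca : C a).
Hypotheses (uu : unit_in O u) (su : sb u = a * u ^+ z * theta ^+ p).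

(** To first order in eta, the equation of sb u says that sb eta is zb eta up to p-th powers, while
    sb multiplies the leading term of eta by zb^(-i0). If these factors differed, eta times a unit
    would be a p-th power, although p does not divide its order i0. *)
Lemma eigen_break y eta (i0 : nat) : u = y ^+ p + eta -> eta != 0 -> dg eta = - i0%:Z ->
  ~~ (p %| i0)%N -> (0 < i0)%N -> zb ^+ i0.+1 = 1.
Proof.
move=> uy eta0 de npi i1; have lO : is_local O := dO; have [u0 Ou _] := uu.
have [b Cb ab] := Cp Ca; pose x := theta * b; pose Y := y ^+ p.
have sux : sb u = u ^+ z * x ^+ p by rewrite su exprMn ab; ring.
have Ozb := CO Czb.
have Czbi (n : int) : C (zb ^ n).
  by case: n => n; [exact: srX|rewrite NegzE; apply: CV; exact: srX].
have meta : max_ideal O eta by apply/(ordv_max dO) => _; move: de; rewrite /dg; lia.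
have uY : unit_in O Y.
  by rewrite (_ : Y = u - eta); [apply: unitDmax ; mem|rewrite uy addrK].
have [Y0 OY _] := uY.
have ms : max_ideal O (sb u - u).
  have := sb_lead u0; rewrite (dg_unit dO uu) expr0z => m.
  have -> : sb u - u = (sb u / u - 1) * u by rewrite mulrBl divfK ?mul1r. by mem.
have usu : unit_in O (sb u) by apply: (unit_congr lO uu); rewrite -opprB; mem.
have Ox : O x.
  apply: (dvr_integral dO p_gt0); have [_ _ Ouz] := unitX lO z uu.
  have -> : x ^+ p = (u ^+ z)^-1 * sb u by rewrite sux mulKf ?expf_neq0. by mem.
have [r Or ur] : exists2 r, O r & u ^+ z = Y ^+ z + z%:R * Y ^+ z.-1 * eta + eta ^+ 2 * r.
  elim: (z) => [|n [r Or e]]; first by exists 0; [mem|rewrite !expr0; ring]. exists (Y * r + n%:R * Y ^+ n.-1 + eta * r).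
    apply: (srD lO); last mem. apply: (srD lO); first mem. by apply: (srM lO); [apply: (sr_int lO n)|exact: (srX lO)].
  rewrite exprS e {1}uy -/Y -natr1; case: n {e} => [|n]; rewrite ?exprS; ring.
have z1 : (0 < z)%N by case: z zE => // e; move: zb0; rewrite -e eqxx.
have key : sb eta - zb * (x ^+ p * Y ^+ z.-1) * eta =
    (x * y ^+ z - sb y) ^+ p + eta ^+ 2 * (x ^+ p * r).
  have sbX n h : sb (h ^+ n.+1) = sb h ^+ n.+1.
    by elim: n => [|n IH]; rewrite // exprS sbM IH -exprS.
  have pS : p = p.-1.+1 by have := p_gt0; lia. have -> : sb eta = sb u - sb y ^+ p.
    have -> : eta = u - y ^+ p by rewrite uy addrC addKr. by rewrite sbB {1}pS sbX -pS.
  have e1 : (x * y ^+ z) ^+ p = x ^+ p * Y ^+ z by rewrite exprMn -!exprM mulnC. rewrite sux ur frobB e1 zE; ring.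
apply: contrapT => zne.
(* The factor in front of zb eta has value 1, because sb u and u have the same value at the
   point. *)
have mk : max_ideal O (x ^+ p * Y ^+ z.-1 - 1).
  suff m : max_ideal O (Y * (x ^+ p * Y ^+ z.-1 - 1)).
    by apply: (max_unit_mul lO uY); rewrite mulrC.
  have -> : Y * (x ^+ p * Y ^+ z.-1 - 1) = (sb u - u) + eta * (1 - x ^+ p * (z%:R * Y ^+ z.-1 + eta * r)).
    have -> : sb u = (Y ^+ z + z%:R * Y ^+ z.-1 * eta + eta ^+ 2 * r) * x ^+ p by rewrite sux ur.
    have -> : u = Y + eta by []. have -> : Y ^+ z = Y * Y ^+ z.-1 by rewrite -exprS prednK. ring.
  apply: (maxD lO ms); apply: (maxMr lO meta); apply: (srB lO); first mem. apply: (srM lO); first exact: (srX lO).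
  apply: (srD lO); [apply: (srM lO); [mem|exact: (srX lO)]|mem].
pose w := sb eta / eta - zb * (x ^+ p * Y ^+ z.-1).
have uw : unit_in O w.
  have nz : zb ^ (- i0%:Z) - zb != 0.
    apply/eqP => /eqP; rewrite subr_eq0 => /eqP e; apply: zne. by rewrite exprS -{1}e -invr_expz mulVf ?expf_neq0.
  apply: (unit_congr lO (C_unit CV CO (srB sC (Czbi _) Czb) nz)).
  have -> : zb ^ (- i0%:Z) - zb - w = - (sb eta / eta - zb ^ dg eta) + zb * (x ^+ p * Y ^+ z.-1 - 1).
    by rewrite /w de; ring.
  by apply: (maxD lO); [apply: (maxN lO); exact: sb_lead|mem].
have eQ : (x * y ^+ z - sb y) ^+ p = eta * (w - eta * (x ^+ p * r)).
  move: key; set Q := (_ - sb y) ^+ p => key.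
  have -> : Q = Q + eta ^+ 2 * (x ^+ p * r) - eta ^+ 2 * (x ^+ p * r) by rewrite addrK. by rewrite -key /w; field.
have uw' : unit_in O (w - eta * (x ^+ p * r)).
  apply: (unitDmax lO uw); apply: (maxN lO); apply: (maxMr lO meta). by apply: (srM lO) => //; exact: (srX lO).
have [w0 _ _] := uw'; have Q0 : x * y ^+ z - sb y != 0.
  by apply/eqP => q0; have /eqP := eQ; rewrite q0 expr0n gtn_eqF ?p_gt0 // eq_sym mulf_eq0 (negbTE eta0) (negbTE w0).
have := congr1 dg eQ; rewrite dgXn // dgM // (dg_unit dO uw') de addr0 => e.
case/negP: npi; apply/dvdnP; exists (absz (dg (x * y ^+ z - sb y))).
lia.
Qed.
End FrobeniusCount.

(** * Charts of the model and separatedness *)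

Section Surface.
Variables (K F : fieldType) (OK : set K) (iota : {rmorphism K -> F}).
Variables (dimP : nat) (phi : 'I_dimP.+1 -> F).

(** The non-units of OK are the preimage of the maximal ideal of the local ring y, so they are
    closed under addition. *)
Lemma special_OK_local y : subring OK -> special_points OK iota phi y -> is_local OK.
Proof.
move=> sO [[i [_ [P pP ey]]] Hy].
have sC : subring (chart_ring OK iota phi i).
  split.
  - exists 1; last exact: rmorph1.
    by move=> m; rewrite -mpolyC1 mcoeffC; apply: srM => //; [mem|mem].
  - move=> _ _ [u Ou <-] [v Ov <-]; exists (u - v); last exact: rmorphB.
    by move=> m; rewrite mcoeffB; apply: srB.
  - move=> _ _ [u Ou <-] [v Ov <-]; exists (u * v); last exact: rmorphM.
    by move=> m; rewrite mcoeffM; apply: sr_sum => // j _; apply: srM.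
have ly : is_local y by rewrite ey; exact: loc_local.
split=> // a b ma mb; have [Oa _] := ma; have [Ob _] := mb.
apply/Hy; first mem.
by rewrite rmorphD; apply: (maxD ly); apply/Hy.
Qed.

Hypotheses (dO : dvr OK) (nthO : noeth OK).
Hypothesis Hfun : is_function_field OK iota phi.
Let sOK : subring OK := dO.
Let OiF : set F := iota @` OK.
Local Notation C := (chart_ring OK iota phi).
Local Notation Mod := (model OK iota phi).
Local Notation ch := (chart OK iota phi).

Lemma Oi_sub : subring OiF.
Proof.
split; first by exists 1; rewrite ?rmorph1; mem.
- by move=> _ _ [a Oa <-] [b Ob <-]; exists (a - b); rewrite ?rmorphB; mem.
- by move=> _ _ [a Oa <-] [b Ob <-]; exists (a * b); rewrite ?rmorphM; mem.
Qed.
Lemma Oi_noeth : noeth OiF.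
Proof.
move=> a Oa; have [b bP] := choice (fun n => let: ex_intro2 u v w := Oa n in
  ex_intro (fun u => OK u /\ iota u = a n) u (conj v w)).
have [n [c Oc e]] := nthO (fun n => proj1 (bP n)).
exists n, (fun m => iota (c m)); first by move=> m; exists (c m).
rewrite -(proj2 (bP n)) e rmorph_sum; apply: eq_bigr => i _.
by rewrite rmorphM (proj2 (bP i)).
Qed.

Lemma poly_over_ind (Q : {mpoly K[dimP.+1]} -> Prop) :
  (forall c, OK c -> Q c%:MP) -> (forall i, Q 'X_i) ->
  (forall p q, Q p -> Q q -> Q (p + q)) -> (forall p q, Q p -> Q q -> Q (p * q)) ->
  forall p, poly_over OK p -> Q p.
Proof.
move=> QC QX QD QM p Op; rewrite [p]mpolyE.
have Q0 : Q 0 by rewrite -(mpolyC0 dimP.+1); apply: QC; mem.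
have Q1 : Q 1 by rewrite -(mpolyC1 dimP.+1); apply: QC; mem.
apply: (big_ind Q) => [//||m _] //.
rewrite -mul_mpolyC; apply: (QM); first exact/QC/Op.
rewrite mpolyXE_id; apply: (big_ind Q) => [//||j _] //.
by elim: (m j) => [|n IH]; rewrite ?exprS //; apply: QM.
Qed.
Lemma poly_overC c : OK c -> poly_over OK (c%:MP_[dimP.+1]).
Proof. by move=> Oc m; rewrite mcoeffC; apply: srM => //; exact: sr_nat. Qed.
Lemma poly_overXi i : poly_over OK ('X_i : {mpoly K[dimP.+1]}).
Proof. by move=> m; rewrite mcoeffX; exact: sr_nat. Qed.
Lemma poly_overB p q : poly_over OK p -> poly_over OK q -> poly_over OK (p - q : {mpoly K[dimP.+1]}).
Proof. by move=> Op Oq m; rewrite mcoeffB; apply: srB. Qed.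
Lemma poly_overM p q : poly_over OK p -> poly_over OK q -> poly_over OK (p * q : {mpoly K[dimP.+1]}).
Proof.
by move=> Op Oq m; rewrite mcoeffM; apply: sr_sum => // i _; apply: srM.
Qed.

Lemma evalC i c : eval iota phi i c%:MP = iota c.
Proof. exact: mmapC. Qed.
Lemma evalXi i j : eval iota phi i 'X_j = phi j / phi i.
Proof. by rewrite /eval mmapX mmap1U. Qed.
Lemma evalD i p q : eval iota phi i (p + q) = eval iota phi i p + eval iota phi i q.
Proof. exact: rmorphD. Qed.
Lemma evalB i p q : eval iota phi i (p - q) = eval iota phi i p - eval iota phi i q.
Proof. exact: rmorphB. Qed.
Lemma evalM i p q : eval iota phi i (p * q) = eval iota phi i p * eval iota phi i q.
Proof. exact: rmorphM. Qed.

Lemma C_iota i c : OK c -> C i (iota c).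
Proof. by move=> Oc; exists c%:MP; [exact: poly_overC|exact: evalC]. Qed.
Lemma C_coord i j : C i (phi j / phi i).
Proof. by exists 'X_j; [exact: poly_overXi|exact: evalXi]. Qed.
Lemma C_sub i : subring (C i).
Proof.
split; first by rewrite -(rmorph1 iota); apply: C_iota; mem.
- by move=> _ _ [p Op <-] [q Oq <-]; exists (p - q); [exact: poly_overB|exact: evalB].
- by move=> _ _ [p Op <-] [q Oq <-]; exists (p * q); [exact: poly_overM|exact: evalM].
Qed.
Lemma C_min i (B : set F) : subring B -> OiF `<=` B -> (forall j, B (phi j / phi i)) -> C i `<=` B.
Proof.
move=> sB OB fB _ [p Op <-]; elim/poly_over_ind: p / Op => [c Oc|j|p q|p q].
- by rewrite evalC; apply: OB; exists c.
- by rewrite evalXi.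
- by rewrite evalD; mem.
- by rewrite evalM; mem.
Qed.
Definition coords i : seq F := [seq phi j / phi i | j <- enum 'I_dimP.+1].
Lemma C_adj i : C i = foldl (@adj F) OiF (coords i).
Proof.
have [sL nL] := noeth_adjs (coords i) Oi_sub Oi_noeth.
apply/seteqP; split.
  apply: C_min => // [|j]; first exact: foldl_adj_base Oi_sub.
  by apply: foldl_adj_gen Oi_sub _; apply: map_f; rewrite mem_enum.
apply: foldl_adj_min; first exact: C_sub.
  by move=> _ [c Oc <-]; exact: C_iota.
by move=> _ /mapP[j _ ->]; exact: C_coord.
Qed.
Lemma C_noeth i : noeth (C i).
Proof. by rewrite C_adj; case: (noeth_adjs (coords i) Oi_sub Oi_noeth). Qed.

Section Chart.
Variables (i : 'I_dimP.+1) (x : set F).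
Hypothesis cx : ch i x.
Lemma chart_f0 : phi i != 0. Proof. by case: cx. Qed.
Lemma chart_prime : exists2 P, prime_ideal_in (C i) P & x = localization (C i) P.
Proof. by case: cx => _ [P pP e]; exists P. Qed.
Lemma chart_C : C i `<=` x.
Proof. by have [P pP ->] := chart_prime; apply: localizationl => //; exact: C_sub. Qed.
Lemma chart_local : is_local x.
Proof. by have [P pP ->] := chart_prime; apply: loc_local => //; exact: C_sub. Qed.
Lemma chart_noeth : noeth x.
Proof.
have [P pP ->] := chart_prime; apply: noeth_localization => //; first exact: C_sub.
exact: C_noeth.
Qed.
Lemma chart_quot h : x h -> exists a b, [/\ C i a, C i b, unit_in x b & h = a / b].
Proof.
have [P pP ->] := chart_prime => -[a [b [Ca Cb nb b0 ->]]]; exists a, b; split=> //.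
exact: (loc_unit (C_sub i) pP Cb nb).
Qed.
Lemma chart_center : x = localization (C i) [set a | C i a /\ max_ideal x a].
Proof.
have [P pP e] := chart_prime; rewrite e; congr localization.
apply/seteqP; split=> [a Pa|a [Ca]]; last by move/(loc_maxA (C_sub i) pP Ca).
have Ca : C i a by case: pP => + _ _ _ _; apply.
by split=> //; apply/(loc_maxA (C_sub i) pP).
Qed.
Lemma chart_frac h : exists a b, [/\ x a, x b, b != 0 & h = a / b].
Proof.
have [_ H] := Hfun; have [a [b [Ca Cb b0 e]]] := H i chart_f0 h.
by exists a, b; split=> //; apply: chart_C.
Qed.
Lemma chart_iota c : OK c -> x (iota c).
Proof. by move=> /(C_iota i); apply: chart_C. Qed.
End Chart.

Lemma mod_local x : Mod x -> is_local x. Proof. by case=> i /chart_local. Qed.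
Lemma mod_noeth x : Mod x -> noeth x. Proof. by case=> i /chart_noeth. Qed.
Lemma mod_frac x h : Mod x -> exists a b, [/\ x a, x b, b != 0 & h = a / b].
Proof. by case=> i /chart_frac. Qed.
Lemma mod_iota x c : Mod x -> OK c -> x (iota c).
Proof. by case=> i /chart_iota cx /cx. Qed.

(** Separatedness: the ratio phi j / phi i of the coordinates that define the two charts is a unit
    of Z, hence of y by domination, and so y contains the other chart ring. *)
Lemma dom_sub y y' Z : Mod y -> Mod y' -> is_local Z -> dominates Z y -> dominates Z y' ->
  y' `<=` y.
Proof.
move=> [i cy] [j cy'] lZ dy dy'.
have ly := chart_local cy.
have fi := chart_f0 cy; have fj := chart_f0 cy'.
have yu h : y h -> unit_in Z h -> unit_in y h.
  move=> yh uh; have [//|m] := @unit_or_max _ y _ yh. by have [_ []] := dy _ yh => /(_ m) /(unit_not_max uh).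
have uij : unit_in y (phi j / phi i).
  apply: yu; first exact: (chart_C cy (C_coord _ _)). split; first by rewrite mulf_neq0 // invr_eq0.
    by case: (dy _ (chart_C cy (C_coord i j))).
  by rewrite invf_div; case: (dy' _ (chart_C cy' (C_coord j i))).
have Cy : C j `<=` y.
  apply: C_min; first exact: ly.
    by move=> _ [c Oc <-]; exact: chart_iota cy _ Oc.
  move=> l; have -> : phi l / phi j = phi l / phi i * (phi j / phi i)^-1 by field; rewrite fi.
  apply: (srM ly); first exact: (chart_C cy (C_coord _ _)). by case: uij.
move=> h /(chart_quot cy') [a [b [Ca Cb ub ->]]].
apply: (srM ly); first exact: Cy.
suff [] : unit_in y b by [].
apply: yu; first exact: Cy.
have [b0 y'b y'b'] := ub; split=> //; first by case: (dy' _ y'b).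
by case: (dy' _ y'b').
Qed.
Lemma dom_uniq y y' Z : Mod y -> Mod y' -> is_local Z -> dominates Z y -> dominates Z y' ->
  y = y'.
Proof. by move=> My My' lZ d d'; apply/seteqP; split; apply: dom_sub d' d || apply: dom_sub d d'. Qed.

(** A chart contains the generalizations of its points: the localization of [C j] at the centre of x
    is a point dominated by x, hence is x. *)
Lemma gen_chart j x y : ch j y -> Mod x -> y `<=` x -> ch j x.
Proof.
move=> cy Mx yx; have lx := mod_local Mx.
have Cx : C j `<=` x := subset_trans (chart_C cy) yx.
have pP := center_prime (C_sub j) lx Cx; set P := [set a | _] in pP.
have c1 : ch j (localization (C j) P).
  by split; [exact: chart_f0 cy|exists P].
rewrite (_ : x = localization (C j) P) //.
apply: (dom_uniq (Z := x)) => //; first by exists j.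
move=> h Lh; have [a [b [Ca Cb nb b0 e]]] := Lh.
have ub : unit_in x b.
  by have [//|m] := @unit_or_max _ x _ (Cx _ Cb); case: nb.
have [_ _ xb'] := ub.
split; first by rewrite e; apply: (srM lx) => //; exact: Cx.
rewrite e (loc_max (C_sub j) pP Ca Cb nb); split=> [[_ m]|m]; first mem.
split=> //; apply: (max_unit_mul lx (unitV ub)) => //.
Qed.

(** * Points of the generic fibre *)

Hypothesis HS : smooth_dim1 OK iota phi.
Local Notation X := (generic_fiber OK iota phi).
Local Notation Sp := (special_points OK iota phi).
Variable pi : K.
Hypothesis upi : uniformizer OK pi.
Let pi0 : pi != 0. Proof. by case: upi. Qed.
Let mpi : max_ideal OK pi. Proof. exact: unif_max dO upi. Qed.
Let Opi : OK pi. Proof. by case: mpi. Qed.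
Let ipi0 : iota pi != 0. Proof. by rewrite fmorph_eq0. Qed.

Lemma sp_mem y : Mod y -> max_ideal y (iota pi) -> Sp y.
Proof.
move=> My mp; have ly := mod_local My; split=> // c Oc; split=> [[_ nu]|m].
  have [_ /(_ c)[+ _]] := upi => /(_ (conj Oc nu)) Ocp.
  rewrite -[c](divfK pi0) rmorphM; apply: (maxMl ly) => //; exact: mod_iota.
split=> // -[c0 _ Oc']; have := maxMr ly m (mod_iota My Oc').
by rewrite -rmorphM mulfV // rmorph1 => /(not_max1 ly).
Qed.
Lemma sp_pi y : Sp y -> max_ideal y (iota pi).
Proof. by case=> _ H; apply/H. Qed.
Lemma X_mem x : Mod x -> x (iota pi^-1) -> X x.
Proof.
move=> Mx xp; split=> // c; have [->|c0] := eqVneq c 0.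
  by rewrite rmorph0; exact: sr0 (mod_local Mx).
have lx := mod_local Mx.
have := ordvP dO c0 => /(has_orderE dO upi) [_ Oc _].
rewrite -[c](divfK (expfz_neq0 (ordv OK c) pi0)) rmorphM.
apply: (srM lx); first exact: mod_iota.
case: (ordv OK c) => n; first by rewrite rmorphXn; apply: (srX lx); exact: mod_iota.
by rewrite NegzE -exprnN -exprVn rmorphXn; apply: (srX lx).
Qed.

Lemma frac_loc y P : is_local y -> prime_ideal_in y P -> forall j, ch j y -> exists Q,
  [/\ prime_ideal_in (C j) Q & localization y P = localization (C j) Q].
Proof.
move=> ly pP j cy; have Cy := chart_C cy.
exists [set a | C j a /\ P a]; split.
  have [P1 P2 P3 P4 [P5 P6]] := pP; have sC := C_sub j; split.
  - by move=> a [].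
  - by split; mem.
  - by move=> a b [Ca Pa] [Cb Pb]; split; [mem|exact: P3].
  - by move=> a b Ca [Cb Pb]; split; [mem|apply: P4 => //; exact: Cy].
  - split=> [[]//|a b Ca Cb [_ /(P6 _ _ (Cy _ Ca) (Cy _ Cb))]].
    by case; [left|right].
apply/seteqP; split=> [_ [a [b [ya yb nb b0 ->]]]|_ [a [b [Ca Cb nb b0 ->]]]]; last first.
  by exists a, b; split=> //; [exact: Cy|exact: Cy|move=> Pb; apply: nb].
have [a1 [a2 [Ca1 Ca2 ua2 ea]]] := chart_quot cy ya.
have [b1 [b2 [Cb1 Cb2 ub2 eb]]] := chart_quot cy yb.
have [a20 _ ya2] := ua2; have [b20 _ yb2] := ub2.
have iP := prime_ideal pP.
have nu u : unit_in y u -> ~ P u.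
  case=> u0 yu yu' Pu; have := idM iP yu' Pu; rewrite mulVf //. by case: pP => _ _ _ _ [].
have b10 : b1 != 0 by apply: contraNneq b0 => b10; rewrite eb b10 mul0r.
exists (a1 * b2), (a2 * b1); split.
- exact: (srM (C_sub j)).
- exact: (srM (C_sub j)).
- case=> _; have [_ _ _ _ [_ H]] := pP => /(H _ _ (Cy _ Ca2) (Cy _ Cb1)) [/(nu _ ua2)//|Pb1].
  by apply: nb; rewrite eb mulrC; apply: (idM iP).
- by rewrite mulf_neq0.
- by rewrite ea eb; field; rewrite a20 b10.
Qed.

(** A prime of the chart ring maximal among the ideals without power of pi gives a point x1 closed
    in the generic part of the chart. If x1 is not closed in X, a smaller point leaves this chart
    and enters no new one, so induction on the number of charts applies. *)
Lemma closed_below x : X x -> exists2 x0, closed_point X x0 & x0 `<=` x.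
Proof.
pose S (x : set F) := [pred i : 'I_dimP.+1 | `[<ch i x>]].
move=> Xx; have [n le] := ubnP #|S x|; elim: n x Xx le => // n IH x Xx le.
have [Mx xK] := Xx; have [i cx] := Mx; have lx := mod_local Mx.
have Cx := chart_C cx.
have pP := center_prime (C_sub i) lx Cx; set P := [set a | _] in pP.
have nP k : ~ P (iota pi ^+ k).
  case=> _ m; have := maxMr lx m (srX lx k (xK pi^-1)).
  by rewrite -exprMn -rmorphM mulfV // rmorph1 expr1n => /(not_max1 lx).
have [Q [pQ PQ nQ maxQ]] := prime_avoid (C_sub i) (@C_noeth i) (prime_ideal pP)
   (C_iota i Opi) nP.
pose x1 := localization (C i) Q.
have cx1 : ch i x1 by split; [exact: chart_f0 cx|exists Q].
have Mx1 : Mod x1 by exists i.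
have Xx1 : X x1.
  apply: X_mem => //; rewrite fmorphV. by have [] := loc_unit (C_sub i) pQ (C_iota i Opi) nQ.
have x1x : x1 `<=` x.
  move=> _ [a [b [Ca Cb nb b0 ->]]]; apply: (srM lx); first exact: Cx. have [[]//|m] := @unit_or_max _ x _ (Cx _ Cb).
  by case: nb; apply: PQ.
have [cl|ncl] := EM (closed_point X x1); first by exists x1.
have [x2 [Xx2 x21 ne]] : exists x2, [/\ X x2, x2 `<=` x1 & x2 <> x1].
  apply: contrapT => H; apply: ncl; split=> // y Xy yx; apply: contrapT => ne. by apply: H; exists y.
have nS2 : i \notin S x2.
  rewrite inE; apply/negP => /asboolP cx2; apply: ne. have [Mx2 x2K] := Xx2; have lx2 := mod_local Mx2.
  have pP2 := center_prime (C_sub i) lx2 (chart_C cx2); set P2 := [set a | _] in pP2.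
  rewrite (chart_center cx2); congr localization; rewrite -/P2. have QP2 : Q `<=` P2.
    move=> a Qa; have Ca : C i a by case: pQ => + _ _ _ _; apply.
    split=> //; have [u|//] := @unit_or_max _ x2 _ (chart_C cx2 Ca).
    have [a0 _ x2a] := u; have := x21 _ x2a => -[c [d [Cc Cd nd d0 e]]].
    case: nd; have -> : d = c * a by rewrite -[c](divfK d0) -e mulrAC mulVf ?mul1r. exact: (idM (prime_ideal pQ)).
  apply/seteqP; split => //. apply: maxQ => //; first exact: prime_ideal pP2.
  move=> k [_ m]; have := maxMr lx2 m (srX lx2 k (x2K pi^-1)).
  by rewrite -exprMn -rmorphM mulfV // rmorph1 expr1n => /(not_max1 lx2).
have S2 : S x2 \subset S x.
  apply/fintype.subsetP => j jS; have cj : ch j x2 by apply: asboolW; exact: jS.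
have cj' : ch j x.
    by apply: (gen_chart cj Mx); exact: subset_trans x21 x1x.
exact: asboolT cj'.
have lt : (#|S x2| < n)%N.
  rewrite ltnS in le; apply: leq_trans le; apply: proper_card. apply/fintype.properP; split=> //.
  by exists i => //; apply: asboolT cx.
have [x0 cl0 x02] := IH x2 Xx2 lt.
by exists x0 => //; apply: subset_trans x02 (subset_trans x21 x1x).
Qed.

(** * Regularity at closed points of the special fibre *)

Variable p : nat.
Hypotheses (pr : prime p) (pm : max_ideal OK p%:R).
Hypothesis Hq1 : exists e : nat, (0 < e)%N /\
  forall c, OK c -> max_ideal OK (c ^+ (p ^ e) - c).
Local Notation ev := (eval iota phi).

Lemma max_OK_pi c : max_ideal OK c -> exists2 b, OK b & c = pi * b.
Proof.
by have [_ H] := upi => /H Ob; exists (c / pi) => //; rewrite mulrC divfK.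
Qed.

Lemma sp_mod y : Sp y -> Mod y. Proof. by case. Qed.
Lemma sp_local y : Sp y -> is_local y. Proof. by case=> /mod_local. Qed.

Definition closed_sp y := Sp y /\ forall y', Sp y' -> y' `<=` y -> y' = y.

(** The chart ring modulo the centre of y is already a field: a prime containing the centre and b
    would give a smaller special point. *)
Lemma closed_sp_max y i : closed_sp y -> ch i y -> forall b, C i b -> unit_in y b ->
  exists2 c, C i c & max_ideal y (b * c - 1).
Proof.
move=> [Sy cl] cy b Cb ub; have ly := sp_local Sy; have sC := C_sub i.
have Cy := chart_C cy; have pP := center_prime sC ly Cy; set P := [set a | _] in pP.
apply: contrapT => H.
have iP := ideal_gen sC (prime_ideal pP) Cb.
have n1 n : ~ idgen (C i) P b (1 ^+ n).
  rewrite expr1n => -[a [c [Pa Cc e1]]]; apply: H; exists c => //. have -> : b * c - 1 = - a by rewrite e1; ring.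
  by apply: (maxN ly); case: Pa.
have [Q [pQ PQ _ _]] := prime_avoid sC (@C_noeth i) iP (sr1 sC) n1.
have cy1 : ch i (localization (C i) Q) by split; [exact: chart_f0 cy|exists Q].
have QP a : Q a -> C i a by case: pQ => + _ _ _ _; apply.
have Qb : Q b by apply: PQ; exact: idgenr _ sC (prime_ideal pP).
have y1y : localization (C i) Q `<=` y.
  move=> _ [a [c [Ca Cc nc c0 ->]]]; apply: (srM ly); first exact: Cy. have [[]//|m] := @unit_or_max _ y _ (Cy _ Cc).
  by case: nc; apply: PQ; apply: (idgenl _ sC).
have Sy1 : Sp (localization (C i) Q).
  apply: (sp_mem); first by exists i. apply/(loc_maxA sC pQ); first exact: C_iota.
  apply: PQ; apply: (idgenl _ sC); split; first exact: C_iota. exact: (sp_pi Sy).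
have e1 := cl _ Sy1 y1y.
have := unit_not_max ub; rewrite -e1; apply; exact/(loc_maxA sC pQ).
Qed.

Section ResidueMap.
Variables (O : set F) (k : fieldType) (ry : F -> k).
Hypotheses (Hr : is_residue_field O ry) (sO : subring O).
Lemma rf_additive : [/\ ry 0 = 0, ry 1 = 1, forall a b, O a -> O b -> ry (a + b) = ry a + ry b,
  forall a, O a -> ry (- a) = - ry a & forall a b, O a -> O b -> ry (a * b) = ry a * ry b].
Proof.
have [[r1 rB rM] _ _] := Hr.
have r0 : ry 0 = 0 by rewrite -(subrr 1) rB ?subrr; mem.
have rN a : O a -> ry (- a) = - ry a by move=> Oa; rewrite -sub0r rB ?r0 ?sub0r; mem.
split=> // a b Oa Ob; rewrite -[b in LHS]opprK rB ?rN ?opprK; mem.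
Qed.
Lemma rf_exp a n : O a -> ry (a ^+ n) = ry a ^+ n.
Proof.
have [_ r1 _ _ rM] := rf_additive.
by move=> Oa; elim: n => [|n IH]; rewrite // !exprS rM ?IH //; exact: srX.
Qed.
Lemma rf_eq a b : O a -> O b -> ry a = ry b <-> max_ideal O (a - b).
Proof.
move=> Oa Ob; have [[_ rB _] _ rm] := Hr.
rewrite -(rm _ (srB sO Oa Ob)) rB //; split=> [->|/eqP]; first exact: subrr.
by rewrite subr_eq0 => /eqP.
Qed.
Lemma rf_sum (I : Type) (s : seq I) (P : pred I) (G : I -> F) : (forall i, P i -> O (G i)) ->
  ry (\sum_(i <- s | P i) G i) = \sum_(i <- s | P i) ry (G i).
Proof.
move=> OG; have [r0 _ rD _ _] := rf_additive.
suff [] : O (\sum_(i <- s | P i) G i) /\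
    ry (\sum_(i <- s | P i) G i) = \sum_(i <- s | P i) ry (G i) by [].
elim/big_rec2: _ => [|i u v Pi [Ov <-]]; first by split; mem.
by split; [apply: srD|rewrite rD] => //; exact: OG.
Qed.
Lemma rf_image (B : set F) : subring B -> B `<=` O -> subring (ry @` B).
Proof.
move=> sB BO; have [_ r1 rD rN rM] := rf_additive; split; first by exists 1; mem.
- move=> _ _ [a Ba <-] [b Bb <-]; exists (a - b); first mem.
  by rewrite rD ?rN //; try exact: BO; apply: (srN sO); exact: BO.
- move=> _ _ [a Ba <-] [b Bb <-]; exists (a * b); first mem.
  by rewrite rM //; exact: BO.
Qed.
(** Generators of a chart ring generate its image in a residue field. *)
Lemma residue_adj (S : set k) i : ch i O -> subring S -> (forall a, OK a -> S (ry (iota a))) ->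
  subring (foldl (@adj k) S (map ry (coords i))) /\
  forall a, C i a -> foldl (@adj k) S (map ry (coords i)) (ry a).
Proof.
move=> cO sS Si; have [_ r1 rD rN rM] := rf_additive; set cs := map _ _.
have sL : subring (foldl (@adj k) S cs).
  by elim: cs (S) sS => //= c l IH R' sR'; apply: IH; exact: adj_subring.
split=> // a Ca; suff [] : O a /\ foldl (@adj k) S cs (ry a) by [].
move: a Ca; apply: C_min.
- split; first by split; [mem|rewrite r1; mem].
    move=> a b [ya La] [yb Lb]; split; first mem. by rewrite rD ?rN //; [mem|mem].
  by move=> a b [ya La] [yb Lb]; split; [mem|rewrite rM //; mem].
- move=> _ [c Oc <-]; split; first exact: chart_C cO _ (C_iota i Oc).
  by apply: foldl_adj_base => //; exact: Si.
- move=> j; split; first exact: chart_C cO _ (C_coord i j).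
  by apply: foldl_adj_gen => //; apply: map_f; apply: map_f; rewrite mem_enum.
Qed.
End ResidueMap.

(** By Zariski's lemma the residue field at y is algebraic over that of OK, which is finite; hence
    one power of Frobenius fixes the residues of OK and of the finitely many coordinates. *)
Lemma closed_sp_frob y i : closed_sp y -> ch i y -> exists2 n : nat, (0 < n)%N &
  (forall c, OK c -> max_ideal OK (c ^+ (p ^ n) - c)) /\
  forall j, max_ideal y ((phi j / phi i) ^+ (p ^ n) - phi j / phi i).
Proof.
move=> cly cy; have [Sy _] := cly; have ly := sp_local Sy; have sC := C_sub i.
have My := sp_mod Sy; have sO : subring OK := dO.
have Cy := chart_C cy.
have [k [ry Hr]] := residue_field_ex ly.
have [r0 r1 rD rN rM] := rf_additive Hr ly; have rX := rf_exp Hr ly.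
have [_ rs rm] := Hr.
pose R := ry @` (iota @` OK).
have sR : subring R by apply: (rf_image Hr ly Oi_sub) => _ [a Oa <-]; exact: (mod_iota My).
have RV z : R z -> R z^-1.
  move=> [_ [a Oa <-] <-]; have [[a0 _ Oa']|m] := @unit_or_max _ OK _ Oa; last first.
    have -> : ry (iota a) = 0.
      by apply/rm; [exact: (mod_iota My)|case: Sy => _ <-].
    by rewrite invr0; mem.
  exists (iota a^-1) => //. apply: (mulfI (x := ry (iota a))).
    apply/eqP => /(proj1 (rm _ (mod_iota My Oa))). by case: Sy => _ /(_ _ Oa) <- [_]; case; split.
  rewrite -rM; [|exact: (mod_iota My)..]. rewrite -rmorphM mulfV // rmorph1 mulfV //.
  apply/eqP => /(proj1 (rm _ (mod_iota My Oa))). by case: Sy => _ /(_ _ Oa) <- [_]; case; split.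
pose cs := map ry (coords i).
have full z : foldl (@adj k) R cs z.
  have [|sL LC] := residue_adj Hr ly cy sR; first by move=> a Oa; exists (iota a) => //; exists a.
  have [h yh <-] : exists2 h, y h & ry h = z by have : setT z by []; rewrite -rs => -[h]; exists h.
  have [a [b [Ca Cb ub ->]]] := chart_quot cy yh. have [c Cc mc] := closed_sp_max cly cy Cb ub. have [b0 yb yb'] := ub.
  have -> : ry (a / b) = ry (a * c).
    apply/(rf_eq Hr ly); [by apply: (srM ly) => //; exact: Cy|by apply: (srM ly); exact: Cy|].
    have -> : a / b - a * c = - (a / b * (b * c - 1)) by field.
    by apply: (maxN ly); apply: (maxMl ly) => //; apply: (srM ly) => //; exact: Cy.
  by apply: LC; mem.
have int := zariski sR RV full.
have [e [e0 He]] := Hq1.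
have pk : p%:R = 0 :> k.
  have -> : p%:R = ry (iota p%:R) :> k.
    rewrite rmorph_nat; elim: (p) => [|n IH] //. by rewrite -natr1 IH -natr1 rD ?r1 //; [mem|mem].
  by apply/rm; [apply: (mod_iota My); case: pm|case: Sy => _ <-; case: pm].
have fR c : R c -> c ^+ (p ^ e) = c.
  move=> [_ [a Oa <-] <-]; rewrite -rX; last exact: (mod_iota My). rewrite -rmorphXn; apply/(rf_eq Hr ly);
    [by apply: (mod_iota My); exact: srX|exact: (mod_iota My)|].
  have Oe : OK (a ^+ (p ^ e) - a) by apply: srB => //; exact: srX. by rewrite -rmorphB; case: Sy => _ <- //; exact: He.
have [n nP] : exists n : 'I_dimP.+1 -> nat, forall j, (0 < n j)%N /\
    ry (phi j / phi i) ^+ (p ^ (e * n j)) = ry (phi j / phi i).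
  have H j : exists n : nat, (0 < n)%N /\ ry (phi j / phi i) ^+ (p ^ (e * n)) = ry (phi j / phi i).
    have [n n0 en] := frob_period pr pk (int (ry (phi j / phi i))) fR. by exists n.
  by have [n nP] := choice H; exists n.
pose N := (\prod_j n j)%N.
exists (e * N)%N; first by rewrite muln_gt0 e0 prodn_gt0 // => j; case: (nP j).
split=> [c Oc|j].
  elim: N => [|N IH]; first by rewrite muln0 subrr; mem. have -> : c ^+ (p ^ (e * N.+1)) - c =
     ((c ^+ (p ^ (e * N))) ^+ (p ^ e) - c ^+ (p ^ (e * N))) + (c ^+ (p ^ (e * N)) - c).
    by rewrite -exprM -expnD mulnS addnC subrKA.
  by apply: (maxD dO) => //; apply: He; exact: srX.
have yc := Cy _ (C_coord i j).
apply/rm; first by apply: (srB ly) => //; exact: (srX ly).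
rewrite rD ?rN ?rX //; [|exact: (srX ly)|mem].
by rewrite /N (bigD1 j) //= mulnA frob_iter ?subrr; case: (nP j).
Qed.

(** Modulo pi, the q-th power of H is H evaluated at the q-th powers of the coordinates. The
    coordinates differ from these by elements of the maximal ideal, so this is Taylor's formula to
    first order. The q-th powers play the part of the coordinates of the point, which need not lift
    to K. *)
Lemma taylor_frob y i (q : nat) (J : set F) : Sp y -> ch i y -> ideal y J ->
  (exists n, q = (p ^ n)%N) ->
  (forall c, OK c -> max_ideal OK (c ^+ q - c)) ->
  (forall j, max_ideal y ((phi j / phi i) ^+ q - phi j / phi i)) ->
  J (iota pi) -> (forall a b, max_ideal y a -> max_ideal y b -> J (a * b)) ->
  forall H, poly_over OK H ->
  J (ev i H - ev i H ^+ q - \sum_j ev i H^`M(j) * (phi j / phi i - (phi j / phi i) ^+ q)).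
Proof.
move=> Sy cy iJ [n eq] Oq Fq Jpi JJ H OH.
have ly := sp_local Sy; have My := sp_mod Sy; have Cy := chart_C cy.
pose de j := phi j / phi i - (phi j / phi i) ^+ q.
have mde j : max_ideal y (de j) by rewrite /de -opprB; apply: (maxN ly).
pose u (H : {mpoly K[dimP.+1]}) := \sum_j ev i H^`M(j) * de j.
pose Q (H : {mpoly K[dimP.+1]}) := [/\ y (ev i H), (forall j, y (ev i H^`M(j))) &
   J (ev i H - ev i H ^+ q - u H)].
have mu H0 : (forall j, y (ev i H0^`M(j))) -> max_ideal y (u H0).
  by move=> yd; apply: (max_sum ly) => j _; apply: (maxMl ly).
suff : Q H by case.
have yev G : poly_over OK G -> y (ev i G) by move=> OG; apply: Cy; exists G.
have JOK c : max_ideal OK c -> J (iota c).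
  move=> /max_OK_pi [b Ob ->]; rewrite rmorphM mulrC; apply: (idM iJ) => //. exact: (mod_iota My).
have JB a b : J a -> J b -> J (a - b).
  move=> Ja Jb; rewrite -mulN1r; apply: (idD iJ) => //; apply: (idM iJ) => //. by mem.
move: H OH; apply: (poly_over_ind).
- move=> c Oc; have e0 j : (c%:MP_[dimP.+1])^`M(j) = 0 by exact: mderivC.
  have ec : ev i c%:MP = iota c by exact: evalC. split; first by rewrite ec; exact: (mod_iota My).
    by move=> j; rewrite e0 /eval rmorph0; mem.
  rewrite /u big1 ?subr0 => [|j _]; last by rewrite e0 /eval rmorph0 mul0r.
  rewrite ec -rmorphXn -rmorphB; apply: JOK; rewrite -opprB; apply: (maxN dO); exact: Oq.
- move=> j; have e0 l : ev i ('X_j)^`M(l) = (l == j)%:R.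
    rewrite mderivX mnm1E eq_sym; case: eqP => [->|_]; last by rewrite scale0r /eval rmorph0.
    by rewrite scale1r (_ : (_ - _)%MM = 0%MM) ?mpolyX0 /eval ?rmorph1 //; apply/mnmP => t; rewrite mnmBE mnm0E subnn.
  have ec : ev i 'X_j = phi j / phi i by exact: evalXi. split; first by rewrite ec; exact: Cy (C_coord i j).
    by move=> l; rewrite e0; mem.
  rewrite /u (bigD1 j) //= big1 => [|l /negbTE lj]; last by rewrite e0 lj mul0r.
  by rewrite ec e0 eqxx mul1r addr0 subrr; exact: id0 iJ.
- move=> G H [yG dG JG] [yH dH JH].
  have eD j : ev i (G + H)^`M(j) = ev i G^`M(j) + ev i H^`M(j) by rewrite mderivD evalD. split; first by rewrite evalD; mem.
    by move=> j; rewrite eD; mem.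
  have -> : u (G + H) = u G + u H.
    by rewrite -big_split; apply: eq_bigr => j _; rewrite eD mulrDl.
  rewrite evalD. have Jp : J p%:R by rewrite -(rmorph_nat iota); exact: JOK.
  have := frobD n ly iJ pr Jp yG yH; rewrite -eq => JF. set a := ev i G in JG JF *; set b := ev i H in JH JF *.
  have -> : a + b - (a + b) ^+ q - (u G + u H) = (a - a ^+ q - u G) + (b - b ^+ q - u H)
     - ((a + b) ^+ q - a ^+ q - b ^+ q) by ring.
  by apply: JB => //; apply: (idD iJ).
- move=> G H [yG dG JG] [yH dH JH].
  have eM j : ev i (G * H)^`M(j) = ev i G^`M(j) * ev i H + ev i G * ev i H^`M(j).
    by rewrite mderivM evalD !evalM.
  split; first by rewrite evalM; mem.
    by move=> j; rewrite eM; apply: (srD ly); mem.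
  have -> : u (G * H) = u G * ev i H + ev i G * u H.
    rewrite mulr_suml mulr_sumr -big_split; apply: eq_bigr => j _; rewrite eM /=; ring.
  rewrite evalM exprMn; set a := ev i G in yG JG *; set b := ev i H in yH JH *.
  set ga := a - a ^+ q - u G in JG; set gb := b - b ^+ q - u H in JH. have yu : y (u G) by case: (mu G dG).
  have -> : a * b - a ^+ q * b ^+ q - (u G * b + a * u H) =
     b ^+ q * ga + a * gb - u G * gb - u G * u H.
    by rewrite /ga /gb; ring.
  apply: (JB); last by apply: JJ; exact: mu. apply: (JB); last exact: (idM iJ).
  by apply: (idD iJ); apply: (idM iJ) => //; exact: (srX ly).
Qed.

(** With pi, de j0 and the square of the maximal ideal in J, [taylor_frob] turns each equation G k
    into a linear relation among the de j modulo J. The invertible Jacobian minor puts all the other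
    de j into J, the formula applied to any function of the maximal ideal puts it into J, and
    Nakayama concludes. *)
Lemma closed_sp_param y : closed_sp y -> exists2 de, max_ideal y de &
  forall h, max_ideal y h -> exists a b, [/\ y a, y b & h = iota pi * a + de * b].
Proof.
move=> cly; have [Sy _] := cly; have ly := sp_local Sy; have My := sp_mod Sy.
have [i cy] := My; have Cy := chart_C cy.
have [n n0 [Oq Fq]] := closed_sp_frob cly cy; set q := (p ^ n)%N in Oq Fq.
pose de j := phi j / phi i - (phi j / phi i) ^+ q.
have mde j : max_ideal y (de j) by rewrite /de -opprB; apply: (maxN ly).
have [G [IG _ [j0 ud]]] := HS cy.
exists (de j0) => //.
pose N0 := [set h | exists a b, [/\ y a, y b & h = iota pi * a + de j0 * b]].
have ypi : max_ideal y (iota pi) by exact: (sp_pi Sy).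
have iN : ideal y (max_ideal y).
  by split; [move=> ? []|mem|mem|move=> *; exact: (maxMl ly)].
have iN0 : ideal y N0.
  split.
  - move=> _ [a [b [ya yb ->]]]; apply: (srD ly); apply: (srM ly) => //.
      by case: ypi.
    by case: (mde j0).
  - by exists 0, 0; split; rewrite ?mulr0 ?addr0; mem.
  - move=> _ _ [a [b [ya yb ->]]] [a' [b' [ya' yb' ->]]]; exists (a + a'), (b + b').
    by split; [mem|mem|ring].
  - move=> c _ yc [a [b [ya yb ->]]]; exists (c * a), (c * b).
    by split; [mem|mem|ring].
apply: (nakayama ly (mod_noeth My) iN iN0).
  by move=> _ [a [b [ya yb ->]]]; apply: (maxD ly); mem.
move=> J iJ N0J JJ.
have Jpi : J (iota pi).
  by apply: N0J; exists 1, 0; split; [mem|mem|ring].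
have Jd0 : J (de j0).
  by apply: N0J; exists 0, 1; split; [mem|mem|ring].
have T := taylor_frob Sy cy iJ (ex_intro _ n erefl) Oq Fq Jpi JJ.
have yd k j : y (ev i (G k)^`M(j)).
  have [OG _] := IG k; apply: Cy; exists (G k)^`M(j) => //. move=> m; rewrite mcoeff_deriv; apply: srMn; first exact: dO.
  exact: OG.
have JN a : J a -> J (- a).
  by move=> Ja; rewrite -mulN1r; apply: (idM iJ) => //; apply: (srN ly); mem.
have Jsum (m : nat) (a : 'I_m -> F) : (forall k, J (a k)) -> J (\sum_k a k).
  by move=> Ja; apply: (id_sum iJ).
set M := \matrix_(k < dimP, l < dimP) _ in ud.
have JM k : J (\sum_l M k l * de (lift j0 l)).
  have [OG eG] := IG k; have := T _ OG; rewrite eG expr0n. have -> : (q == 0)%N = false.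
    by apply/eqP => /eqP; rewrite expn_eq0; move: (prime_gt0 pr); case: (p).
  rewrite !sub0r oppr0 add0r => /JN; rewrite opprK (bigD1_ord j0) //= => JT.
  rewrite (eq_bigr (fun l => ev i (G k)^`M(lift j0 l) * de (lift j0 l))); last first.
    by move=> l _; rewrite mxE.
  rewrite -[X in J X](addKr (ev i (G k)^`M(j0) * de j0)). apply: (idD iJ) => //; apply: JN; exact: (idM iJ).
have Jde l : J (de (lift j0 l)).
  have yadj k : y ((\adj M) l k).
    rewrite mxE; apply: (srM ly); first by apply: (srX ly); apply: (srN ly); mem.
    rewrite /determinant; apply: (sr_sum ly) => s _; apply: (srM ly).
      by apply: (srX ly); apply: (srN ly); mem.
    by apply: (sr_prod ly) => a _; rewrite !mxE.
  have : J (\sum_k (\adj M) l k * (\sum_j M k j * de (lift j0 j))).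
    by apply: Jsum => k; exact: (idM iJ).
  have -> : \sum_k (\adj M) l k * (\sum_j M k j * de (lift j0 j)) = \det M * de (lift j0 l).
    under eq_bigr do rewrite mulr_sumr. rewrite exchange_big /= (eq_bigr (fun j => (\adj M *m M) l j * de (lift j0 j))).
      rewrite mul_adj_mx (bigD1 l) //= big1 => [|j /negbTE jl]; first by rewrite mxE eqxx addr0.
      by rewrite mxE eq_sym jl mul0r.
    by move=> j _; rewrite mxE mulr_suml; apply: eq_bigr => k _; rewrite mulrA.
  case: ud => d0 _ yd' /(idM iJ yd'); rewrite mulrA mulVf ?mul1r //.
have Jall j : J (de j) by case: (unliftP j0 j) => [l ->|->].
move=> h [yh nh]; have [a [b [Ca Cb ub e]]] := chart_quot cy yh.
have [b0 yb yb'] := ub; rewrite e mulrC; apply: (idM iJ) => //.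
have ma : max_ideal y a.
  have -> : a = h * b by rewrite e divfK. by mem.
have [H OH eH] := Ca; have := T _ OH; rewrite eH => JT.
have Js : J (\sum_j ev i H^`M(j) * de j).
  apply: Jsum => j; apply: (idM iJ) => //; apply: Cy; exists H^`M(j) => // m.
  by rewrite mcoeff_deriv; apply: srMn; [exact: dO|mem].
have Jq : J (a ^+ q).
  have : (1 < q)%N by rewrite -(exp1n n) ltn_exp2r // prime_gt1.
  case: (q) => [|[|q']] // _; rewrite exprS; apply: (JJ) => //. rewrite exprS; apply: (maxMr ly) => //; apply: (srX ly); mem.
rewrite -[a](subrK (a ^+ q)); apply: (idD iJ) => //.
by rewrite -[a - _](subrK (\sum_j ev i H^`M(j) * de j)); apply: (idD iJ).
Qed.

(** * The special fibre as a curve, and normality of the model *)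

Variable eta : set F.
Hypothesis Heta : is_special_generic_point OK iota phi eta.

Let Seta : Sp eta. Proof. by case: Heta. Qed.
Let leta : is_local eta. Proof. exact: sp_local Seta. Qed.
Let Meta : Mod eta. Proof. exact: sp_mod Seta. Qed.
Let mepi : max_ideal eta (iota pi). Proof. exact: (sp_pi Seta). Qed.
Variables (FY : fieldType) (rho : F -> FY).
Hypothesis Hrho : is_residue_field eta rho.
Local Notation Y := (special_fiber OK iota phi rho).
Local Notation csp := closed_sp.
Lemma sp_eta y : Sp y -> y `<=` eta. Proof. by case: Heta => _; apply. Qed.
Variables (oo R : set F).
Hypothesis Hoo : is_section OK iota phi oo R.
Variables (g : nat) (mu : 'I_g -> nat).
Hypothesis gapX : gap_sequence X (@zero_divisor F) oo = range mu.
Hypothesis gapY : gap_sequence Y (@zero_divisor FY) (rho @` R) = range mu.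

Lemma Xunif x : closed_point X x -> exists t, uniformizer x t.
Proof. exact: gap_unif gapX x. Qed.

(** Otherwise the only point of the special fibre would be its whole function field, which has no
    uniformizer. *)
Lemma eta_nc : ~ csp eta.
Proof.
move=> [_ cl]; have [_ rs _] := Hrho.
have Yu z : Y z -> z = setT.
  move=> [y Sy ->]; rewrite (cl y Sy) //; exact: (sp_eta Sy).
have cT : closed_point Y (rho @` eta).
  by split=> [|z Yz _]; [exists eta|rewrite (Yu z Yz)].
have [t [t0 ut]] := gap_unif gapY cT; move: ut; rewrite rs => ut.
by have [_] := (ut 1).2 I; case; split; rewrite ?oner_eq0.
Qed.

Let RS : Sp R. Proof. by case: Hoo. Qed.
Let lR : is_local R. Proof. exact: (sp_local RS). Qed.
Let MR := sp_mod RS.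
Let Rx : R `<=` oo. Proof. by case: Hoo. Qed.
Let Xoo : X oo. Proof. by case: Hoo. Qed.
Let lX : is_local oo. Proof. by case: Xoo => M _; exact: (mod_local M). Qed.
Lemma R_iota c : OK c -> R (iota c). Proof. exact: (mod_iota MR). Qed.

(** If h were a unit of R but not of a smaller special point y, its value c along the section would
    be a unit of OK, and h - c a unit of y vanishing at oo. *)
Lemma R_csp : csp R.
Proof.
have [_ _ _ Hres Hev] := Hoo.
split=> // y Sy yR; have ly := sp_local Sy; have My := sp_mod Sy.
apply: (dom_uniq My MR lR) => //.
move=> h yh; have Rh := yR _ yh; split=> //; split=> [mh|[_ nu]]; last first.
  split=> // -[h0 _ yh']; apply: nu; split=> //; exact: yR.
have [//|uh] := pselect (max_ideal R h).
have {}uh : unit_in R h by have [] := @unit_or_max _ R _ Rh.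
have [c mc] := Hres h (Rx Rh); have [Oc uc] := Hev h c Rh mc.
have [c0 _ Oc'] := uc.1 uh.
have yc : y (iota c) by exact: (mod_iota My Oc).
have uc' : unit_in y (iota c).
  by split; [rewrite fmorph_eq0|by []|rewrite -fmorphV; exact: (mod_iota My Oc')].
have u1 : unit_in y (h - iota c).
  rewrite -opprB; apply: (unitN ly); apply: (unitDmax ly) ; mem.
have [z0 yz yz'] := u1; exfalso; apply: (not_max1 lX).
by rewrite -(mulfV z0); apply: (maxMr lX) => //; apply: Rx; exact: yR.
Qed.

Lemma param_not_eta y de : closed_sp y -> max_ideal y de ->
  (forall h, max_ideal y h -> exists a b, [/\ y a, y b & h = iota pi * a + de * b]) ->
  ~ max_ideal eta de.
Proof.
move=> cly mde gen; have [Sy _] := cly; have ye := sp_eta Sy.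
move=> me; apply: eta_nc; suff -> : eta = y by [].
have mm v : max_ideal y v -> max_ideal eta v.
  move=> /gen [a [b [ya yb ->]]]; apply: (maxD leta); apply: (maxMr leta) => //; exact: ye.
apply: (dom_uniq Meta (sp_mod Sy) leta) => //.
move=> v yv; split; first exact: ye.
split; first exact: mm.
move=> mv; have [[v0 _ yv']|//] := @unit_or_max _ y _ yv.
by case: (unit_not_max _ mv); split=> //; exact: ye.
Qed.

(** An element of the prime of eta in y is pi a + de b; as de is not in this prime, b is. So the
    prime is generated by pi up to its product with the maximal ideal, and Nakayama applies. *)
Lemma closed_sp_eta y h : closed_sp y -> y h -> max_ideal eta h ->
  exists2 a, y a & h = iota pi * a.
Proof.
move=> cly yh mh; have [Sy _] := cly; have ly := sp_local Sy; have ye := sp_eta Sy.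
have [ypi _] := sp_pi Sy.
have [de mde gen] := closed_sp_param cly.
have nde := param_not_eta cly mde gen.
pose N := [set v | y v /\ max_ideal eta v].
pose N0 := [set v | exists2 a, y a & v = iota pi * a].
have iN : ideal y N.
  split; [by move=> v []|by split; [mem|mem]| |].
    by move=> a b [ya ma] [yb mb]; split; [mem|mem].
  by move=> a b ya [yb mb]; split; [mem|apply: (maxMl leta) => //; exact: ye].
have iN0 : ideal y N0.
  split.
  - by move=> _ [a ya ->]; mem.
  - by exists 0; rewrite ?mulr0; mem.
  - by move=> _ _ [a ya ->] [b yb ->]; exists (a + b); [mem|rewrite mulrDr].
  - by move=> c _ yc [a ya ->]; exists (c * a); [mem|rewrite mulrCA].
apply: (nakayama ly (mod_noeth (sp_mod Sy)) iN iN0) => //.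
  move=> _ [a ya ->]; split; first mem. by apply: (maxMr leta) => //; exact: ye.
move=> J iJ N0J JJ v [yv mv].
have my : max_ideal y v.
  split=> // -[v0 _ yv']; case: (unit_not_max _ mv); split=> //; exact: ye.
have [a [b [ya yb e]]] := gen _ my.
rewrite e; apply: (idD iJ); first by apply: N0J; exists a.
apply: (JJ) => //; split=> //.
have : max_ideal eta (de * b).
  have -> : de * b = v - iota pi * a by rewrite e; ring. by apply: (maxB leta) => //; apply: (maxMr leta) => //; exact: ye.
have [yde _] := mde.
by move/(max_prod leta (ye _ yde) (ye _ yb)) => [/nde|].
Qed.

Lemma eta_unif : uniformizer eta (iota pi).
Proof.
split=> // h; split=> [mh|eh]; last first.
  by rewrite -[h](divfK ipi0); mem.
have [eh _] := mh; have [SR _] := R_csp; have [i cR] := sp_mod SR.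
have ce := gen_chart cR Meta (sp_eta SR).
have [a [b [Ca Cb ub e]]] := chart_quot ce eh; have [b0 eb eb'] := ub.
have ma : max_ideal eta a by rewrite -[a](divfK b0) -e; mem.
have [a' ya' ea] := closed_sp_eta R_csp (chart_C cR Ca) ma.
rewrite e ea mulrAC [iota pi * _]mulrC mulfK //.
by apply: (srM leta) => //; exact: (sp_eta SR).
Qed.
Lemma eta_dvr : dvr eta.
Proof.
apply: noeth_dvr => //; first exact: (mod_noeth Meta).
  by exists (iota pi); exact: eta_unif.
by move=> h; exact: (mod_frac h Meta).
Qed.

Lemma closed_sp_eta_pow y h : closed_sp y -> y h -> h != 0 -> exists n b,
  [/\ y b, unit_in eta b & h = iota pi ^+ n * b].
Proof.
move=> cly yh h0; have [Sy _] := cly; have ye := sp_eta Sy.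
have := (ordv_ge0 eta_dvr h).1 (ye _ yh) h0; move e: (ordv eta h) => m m0.
case: m m0 e => [n|n] // _; elim: n h h0 yh => [|n IH] h h0 yh e.
  by exists 0%N, h; split; rewrite ?mul1r //; exact: (unit_ordv eta_dvr).
have mh : max_ideal eta h by apply/(ordv_max eta_dvr) => _; rewrite e.
have [a ya ea] := closed_sp_eta cly yh mh.
have a0 : a != 0 by apply: contraNneq h0 => a0; rewrite ea a0 mulr0.
have oa : ordv eta a = n%:Z.
  by move: e; rewrite ea (ordvM eta_dvr) // (ordv_unif eta_dvr eta_unif); lia.
have [n' [b [yb ub eb]]] := IH a a0 ya oa.
by exists n'.+1, b; split=> //; rewrite ea eb exprS mulrA.
Qed.

Lemma closed_dvr x : closed_point X x -> dvr x.
Proof.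
move=> cx; have [[Mx _] _] := cx; apply: noeth_dvr.
- exact: (mod_local Mx).
- exact: (mod_noeth Mx).
- exact: Xunif.
- by move=> h; exact: (mod_frac h Mx).
Qed.

Lemma dvr_over (O x : set F) : dvr O -> subring x -> O `<=` x -> O = x \/ x = setT.
Proof.
move=> d sx Ox; have [e|ne] := EM (x `<=` O); first by left; apply/seteqP.
right; have [h xh nOh] : exists2 h, x h & ~ O h.
  by apply: contrapT => H; apply: ne => h xh; apply: contrapT => nh; apply: H; exists h.
have h0 : h != 0 by apply: contra_notN nOh => /eqP->; mem.
have oh : ordv O h < 0.
  by rewrite ltNge; apply/negP => H; apply: nOh; apply/(ordv_ge0 d).
apply/seteqP; split=> // u _; have [->|u0] := eqVneq u 0; first mem.
pose n := `|ordv O u|%N; have hn0 : h ^+ n != 0 by rewrite expf_neq0.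
rewrite -[u](divfK hn0); apply: srM => //; last exact: srX.
apply: Ox; apply/(ordv_ge0 d) => _; rewrite (ordv_div d) // (ordvX d) //.
rewrite -mulr_natr; nia.
Qed.

Lemma X_cases x : X x -> closed_point X x \/ x = setT.
Proof.
move=> Xx; have [x0 cx0 x0x] := closed_below Xx.
have [Mx _] := Xx.
by have [<-|] := dvr_over (closed_dvr cx0) (mod_local Mx) x0x; [left|right].
Qed.

Lemma loc_mod y P : Mod y -> prime_ideal_in y P -> Mod (localization y P).
Proof.
move=> My pP; have [i cy] := My.
have [Q [pQ ->]] := frac_loc (mod_local My) pP cy.
by exists i; split; [exact: chart_f0 cy|exists Q].
Qed.

(** Integrality in codimension one suffices. If the denominators I of h in y contained no power of
    pi, a prime above I would be a point of X at which h is integral, a contradiction. So pi^n h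
    lies in y for some n, and the factors pi cancel one by one because h is integral at eta. *)
Lemma normality y h : closed_sp y -> eta h ->
  (forall x, closed_point X x -> y `<=` x -> x h) -> y h.
Proof.
move=> cly eh Hx; have [Sy _] := cly; have ly := sp_local Sy; have My := sp_mod Sy.
have [ypi _] := sp_pi Sy.
pose I := [set c | y c /\ y (c * h)].
have iI : ideal y I.
  split; [by move=> v []|by split; rewrite ?mul0r; mem| |].
    by move=> a b [ya ma] [yb mb]; split; rewrite ?mulrDl; mem.
  by move=> a b ya [yb mb]; split; rewrite -?mulrA; mem.
have [[n In]|nI] := EM (exists n, I (iota pi ^+ n)).
  elim: n In => [[_]|n IH [_ yn]]; first by rewrite mul1r. apply: IH; split; first exact: (srX ly).
  have mn : max_ideal eta (iota pi ^+ n.+1 * h).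
    by rewrite exprS -mulrA; apply: (maxMr leta) => //; apply: (srM leta) => //;
      apply: (srX leta); case: mepi.
  have [a ya] := closed_sp_eta cly yn mn. by rewrite exprS -mulrA => /(mulfI ipi0) ->.
have nI' n : ~ I (iota pi ^+ n) by move=> H; apply: nI; exists n.
have [Q [pQ IQ nQ _]] := prime_avoid ly (mod_noeth My) iI ypi nI'.
have Mx := loc_mod My pQ; set x := localization y Q in Mx.
have yx : y `<=` x by exact: localizationl ly pQ.
have Xx : X x.
  apply: (X_mem Mx); rewrite fmorphV. by have [] := loc_unit ly pQ ypi nQ.
have : x h by have [cx|->] := X_cases Xx; first exact: Hx.
move=> [a [b [ya yb nb b0 e]]]; case: nb; apply: IQ; split=> //.
by rewrite e mulrC divfK.
Qed.

Lemma dom_center y Z : Mod y -> is_local Z -> y `<=` Z ->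
  exists y', [/\ Mod y', y `<=` y' & dominates Z y'].
Proof.
move=> My lZ yZ; have ly := mod_local My.
have pP := center_prime ly lZ yZ; set P := [set a | _] in pP.
exists (localization y P); split; [exact: loc_mod|exact: localizationl ly pP|].
move=> _ [a [b [ya yb nb b0 ->]]].
have ub : unit_in Z b by have [//|m] := @unit_or_max _ Z _ (yZ _ yb); case: nb.
have [_ _ Zb'] := ub; split; first by apply: (srM lZ) => //; exact: yZ.
rewrite (loc_max ly pP ya yb nb); split=> [[_ m]|m]; first mem.
by split=> //; exact: (max_unit_mul lZ (unitV ub)).
Qed.

Lemma sp_max_eta y h : Sp y -> y h -> max_ideal eta h -> max_ideal y h.
Proof.
move=> Sy yh mh; split=> // -[h0 _ yh']; case: (unit_not_max _ mh).
by split=> //; apply: (sp_eta Sy).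
Qed.

Lemma rho_max y h : Sp y -> y h -> max_ideal (rho @` y) (rho h) <-> max_ideal y h.
Proof.
move=> Sy yh; have ly := sp_local Sy; have ye := sp_eta Sy.
have [r0 r1 rD rN rM] := rf_additive Hrho leta.
have [_ _ rm] := Hrho.
split=> [[_ nu]|mh].
  split=> // -[h0 _ yh']; apply: nu; split.
  - apply/eqP => /(rm _ (ye _ yh)).1; apply: unit_not_max; split=> //; exact: ye.
  - by exists h.
  - exists h^-1 => //; apply: (mulfI (x := rho h)).
      apply/eqP => /(rm _ (ye _ yh)).1; apply: unit_not_max; split=> //; exact: ye.
    rewrite -rM; [|exact: ye..]; rewrite mulfV // mulfV //.
    apply/eqP => /(rm _ (ye _ yh)).1; apply: unit_not_max; split=> //; exact: ye.
split => //.
case=> rh0 _ [b yb eb].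
have : rho (h * b) = rho 1 by rewrite rM; [rewrite eb mulfV|exact: ye|exact: ye].
move/(rf_eq Hrho leta (srM leta (ye _ yh) (ye _ yb)) (sr1 leta)).
move=> m; have := sp_max_eta Sy (srB ly (srM ly yh yb) (sr1 ly)) m.
move=> m1; apply: (not_max1 ly).
have -> : 1 = h * b - (h * b - 1) by ring.
by mem.
Qed.

Lemma rho_subring y : Sp y -> subring (rho @` y).
Proof. by move=> Sy; apply: (rf_image Hrho leta (sp_local Sy)); exact: sp_eta. Qed.

Lemma rho_local y : Sp y -> is_local (rho @` y).
Proof.
move=> Sy; have ly := sp_local Sy; have ye := sp_eta Sy.
have [r0 r1 rD rN rM] := rf_additive Hrho leta.
split; first exact: rho_subring.
move=> u v m1 m2; have [[a ya ea] _] := m1; have [[b yb eb] _] := m2.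
move: m1 m2; rewrite -ea -eb => /(rho_max Sy ya) ma /(rho_max Sy yb) mb.
rewrite -rD; [|exact: ye..]; apply/(rho_max Sy); first mem.
by mem.
Qed.

(** The preimage Z in eta of the local ring of y on the special fibre is local, contains y' and
    dominates y. The centre of Z above y' is then y by separatedness. *)
Lemma rho_sub y y' : Sp y -> Sp y' -> rho @` y' `<=` rho @` y -> y' `<=` y.
Proof.
move=> Sy Sy' sub; have ye := sp_eta Sy; have ye' := sp_eta Sy'.
have [r0 r1 rD rN rM] := rf_additive Hrho leta.
pose Z := [set h | eta h /\ (rho @` y) (rho h)].
have lrY := rho_local Sy; have [_ _ rm] := Hrho.
have sZ : subring Z.
  split; first by split; rewrite ?r1; [mem|mem].
  - move=> a b [ea Ya] [eb Yb]; split; first mem.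
    by rewrite rD ?rN //; [mem|mem].
  - move=> a b [ea Ya] [eb Yb]; split; first mem.
    by rewrite rM; mem.
have Zm h : Z h -> max_ideal Z h <-> max_ideal (rho @` y) (rho h).
  move=> [eh Yh]; split=> [[_ nu]|[_ nu]]; split=> // -[h0 _ Yh'].
  - apply: nu; have [uh|mh] := @unit_or_max _ eta _ eh; last first.
      by move/(rm _ eh): mh h0 => ->; rewrite eqxx.
    have [hn0 _ eh'] := uh; split=> //; split=> //. have -> : rho h^-1 = (rho h)^-1 => //.
    by apply: (mulfI h0); rewrite -rM // !mulfV.
  - case: Yh' => eh' Yh'; apply: nu.
    have e1 : rho h * rho h^-1 = 1 by rewrite -rM // mulfV.
    have rh0 : rho h != 0 by apply/eqP => H; move/eqP: e1; rewrite H mul0r eq_sym oner_eq0.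
    split=> //; have -> : (rho h)^-1 = rho h^-1 => //. by apply: (mulfI rh0); rewrite mulfV.
have lZ : is_local Z.
  split=> // a b ma mb; have [Za _] := ma; have [Zb _] := mb. have Zab := srD sZ Za Zb; apply/(Zm _ Zab).
  move/(Zm _ Za): ma => ma; move/(Zm _ Zb): mb => mb. rewrite rD; [|by case: Za|by case: Zb]; mem.
have dy : dominates Z y.
  move=> h yh; have Zh : Z h by split; [exact: ye|exists h]. by split=> //; rewrite (Zm _ Zh) (rho_max Sy yh).
have y'Z : y' `<=` Z by move=> h yh; split; [exact: ye'|apply: sub; exists h].
have [y'' [My'' y'y'' dy'']] := dom_center (sp_mod Sy') lZ y'Z.
by rewrite (dom_uniq (sp_mod Sy) My'' lZ dy dy'').
Qed.

Lemma Y_closed z : closed_point Y z -> exists2 y, closed_sp y & z = rho @` y.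
Proof.
move=> [[y Sy ->] cl]; exists y; split=> // y' Sy' sub.
have e : rho @` y' = rho @` y.
  apply: cl; first by exists y'. by move=> _ [h yh <-]; exists h => //; exact: sub.
by apply/seteqP; split=> //; apply: (rho_sub Sy' Sy); rewrite e.
Qed.
Lemma Y_closed_sp y : closed_sp y -> closed_point Y (rho @` y).
Proof.
move=> [Sy cl]; split; first by exists y.
move=> _ [y' Sy' ->] sub; congr (_ @` _); apply: cl => //; exact: rho_sub sub.
Qed.

(** Modulo pi only one generator of the maximal ideal is left by [closed_sp_param]. *)
Lemma Y_dvr y : closed_sp y -> dvr (rho @` y).
Proof.
move=> cly; have [Sy _] := cly; have ly := sp_local Sy; have ye := sp_eta Sy.
have [r0 r1 rD rN rM] := rf_additive Hrho leta; have [_ rs rm] := Hrho.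
apply: noeth_dvr; first exact: rho_local.
- move=> a Ya; have [b bP] : {b : nat -> F & forall n, y (b n) /\ rho (b n) = a n}.
    apply: (@choice _ _ (fun n b => y b /\ rho b = a n)) => n. by have [b yb eb] := Ya n; exists b.
  have [n [c yc e]] := mod_noeth (sp_mod Sy) (fun n => (bP n).1).
  exists n, (fun i => rho (c i)); first by move=> i; exists (c i). rewrite -(bP n).2 e (@rf_sum eta FY rho) //; last first.
    by move=> i _; apply: (srM leta); apply: ye; case: (bP i).
  by exact: leta. by apply: eq_bigr => i _; rewrite rM ?(bP i).2 //; apply: ye; case: (bP i).
- have [de mde gen] := closed_sp_param cly; exists (rho de).
  have [yde _] := mde. have nde : rho de != 0.
    by apply/eqP => /(rm _ (ye _ yde)).1; exact: param_not_eta gen.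
  have epi0 : rho (iota pi) = 0 by apply/rm; case: mepi. have epi : eta (iota pi) by mem.
  split=> // h; split=> [mh|[a ya ea]].
    have [[a ya ea] _] := mh; rewrite -ea in mh *. have [a' [b [ya' yb ->]]] := gen _ ((rho_max Sy ya).1 mh).
    exists b => //; rewrite rD ?rM ?epi0 ?mul0r ?add0r 1?mulrC ?mulKf //; try exact: ye;
      by apply: (srM leta) => //; exact: ye.
  have -> : h = rho (de * a) by rewrite rM ?ea; [rewrite mulrC divfK|exact: ye|exact: ye]. by apply/(rho_max Sy); [mem|mem].
- move=> h; have [e ee <-] : exists2 e, eta e & rho e = h.
    by have : setT h by []; rewrite -rs => -[e]; exists e.
  have [i cy] := sp_mod Sy; have ce := gen_chart cy Meta (sp_eta Sy).
  have [a [b [Ca Cb ub ->]]] := chart_quot ce ee; have [b0 eb eb'] := ub. have ya := chart_C cy Ca; have yb := chart_C cy Cb.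
  have rb0 : rho b != 0 by apply/eqP => /(rm _ eb).1; exact: unit_not_max.
  exists (rho a), (rho b); split; [by exists a|by exists b|by []|].
  by apply: (mulIf rb0); rewrite // -rM ?divfK //; apply: (srM leta) => //; exact: ye.
Qed.

(** A direct proof of the factoriality needed on the regular surface. Among the elements of the
    prime Q of x that are units at eta, q has a reduction of least order. The reduction of any v in
    Q is then a multiple of that of q, so v - q c is divisible by pi, with quotient in Q because pi
    is a unit at x; Nakayama gives Q = (q). *)
Lemma principal_prime x y : closed_sp y -> closed_point X x -> y `<=` x -> exists q,
  [/\ unit_in eta q, y q /\ ordv x q = 1,
    forall v, y v -> max_ideal x v -> exists2 c, y c & v = q * c &
    forall x', closed_point X x' -> y `<=` x' -> x' <> x -> unit_in x' q].
Proof.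
move=> cly cx yx; have [Sy _] := cly; have ly := sp_local Sy; have ye := sp_eta Sy.
have My := sp_mod Sy; have dx := closed_dvr cx; have [Xx xmin] := cx.
have [r0 r1 rD rN rM] := rf_additive Hrho leta; have [_ rs rm] := Hrho.
have dz := Y_dvr cly; have [Mx xK] := Xx.
pose Q := [set v | y v /\ max_ideal x v].
have uxpi : unit_in x (iota pi).
  by split=> //; rewrite -fmorphV; exact: xK.
have iQ : ideal y Q.
  split; [by move=> v []|by split; [mem|mem]| |].
    by move=> a b [ya ma] [yb mb]; split; [mem|mem].
  by move=> a b ya [yb mb]; split; [mem|apply: (maxMl dx) => //; exact: yx].
have Qpi v : y v -> Q (iota pi * v) -> Q v.
  by move=> yv [_ mv]; split=> //; apply: (max_unit_mul dx uxpi); rewrite mulrC.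
have quo v : x v -> exists a b, [/\ y a, y b, unit_in x b & v = a / b].
  have [i cy] := My; have ccx := gen_chart cy Mx yx. move=> xv; have [a [b [Ca Cb ub ->]]] := chart_quot ccx xv.
  by exists a, b; split=> //; exact: (chart_C cy).
have [t ut] := Xunif cx.
have mt := unif_max dx ut; have [xt _] := mt; have [t0 _] := ut.
have [a [b [ya yb ub et]]] := quo _ xt; have [b0 _ _] := ub.
have a0 : a != 0 by apply: contraNneq t0 => a0; rewrite et a0 mul0r.
have Qa : Q a by split=> //; rewrite -[a](divfK b0) -et; apply: (maxMr dx) ; mem.
have oa : ordv x a = 1.
  by rewrite -[a](divfK b0) -et (ordvM dx) // (ordv_unif dx ut) (ordv_unit dx ub).
pose S (n : nat) := exists v, [/\ Q v, unit_in eta v & ordv (rho @` y) (rho v) = n].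
have exS : exists n, `[< S n >].
  have [n [a' [ya' ua' ea]]] := closed_sp_eta_pow cly ya a0. have Qa' : Q a'.
    have Hn m : Q (iota pi ^+ m * a') -> Q a'.
      elim: m => [|m IH]; first by rewrite mul1r. rewrite exprS -mulrA => /Qpi H; apply: IH; apply: H; apply: (srM ly) => //.
      by apply: (srX ly); case: (sp_pi Sy).
    by apply: (Hn n); rewrite -ea.
  have ra0 : rho a' != 0 by apply/eqP => /(rm _ (ye _ ya')).1; exact: unit_not_max.
  have := (ordv_ge0 dz (rho a')).1; case: (ordvP dz ra0) => _ _.
  move=> /(_ _ ra0); case E : (ordv _ _) => [m|m]; last by move=> H; have := H (ex_intro2 _ _ a' ya' erefl).
  by exists m; apply/asboolP; exists a'.
have [n /asboolP [q [Qq uq eq]] nmin] := ex_minnP exS.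
have [yq mq] := Qq.
have rq0 : rho q != 0 by apply/eqP => /(rm _ (ye _ yq)).1; exact: unit_not_max.
pose N0 := [set v | exists2 c, y c & v = q * c].
have iN0 : ideal y N0.
  split.
  - by move=> _ [c yc ->]; mem.
  - by exists 0; rewrite ?mulr0; mem.
  - by move=> _ _ [c yc ->] [c' yc' ->]; exists (c + c'); [mem|rewrite mulrDr].
  - by move=> c _ yc [c' yc' ->]; exists (c * c'); [mem|rewrite mulrCA].
have Qgen : Q `<=` N0.
  apply: (nakayama ly (mod_noeth My) iQ iN0).
    by move=> _ [c yc ->]; rewrite mulrC; exact: (idM iQ).
  move=> J iJ N0J JJ v Qv; have [yv mv] := Qv. have piJ w : y w -> max_ideal eta w -> Q w -> J w.
    move=> yw mw; have [w' yw' ->] := closed_sp_eta cly yw mw.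
    by move=> /(Qpi _ yw') Qw'; apply: JJ => //; exact: (sp_pi Sy).
  have [uv|mev] := @unit_or_max _ eta _ (ye _ yv); last exact: piJ.
  have rv0 : rho v != 0 by apply/eqP => /(rm _ (ye _ yv)).1; exact: unit_not_max.
  have [c yc ec] : (rho @` y) (rho v / rho q).
    apply/(ordv_ge0 dz) => _; rewrite (ordv_div dz) // eq subr_ge0.
    have := (ordv_ge0 dz (rho v)).1 (ex_intro2 _ _ v yv erefl) rv0.
    case E : (ordv _ _) => [m|m] // _; rewrite lez_nat; apply: nmin. by apply/asboolP; exists v.
  rewrite -[v](subrK (q * c)); apply: (idD iJ); last by apply: N0J; exists c. apply: piJ; first by apply: (srB ly) ; mem.
    apply/(rf_eq Hrho leta); [mem|by apply: ye; mem|]. by rewrite rM ?ec 1?mulrC ?divfK //; exact: ye.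
  split; first by apply: (srB ly) ; mem. by apply: (maxB dx) => //; apply: (maxMr dx) => //; exact: yx.
exists q; split=> //.
- split=> //; have [c yc ec] := Qgen _ Qa.
  have q0 : q != 0 by case: uq. have c0 : c != 0 by apply: contraNneq a0 => c0; rewrite ec c0 mulr0.
  have := (ordv_ge0 dx c).1 (yx _ yc) c0; have := (ordv_max dx q).1 mq q0. by move: oa; rewrite ec (ordvM dx) //; lia.
- by move=> v yv mv; apply: Qgen.
- move=> x' cx' yx' ne; have dx' := closed_dvr cx'; have [[Mx' _] _] := cx'.
  have [//|mq'] := @unit_or_max _ x' _ (yx' _ yq); exfalso; apply: ne. apply: xmin; first by case: cx'.
  have [i cy] := My; have ccx := gen_chart cy Mx' yx'. move=> v xv; have [c [d [Cc Cd ud ->]]] := chart_quot ccx xv.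
  have yc := chart_C cy Cc; have yd := chart_C cy Cd. apply: (srM dx); first exact: yx.
  have [[]//|md] := @unit_or_max _ x _ (yx _ yd). have [d' yd' ed] := Qgen _ (conj yd md).
  by case: (unit_not_max ud); rewrite ed; apply: (maxMr dx') => //; exact: yx'.
Qed.

(** The analogue of [closed_sp_max] on the generic fibre, where powers of pi serve as
    denominators. *)
Lemma closed_X_inv x i : closed_point X x -> ch i x -> forall b, C i b -> unit_in x b ->
  exists c (n : nat), C i c /\ max_ideal x (b * (c / iota pi ^+ n) - 1).
Proof.
move=> [Xx cl] cx b Cb ub; have [Mx xK] := Xx; have lx := mod_local Mx.
have sC := C_sub i.
have Cx := chart_C cx; have pP := center_prime sC lx Cx; set P := [set a | _] in pP.
apply: contrapT => H.
have iP := ideal_gen sC (prime_ideal pP) Cb.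
have n1 n : ~ idgen (C i) P b (iota pi ^+ n).
  move=> -[a [c [Pa Cc e1]]]; apply: H; exists c, n; split=> //. have pn0 : iota pi ^+ n != 0 by rewrite expf_neq0.
  have -> : b * (c / iota pi ^+ n) - 1 = - (a * (iota pi^-1) ^+ n).
    have -> : a = iota pi ^+ n - c * b by rewrite e1; ring. by rewrite fmorphV exprVn; field.
  by apply: (maxN lx); apply: (maxMr lx); [case: Pa|apply: (srX lx)].
have [Q [pQ PQ nQ _]] := prime_avoid sC (@C_noeth i) iP (C_iota i Opi) n1.
have cx1 : ch i (localization (C i) Q) by split; [exact: chart_f0 cx|exists Q].
have Qb : Q b by apply: PQ; exact: idgenr _ sC (prime_ideal pP).
have x1x : localization (C i) Q `<=` x.
  move=> _ [a [c [Ca Cc nc c0 ->]]]; apply: (srM lx); first exact: Cx. have [[]//|m] := @unit_or_max _ x _ (Cx _ Cc).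
  by case: nc; apply: PQ; apply: (idgenl _ sC).
have Xx1 : X (localization (C i) Q).
  apply: (X_mem); first by exists i. by rewrite fmorphV; have [] := loc_unit sC pQ (C_iota i Opi) nQ.
have e1 := cl _ Xx1 x1x.
have := unit_not_max ub; rewrite -e1; apply; exact/(loc_maxA sC pQ).
Qed.

Lemma generic_algebraic x h : closed_point X x -> x h ->
  exists P : {poly K}, P \is monic /\ max_ideal x (map_poly iota P).[h].
Proof.
move=> clx xh; have [[Mx xK] _] := clx; have lx := mod_local Mx.
have [i cx] := Mx; have sC := C_sub i; have Cx := chart_C cx.
have [k [ry Hr]] := residue_field_ex lx.
have [r0 r1 rD rN rM] := rf_additive Hr lx; have rX := rf_exp Hr lx.
have [_ rs rm] := Hr.
pose Rk := ry @` (range iota).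
have sR : subring Rk by apply: (rf_image Hr lx (K_sub iota)) => _ [a _ <-]; exact: xK.
have RV z : Rk z -> Rk z^-1.
  move=> [_ [a _ <-] <-]; have [->|a0] := eqVneq a 0.
    by rewrite rmorph0 r0 invr0; mem.
  exists (iota a^-1) => //. have e1 : ry (iota a^-1) * ry (iota a) = 1 by rewrite -rM // -rmorphM mulVf // rmorph1.
  have ra0 : ry (iota a) != 0.
    by apply/eqP => H; move/eqP: e1; rewrite H mulr0 eq_sym oner_eq0.
  by apply: (mulIf ra0); rewrite mulVf.
pose cs := map ry (coords i).
have full z : foldl (@adj k) Rk cs z.
  have [|sL LC] := residue_adj Hr lx cx sR; first by move=> a _; exists (iota a) => //; exists a.
  have [h1 xh1 <-] : exists2 h, x h & ry h = z by have : setT z by []; rewrite -rs => -[h1]; exists h1.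
  have [a [b [Ca Cb ub ->]]] := chart_quot cx xh1. have [c [n [Cc mc]]] := closed_X_inv clx cx Cb ub. have [b0 yb yb'] := ub.
  have xpn : x ((iota pi^-1) ^+ n) by apply: (srX lx).
  have epn : c / iota pi ^+ n = c * (iota pi^-1) ^+ n by rewrite fmorphV exprVn.
  have -> : ry (a / b) = ry (a * c) * ry ((iota pi^-1) ^+ n).
    rewrite -rM //; last by apply: (srM lx); exact: Cx. apply/(rf_eq Hr lx); [by apply: (srM lx) => //; exact: Cx| |].
      by apply: (srM lx) => //; apply: (srM lx); exact: Cx.
    have -> : a / b - a * c * (iota pi^-1) ^+ n = - (a / b * (b * (c / iota pi ^+ n) - 1)).
      by rewrite epn; field.
    by apply: (maxN lx); apply: (maxMl lx) => //; apply: (srM lx) => //; exact: Cx.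
  apply: (srM sL); first by apply: LC; mem. apply: foldl_adj_base => //; exists ((iota pi^-1) ^+ n) => //.
  by exists (pi^-1 ^+ n) => //; exact: rmorphXn.
have [Pk [mP RP rP]] := zariski sR RV full (ry h).
have H j : exists c : K, ry (iota c) = Pk`_j by have [_ [c _ <-] e] := RP j; exists c.
have [c cP] := choice H.
have n0 : (0 < size Pk)%N by rewrite lt0n size_poly_eq0 monic_neq0.
pose c' j := if j == (size Pk).-1 then 1 else c j.
have c'P j : (j < size Pk)%N -> ry (iota (c' j)) = Pk`_j.
  rewrite /c'; case: eqP => [->|//] _; rewrite rmorph1 r1. by move: mP; rewrite monicE => /eqP.
exists (\poly_(j < size Pk) c' j); split.
  by rewrite monicE lead_coef_poly ?/c' ?eqxx ?oner_eq0.
rewrite (_ : map_poly iota _ = \poly_(j < size Pk) iota (c' j)); last first.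
  by apply/polyP => j; rewrite coef_map !coef_poly; case: ifP => // _; exact: rmorph0.
rewrite horner_poly.
have xj j : x (iota (c' j) * h ^+ j) by apply: (srM lx) => //; exact: (srX lx).
apply/rm; first mem.
rewrite (@rf_sum x k ry) //; last exact: lx.
rewrite -[RHS](rootP rP) horner_coef; apply: eq_bigr => j _.
by rewrite rM ?rX ?c'P //; exact: (srX lx).
Qed.

Lemma R_eta_pi h : R h -> max_ideal eta h -> exists2 a, R a & h = iota pi * a.
Proof. exact: (closed_sp_eta R_csp). Qed.
Lemma R_eta : R `<=` eta. Proof. exact: (sp_eta RS). Qed.
(** The ring Z of functions whose value at oo is integral dominates both points. It contains y: if a
    function h of y had a non-integral value c, then 1 - h / c would be a unit of y vanishing at
    oo. *)
Lemma csp_oo y : csp y -> y `<=` oo -> y = R.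
Proof.
move=> cy yX; have [_ _ _ Hres Hev] := Hoo; have [Sy _] := cy.
have ly := sp_local Sy; have My := sp_mod Sy.
pose Z := [set h | oo h /\ exists2 c, OK c & max_ideal oo (h - iota c)].
have cu h c c' : max_ideal oo (h - iota c) -> max_ideal oo (h - iota c') -> c = c'.
  move=> m m'; apply/eqP; rewrite -subr_eq0; apply/negP => /negP ne. have : max_ideal oo (iota (c - c')).
    have -> : iota (c - c') = (h - iota c') - (h - iota c) by rewrite rmorphB; ring. by mem.
  apply: unit_not_max; split; [by rewrite fmorph_eq0|by case: Xoo|]. by rewrite -fmorphV; case: Xoo.
have sZ : subring Z.
  split.
  - split; first mem.
    by exists 1; [mem|rewrite rmorph1 subrr; mem].
  - move=> a b [Xa [c Oc mc]] [Xb [c' Oc' mc']]; split; first mem.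
    exists (c - c'); first mem. have -> : a - b - iota (c - c') = (a - iota c) - (b - iota c') by rewrite rmorphB; ring.
    by mem.
  - move=> a b [Xa [c Oc mc]] [Xb [c' Oc' mc']]; split; first mem.
    exists (c * c'); first mem. have -> : a * b - iota (c * c') = (a - iota c) * b + iota c * (b - iota c').
      ring.
    apply: (maxD lX); [mem|apply: (maxMl lX); by case: Xoo].
have Zu h c : Z h -> OK c -> max_ideal oo (h - iota c) -> unit_in Z h <-> unit_in OK c.
  move=> Zh Oc mc; split=> [[h0 _ [Xh' [c' Oc' mc']]]|[c0 _ Oc']].
    have e : c * c' = 1.
      apply: (cu (h * h^-1)); last by rewrite mulfV // rmorph1 subrr; mem.
      have -> : h * h^-1 - iota (c * c') = (h - iota c) * h^-1 + iota c * (h^-1 - iota c').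
        ring.
      apply: (maxD lX); [mem|apply: (maxMl lX); by case: Xoo].
    have c0 : c != 0.
      by apply/eqP => c0; move/eqP: e; rewrite c0 mul0r eq_sym oner_eq0.
    by split=> //; have -> : c^-1 = c' by apply: (mulfI c0); rewrite mulfV.
  have ic : unit_in oo (iota c).
    by split; [rewrite fmorph_eq0|by case: Xoo|rewrite -fmorphV; case: Xoo].
  have uh : unit_in oo h.
    by rewrite -[h](subrK (iota c)) addrC; exact: (unitDmax lX).
  have [h0 Xh Xh'] := uh; split=> //; split=> //; exists c^-1 => //.
  have -> : h^-1 - iota c^-1 = - (h - iota c) * (h^-1 * iota c^-1).
    have ic0 : iota c != 0 by rewrite fmorph_eq0. by rewrite fmorphV; field; rewrite ic0.
  by apply: (maxMr lX); [mem|apply: (srM lX); case: Xoo].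
have Zm h c : Z h -> OK c -> max_ideal oo (h - iota c) -> max_ideal Z h <-> max_ideal OK c.
  by move=> Zh Oc mc; have u := Zu h c Zh Oc mc; split=> -[_ nu]; split=> // /u.
have lZ : is_local Z.
  split=> // a b ma mb; have [[Xa [c Oc mc]] _] := ma; have [[Xb [c' Oc' mc']] _] := mb.
  have Zab : Z (a + b) by apply: srD => //; [case: ma|case: mb]. apply/(Zm _ (c + c') Zab); first mem.
    have -> : a + b - iota (c + c') = (a - iota c) + (b - iota c') by rewrite rmorphD; ring. by mem.
  by apply: (maxD dO); [apply/(Zm a) => //; case: ma|apply/(Zm b); case: mb].
have dR : dominates Z R.
  move=> h Rh; have [c mc] := Hres h (Rx Rh); have [Oc uc] := Hev h c Rh mc. have Zh : Z h by split; [exact: Rx|exists c].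
  split=> //; have u := Zu h c Zh Oc mc. by split=> -[_ nu]; split=> //; [move=> /u /uc|move=> /uc /u].
have yZ : y `<=` Z.
  move=> h yh; split; first exact: yX. have [c mc] := Hres h (yX _ yh); exists c => //.
  apply: contrapT => nc; have c0 : c != 0.
    by apply/eqP => c0; apply: nc; rewrite c0; mem.
  have mc' : max_ideal OK c^-1.
    have [//|Oc'] := valuation_ring dO c0; split=> // -[_ _]; rewrite invrK //.
  have m1 : max_ideal y (iota c^-1 * h).
    by apply: (maxMr ly) => //; case: Sy => _ <-; case: mc'.
  have [z0 yz yz'] := unitN ly (unit1B ly m1). apply: (not_max1 lX); rewrite -(mulfV z0); apply: (maxMr lX); last exact: yX.
  have -> : - (1 - iota c^-1 * h) = iota c^-1 * (h - iota c).
    have ic0 : iota c != 0 by rewrite fmorph_eq0. by rewrite fmorphV; field.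
  by apply: (maxMl lX); case: Xoo.
have dy : dominates Z y.
  move=> h yh; have Zh := yZ h yh; split=> //; have [_ [c Oc mc]] := Zh. split=> [mh|[_ nu]]; last first.
    by split=> // -[h0 yh1 yh']; apply: nu; split=> //; exact: yZ.
  apply/(Zm h c Zh Oc mc); split=> // uc; have [c0 _ Oc'] := uc. have uc' : unit_in y (iota c).
    by split; [rewrite fmorph_eq0|exact: (mod_iota My)|rewrite -fmorphV; exact: (mod_iota My)].
  have [z0 yz yz'] : unit_in y (h - iota c).
    rewrite -opprB; apply: (unitN ly); apply: (unitDmax ly) ; mem.
  by apply: (not_max1 lX); rewrite -(mulfV z0); apply: (maxMr lX) => //; exact: yX.
exact: (dom_uniq My MR lZ dy dR).
Qed.

(** * The coordinate along the section and the action of sigma *)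

Variable (E : F -> int -> K).
Hypothesis HE : is_laurent_embedding iota E.
Hypothesis Ecompl : is_completion OK R E.
Hypothesis Hev0 : forall h, R h -> (max_ideal oo h <-> E h 0 = 0).
Variables (sigma : {rmorphism F -> F}) (d : nat) (zeta : K).
Hypothesis sK : forall c, sigma (iota c) = iota c.
Hypothesis sX : forall x, X x <-> X (sigma @^-1` x).
Hypothesis sE : forall h, R h -> R (sigma h) /\ forall i, E (sigma h) i = zeta ^ i * E h i.
Hypothesis sig_d : has_order_aut sigma d.
Hypothesis p_mod_d : p = 1 %[mod d].
Hypothesis d_gt1 : (1 < d)%N.

Lemma E_int h i : R h -> OK (E h i). Proof. by case: Ecompl => H _ _ /H []. Qed.
Lemma E_le0 h : R h -> degT_le (E h) 0. Proof. by case: Ecompl => H _ _ /H []. Qed.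
Lemma R_ev h : R h -> max_ideal oo (h - iota (E h 0)).
Proof.
move=> Rh; apply/Hev0; first by apply: (srB lR) => //; apply: R_iota; exact: E_int.
by rewrite (EB HE) (EC HE) subrr.
Qed.
Lemma R_unit h : R h -> unit_in R h <-> unit_in OK (E h 0).
Proof. by move=> Rh; case: Hoo => _ _ _ _ /(_ h _ Rh (R_ev Rh)) []. Qed.

(** Density of R in OK[[1/T]] gives an element whose coefficient at 1/T is a unit; the constant term
    is then subtracted and this unit divided out. *)
Lemma R_t : exists t, [/\ R t, E t 0 = 0 & E t (- 1) = 1].
Proof.
have [_ _ dens] := Ecompl; pose s (i : int) : K := (i == - 1)%:R.
have Is : integral_series OK s.
  split=> [i i0|i]; last exact: (sr_nat dO). by rewrite /s; case: eqP => // e; move: i0; rewrite e.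
have [h Rh [_ mh]] := dens 2 s Is.
have m1 : max_ideal OK (1 - E h (- 1)).
  by have := mh 1%N isT; rewrite /s => /(max_pow1 dO).
have u1 : unit_in OK (E h (- 1)).
  by rewrite -[E h _](subKr 1); exact: (unit1B dO).
have [e0 _ Oe'] := u1.
exists (iota (E h (- 1))^-1 * (h - iota (E h 0))); split.
- apply: (srM lR); first exact: R_iota.
  by apply: (srB lR) => //; apply: R_iota; exact: E_int.
- by rewrite (EZ HE) (EB HE) (EC HE) subrr mulr0.
- by rewrite (EZ HE) (EB HE) (EC HE) subr0 mulVf.
Qed.

Lemma iter_sigma k h : R h -> R (iter k sigma h) /\
  forall i, E (iter k sigma h) i = zeta ^ (i * k%:Z) * E h i.
Proof.
have [t [Rt _ t1]] := R_t.
have z0 : zeta != 0.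
  apply/eqP => z0; have [_ He] := sE Rt; have [d0 di _] := sig_d.
  have Ei j : (0 < j)%N -> E (iter j sigma t) (- 1) = 0 /\ R (iter j sigma t).
    case: j => // j _; elim: j => [|j [IH Rj]] /=.
      by split; [rewrite He z0 exp0rz mul0r|case: (sE Rt)].
    by have [R' He'] := sE Rj; split=> //; rewrite He' IH mulr0.
  have [e _] := Ei d d0; move: e; rewrite di t1; apply/eqP; exact: oner_neq0.
move=> Rh; elim: k => [|k [IH1 IH2]]; first by split=> // i; rewrite mulr0 mul1r.
have [R' He'] := sE IH1; split=> // i.
by rewrite He' IH2 mulrA -expfzDr //; congr (zeta ^ _ * _); rewrite -addn1 PoszD; ring.
Qed.

Lemma zeta_d : zeta ^+ d = 1.
Proof.
have [t [Rt _ t1]] := R_t; have [d0 di _] := sig_d.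
have [_ He] := iter_sigma d Rt; have := He (- 1); rewrite di t1 mulr1 mulN1r -invr_expz => e.
by rewrite -[RHS]invr1 e invrK.
Qed.
Lemma zeta_unit : unit_in OK zeta.
Proof.
have z0 : zeta != 0.
  by apply/eqP => z0; have := zeta_d; rewrite z0 expr0n gtn_eqF ?(ltnW d_gt1) // => /eqP; rewrite eq_sym oner_eq0.
have Oz' : OK zeta^-1.
  have [t [Rt _ t1]] := R_t; have [R' He] := sE Rt. by have := E_int (- 1) R'; rewrite He t1 mulr1.
split=> //; have -> : zeta = (zeta^-1) ^+ d.-1; last exact: (srX dO).
apply: (mulfI (x := zeta^-1)); first by rewrite invr_eq0.
by rewrite mulVf // -exprS prednK ?(ltnW d_gt1) // exprVn zeta_d invr1.
Qed.
Lemma d_unit : unit_in OK (d%:R : K).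
Proof.
have [//|md] := @unit_or_max _ OK _ (sr_nat dO d).
have pd : (d %| p.-1)%N.
  have p1 := prime_gt1 pr; rewrite -subn1 -eqn_mod_dvd; first exact/eqP. exact: ltnW.
have /dvdnP[k ek] := pd.
exfalso; apply: (not_max1 dO).
have -> : (1 : K) = p%:R - k%:R * d%:R.
  by rewrite -natrM -ek -subn1 natrB ?prime_gt0 // subKr.
by mem.
Qed.

(** Since p does not divide d, 1 is the only d-th root of unity congruent to 1. And zeta^j = 1 with
    0 < j < d would make the j-th iterate of sigma the identity on R, hence on F. *)
Lemma zeta_unity (i : nat) : max_ideal OK (zeta ^+ i - 1) -> (d %| i)%N.
Proof.
move=> m.
have z1 : zeta ^+ i = 1.
  pose x := zeta ^+ i - 1; have ex : zeta ^+ i = 1 + x by rewrite addrC subrK.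
  have e1 : (1 + x) ^+ d = 1 by rewrite -ex -exprM mulnC exprM zeta_d expr1n.
  have [y Oy ey] : exists2 y, OK y & (1 + x) ^+ d = 1 + x * (d%:R + x * y).
    elim: (d) => [|n [y Oy ey]].
      by exists 0; [mem|rewrite expr0; ring].
    exists (n%:R + y + x * y); last by rewrite exprS ey; ring. by mem.
  have [u0 _ _] : unit_in OK (d%:R + x * y).
    by apply: (unitDmax dO); [exact: d_unit|mem].
  have : x * (d%:R + x * y) = 0 by apply: (addrI 1); rewrite addr0 -ey.
  by move/eqP; rewrite mulf_eq0 (negbTE u0) orbF => /eqP x0; rewrite ex x0 addr0.
rewrite /dvdn; have [d0 di dmin] := sig_d.
have zm : zeta ^+ (i %% d) = 1.
  by move: z1; rewrite {1}(divn_eq i d) exprD mulnC exprM zeta_d expr1n mul1r.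
have [//|im] := eqVneq (i %% d)%N 0%N; exfalso.
apply: (dmin (i %% d)%N); first by rewrite lt0n im ltn_pmod.
have RH h : R h -> iter (i %% d) sigma h = h.
  move=> Rh; have [_ He] := iter_sigma (i %% d) Rh. apply/eqP; rewrite -subr_eq0; apply/negP => /negP /(E_neq0 HE) [j].
  by rewrite (EB HE) He [j * _]mulrC -exprz_exp -exprnP zm exp1rz mul1r subrr eqxx.
move=> h; have [a [b [Ra Rb b0 ->]]] := mod_frac h MR.
have iM k u v : iter k sigma (u / v) = iter k sigma u / iter k sigma v.
  by elim: k => //= k ->; rewrite fmorph_div.
by rewrite iM !RH.
Qed.

(** Averaging over the group generated by sigma, whose order is a unit of OK, projects t onto an
    eigenvector. From here on s takes the place of 1/T and its inverse that of T. *)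
Lemma R_s : exists s, [/\ R s, E s 0 = 0, E s (- 1) = 1 & sigma s = iota zeta^-1 * s].
Proof.
have [t [Rt t0 t1]] := R_t; have [z0 Oz Oz'] := zeta_unit; have [dn0 _ Od'] := d_unit.
exists (iota d%:R^-1 * \sum_(j < d) iota (zeta ^+ j) * iter j sigma t).
have Es i : E (iota d%:R^-1 * \sum_(j < d) iota (zeta ^+ j) * iter j sigma t) i =
    d%:R^-1 * \sum_(j < d) zeta ^+ j * (zeta ^ (i * j%:Z) * E t i).
  rewrite (EZ HE) (E_sum HE); congr (_ * _); apply: eq_bigr => j _. by rewrite (EZ HE); have [_ ->] := iter_sigma j Rt.
split.
- apply: (srM lR); first exact: R_iota.
  apply: (sr_sum lR) => j _; apply: (srM lR); last by case: (iter_sigma j Rt). by apply: R_iota; exact: (srX dO).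
- by rewrite Es t0 big1 ?mulr0 // => j _; rewrite !mulr0.
- rewrite Es t1; under eq_bigr => j _.
    rewrite mulr1 mulN1r -invr_expz mulfV; last by rewrite expf_neq0. over.
  by rewrite sumr_const card_ord mulVf.
- rewrite rmorphM sK rmorph_sum mulrCA; congr (_ * _).
  have [n en] : exists n, d = n.+1 by exists d.-1; rewrite prednK // ltnW. have [_ di _] := sig_d.
  have e1 j : sigma (iota (zeta ^+ j) * iter j sigma t) =
      iota zeta^-1 * (iota (zeta ^+ j.+1) * iter j.+1 sigma t).
    by rewrite rmorphM sK mulrA -rmorphM exprS mulrA mulVf // mul1r.
  under eq_bigr do rewrite e1. rewrite -mulr_sumr; congr (_ * _).
  rewrite -(big_mkord xpredT (fun j => iota (zeta ^+ j.+1) * iter j.+1 sigma t)).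
  rewrite -(big_mkord xpredT (fun j => iota (zeta ^+ j) * iter j sigma t)).
  rewrite en big_nat_recr // [RHS]big_nat_recl //= -en addrC; congr (_ + _). by rewrite zeta_d -iterS -en di expr0.
Qed.

Variable s : F.
Hypothesis Rs : R s.
Hypotheses (Es0 : E s 0 = 0) (Es1 : E s (- 1) = 1).

Lemma s_neq0 : s != 0.
Proof.
by apply/eqP => e; move: Es1; rewrite e (E0 HE) => /esym/eqP; rewrite oner_eq0.
Qed.
Lemma s_max : max_ideal oo s. Proof. exact/(Hev0 Rs). Qed.
Lemma cl_oo : closed_point X oo.
Proof.
have [//|e] := X_cases Xoo.
have [_] := s_max; rewrite e; case; split=> //; exact: s_neq0.
Qed.
(** Comparing coefficients at 1/T shows that s is a unit of R times the generator of the prime of oo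
    given by [principal_prime]. *)
Lemma s_facts : [/\ unit_in eta s, ordv oo s = 1,
  forall h, R h -> max_ideal oo h -> R (h / s) &
  forall x, closed_point X x -> R `<=` x -> x <> oo -> unit_in x s].
Proof.
have [q [uq [Rq oq] gen ux]] := principal_prime R_csp cl_oo Rx.
have q0 : q != 0 by case: uq.
have mq : max_ideal oo q by apply/(ordv_max (closed_dvr cl_oo)) => _; rewrite oq.
have Eq0 : E q 0 = 0 by exact/(Hev0 Rq).
have [c Rc ec] := gen s Rs s_max.
have uc : unit_in R c.
  apply/(R_unit Rc). have e : E q (- 1) * E c 0 = 1.
    have := E_mul HE 1 (E_le0 Rq) (E_le0 Rc); rewrite -ec => e. move: e; rewrite Es1 !big_ord_recr big_ord0 /=.
    by rewrite // Eq0 mul0r !add0r => ->.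
  have Oq' := E_int (- 1) Rq. by apply: (unit_divl dO (E_int 0 Rc) Oq'); rewrite mulrC e; mem.
have [c0 _ Rc'] := uc.
split.
- rewrite ec; apply: (unitM leta) => //; split=> //; exact: R_eta.
- have ucx : unit_in oo c by split=> //; exact: Rx.
  by rewrite ec (ordvM (closed_dvr cl_oo)) // oq (ordv_unit (closed_dvr cl_oo) ucx).
- move=> h Rh mh; have [b Rb ->] := gen h Rh mh.
  have -> : q * b / s = b * c^-1 by rewrite ec; field; rewrite c0. by mem.
- move=> x cx Rsx ne; rewrite ec; apply: (unitM (closed_dvr cx)); first exact: ux.
  by split=> //; exact: Rsx.
Qed.
Lemma rho_s : uniformizer (rho @` R) (rho s).
Proof.
have [us _ gen _] := s_facts; have [r0 r1 rD rN rM] := rf_additive Hrho leta.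
have [_ _ rm] := Hrho; have es : eta s by case: us.
have rs0 : rho s != 0 by apply/eqP => /(rm _ es).1; exact: unit_not_max.
have dY := Y_dvr R_csp.
have rR h : R h -> max_ideal (rho @` R) (rho h) <-> max_ideal R h.
  exact: (rho_max RS).
have ms : max_ideal R s.
  split=> // /(R_unit Rs); rewrite Es0; case=> /eqP //.
split=> // h; split=> [mh|Yh]; last first.
  by rewrite -[h](divfK rs0); apply: (maxMl dY) => //; exact/(rR s Rs).
have [[a Ra ea] _] := mh; rewrite -ea in mh *; move/(rR a Ra): mh => ma.
have OEa := E_int 0 Ra.
have mE : max_ideal OK (E a 0) by split=> // /(R_unit Ra); case: ma.
have Rb := gen _ (srB lR Ra (R_iota OEa)) (R_ev Ra).
exists ((a - iota (E a 0)) / s) => //; apply: (mulIf rs0); rewrite divfK // -rM //; last exact: R_eta.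
rewrite divfK; last exact: s_neq0.
apply/(rf_eq Hrho leta); [by apply: R_eta; apply: (srB lR) => //; exact: R_iota|exact: R_eta|].
rewrite addrAC subrr sub0r; apply: (maxN leta); case: Seta => _ <- //.
Qed.
Lemma sigma_R h : R h <-> R (sigma h).
Proof.
split=> [/sE []//|Rh]; have [d0 di _] := sig_d.
rewrite -[h]di; have -> : iter d sigma h = iter d.-1 sigma (sigma h).
  by rewrite -iterSr prednK.
by case: (iter_sigma d.-1 Rh).
Qed.
Lemma eta_frac h : eta h -> exists a b, [/\ R a, R b, unit_in eta b & h = a / b].
Proof.
have [i cy] := MR; have ce := gen_chart cy (sp_mod Seta) (sp_eta RS).
move=> eh; have [a [b [Ca Cb ub ->]]] := chart_quot ce eh.
by exists a, b; split=> //; exact: (chart_C cy).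
Qed.
Lemma sigma_eta_max h : R h -> max_ideal eta h <-> max_ideal eta (sigma h).
Proof.
have epi : max_ideal eta (iota pi) by exact: unif_max leta eta_unif.
have imp v : R v -> max_ideal eta v -> max_ideal eta (sigma v).
  move=> Rv /(R_eta_pi Rv) [a Ra ->]; rewrite rmorphM sK; apply: (maxMr leta) => //. by apply: R_eta; apply/(sigma_R a).1.
have impk k v : R v -> max_ideal eta v -> max_ideal eta (iter k sigma v).
  elim: k => //= k IH Rv mv; apply: imp; last exact: IH. by case: (iter_sigma k Rv).
move=> Rh; split; first exact: imp.
have [d0 di _] := sig_d; move=> m; rewrite -[h]di.
have -> : iter d sigma h = iter d.-1 sigma (sigma h) by rewrite -iterSr prednK.
by apply: impk => //; exact: (sigma_R h).1.
Qed.
Lemma sigma_eta h : eta h -> eta (sigma h) /\ (max_ideal eta h <-> max_ideal eta (sigma h)).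
Proof.
move=> /eta_frac [a [b [Ra Rb ub ->]]]; rewrite fmorph_div.
have usb : unit_in eta (sigma b).
  have [//|/(sigma_eta_max Rb) m] := @unit_or_max _ eta _ (R_eta ((sigma_R b).1 Rb)). by case: (unit_not_max ub).
have esa := R_eta ((sigma_R a).1 Ra).
split; first mem.
have H u v : eta u -> unit_in eta v -> max_ideal eta (u / v) <-> max_ideal eta u.
  move=> eu uv; split=> m; first exact: (max_unit_mul leta (unitV uv) m). by mem.
by rewrite !H //; [exact: sigma_eta_max|exact: R_eta].
Qed.
Hypotheses (sbij : bijective sigma) (soo : sigma @^-1` oo = oo) (sig_s : sigma s = iota zeta^-1 * s).
Lemma sigma_closed x : closed_point X x <-> closed_point X (sigma @^-1` x).
Proof.
have [si st ts] := sbij; have inj (y y' : set F) : sigma @^-1` y = sigma @^-1` y' -> y = y'.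
  move=> e; have H v : y (sigma v) = y' (sigma v) by exact: (congr1 (fun B : set F => B v) e).
  by apply/funext => v; rewrite -[v]ts.
split=> -[Xx clx]; split; [exact: (sX x).1| |exact: (sX x).2|].
  move=> z Xz zx; have ez : z = sigma @^-1` (si @^-1` z) by apply/funext => v; rewrite /= st.
  rewrite ez (clx (si @^-1` z)) //; first by apply: (sX _).2; rewrite -ez. by move=> v /zx; rewrite /= ts.
by move=> y /(sX y).1 Xy yx; apply: inj; apply: clx => // v; exact: yx.
Qed.

(** * Reduction of functions to the special fibre *)

Hypothesis Hmu : enumerates (gap_sequence X (@zero_divisor F) oo) mu.
Hypothesis Hg : has_genus iota X g.
Hypotheses (g_ge2 : (2 <= g)%N) (dg1 : (2 * g + 1 <= d)%N).
Hypothesis Ocompl : forall x : nat -> K, (forall N, OK ((x N.+1 - x N) / pi ^+ N)) ->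
  exists l, forall N, OK ((l - x N) / pi ^+ N).

Local Notation cl := (closed_point X).
Local Notation dgX := (dg oo).
Local Notation dgY := (dg (rho @` R)).
Local Notation MX := (MD X oo).
Let de : dvr eta := eta_dvr. Let ue := eta_unif. Let Xd x : cl x -> dvr x := @closed_dvr x. Let coo := cl_oo.
Let XK x : cl x -> forall k, x (iota k). Proof. by case=> -[]. Qed.
Let Re := R_eta. Let Ri := R_iota. Let doo : dvr oo := Xd coo. Let lO : is_local OK := dO.
Let Yd z : closed_point Y z -> dvr z. Proof. by move=> /Y_closed [y cy ->]; exact: Y_dvr. Qed.
Let YR : closed_point Y (rho @` R) := Y_closed_sp R_csp. Let dYo : dvr (rho @` R) := Yd YR.
Let Koo h : oo h -> exists k, max_ideal oo (h - iota k). Proof. by case: Hoo => _ _ _ + _; apply. Qed.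
Let se : unit_in eta s. Proof. by case: s_facts. Qed.
Let sord : ordv oo s = 1. Proof. by case: s_facts. Qed.
Let sgen h : R h -> max_ideal oo h -> R (h / s). Proof. by case: s_facts => _ _ H _; exact: H. Qed.
Let sx x : cl x -> R `<=` x -> x <> oo -> unit_in x s. Proof. by case: s_facts => _ _ _; apply. Qed.
Implicit Types (h u v : F) (N : nat).
Ltac in_local B k ::= match goal with
  | H : is_local B |- _ => k H
  | H : dvr B |- _ => let H' := constr:(dvr_local H) in k H'
  | H : closed_point X B |- _ => let H' := constr:(dvr_local (Xd H)) in k H'
  end.

Lemma eta_iota a : OK a -> eta (iota a). Proof. by move=> Oa; apply: Re; exact: Ri. Qed.
Lemma OK_max_div a : max_ideal OK a -> exists2 b, OK b & a = pi * b.
Proof.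
case: upi => p0 H /H Ob; exists (a / pi) => //; by rewrite mulrC divfK.
Qed.
Lemma iota_max a : OK a -> max_ideal OK a <-> max_ideal eta (iota a).
Proof.
move=> Oa; split=> [/OK_max_div [b Ob ->]|m].
  by rewrite rmorphM; apply: (maxMr leta); [exact: mepi|exact: eta_iota].
split=> // -[a0 _ Oa']; apply: (unit_not_max _ m); split; first by rewrite fmorph_eq0.
  by mem.
by rewrite -fmorphV; exact: eta_iota.
Qed.
Lemma eta_OK a : eta (iota a) -> OK a.
Proof.
move=> ea; apply: contrapT => na; have a0 : a != 0.
  by apply/eqP => a0; apply: na; rewrite a0; mem.
have [//|Oa'] := valuation_ring dO a0.
have ma : max_ideal OK a^-1 by split=> // -[_ _]; rewrite invrK.
have := (iota_max Oa').1 ma; apply: unit_not_max; rewrite fmorphV; apply: unitV.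
by split; [rewrite fmorph_eq0|mem|rewrite -fmorphV; exact: eta_iota].
Qed.
Lemma rho0 : rho 0 = 0. Proof. by case: (rf_additive Hrho leta). Qed.
Lemma rho1 : rho 1 = 1. Proof. by case: (rf_additive Hrho leta). Qed.
Lemma rhoD u v : eta u -> eta v -> rho (u + v) = rho u + rho v.
Proof. by case: (rf_additive Hrho leta) => _ _ H _ _; exact: H. Qed.
Lemma rhoN u : eta u -> rho (- u) = - rho u.
Proof. by case: (rf_additive Hrho leta) => _ _ _ H _; exact: H. Qed.
Lemma rhoB u v : eta u -> eta v -> rho (u - v) = rho u - rho v.
Proof. by move=> eu ev; rewrite rhoD ?rhoN //; exact: (srN leta). Qed.
Lemma rhoM u v : eta u -> eta v -> rho (u * v) = rho u * rho v.
Proof. by case: (rf_additive Hrho leta) => _ _ _ _ H; exact: H. Qed.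
Lemma rhoX u n : eta u -> rho (u ^+ n) = rho u ^+ n.
Proof. exact: (rf_exp Hrho leta). Qed.
Lemma rho_eq0 u : eta u -> rho u = 0 <-> max_ideal eta u.
Proof. by case: Hrho => _ _; apply. Qed.
Lemma rho_neq0 u : unit_in eta u <-> eta u /\ rho u != 0.
Proof.
split=> [uu|[eu r0]].
  have [_ eu _] := uu; split=> //; apply/eqP => /(rho_eq0 eu).1; exact: unit_not_max.
by have [//|m] := @unit_or_max _ eta _ eu; move: r0; rewrite ((rho_eq0 eu).2 m) eqxx.
Qed.
Lemma rhoV u : unit_in eta u -> rho u^-1 = (rho u)^-1.
Proof.
move=> uu; have [u0 eu eu'] := uu; have [_ r0] := (rho_neq0 u).1 uu.
by apply: (mulfI r0); rewrite -rhoM // !mulfV // rho1.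
Qed.
Lemma rhoXz u (n : int) : unit_in eta u -> rho (u ^ n) = rho u ^ n.
Proof.
move=> uu; have [_ eu _] := uu; case: n => n; first by rewrite rhoX.
by rewrite NegzE -!exprnN rhoV ?rhoX; mem.
Qed.
Lemma rho_iota_unit a : unit_in OK a -> unit_in eta (iota a).
Proof.
case=> a0 Oa Oa'; split; first by rewrite fmorph_eq0.
  exact: eta_iota.
by rewrite -fmorphV; exact: eta_iota.
Qed.
Ltac mem_leaf ::= (exact: Opi) + (exact: mpi) + (exact: mepi) + (apply: eta_iota) + (apply: Re) + (apply: Ri) + (apply: XK).
Lemma scale_eta h : h != 0 -> exists n : int, unit_in eta (iota (pi ^ n) * h).
Proof.
move=> h0; exists (- ordv eta h); have := has_orderE de ue (ordvP de h0).
by rewrite invr_expz fmorphXz mulrC.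
Qed.
Lemma max_eta_div h : max_ideal eta h -> exists2 v, eta v & h = iota pi * v.
Proof.
by case: ue => p0 H /H ev; exists (h / iota pi) => //; rewrite mulrC divfK.
Qed.
Lemma eta_sep h : (forall n : nat, eta (h / iota (pi ^+ n))) -> h = 0.
Proof.
move=> H; apply/eqP; apply: contraT => h0.
pose n := absz (ordv eta h); have := H n.+1.
move/(ordv_ge0 de) => /(_ _); rewrite rmorphXn mulf_neq0 ?invr_eq0 ?expf_neq0 ?ipi0 //.
move=> /(_ isT); rewrite (ordv_div de) ?expf_neq0 ?ipi0 // (ordvX de) ?ipi0 //.
by rewrite (ordv_unif de ue) -mulr_natr; lia.
Qed.

Definition CX : set F := range iota.
Definition CY : set FY := rho @` (iota @` OK).
Lemma CX_sub : subring CX. Proof. exact: K_sub. Qed.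
Lemma CX_V a : CX a -> CX a^-1. Proof. exact: CV. Qed.
Lemma CX_oo : CX `<=` oo. Proof. by move=> _ [a _ <-]; exact: XK. Qed.
Lemma CX_res h : oo h -> exists2 a, CX a & max_ideal oo (h - a).
Proof. by move=> /Koo [a ma]; exists (iota a) => //; exists a. Qed.
Lemma CY_sub : subring CY.
Proof. by apply: (rf_image Hrho leta Oi_sub) => _ [a Oa <-]; exact: eta_iota. Qed.
Lemma CY_V a : CY a -> CY a^-1.
Proof.
move=> [_ [b Ob <-] <-]; have [ub|mb] := @unit_or_max _ OK _ Ob; last first.
  have -> : rho (iota b) = 0 by apply/rho_eq0; [mem|exact/iota_max]. by rewrite invr0; exact: sr0 CY_sub.
have [b0 _ Ob'] := ub; exists (iota b^-1) => //.
by rewrite fmorphV rhoV //; exact: rho_iota_unit.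
Qed.
Lemma CY_o : CY `<=` rho @` R.
Proof. by move=> _ [_ [b Ob <-] <-]; exists (iota b) => //; exact: Ri. Qed.
Lemma CY_res (h : FY) : (rho @` R) h -> exists2 a, CY a & max_ideal (rho @` R) (h - a).
Proof.
move=> [v Rv <-]; have Ov := E_int 0 Rv; exists (rho (iota (E v 0))).
  by exists (iota (E v 0)) => //; exists (E v 0).
have Rw := sgen (srB lR Rv (Ri Ov)) (R_ev Rv).
rewrite -rhoB; [|mem|mem].
rewrite -[v - _](divfK s_neq0) rhoM; [|mem|mem].
apply: (maxMl dYo); first mem.
exact: unif_max dYo rho_s.
Qed.
Lemma ordY_s : ordv (rho @` R) (rho s) = 1.
Proof. exact: (ordv_unif dYo rho_s). Qed.
Lemma rho_s0 : rho s != 0. Proof. by case: rho_s. Qed.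

(** TR N = T^N R *)
Definition TR N : set F := [set h | R (h * s ^+ N)].
Lemma TR_eta N h : TR N h -> eta h.
Proof.
move=> /Re eh; rewrite -[h](mulfK (expf_neq0 N s_neq0)).
by apply: (srM leta); have [] := unitV (unitX leta N se).
Qed.
Lemma TR_dgY N h : TR N h -> dle (rho @` R) N (rho h).
Proof.
move=> Th; have eh := TR_eta Th; move=> r0.
have : (rho @` R) (rho (h * s ^+ N)) by exists (h * s ^+ N).
have [_ es _] := unitX leta N se.
rewrite rhoM // => /(ordv_ge0 dYo) /(_ _); rewrite rhoX ?mulf_neq0 ?expf_neq0 ?rho_s0 //; last by case: se.
move=> /(_ isT); rewrite (ordvM dYo) ?expf_neq0 ?rho_s0 // (ordvX dYo) ?rho_s0 // ordY_s.
by rewrite /dg; lia.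
Qed.
Lemma TR_dgX N h : TR N h -> dle oo N h.
Proof.
move=> /Rx /(ordv_ge0 doo) H h0; have := H (mulf_neq0 h0 (expf_neq0 N s_neq0)).
rewrite (ordvM doo) ?expf_neq0 ?s_neq0 // (ordvX doo) ?s_neq0 // sord /dg; lia.
Qed.
Lemma TR_norm N h : eta h -> (forall x, cl x -> R `<=` x -> x <> oo -> x h) -> dle oo N h -> TR N h.
Proof.
move=> eh hx dh; apply: (normality R_csp).
  by apply: (srM leta); case: (unitX leta N se).
move=> x cx Rsx; have dx := Xd cx; have [xo|xo] := pselect (x = oo); last first.
  by apply: (srM dx); [exact: hx|apply: (srX dx); exact: Rsx].
rewrite xo; apply/(ordv_ge0 doo) => hs0.
have h0 : h != 0 by apply: contraNneq hs0 => ->; rewrite mul0r.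
have := dh h0; rewrite (ordvM doo) ?expf_neq0 ?s_neq0 // (ordvX doo) ?s_neq0 // sord.
by rewrite /dg; lia.
Qed.
Lemma TR_le M N h : (M <= N)%N -> TR M h -> TR N h.
Proof.
move=> le Th; rewrite /TR /= -(subnKC le) exprD mulrA.
by apply: (srM lR) => //; exact: (srX lR).
Qed.
Lemma TR_csub N : forall u v, TR N u -> TR N v -> TR N (u - v).
Proof. by move=> u v Tu Tv; rewrite /TR /= mulrBl; exact: (srB lR). Qed.
Lemma TRM M N u v : TR M u -> TR N v -> TR (M + N) (u * v).
Proof. by move=> Tu Tv; rewrite /TR /= exprD mulrACA; exact: (srM lR). Qed.
Lemma TR_pi N h : TR N h -> max_ideal eta h -> exists2 v, TR N v & h = iota pi * v.
Proof.
move=> Th mh; have m : max_ideal eta (h * s ^+ N).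
  by apply: (maxMr leta); case: (unitX leta N se).
have [a Ra e] := R_eta_pi Th m; exists (a / s ^+ N).
  by rewrite /TR /= divfK ?expf_neq0 ?s_neq0.
by apply: (mulIf (expf_neq0 N s_neq0)); rewrite -mulrA divfK ?expf_neq0 ?s_neq0.
Qed.
(** The ring R[1/s]: functions whose only poles near the closed point of the section are along the
    section. *)
Definition Om : set F := [set h | exists N, TR N h].
Lemma Om_sub : subring Om.
Proof.
split; first by exists 0%N; rewrite /TR /= mulr1; mem.
- move=> u v [M Tu] [N Tv]; exists (maxn M N); apply: TR_csub.
    exact: TR_le (leq_maxl _ _) Tu.
  exact: TR_le (leq_maxr _ _) Tv.
- by move=> u v [M Tu] [N Tv]; exists (M + N)%N; exact: TRM.
Qed.
Lemma Om_eta : Om `<=` eta. Proof. by move=> h [N /TR_eta]. Qed.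
Lemma R_Om : R `<=` Om. Proof. by move=> h Rh; exists 0%N; rewrite /TR /= mulr1. Qed.
Lemma Om_tau : Om s^-1.
Proof. by exists 1%N; rewrite /TR /= mulVf ?s_neq0 //; exact: (sr1 lR). Qed.
Lemma Om_pi h : Om h -> max_ideal eta h -> exists2 v, Om v & h = iota pi * v.
Proof. by move=> [N Th] mh; have [v Tv e] := TR_pi Th mh; exists v => //; exists N. Qed.

(** * Saturation and lattices of sections *)

Lemma csub_0 (G : fieldType) (C : set G) : csub C [set 0].
Proof. by split=> [//|a b -> ->|a b _ ->]; [exact: subr0|exact: mulr0]. Qed.

(** Saturation: by completeness of OK, reduction does not lose degrees. *)
Lemma saturation (V : set F) (us : seq F) v : csub CX V ->
  (forall u, u \in us -> [/\ V u, eta u & rho u != 0]) ->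
  uniq (map (fun u => dgY (rho u)) us) ->
  V v -> ~ cadjs CX [set 0] us v ->
  exists w, [/\ V w, eta w, rho w != 0 & dgY (rho w) \notin map (fun u => dgY (rho u)) us].
Proof.
move=> sV Hus uus Vv nv; apply: contrapT => nw.
pose W := cadjs CY [set 0] (map rho us).
have s0 := csub_0 CY.
have sW : csub CY W by exact: (cadjs_csub CY_sub _ s0).
have inW u : u \in us -> W (rho u).
  rewrite /W; elim: us {Hus uus nv nw W sW} => //= a us' IH; rewrite inE => /orP[/eqP->|ui].
    by apply: (cadj_r CY_sub); exact: (cadjs_csub CY_sub).
  by apply: (cadj_l CY_sub); exact: IH.
have degW w : V w -> eta w -> rho w != 0 -> degs (rho @` R) W (dgY (rho w)).
  move=> Vw ew w0; have : dgY (rho w) \in map (fun u => dgY (rho u)) us.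
    by apply: contraT => nin; case: nw; exists w.
  move=> /mapP[u ui ->]; exists (rho u); split=> //; [exact: inW|by case: (Hus u ui)].
have [b bP] : exists b : int, forall u, u \in us -> b <= dgY (rho u).
  elim: us {Hus uus nv nw W sW inW degW} => [|u us' [b IH]]; first by exists 0.
  exists (Num.min b (dgY (rho u))) => u'; rewrite inE => /orP[/eqP->|/IH]; lia.
(* As no reduction has a new degree, each w is modulo pi an OK-combination of us. The remainder
   divided by pi is again in V and integral at eta, so the division can be repeated. *)
have step w : V w /\ eta w -> exists (k : nat -> K) w', [/\ forall i, OK (k i), V w' /\ eta w' &
    w = \sum_(i < size us) iota (k i) * us`_i + iota pi * w'].
  move=> [Vw ew]; have [z Wz Hz] := reduce dYo CY_res b (rho w) sW. have [v0 [k' [-> Ck' ez]]] := cadjs_mem CY_sub Wz.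
  have [k kP] : {k : nat -> K & forall i, OK (k i) /\ rho (iota (k i)) = k' i}.
    apply: (@choice _ _ (fun i ki => OK ki /\ rho (iota ki) = k' i)) => i. by have [_ [a Oa <-] e] := Ck' i; exists a.
  pose S := \sum_(i < size us) iota (k i) * us`_i. have usi (i : 'I_(size us)) : us`_i \in us by exact: mem_nth.
  have VS : V S.
    apply: (cs_sum (C := CX)) => // i _; apply: (csZ sV); first by exists (k i). by case: (Hus _ (usi i)).
  have eS : eta S.
    apply: (sr_sum leta) => i _; apply: (srM leta); first by apply: eta_iota; case: (kP i). by case: (Hus _ (usi i)).
  have rS : rho S = z.
    rewrite ez add0r size_map (@rf_sum eta FY rho) //; last first.
    - move=> i _; apply: (srM leta); first by apply: eta_iota; case: (kP i).
      by case: (Hus _ (usi i)).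
    - exact: leta.
    apply: eq_bigr => i _; rewrite rhoM; [|by apply: eta_iota; case: (kP i)|by case: (Hus _ (usi i))].
    by rewrite (nth_map 0) //; case: (kP i) => _ ->.
  have ewS : eta (w - S) by mem. have VwS : V (w - S) by exact: (csB sV). have mwS : max_ideal eta (w - S).
    apply/(rho_eq0 ewS); rewrite rhoB // rS; case: Hz => // -[h0 Hd]. have dW : degs (rho @` R) W (dgY (rho w - z)).
      by rewrite -rS -rhoB //; apply: degW => //; rewrite rhoB // rS.
    case: Hd => // lt; exfalso. have : dgY (rho w - z) \in map (fun u => dgY (rho u)) us.
      apply: contraT => nin; case: nw; exists (w - S); rewrite rhoB // rS; split=> //.
    by move=> /mapP[u ui eu]; have := bP u ui; rewrite -eu leNgt lt.
  have [w' ew' eq'] := max_eta_div mwS. exists k, w'; split; first by move=> i; case: (kP i).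
    split=> //; have -> : w' = iota pi^-1 * (w - S) by rewrite eq' fmorphV mulKf ?ipi0.
    by apply: (csZ sV) => //; exists pi^-1.
  by rewrite -eq' addrC subrK.
have [v0|v0] := eqVneq v 0.
  by apply: nv; rewrite v0; apply: cs0 (cadjs_csub CX_sub us (csub_0 CX)).
have [n un] := scale_eta v0; have [w00 ew0 _] := un.
pose w0 := iota (pi ^ n) * v.
have Vw0 : V w0 by apply: (csZ sV) => //; exists (pi ^ n).
pose T := {w : F | V w /\ eta w}.
have stepT (w : T) : exists kw : (nat -> K) * T, (forall i, OK (kw.1 i)) /\
    sval w = \sum_(i < size us) iota (kw.1 i) * us`_i + iota pi * sval kw.2.
  by have [k [w' [Ok Hw' e]]] := step _ (svalP w); exists (k, exist _ w' Hw').
have [st stP] := choice stepT.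
pose ws (m : nat) : T := iter m (fun w => (st w).2) (exist _ w0 (conj Vw0 ew0)).
pose ks m i := (st (ws m)).1 i.
pose xs i N := \sum_(m < N) pi ^+ m * ks m i.
have Oks m i : OK (ks m i) := (stP (ws m)).1 i.
(* The digits ks m i sum to coefficients in OK; what then remains of w0 is divisible by every power
   of pi, so v would lie in the span of us. *)
have lim i : exists l, forall N, OK ((l - xs i N) / pi ^+ N).
  apply: Ocompl => N; rewrite /xs big_ord_recr /= [_ + pi ^+ N * _]addrC addrK mulrC mulKf //. by rewrite expf_neq0 // pi0.
have [l lP] := choice lim.
have main N : w0 = \sum_(i < size us) iota (xs i N) * us`_i + iota (pi ^+ N) * sval (ws N).
  elim: N => [|N IH].
    rewrite rmorph1 mul1r big1 ?add0r // => i _. by rewrite /xs big_ord0 rmorph0 mul0r.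
  have [_ e] := stP (ws N); rewrite IH e mulrDr addrA mulr_sumr -big_split /=; congr (_ + _).
    apply: eq_bigr => i _; rewrite /xs big_ord_recr rmorphD rmorphM mulrDl mulrA //.
  by rewrite exprSr rmorphM mulrA.
have e0 : w0 - \sum_(i < size us) iota (l i) * us`_i = 0.
  apply: eta_sep => N; rewrite {1}(main N) addrAC -sumrB mulrDl. apply: (srD leta); last first.
    rewrite mulrAC mulfV ?mul1r; last by rewrite fmorph_eq0 expf_neq0 // pi0. by case: (svalP (ws N)).
  rewrite mulr_suml; apply: (sr_sum leta) => i _. have -> : (iota (xs i N) * us`_i - iota (l i) * us`_i) / iota (pi ^+ N) =
     - (iota ((l i - xs i N) / pi ^+ N) * us`_i).
    by rewrite fmorph_div; ring.
  apply: (srN leta); apply: (srM leta); first mem. by case: (Hus us`_i (mem_nth _ (ltn_ord i))).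
apply: nv; have pn0 : pi ^ n != 0 by rewrite expfz_neq0 // pi0.
have -> : v = 0 + \sum_(i < size us) iota ((pi ^ n)^-1 * l i) * us`_i.
  apply: (mulfI (x := iota (pi ^ n))); first by rewrite fmorph_eq0.
  move/eqP: e0; rewrite subr_eq0 => /eqP e0; rewrite -/w0 e0 add0r mulr_sumr.
  by apply: eq_bigr => i _; rewrite mulrA -rmorphM mulVKf.
apply: (cadjs_in us (c := fun i => iota ((pi ^ n)^-1 * l i)) (csub_0 CX)) => // i.
by exists ((pi ^ n)^-1 * l i).
Qed.

Lemma span_degs (us : seq F) : exists L : seq int, (size L <= size us)%N /\
  forall n, degs oo (cadjs CX [set 0] us) n -> n \in L.
Proof.
elim: us => [|e us [L [sL HL]]].
  by exists [::]; split=> // n [v [-> /eqP]].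
have sW : csub CX (cadjs CX [set 0] us) by exact: (cadjs_csub CX_sub us (csub_0 CX)).
have [We|nW] := pselect (cadjs CX [set 0] us e).
  exists L; split=> /=; first exact: leqW. move=> n [v [Vv v0 dv]]; apply: HL; exists v; split=> //.
  exact: (cadj_sub sW _ We Vv).
have [b bP] : exists b : int, forall n, n \in L -> b <= n.
  elim: (L) => [|m L' [b IH]]; first by exists 0. by exists (Num.min b m) => u'; rewrite inE => /orP[/eqP->|/IH]; lia.
have [d' [_ ed]] := cadj_degs doo CX_sub CX_V CX_oo CX_res sW (fun n Hn => bP n (HL n Hn)) nW.
exists (d' :: L); split=> //= n; rewrite ed inE => -[/HL->|->]; first by rewrite orbT.
by rewrite eqxx.
Qed.

Definition rdegs (V : set F) : set int :=
  [set n | exists u, [/\ V u, eta u, rho u != 0 & dgY (rho u) = n]].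

(** Semicontinuity: as long as fewer reduced degrees than elements of L are found, some element of V
    is outside the span of the functions chosen so far, and [saturation] supplies one more
    degree. *)
Lemma saturate (V : set F) (L : seq int) : csub CX V -> uniq L ->
  (forall n, n \in L -> degs oo V n) ->
  exists L', [/\ size L' = size L, uniq L' & forall n, n \in L' -> rdegs V n].
Proof.
move=> sV uL HL; suff H j : (j <= size L)%N -> exists us : seq F, [/\ size us = j,
   forall u, u \in us -> [/\ V u, eta u & rho u != 0] & uniq (map (fun u => dgY (rho u)) us)].
  have [us [su Hus uus]] := H _ (leqnn _). exists (map (fun u => dgY (rho u)) us); split=> //; first by rewrite size_map.
  by move=> n /mapP[u ui ->]; have [] := Hus u ui; exists u.
elim: j => [|j IH] lt; first by exists [::].
have [us [su Hus uus]] := IH (ltnW lt).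
have [n [nL [v [Vv nv]]]] : exists n, n \in L /\ exists v, V v /\ ~ cadjs CX [set 0] us v.
  apply: contrapT => Hn; have [L' [sL' HL']] := span_degs us. have sub : {subset L <= L'}.
    move=> n nL; apply: HL'; have [v [Vv v0 dv]] := HL n nL; exists v; split=> //.
    by apply: contrapT => nv; apply: Hn; exists n; split=> //; exists v.
  by have := leq_trans (uniq_leq_size uL sub) sL'; rewrite su leqNgt lt.
have [w [Vw ew w0 wn]] := saturation sV Hus uus Vv nv.
exists (w :: us); split=> /=; first by rewrite su.
  by move=> u; rewrite inE => /orP[/eqP->|/Hus].
by rewrite wn.
Qed.
Lemma saturate_eq (V : set F) (L L' : seq int) : csub CX V -> uniq L ->
  (forall n, n \in L -> degs oo V n) -> (forall n, rdegs V n -> n \in L') ->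
  (size L' <= size L)%N -> forall n, n \in L' -> rdegs V n.
Proof.
move=> sV uL HL HL' le n nL'; have [M [sM uM HM]] := saturate sV uL HL.
have sub : {subset M <= L'} by move=> m /HM /HL'.
by apply: HM; have [_ ->] := uniq_min_size uM sub (leq_trans le (eq_leq (esym sM))).
Qed.

Lemma TR_drop N h : TR N.+1 h -> E (h * s ^+ N.+1) 0 = 0 -> TR N h.
Proof.
move=> Th e0; have := sgen Th; have := R_ev Th; rewrite e0 rmorph0 subr0 => m /(_ m).
by rewrite exprSr mulrA mulfK ?s_neq0.
Qed.
Lemma R_rho_unit h : R h -> unit_in (rho @` R) (rho h) <-> unit_in R h.
Proof.
move=> Rh; split=> [[h0 _ [v Rv ev]]|[h0 _ Rh']].
  have Rw : R (h * v - 1) by mem; mem. have mw : max_ideal eta (h * v - 1).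
    have e1 : rho (h * v) = 1 by rewrite rhoM ?ev ?mulfV; mem.
    apply/(rho_eq0 (Re Rw)); rewrite rhoB ?e1 ?rho1 ?subrr //; last mem. by mem.
  have [a Ra ea] := R_eta_pi Rw mw. have mpR : max_ideal R (iota pi).
    split; first mem. by move/(R_unit (Ri Opi)); rewrite (EC HE); case: mpi.
  have uv : unit_in R (h * v).
    by rewrite -[h * v](subrK 1) ea addrC; apply: (unitDmax lR); [mem|mem].
  exact: (unit_divl lR Rh Rv uv).
have uh : unit_in eta h by split; mem.
split; [by case: ((rho_neq0 h).1 uh)|by exists h|by exists h^-1 => //; rewrite rhoV].
Qed.
Lemma TR_lead N h : TR N h -> (rho h != 0 /\ dgY (rho h) = N%:Z) <-> unit_in OK (E (h * s ^+ N) 0).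
Proof.
move=> Th; have eh := TR_eta Th; have esN := unitX leta N se; have [_ esN' _] := esN.
have rs0 : rho (s ^+ N) != 0 by case: ((rho_neq0 _).1 esN).
rewrite -(R_unit Th) -(R_rho_unit Th) rhoM //.
have os : ordv (rho @` R) (rho (s ^+ N)) = N%:Z.
  rewrite rhoX; last exact: Re. by rewrite (ordvX dYo) ?rho_s0 // ordY_s -mulr_natr; lia.
split=> [[r0 dN]|u].
  apply: (unit_ordv dYo); first by rewrite mulf_neq0. by rewrite (ordvM dYo) // os; move: dN; rewrite /dg; lia.
have [m0 _ _] := u; have r0 : rho h != 0 by apply: contraNneq m0 => ->; rewrite mul0r.
by split=> //; have := ordv_unit dYo u; rewrite (ordvM dYo) // os /dg; lia.
Qed.
Definition monic_at N h := TR N h /\ E (h * s ^+ N) 0 = 1.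
Lemma monic_atE N h : monic_at N h -> [/\ unit_in eta h, dgY (rho h) = N%:Z & dgX h = N%:Z].
Proof.
move=> [Th e1]; have [|r0 dY] := (TR_lead Th).2; first by rewrite e1; mem.
have uh : unit_in eta h by apply/rho_neq0; split=> //; exact: TR_eta Th.
split=> //; have [h0 _ _] := uh.
have : unit_in R (h * s ^+ N) by apply/(R_unit Th); rewrite e1; mem.
case=> hs0 _ Ri'; have : unit_in oo (h * s ^+ N) by split=> //; exact: Rx.
move/(ordv_unit doo); rewrite (ordvM doo) ?expf_neq0 ?s_neq0 // (ordvX doo) ?s_neq0 // sord.
by rewrite /dg; lia.
Qed.

Definition A : set F := [set h | forall x, cl x -> x <> oo -> x h].
Definition A0 : set F := [set h | A h /\ eta h].
Definition AY : set FY := [set h | forall z, closed_point Y z -> z <> rho @` R -> z h].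
Definition gap (n : nat) := range mu n.
Lemma A_subring : subring A. Proof. exact: (A_sub oo Xd). Qed.
Lemma A0_sub : subring A0.
Proof.
split; first by split; [exact: sr1 A_subring|mem].
- by move=> u v [Au eu] [Av ev]; split; [exact: (srB A_subring)|mem].
- by move=> u v [Au eu] [Av ev]; split; [exact: (srM A_subring)|mem].
Qed.
Lemma AY_sub : subring AY. Proof. exact: (A_sub _ Yd). Qed.
Ltac in_ring B k ::= match goal with
  | H : subring B |- _ => k H
  | _ => in_local B ltac:(fun H => let H' := constr:(local_sr H) in k H')
  | _ => lazymatch B with Om => k Om_sub | A => k A_subring | A0 => k A0_sub | AY => k AY_sub | CX => k CX_sub | CY => k CY_sub end
  end.
Lemma A_csub : csub CX A. Proof. exact: (Acsub oo Xd XK). Qed.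
Let g0 : (0 < g)%N := ltnW g_ge2.
Lemma muY : enumerates (gap_sequence Y (@zero_divisor FY) (rho @` R)) mu.
Proof. by rewrite gapY; case: Hmu. Qed.
Lemma degA (n : nat) : degs oo A n%:Z <-> ~ gap n.
Proof. exact: (gapA Xd coo Hmu). Qed.
Lemma degA_ge0 n : degs oo A n -> 0 <= n.
Proof. exact: (degsA_ge0 Xd coo Hmu g0). Qed.
Lemma degAY (n : nat) : degs (rho @` R) AY n%:Z <-> ~ gap n.
Proof. exact: (gapA Yd YR muY). Qed.
Lemma degAY_ge0 n : degs (rho @` R) AY n -> 0 <= n.
Proof. exact: (degsA_ge0 Yd YR muY g0). Qed.
Lemma A_TR N h : A h -> eta h -> dle oo N h -> TR N h.
Proof. by move=> Ah eh; apply: TR_norm => // x cx _; exact: Ah. Qed.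
Lemma rhoA h : A0 h -> AY (rho h).
Proof.
move=> [Ah eh] z cz nz; have [y cy ez] := Y_closed cz.
have yh : y h.
  apply: (normality cy eh) => x cx yx; apply: Ah => // xo. by apply: nz; rewrite ez (csp_oo cy) // -xo.
by rewrite ez; exists h.
Qed.
Definition dlt N := [set h | dle oo N h].
Lemma dlt_csub N : csub CX (dlt N).
Proof.
split; [exact: dle0|by move=> u v; exact: dleB|].
by move=> a v Ca; exact: (dleZ doo CX_V CX_oo).
Qed.
Lemma csubI (V W : set F) : csub CX V -> csub CX W -> csub CX (V `&` W).
Proof.
move=> sV sW; split; first by split; [exact: cs0 sV|exact: cs0 sW].
- by move=> u v [Vu Wu] [Vv Wv]; split; [exact: (csB sV)|exact: (csB sW)].
- by move=> a v Ca [Vv Wv]; split; [exact: (csZ sV)|exact: (csZ sW)].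
Qed.
Lemma mem_nongaps gp N (n : nat) : (n%:Z \in [seq n%:Z | n <- seq.iota 0 N.+1 & ~~ `[< gp n >]]) <->
  (n <= N)%N /\ ~ gp n.
Proof.
split=> [/mapP[m]|[nN ng]].
  rewrite mem_filter mem_iota add0n ltnS => /andP[/asboolP ng mN] [->]; mem.
by apply/mapP; exists n => //; rewrite mem_filter mem_iota /= ltnS nN andbT; apply/asboolP.
Qed.

(** What equality of the gap sequences on both fibres provides. It holds for the functions regular
    off oo, in [A_good], and for the sections of D, in [D_good]. *)
Record good_lattice (V : set F) (gp : set nat) : Prop := GoodLattice {
  gl_csub : csub CX V;
  gl_TR : forall h N, V h -> eta h -> dle oo N h -> TR N h;
  gl_degs : forall n : nat, degs oo V n <-> ~ gp n;
  gl_ge0 : forall n, degs oo V n -> 0 <= n;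
  gl_rdegs : forall n, rdegs V n -> exists2 k : nat, n = k%:Z & ~ gp k }.

(** Up to degree n the reductions can only have the degrees outside [gp], and by saturation they
    have all of them. A function whose reduction has degree n, with no higher pole at oo, has a unit
    as leading coefficient. *)
Lemma good_basis V gp : good_lattice V gp -> forall n, ~ gp n -> exists2 w, V w & monic_at n w.
Proof.
move=> G n ng; pose L := [seq n%:Z | n <- seq.iota 0 n.+1 & ~~ `[< gp n >]].
pose Vn := V `&` dlt n.
have sVn : csub CX Vn by apply: csubI; [exact: gl_csub G|exact: dlt_csub].
have uL : uniq L by rewrite map_inj_uniq ?filter_uniq ?iota_uniq // => a b [].
have LP m : m \in L -> exists2 k : nat, m = k%:Z & (k <= n)%N /\ ~ gp k.
  move=> mL; have /mapP[k kL e] := mL; exists k => //; apply/mem_nongaps; by rewrite -e.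
have HL m : m \in L -> degs oo Vn m.
  move=> /LP [k -> [kn /(gl_degs G) [v [Vv v0 dv]]]]; exists v; split=> //; split=> //. by move=> _; rewrite dv; lia.
have HL' m : rdegs Vn m -> m \in L.
  move=> [u [[Vu du] eu u0 dm]]; have [|k ek ng'] := gl_rdegs G (n := m); first by exists u.
  rewrite ek; apply/mem_nongaps; split=> //. by have := TR_dgY (gl_TR G Vu eu du) u0; rewrite dm; lia.
have nL : n%:Z \in L by apply/mem_nongaps.
have [u [[Vu du] eu u0 dm]] := saturate_eq sVn uL HL HL' (leqnn _) nL.
have Tu := gl_TR G Vu eu du; have uE := (TR_lead Tu).1 (conj u0 dm).
have [e0 _ Oe'] := uE.
exists (iota (E (u * s ^+ n) 0)^-1 * u).
  by apply: (csZ (gl_csub G)) => //; exists (E (u * s ^+ n) 0)^-1.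
split; first by rewrite /TR /= -mulrA; apply: (srM lR) ; mem.
by rewrite -mulrA (EZ HE) mulVf.
Qed.

Lemma good_expand V gp (w : nat -> F) : good_lattice V gp ->
  (forall n, ~ gp n -> V (w n) /\ monic_at n (w n)) ->
  forall N h, V h -> TR N h -> exists k : nat -> K, [/\ forall n, OK (k n),
    forall n, gp n -> k n = 0 & h = \sum_(n < N.+1) iota (k n) * w n].
Proof.
move=> G wP N; have sV := gl_csub G.
have lead M h : V h -> TR M h -> exists a, [/\ OK a, gp M -> a = 0, V (h - iota a * w M),
    TR M (h - iota a * w M) & E ((h - iota a * w M) * s ^+ M) 0 = 0].
  move=> Vh Th; have Oa := E_int 0 Th; exists (E (h * s ^+ M) 0). have [gM|ngM] := pselect (gp M).
    suff e0 : E (h * s ^+ M) 0 = 0.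
      by rewrite e0 rmorph0 mul0r subr0; split; mem.
    apply/eqP; apply: contraT => ne; exfalso; suff : ~ gp M by apply. apply/(gl_degs G M). have u : unit_in oo (h * s ^+ M).
      have [//|m] := @unit_or_max _ oo _ (Rx Th). have m' : max_ideal oo (iota (E (h * s ^+ M) 0)).
        have := maxB doo m (R_ev Th); by rewrite opprB addrC subrK.
      case: (unit_not_max _ m'); split; rewrite ?fmorph_eq0 //; first mem. by rewrite -fmorphV; exact: XK.
    have [hs0 _ _] := u; have h0 : h != 0 by apply: contraNneq hs0 => ->; rewrite mul0r.
    exists h; split=> //; have := ordv_unit doo u.
    rewrite (ordvM doo) ?expf_neq0 ?s_neq0 // (ordvX doo) ?s_neq0 // sord /dg -mulr_natr. lia.
  have [Vw [Tw w1]] := wP M ngM; split=> //.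
  - by apply: (csB sV) => //; apply: (csZ sV) => //; exists (E (h * s ^+ M) 0).
  - rewrite /TR /= mulrBl -mulrA; apply: (srB lR) => //; apply: (srM lR) ; mem.
  - by rewrite mulrBl -mulrA (EB HE) (EZ HE) w1 mulr1 subrr.
elim: N => [|N IH] h Vh Th; have [a [Oa ga Vh' Th' e0]] := lead _ h Vh Th.
  exists (fun n => if n is 0 then a else 0); split.
  - by case=> [|n]; mem.
  - by case=> [|n] // /ga.
  rewrite big_ord1 /=; apply/eqP; rewrite -subr_eq0; apply: contraT => ne.
  have : 0 <= dgX (h - iota a * w 0%N) by apply: (gl_ge0 G); exists (h - iota a * w 0%N).
  have := R_ev Th'; rewrite e0 rmorph0 subr0 mulr1 => /(ordv_max doo) /(_ ne). by rewrite /dg; lia.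
have [k [Ok gk eh]] := IH _ Vh' (TR_drop Th' e0).
exists (fun n => if n == N.+1 then a else k n); split.
- by move=> n; case: eqP.
- by move=> n; case: eqP => [-> /ga|_ /gk].
rewrite big_ord_recr /= eqxx -[LHS](subrK (iota a * w N.+1)) eh; congr (_ + _).
by apply: eq_bigr => i _; rewrite ltn_eqF.
Qed.

Lemma A_good : good_lattice A gap.
Proof.
split; [exact: A_csub|by move=> h N Ah eh dh; exact: A_TR|exact: degA|exact: degA_ge0|].
move=> n [u [Au eu u0 dn]]; have dA : degs (rho @` R) AY n.
  by exists (rho u); split=> //; apply: rhoA.
have n0 := degAY_ge0 dA; exists (absz n); first by lia.
by apply/degAY; rewrite (_ : (absz n)%:Z = n) //; lia.
Qed.
(** The reductions of the monic functions given by [good_basis] already have all degrees of [AY]. *)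
Lemma AY_A0 (v : FY) : AY v -> exists2 h, A0 h & rho h = v.
Proof.
have sAY : csub CY AY.
  split; [mem|mem|]. move=> a w [_ [b Ob <-] <-] AYw; apply: (srM AY_sub) => //. apply: rhoA; split; last mem.
  by move=> x cx _; exact: XK.
have sW : csub CY (rho @` A0).
  split; first by exists 0; [mem|exact: rho0].
  - move=> _ _ [a Aa <-] [b Ab <-]; exists (a - b); first mem.
    by rewrite rhoB //; [case: Aa|case: Ab].
  - move=> _ _ [_ [b Ob <-] <-] [w Aw <-]; exists (iota b * w).
      apply: (srM A0_sub) => //; split; last mem. by move=> x cx _; exact: XK.
    by rewrite rhoM //; [mem|case: Aw].
have WV : rho @` A0 `<=` AY by move=> _ [h Ah <-]; exact: rhoA.
move=> AYv; have [h Ah e] : (rho @` A0) v; last by exists h.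
apply: (csub_eq dYo CY_res sAY sW WV degAY_ge0) AYv => n dn.
have n0 := degAY_ge0 dn; have en : n = (absz n)%:Z by lia.
rewrite en in dn *; have [w Aw mw] := good_basis A_good ((degAY _).1 dn).
have [uw dw _] := monic_atE mw; have [ew r0] := (rho_neq0 w).1 uw.
by exists (rho w); split=> //; exists w.
Qed.

(** A local equation at R of the closure of the divisor P *)
Definition loceq (P : set F -> int) (t : F) :=
  unit_in eta t /\ forall x, cl x -> R `<=` x -> ordv x t = P x.
(** Multiplication by the local equation t makes the sections of P regular near the section except
    at oo, so that they can be reduced and compared with [TR]. *)
Definition Wt (P : set F -> int) (t : F) : set F := [set t * v | v in MX P].

Lemma Wt_TR P t h N : loceq P t -> Wt P t h -> eta h -> dle oo N h -> TR N h.
Proof.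
move=> [ut Ht] [v Mv <-] eh dh; apply: TR_norm => // x cx Rsx xo; have dx := Xd cx.
have t0 : t != 0 by case: ut.
apply/(ordv_ge0 dx) => tv0; have v0 : v != 0 by apply: contraNneq tv0 => ->; rewrite mulr0.
by rewrite (ordvM dx) // Ht //; have := Mv x cx xo v0; lia.
Qed.
Lemma Wt_csub P t : loceq P t -> csub CX (Wt P t).
Proof.
move=> [[t0 _ _] _]; exact: (Oscale (MDcsub oo Xd XK P) t0).
Qed.
Lemma Wt_idx P t : loceq P t -> is_divisor X P -> degree iota P = 0 ->
  hasidx (degs oo (Wt P t)) g%:Z.
Proof.
move=> [[t0 _ _] Ht] HP dP; rewrite (degs_scale Xd coo mu g0) //.
have := hasidx_shift (dgX t) (idx_deg0 Xd XK coo Koo Hg generic_algebraic Hmu g0 HP dP).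
by congr hasidx; rewrite /dg Ht //; lia.
Qed.
(** The primes of R at the points of P are principal; t is the product of their generators with the
    multiplicities of P. *)
Lemma loceq_ex P : is_divisor X P -> exists t, loceq P t.
Proof.
move=> [Pcl Pfin]; have [s0 es0] := (finite_seqP _).1 Pfin.
pose ss := [seq x <- undup s0 | `[< R `<=` x >]].
have us : uniq ss by rewrite filter_uniq ?undup_uniq.
have ms x : x \in ss -> cl x /\ R `<=` x.
  rewrite mem_filter mem_undup => /andP[/asboolW Rsx xs]; split=> //; apply: Pcl. by have : [set` s0] x by []; rewrite -es0.
have H x : exists q, x \in ss -> [/\ unit_in eta q, ordv x q = 1 &
    forall x', cl x' -> R `<=` x' -> x' <> x -> unit_in x' q].
  have [xs|nxs] := boolP (x \in ss); last by exists 0.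
  have [cx Rsx] := ms x xs; have [q [uq [_ oq] _ ux]] := (principal_prime R_csp) cx Rsx. by exists q.
have [q qP] := choice H.
exists (\prod_(x <- ss) q x ^ P x); split.
  rewrite big_seq; elim/big_ind: _ => [|u v uu uv|x xs]; first mem.
    by mem.
  by apply: (unitXz leta); case: (qP x xs).
move=> y cy Ry; have dy := Xd cy.
have ord1 x : x \in ss -> ordv y (q x ^ P x) = if x == y then P x else 0.
  move=> xs; have [uq oq ux] := qP x xs; have q0 : q x != 0 by case: uq.
  rewrite (ordvXz dy) //; case: eqP => [xy|xy]; first by rewrite -xy oq mulr1.
  by rewrite (ordv_unit dy) ?mulr0 //; apply: ux => // yx; apply: xy.
have : ordv y (\prod_(x <- ss) q x ^ P x) = \sum_(x <- ss) if x == y then P x else 0.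
  have sub : {subset ss <= ss} by []. elim: {1 3 4}ss sub => [|x l IH] sub; first by rewrite !big_nil (ordv1 dy).
  have xs := sub x (mem_head _ _); have [[q0 _ _] _ _] := qP x xs.
  have sub' : {subset l <= ss} by move=> z zl; apply: sub; rewrite inE zl orbT.
  rewrite !big_cons (ordvM dy) ?expfz_neq0 ?ord1 ?IH //. rewrite prodf_seq_neq0; apply/allP => z zl; rewrite expfz_neq0 //.
  by have [[]] := qP z (sub' z zl).
move=> ->; have [ys|nys] := boolP (y \in ss).
  rewrite (big_rem y) //= eqxx big_seq big1 ?addr0 // => x. by rewrite mem_rem_uniq // => /andP[/negbTE->].
rewrite big_seq big1 => [|x xs]; last by case: eqP nys => // <-; rewrite xs.
apply/esym/eqP; apply: contraNT nys => Py; rewrite mem_filter mem_undup.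
have : [set x | P x != 0] y by []; rewrite es0 => ->; rewrite andbT; exact: asboolT.
Qed.

(** * Constants, sigma and section counts on the special fibre *)

Local Notation tau := (s^-1).
Local Notation gp := gap.

Lemma rho_nat (n : nat) : rho n%:R = n%:R.
Proof.
elim: n => [|n IH]; first exact: rho0.
rewrite -!natr1 rhoD ?rho1 ?IH //; last mem.
by mem.
Qed.
Lemma char_FY : p%:R = 0 :> FY.
Proof.
have e1 : iota p%:R = p%:R by rewrite rmorph_nat.
have mp : max_ideal eta (p%:R : F).
  by rewrite -e1; apply/iota_max; [case: pm|exact: pm].
by rewrite -rho_nat; apply/rho_eq0; case: mp.
Qed.
Lemma CY_root (b : FY) : CY b -> exists2 b', CY b' & b' ^+ p = b.
Proof.
move=> [_ [a Oa <-] <-]; have [e [e0 He]] := Hq1.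
exists (rho (iota (a ^+ (p ^ e.-1)))).
  by exists (iota (a ^+ (p ^ e.-1))) => //; exists (a ^+ (p ^ e.-1)) => //; exact: (srX dO).
have ea := eta_iota Oa.
rewrite rmorphXn rhoX // -exprM -expnSr prednK //.
have Oap : OK (a ^+ (p ^ e)) by exact: (srX dO).
have ea' : eta (iota (a ^+ (p ^ e))) by mem.
have Od : OK (a ^+ (p ^ e) - a) by mem.
apply/eqP; rewrite -rhoX // -rmorphXn -subr_eq0 -rhoB //; apply/eqP.
apply/rho_eq0; rewrite -rmorphB; first mem.
by apply/(iota_max Od); exact: He.
Qed.
Lemma CY_rootX k (b : FY) : CY b -> exists2 b', CY b' & b' ^+ (p ^ k) = b.
Proof.
elim: k b => [|k IH] b Cb; first by exists b; rewrite ?expn0.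
have [b1 Cb1 <-] := CY_root Cb; have [b2 Cb2 <-] := IH b1 Cb1.
by exists b2; rewrite // expnSr exprM.
Qed.

Lemma sb_ex : exists sb : FY -> FY, forall h, eta h -> sb (rho h) = rho (sigma h).
Proof.
have [sb sbP] : {sb : FY -> FY & forall y h, eta h -> rho h = y -> sb y = rho (sigma h)}.
  apply: (@choice _ _ (fun y w => forall h, eta h -> rho h = y -> w = rho (sigma h))) => y.
  have : [set: FY] y by []; have [_ <- _] := Hrho => -[h eh ey].
  exists (rho (sigma h)) => h' eh' ey'; have [es ms] := sigma_eta eh; have [es' _] := sigma_eta eh'.
  apply/eqP; rewrite -subr_eq0 -rhoB // -rmorphB; apply/eqP. have ed : eta (h - h') by mem. have [ed' md'] := sigma_eta ed.
  by apply/rho_eq0 => //; apply/md'; apply/rho_eq0 => //; rewrite rhoB // ey ey' subrr.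
by exists sb => h eh; exact: sbP.
Qed.

Section Sb.
Variable sb : FY -> FY.
Hypothesis sbE : forall h, eta h -> sb (rho h) = rho (sigma h).
Let surj (y : FY) : exists2 h, eta h & rho h = y.
Proof. by have : [set: FY] y by []; have [_ <- _] := Hrho. Qed.
Lemma sbB x y : sb (x - y) = sb x - sb y.
Proof.
have [h eh <-] := surj x; have [h' eh' <-] := surj y.
rewrite -rhoB // !sbE //; last mem.
by rewrite rmorphB rhoB //; [case: (sigma_eta eh)|case: (sigma_eta eh')].
Qed.
Lemma sbM x y : sb (x * y) = sb x * sb y.
Proof.
have [h eh <-] := surj x; have [h' eh' <-] := surj y.
rewrite -rhoM // !sbE //; last mem.
by rewrite rmorphM rhoM //; [case: (sigma_eta eh)|case: (sigma_eta eh')].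
Qed.
Lemma sb1 : sb 1 = 1.
Proof. by rewrite -rho1 sbE ?rmorph1 //; exact: (sr1 leta). Qed.
Lemma sbX x n : sb (x ^+ n) = sb x ^+ n.
Proof. by elim: n => [|n IH]; rewrite ?sb1 // !exprS sbM IH. Qed.
Lemma sb0 x : x != 0 -> sb x != 0.
Proof.
by move=> x0; apply/eqP => s0; have := sb1; rewrite -{1}(mulfV x0) sbM s0 mul0r => /eqP; rewrite eq_sym oner_eq0.
Qed.
Lemma sb_V x : x != 0 -> sb x^-1 = (sb x)^-1.
Proof. by move=> x0; apply: (mulfI (sb0 x0)); rewrite -sbM !mulfV ?sb1 ?sb0. Qed.
Lemma sbXz x (n : int) : x != 0 -> sb (x ^ n) = sb x ^ n.
Proof. by move=> x0; case: n => n; rewrite ?NegzE -?exprnN -?exprnP ?sb_V ?expf_neq0 // sbX. Qed.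

Let zb := rho (iota zeta).
(** [sb] fixes the constants and multiplies rho s by zb^-1, so it acts by zb^n on leading terms of
    pole order n. *)
Lemma sb_lead (h : FY) : h != 0 -> max_ideal (rho @` R) (sb h / h - zb ^ dgY h).
Proof.
have lY : is_local (rho @` R) := dYo.
have uz := rho_iota_unit zeta_unit.
have [ez rz0] := (rho_neq0 _).1 uz.
have rs0 := rho_s0; have es := Re Rs.
have sbs : sb (rho s) = zb^-1 * rho s.
  by rewrite sbE // sig_s rhoM // fmorphV ?rhoV; case: (unitV uz).
have sbO : forall x, (rho @` R) x -> (rho @` R) (sb x).
  move=> _ [v Rv <-]; rewrite sbE; last mem. by exists (sigma v) => //; exact: (sigma_R v).1.
have Czb : CY zb by exists (iota zeta) => //; exists zeta; case: zeta_unit.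
have YC (a : FY) : CY a -> (rho @` R) a by move=> [_ [b Ob <-] <-]; exists (iota b) ; mem.
have sbm x : max_ideal (rho @` R) x -> max_ideal (rho @` R) (sb x).
  have [_ H] := rho_s; move=> /H Ox; rewrite -[x](divfK rs0) sbM sbs. apply: (maxMl lY); first exact: sbO.
  by apply: (maxMl lY); [apply: YC; exact: CY_V|exact: unif_max lY rho_s].
have unitc x : unit_in (rho @` R) x -> max_ideal (rho @` R) (sb x / x - 1).
  move=> ux; have [x0 Ox Ox'] := ux; have [a Ca ma] := CY_res Ox. have sa : sb a = a.
    by case: Ca => _ [b Ob <-] <-; rewrite sbE ?sK; mem.
  have -> : sb x / x - 1 = (sb (x - a) - (x - a)) * x^-1.
    by rewrite sbB sa; field.
  by apply: (maxMr lY) => //; apply: (maxB lY) => //; exact: sbm.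
move=> h0; have [n nE] : exists n : int, ordv (rho @` R) h = n by eexists.
have us := rho_s.
have ux := has_orderE dYo us (ordvP dYo h0); rewrite nE in ux.
have [x0 _ _] := ux; set x := h / rho s ^ n in ux x0.
have sn0 : rho s ^ n != 0 by rewrite expfz_neq0.
have eh : h = x * rho s ^ n by rewrite divfK.
have -> : sb h / h - zb ^ dgY h = zb ^ (- n) * (sb x / x - 1).
  rewrite /dg nE eh sbM sbXz // sbs exprzMl ?unitfE ?invr_eq0 // exprz_inv. by field; rewrite x0.
apply: (maxMl lY); last exact: unitc.
case: (- n) => k; first by rewrite -exprnP; apply: (srX lY); exact: YC.
by rewrite NegzE -exprnN -exprVn; apply: (srX lY); apply: YC; exact: CY_V.
Qed.
End Sb.

Lemma gap_bound : exists B : nat, forall n, gap n -> (n < B)%N.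
Proof.
exists (\max_i mu i).+1 => n [i _ <-]; rewrite ltnS.
exact: leq_bigmax.
Qed.
Lemma degAY_count : exists D0 : nat, forall (D : nat) (L : seq int), (D0 <= D)%N -> uniq L ->
  (forall n, n \in L -> degs (rho @` R) AY n /\ n <= D%:Z) -> (size L + g <= D.+1)%N.
Proof.
have [B HB] := gap_bound; exists B => D L BD uL HL.
pose M := [seq absz n | n <- L] ++ [seq mu i | i : 'I_g].
have nn n : n \in L -> 0 <= n by move=> /HL[/degAY_ge0].
have uM : uniq M.
  rewrite cat_uniq map_inj_in_uniq ?uL => [|a b aL bL]; last by have := nn a aL; have := nn b bL; lia.
  rewrite (map_inj_uniq (mu_inj Hmu)) ?enum_uniq ?andbT //=. apply/hasPn => _ /mapP[i _ ->]; apply/negP => /mapP[n nL e].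
  have [dn _] := HL n nL; have en : n = (mu i)%:Z by have := nn n nL; lia.
  by rewrite en in dn; apply: ((degAY _).1 dn); exists i.
have sub : {subset M <= seq.iota 0 D.+1}.
  move=> k; rewrite mem_cat mem_iota /= add0n => /orP[/mapP[n nL ->]|/mapP[i _ ->]].
    by have [_] := HL n nL; have := nn n nL; lia.
  by have := HB (mu i) (ex_intro2 _ _ i I erefl); lia.
by have := uniq_leq_size uM sub; rewrite size_cat size_map size_image card_ord size_iota.
Qed.

(** Riemann's formula on the generic fibre transported by saturation; on the special fibre no such
    formula is used. *)
Lemma sat_list P t : loceq P t -> is_divisor X P -> degree iota P = 0 -> exists N0 : nat, forall N, (N0 <= N)%N ->
  exists L : seq int, [/\ uniq L, (size L + g = N)%N & forall m, m \in L -> rdegs (Wt P t) m /\ m < N%:Z].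
Proof.
move=> lt HP dP; have [N0 [lb HN]] := Wt_idx lt HP dP; exists N0.+1 => -[//|n] Nn.
have cN := HN n.+1 (ltnW Nn).
pose L := [seq i%:Z - n.+1%:Z | i <- seq.iota 0 (n.+1 + n.+1) & `[< degs oo (Wt P t) (i%:Z - n.+1%:Z) >]].
have sL : size L = cnt (degs oo (Wt P t)) n.+1 by rewrite size_map size_filter.
have uL : uniq L by rewrite map_inj_uniq ?filter_uniq ?iota_uniq // => a b; lia.
have sV : csub CX (Wt P t `&` dlt n) by apply: csubI; [exact: Wt_csub|exact: dlt_csub].
have HL m : m \in L -> degs oo (Wt P t `&` dlt n) m.
  move=> /mapP[i]; rewrite mem_filter mem_iota add0n => /andP[/asboolW [v [Wv v0 dv]] /andP[_ iN]] ->.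
  by exists v; split=> //; split=> // _; rewrite dv; lia.
have [L' [sL' uL' HL']] := saturate sV uL HL.
exists L'; split=> //; first by rewrite sL' sL; lia.
move=> m /HL' [v [[Wv dv] ev v0 dm]]; split; first by exists v.
by have := TR_dgY (Wt_TR lt Wv ev dv) v0; rewrite dm; lia.
Qed.
Lemma divZ P (k : int) : is_divisor X P -> is_divisor X (fun x => k * P x).
Proof.
move=> [cP fP]; split.
  by move=> x; rewrite mulf_eq0 negb_or => /andP[_]; exact: cP.
by apply: sub_finite_set fP => x /=; rewrite mulf_eq0 negb_or => /andP[].
Qed.
Lemma degZ P (k : int) : is_divisor X P -> degree iota P = 0 -> degree iota (fun x => k * P x) = 0.
Proof.
move=> [_ fP] dP; have [->|k0] := eqVneq k 0.
  rewrite /degree (_ : [set x | _] = set0) ?fsbig_set0 //. by apply/seteqP; split=> // x /=; rewrite mul0r.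
rewrite /degree (_ : [set x | _] = [set x | P x != 0]); last first.
  by apply/seteqP; split=> x /=; rewrite mulf_eq0 (negbTE k0).
transitivity (k * degree iota P); last by rewrite dP mulr0.
by rewrite /degree !fsbig_finite //= mulr_sumr; apply: eq_bigr => x _; rewrite mulrA.
Qed.

(** A section of negative degree on the special fibre, multiplied by the
    sections of the inverse sheaf, would give too few of the latter. *)
Lemma rdegs_ge0 P t m : loceq P t -> is_divisor X P -> degree iota P = 0 -> rdegs (Wt P t) m -> 0 <= m.
Proof.
move=> [ut Ht] HP dP [_ [[v Mv <-] eu u0 dm]]; have [t0 _ _] := ut.
have lt' : loceq (fun x => -1 * P x) t^-1.
  by split=> [|x cx Rsx]; [mem|rewrite (ordvV (Xd cx)) // Ht // mulN1r].
have [N0 HN] := sat_list lt' (divZ _ HP) (degZ _ HP dP); have [D0 HD0] := degAY_count.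
rewrite leNgt; apply/negP => m0.
have [L [uL sL HL]] := HN (N0 + D0 + absz m + 1)%N ltac:(lia).
have := HD0 (N0 + D0)%N [seq m + l | l <- L] ltac:(lia); rewrite map_inj_uniq => [/(_ uL)|a b]; last by lia.
rewrite size_map sL => H; suff /H : forall n, n \in [seq m + l | l <- L] -> degs (rho @` R) AY n /\ n <= (N0 + D0)%N by lia.
move=> _ /mapP[l /HL [[_ [[v' Mv' <-] ev' v0' dv']] lN] ->]; split; last by lia.
exists (rho ((t * v) * (t^-1 * v'))); split.
- apply: rhoA; split; last mem.
  have -> : t * v * (t^-1 * v') = v * v' by field. move=> x cx xo; apply/(ordv_ge0 (Xd cx)).
  by have := MDM Xd Mv Mv' cx xo; rewrite mulN1r subrr.
- by rewrite rhoM // mulf_neq0.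
- by rewrite rhoM // (dgM dYo) // dm dv'.
Qed.

Lemma rdegs_count P t : loceq P t -> is_divisor X P -> degree iota P = 0 -> exists c0 : nat, forall n, (c0 <= n)%N ->
  (n.+1 <= count (fun i : nat => `[< rdegs (Wt P t) i%:Z >]) (seq.iota 0 n.+1) + g)%N.
Proof.
move=> lt HP dP; have [N0 HN] := sat_list lt HP dP; exists N0 => n Nn.
have [L [uL sL HL]] := HN n.+1 (leqW Nn).
have nn a : a \in L -> 0 <= a by move=> /HL[ra _]; exact: rdegs_ge0 lt HP dP ra.
have sub : {subset [seq absz m | m <- L] <= [seq i <- seq.iota 0 n.+1 | `[< rdegs (Wt P t) i%:Z >]]}.
  move=> _ /mapP[m mL ->]; have [rm mn] := HL m mL; have m0 := nn m mL. have em : (absz m)%:Z = m by lia.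
  by rewrite mem_filter mem_iota em asboolT //=; lia.
have := @uniq_leq_size _ _ _ _ sub; rewrite map_inj_in_uniq ?uL => [/(_ isT)|a b /nn a0 /nn b0]; last by lia.
by rewrite size_map size_filter -sL leq_add2r.
Qed.

Lemma Wt_AM P t a w : A a -> Wt P t w -> Wt P t (a * w).
Proof.
move=> Aa [v Mv <-]; exists (a * v); last by rewrite mulrCA.
move=> x cx xo; rewrite -[- P x]add0r; apply: (vgeM (Xd cx)); last exact: Mv.
by apply/(ordv_ge0 (Xd cx)); exact: Aa.
Qed.

(** The count yields one reduced section; products with functions of all large degrees give the
    rest. *)
Lemma rdegs_top P t : loceq P t -> is_divisor X P -> degree iota P = 0 ->
  exists c0 : nat, forall n : int, c0%:Z <= n -> rdegs (Wt P t) n.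
Proof.
move=> lt HP dP; have [c0 Hc] := rdegs_count lt HP dP.
have [n [v [Wv ev v0 dv]]] : exists n, rdegs (Wt P t) n.
  apply: contrapT => nex; have := Hc (c0 + g)%N (leq_addr _ _).
  rewrite (eq_count (a2 := pred0)) ?count_pred0 => [|i]; last by apply/asboolP => H; apply: nex; exists i%:Z. lia.
have [B HB] := gap_bound; exists (B + absz n)%N => m Hm.
have : degs (rho @` R) AY (absz (m - n)).
  by apply/degAY => /HB; lia.
move=> [_ [/AY_A0 [a [Aa ea] <-] a0 da]]; exists (a * v); split.
- exact: Wt_AM.
- by mem.
- by rewrite rhoM // mulf_neq0.
- by rewrite rhoM // (dgM dYo) // da; lia.
Qed.

Lemma sigma_ord x f0 : cl x -> f0 != 0 -> ordv x (sigma f0) = ordv (sigma @^-1` x) f0.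
Proof.
move=> cx f0n; have cx' := (sigma_closed x).1 cx; have dx := Xd cx; have dx' := Xd cx'.
have sf0 : sigma f0 != 0 by rewrite fmorph_eq0.
have [tau st ts] := sbij.
have uE v : unit_in (sigma @^-1` x) v <-> unit_in x (sigma v).
  by split=> -[v0 xv xv']; split; rewrite -?fmorphV // in v0 xv xv' *;
    move: v0; rewrite fmorph_eq0.
have [t ut] := dvr_unif dx; have [t0 Ht] := ut.
have ut' : uniformizer (sigma @^-1` x) (tau t).
  split; first by apply: contraNneq t0 => e; rewrite -[t]ts e rmorph0.
  move=> v; rewrite -[X in _ <-> X]/(x (sigma (v / tau t))) rmorphM fmorphV ts -Ht. split=> -[H1 H2]; split=> //; by move/uE.
apply/esym/(ordvE dx').
exists (tau t); split=> //; apply/uE; rewrite rmorphM fmorphV fmorphXz ts.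
exact: (has_orderE dx ut (ordvP dx sf0)).
Qed.

(** * Extraction of p-th roots from the reduction of f *)

Section Descend.
Variables (P : set F -> int) (n z : nat) (f h : F) (a : K).
Hypotheses (HP : is_divisor X P) (dP : degree iota P = 0) (uf : unit_in eta f).
Hypothesis of_ : forall x, cl x -> ordv x f = (p ^ n)%N%:Z * P x.
Hypotheses (uh : unit_in eta h) (ua : unit_in OK a) (sf : sigma f = iota a * f ^+ z * h ^+ (p ^ n)).
Hypothesis zz : max_ideal OK (z%:R - zeta).
Let f0 : f != 0. Proof. by case: uf. Qed.
(** The powers f^j act on the sections of j(p^k)^-1 div f. *)
Lemma fW k j t w : (k <= n)%N -> loceq (fun x => (p ^ (n - k))%N%:Z * P x) t ->
  Wt (fun x => (j * p ^ (n - k))%N%:Z * P x) (t ^+ j) w -> eta w ->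
  A0 ((f / t ^+ (p ^ k)) ^+ j * w ^+ (p ^ k)).
Proof.
move=> kn [ut Ht] [v Mv <-] ew; have [t0 _ _] := ut.
split; last first.
  apply: (srM leta); apply: (srX leta) => //. by have [] := unitM leta uf (unitV (unitX leta (p ^ k) ut)).
have -> : (f / t ^+ (p ^ k)) ^+ j * (t ^+ j * v) ^+ (p ^ k) = f ^+ j * v ^+ (p ^ k).
  rewrite expr_div_n exprMn -!exprM [(j * _)%N]mulnC; field; exact: expf_neq0.
move=> x cx xo; have dx := Xd cx; apply/(ordv_ge0 dx) => n0.
have v0 : v != 0.
  apply: contraNneq n0 => ->; rewrite expr0n expn_eq0 gtn_eqF ?(prime_gt0 pr) //= mulr0 //.
rewrite (ordvM dx) ?expf_neq0 // !(ordvX dx) // of_ //.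
have -> : (p ^ n)%N = (p ^ (n - k) * p ^ k)%N by rewrite -expnD subnK.
have := Mv x cx xo v0; move: (p ^ (n - k))%N (p ^ k)%N (ordv x v) (P x) => q1 q2 o y.
have mE (b : int) m : b *+ m = b * m%:Z by rewrite -mulr_natr natz.
rewrite !mE !PoszM => H; have : 0 <= (o + j%:Z * q1%:Z * y) * q2%:Z by apply: mulr_ge0; lia.
lia.
Qed.

Lemma f_unit k t : (k <= n)%N -> loceq (fun x => (p ^ (n - k))%N%:Z * P x) t -> unit_in R (f / t ^+ (p ^ k)).
Proof.
move=> kn [ut Ht]; have [t0 _ _] := ut.
have uu : unit_in eta (f / t ^+ (p ^ k)) := unitM leta uf (unitV (unitX leta (p ^ k) ut)).
have [u0 eu eu'] := uu.
have o0 x : cl x -> R `<=` x -> unit_in x (f / t ^+ (p ^ k)).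
  move=> cx Rsx; have dx := Xd cx; apply: (unit_ordv dx) => //.
  rewrite (ordv_div dx) ?expf_neq0 // (ordvX dx) // of_ // Ht //.
  have mE (b : int) m : b *+ m = b * m%:Z by rewrite -mulr_natr natz. by rewrite mE -{1}(subnK kn) expnD; lia.
split=> //; apply: (normality R_csp) => // x cx Rsx; by have [] := o0 x cx Rsx.
Qed.

(** Changing t to a local equation t' of p^(n-k-1) P multiplies v by the reduction of t / t'^p: this
    is u, and it has to be a p-th power. Otherwise the order i0 given by [break_ex] is less than 2g
    while d divides i0 + 1, against d > 2g. *)
Lemma descend_step k t (v : FY) : (k < n)%N -> loceq (fun x => (p ^ (n - k))%N%:Z * P x) t ->
  rho (f / t ^+ (p ^ k)) = v ^+ (p ^ k) -> exists (t' : F) (v' : FY),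
  loceq (fun x => (p ^ (n - k.+1))%N%:Z * P x) t' /\ rho (f / t' ^+ (p ^ k.+1)) = v' ^+ (p ^ k.+1).
Proof.
move=> kn lt rv; have pF := char_FY.
have pk0 : (0 < p ^ k)%N by rewrite expn_gt0 prime_gt0.
have [t' lt'] := loceq_ex (divZ (p ^ (n - k.+1))%N HP); exists t'.
have [ut Ht] := lt; have [ut' Ht'] := lt'; have [t0 et _] := ut; have [t'0 et' _] := ut'.
pose u := v * rho (t / t' ^+ p).
have ett : unit_in eta (t / t' ^+ p) := unitM leta ut (unitV (unitX leta p ut')).
have [_ ett0 _] := ett.
have eq1 : f / t' ^+ (p ^ k.+1) = f / t ^+ (p ^ k) * (t / t' ^+ p) ^+ (p ^ k).
  by rewrite expr_div_n -exprM -expnS; field; rewrite !expf_neq0.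
have [_ eft _] : unit_in eta (f / t ^+ (p ^ k)) := unitM leta uf (unitV (unitX leta (p ^ k) ut)).
have ru : rho (f / t' ^+ (p ^ k.+1)) = u ^+ (p ^ k).
  by rewrite eq1 rhoM ?rhoX ?rv -?exprMn //; exact: (srX leta).
have uR := f_unit kn lt'; have [_ Rf' _] := uR; have ef' := Re Rf'.
have uu : unit_in (rho @` R) u.
  have : unit_in (rho @` R) (u ^+ (p ^ k)) by rewrite -ru; apply/R_rho_unit. move=> H; have [un0 _ _] := H; have u0 : u != 0.
    by apply: contraNneq un0 => ->; rewrite expr0n gtn_eqF.
  apply: (unit_ordv dYo); have := ordv_unit dYo H; rewrite (ordvX dYo) //. by rewrite -mulr_natr; nia.
suff [v' ev'] : exists v' : FY, u = v' ^+ p.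
  by exists v'; split; rewrite // ru ev' -exprM -expnS.
apply: contrapT => nu.
pose Q j := fun x => (j * p ^ (n - k.+1))%N%:Z * P x.
have lQ j : loceq (Q j) (t' ^+ j).
  split; first mem. move=> x cx Rsx; rewrite (ordvX (Xd cx)) // Ht' // /Q -mulr_natr natz; lia.
have AW j w : Wt (Q j) (t' ^+ j) w -> eta w -> AY (u ^+ j * rho w ^+ p).
  move=> Ww ew z' cz nz; have dz := Yd cz; apply: (dvr_integral dz pk0). have Aw := fW kn lt' Ww ew.
  have -> : (u ^+ j * rho w ^+ p) ^+ (p ^ k) = rho ((f / t' ^+ (p ^ k.+1)) ^+ j * w ^+ (p ^ k.+1)).
    rewrite rhoM ?rhoX ?ru; try exact: (srX leta); rewrite // exprMn -!exprM.
    by rewrite [(j * _)%N]mulnC [(p * _)%N]mulnC expnSr.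
  by apply: (rhoA Aw).
have [c1 Hc1] : exists c1 : nat -> nat, forall j N, (c1 j <= N)%N ->
    (N.+1 <= count (fun i : nat => `[< rdegs (Wt (Q j) (t' ^+ j)) i%:Z >]) (seq.iota 0 N.+1) + g)%N.
  have [c1 Hc1] := choice (fun j => rdegs_count (lQ j) (divZ _ HP) (degZ _ HP dP)); by exists c1.
have [c2 Hc2] : exists c2 : nat -> nat, forall j (m : int), (c2 j)%:Z <= m -> rdegs (Wt (Q j) (t' ^+ j)) m.
  have [c2 Hc2] := choice (fun j => rdegs_top (lQ j) (divZ _ HP) (degZ _ HP dP)); by exists c2.
pose c0 := \max_(j < p) maxn (c1 j) (c2 j).
have c0P j : (j < p)%N -> (c1 j <= c0)%N /\ (c2 j <= c0)%N.
  move=> jp; have := @leq_bigmax _ (fun j : 'I_p => maxn (c1 j) (c2 j)) (Ordinal jp). by rewrite geq_max -/c0 => /andP.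
pose W j := rho @` (Wt (Q j) (t' ^+ j) `&` eta).
have rW j m : rdegs (Wt (Q j) (t' ^+ j)) m <-> degs (rho @` R) (W j) m.
  split=> [[w [Ww ew w0 dm]]|[_ [[w [Ww ew] <-] w0 dm]]]; last by exists w. by exists (rho w); split=> //; exists w.
have sW j : csub CY (W j).
  have sWt := Wt_csub (lQ j); split.
  - by exists 0; [split; [exact: cs0 sWt|mem]|exact: rho0].
  - move=> _ _ [w [Ww ew] <-] [w' [Ww' ew'] <-]; exists (w - w'); last exact: rhoB.
    by split; [exact: (csB sWt)|mem].
  - move=> _ _ [_ [b Ob <-] <-] [w [Ww ew] <-]; have eb := eta_iota Ob.
    exists (iota b * w); last exact: rhoM. by split; [apply: (csZ sWt) => //; exists b|mem].
have sAY : csub CY AY.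
  split; [mem|mem|]. move=> b w [_ [e Oe <-] <-] Aw; apply: (srM (AY_sub)) => //; apply: rhoA.
  by split; [move=> x cx _; mem|mem].
have [D0 HD0] := degAY_count.
have HW j N : (j < p)%N -> (c0 <= N)%N -> (N.+1 <= cW (rho @` R) W j N.+1 + g)%N.
  move=> jp cN; have [l1 _] := c0P j jp; apply: leq_trans (Hc1 j N (leq_trans l1 cN)) _.
  by rewrite leq_add2r; apply: sub_count => i /asboolW H; apply: asboolT; apply/rW.
have Wc0 j (m : int) : (j < p)%N -> c0%:Z <= m -> degs (rho @` R) (W j) m.
  by move=> jp cm; apply/rW/Hc2; have [_ l2] := c0P j jp; lia.
have uW j (w : FY) : (j < p)%N -> W j w -> AY (u ^+ j * w ^+ p).
  by move=> _ [w' [Ww ew] <-]; exact: AW.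
have CYV (b : FY) : CY b -> CY b^-1 by exact: CY_V.
have CYo : CY `<=` rho @` R by exact: CY_o.
have [y [ete [i0 [uy eta0 di [npi i1]]]]] := break_ex dYo CY_sub CYV CYo CY_res pr pF CY_root
  sAY degAY_ge0 HD0 sW HW Wc0 uW uu nu.
have ib := break_bound dYo CY_sub CYV CYo CY_res pr pF CY_root
  sAY degAY_ge0 HD0 sW HW Wc0 uW uy eta0 di npi.
have [sb sbE] := sb_ex; have [zn0 Oz Oz'] := zeta_unit.
have zu' := rho_iota_unit zeta_unit; have [ezt rz0] := (rho_neq0 _).1 zu'.
have zE : z%:R = rho (iota zeta).
  have Ozz : OK z%:R by mem; rewrite -pmulrn. have ezz := eta_iota Ozz.
  rewrite -rho_nat -(rmorph_nat iota); apply/eqP; rewrite -subr_eq0 -rhoB // -rmorphB; apply/eqP.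
  by apply/rho_eq0; [apply: eta_iota|apply/iota_max => //]; mem.
have Czb : CY (rho (iota zeta)) by exists (iota zeta) => //; exists zeta.
have [a0 Oa _] := ua; have ea := eta_iota Oa.
have Ca : CY (rho (iota a)) by exists (iota a) => //; exists a.
have [b Cb eb] := CY_rootX k Ca.
have [h0 eh _] := uh; have [est' mst'] := sigma_eta et'.
have ust' : unit_in eta (sigma t').
  have [//|m] := @unit_or_max _ eta _ est'; case: (unit_not_max ut'); exact/mst'.
have [st0 _ est'V] := ust'.
pose th := t' ^+ z * h ^+ (p ^ (n - k.+1)) / sigma t'.
have eth : eta th by do 2 ?[apply: (srM leta)] => //; exact: (srX leta).
have esf : sigma (f / t' ^+ (p ^ k.+1)) = iota a * (f / t' ^+ (p ^ k.+1)) ^+ z * th ^+ (p ^ k.+1).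
  rewrite rmorphM fmorphV rmorphXn sf /th.
  have -> : h ^+ (p ^ n) = (h ^+ (p ^ (n - k.+1))) ^+ (p ^ k.+1) by rewrite -exprM -expnD subnK.
  by rewrite !expr_div_n exprMn -!exprM [(p ^ k.+1 * z)%N]mulnC; field; rewrite !expf_neq0.
(* The equation of sigma f, reduced, holds after raising to the power p^k, and p^k-th roots are
   unique in characteristic p. *)
have su : sb u = b * u ^+ z * rho th ^+ p.
  apply: (frob_inj pr pF (n := k)); rewrite -(sbX sbE) -ru sbE // esf.
  have e1 (x x' w : F) z' q : eta x -> eta x' -> eta w ->
      rho (x * x' ^+ z' * w ^+ q) = rho x * rho x' ^+ z' * rho w ^+ q.
    move=> ex ex' ew; have eyz : eta (x' ^+ z') by exact: (srX leta). have ewq : eta (w ^+ q) by exact: (srX leta).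
    by rewrite rhoM // ?rhoM ?rhoX //; mem.
  by rewrite e1 // ru -eb !exprMn -!exprM [(z * _)%N]mulnC expnSr [(p ^ k * p)%N]mulnC.
have := eigen_break dYo CY_sub CYV CYo pr pF CY_root (sbB sbE) (sbM sbE) (sb_lead sbE)
  Czb rz0 zE Cb uu su uy eta0 di npi i1.
rewrite -rhoX // -rmorphXn => zi.
have Ozi : OK (zeta ^+ i0.+1) by exact: (srX dO).
have /zeta_unity : max_ideal OK (zeta ^+ i0.+1 - 1).
  have Od : OK (zeta ^+ i0.+1 - 1) by mem; mem. apply/(iota_max Od)/rho_eq0; first mem.
  rewrite rmorphB rhoB ?zi ?rmorph1 ?rho1 ?subrr //; [mem|mem].
by move=> /(dvdn_leq (ltn0Sn _)) dl; have cd := dg1; clear -dl cd ib; lia.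
Qed.

Lemma descend : exists t (v : FY), loceq P t /\ rho (f / t ^+ (p ^ n)) = v ^+ (p ^ n).
Proof.
have H k : (k <= n)%N -> exists t (v : FY), loceq (fun x => (p ^ (n - k))%N%:Z * P x) t /\
    rho (f / t ^+ (p ^ k)) = v ^+ (p ^ k).
  elim: k => [|k IH] kn.
    exists f, 1; rewrite subn0 expr1 mulfV // rho1; split=> //. by split=> // x cx _; exact: of_.
  by have [t [v [lt rv]]] := IH (ltnW kn); exact: descend_step kn lt rv.
have [t [v [[ut Ht] rv]]] := H _ (leqnn n); exists t, v; split=> //; split=> // x cx Rsx.
by rewrite Ht // subnn mul1r.
Qed.
End Descend.

Lemma deg0_const (G : fieldType) (O C V : set G) (h : G) : dvr O -> subring C -> csub C V -> C `<=` V ->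
  (forall x, O x -> exists2 a, C a & max_ideal O (x - a)) -> (forall n, degs O V n -> 0 <= n) ->
  V h -> dle O 0 h -> C h.
Proof.
move=> dG sC sV CV Cres V0 Vh /(dle0_O dG) /Cres [a Ca ma].
suff e : h - a = 0 by rewrite -[h](subrK a) e add0r.
apply/eqP; apply: contraT => n0; have : 0 <= dg O (h - a).
  by apply: V0; exists (h - a); split=> //; apply: (csB sV) => //; exact: CV.
by have := (ordv_max dG _).1 ma n0; rewrite /dg; lia.
Qed.
Lemma CY_AY : CY `<=` AY.
Proof.
move=> _ [_ [b Ob <-] <-]; apply: rhoA; split; last mem.
by move=> x cx _; exact: XK.
Qed.
Lemma AY_csub : csub CY AY.
Proof.
split; [mem|mem|].
by move=> b w /CY_AY Ab Aw; mem.
Qed.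
Lemma AY_const (h : FY) : AY h -> dle (rho @` R) 0 h -> CY h.
Proof.
exact: (deg0_const dYo CY_sub AY_csub CY_AY CY_res (degAY_ge0)).
Qed.
Lemma A_const h : A h -> dle oo 0 h -> CX h.
Proof.
apply: (deg0_const doo CX_sub (A_csub)); [|exact: CX_res|exact: degA_ge0].
by move=> _ [a _ <-] x cx _; exact: XK.
Qed.

(** The reduction of P is principal; after changing P by the divisor of psi, its
    function f reduces to 1 and P is supported on the residue disk of oo. *)
Lemma trivialize (P : set F -> int) (n z : nat) (f h : F) (a : K) :
  is_divisor X P -> degree iota P = 0 -> unit_in eta f ->
  (forall x, cl x -> ordv x f = (p ^ n)%N%:Z * P x) -> unit_in eta h -> unit_in OK a ->
  sigma f = iota a * f ^+ z * h ^+ (p ^ n) -> max_ideal OK (z%:R - zeta) ->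
  exists psi t v0, [/\ psi != 0 /\ forall x, cl x -> x <> oo -> 0 <= P x + ordv x psi,
    loceq (fun x => P x + ordv x psi) t /\ exists N, TR N t, unit_in R v0 /\ max_ideal eta (t * v0 - 1) &
    A0 (f * psi ^+ (p ^ n)) /\ rho (f * psi ^+ (p ^ n)) = 1].
Proof.
move=> HP dP uf of_ uh ua sf zz; have m0 : (0 < p ^ n)%N by rewrite expn_gt0 prime_gt0 // pr.
have [t0 [v [lt rv]]] := descend HP dP uf of_ uh ua sf zz.
have [ut0 Ht0] := lt; have [t00 _ _] := ut0.
have ltn : loceq (fun x => (p ^ (n - n))%N%:Z * P x) t0.
  by rewrite subnn; split=> // x cx Rsx; rewrite Ht0 // mul1r.
have uR := f_unit dP uf of_ (leqnn n) ltn; have [_ Rft _] := uR.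
have vv : unit_in (rho @` R) v.
  have H : unit_in (rho @` R) (v ^+ (p ^ n)) by rewrite -rv; apply/R_rho_unit.
  have [vn0 _ _] := H; have v00 : v != 0 by apply: contraNneq vn0 => ->; rewrite expr0n gtn_eqF.
  by apply: (unit_ordv dYo); have := ordv_unit dYo H; rewrite (ordvX dYo) // -mulr_natr natz; nia.
have [v1 [v0 Rv0 ev0] _] := vv.
have AW w : Wt P t0 w -> eta w -> A0 (f / t0 ^+ (p ^ n) * w ^+ (p ^ n)) /\ AY (v * rho w).
  move=> Ww ew; have eft := Re Rft. have A1 : A0 (f / t0 ^+ (p ^ n) * w ^+ (p ^ n)).
    rewrite -[f / _]expr1; apply: (fW dP uf of_ (leqnn n) ltn (j := 1)) => //.
    by rewrite subnn; move: Ww; congr (Wt _ _ _); apply/funext => x; rewrite mul1r.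
  split=> // y cy ny; apply: (dvr_integral (Yd cy) m0); rewrite exprMn -rv -rhoX // -rhoM //.
    exact: (rhoA A1).
  exact: (srX leta).
have [N0 HN] := sat_list lt HP dP; have [D0 HD0] := degAY_count.
(* Multiplication by v, a unit at the section, maps reduced sections of P to functions in [AY]
   without changing their degrees. If 0 were not among these degrees, the constants would add one
   degree too many. *)
have [w [Ww ew w0 dw]] : rdegs (Wt P t0) 0.
  apply: contrapT => n0; have [L [uL sL HL]] := HN (N0 + D0).+1 ltac:(lia).
  have := HD0 (N0 + D0)%N (0 :: L) (leq_addl _ _); rewrite /= uL addSn sL ltnn andbT => H.
  suff : false by []; apply: H; first by apply/negP => /HL[].
  move=> m; rewrite inE => /orP[/eqP->|/HL [[w [Ww ew w0 dw]] mN]]; last first.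
    split => //. exists (v * rho w); split; [by have [_] := AW w Ww ew|by rewrite mulf_neq0|].
    by rewrite (dgM dYo) // (dg_unit dYo vv) add0r.
  split=> //; apply/degAY => -[i _ mi]; have := (degA 0).1; case; last by exists i.
  exists 1; split; [mem|exact: oner_neq0|exact: (dg_unit doo (unit1 doo))].
have [_ Aw] := AW w Ww ew.
(* A regular function of degree 0 is constant; dividing w by it gives a section whose reduction is
   the inverse of v. *)
have Cw : CY (v * rho w).
  by apply: AY_const => // _; rewrite (dgM dYo) // dw (dg_unit dYo vv).
have [_ [b Ob <-] eb] := CY_V Cw; have eib := eta_iota Ob.
have Wb : Wt P t0 (iota b * w).
  by apply: (csZ (Wt_csub lt)) => //; exists b.
have r1 : v * rho (iota b * w) = 1.
  by rewrite rhoM // eb mulrCA mulVf // mulf_neq0.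
have etw : eta (iota b * w) by mem.
have [A1 _] := AW _ Wb etw; have [psi Mpsi ew'] := Wb.
have r0 : rho (iota b * w) != 0.
  by apply/eqP => e; move: r1; rewrite e mulr0 => /eqP; rewrite eq_sym oner_eq0.
have psi0 : psi != 0.
  by apply: contraNneq r0 => e; rewrite -ew' e mulr0 rho0.
have uR0 : unit_in R v0 by apply/R_rho_unit => //; rewrite ev0.
exists psi, (iota b * w), v0; split.
- by split=> // x cx xo; have := Mpsi x cx xo psi0; lia.
- split.
    split; first by apply/rho_neq0. by move=> x cx Rsx; rewrite -ew' (ordvM (Xd cx)) // Ht0.
  exists (absz (dgX (iota b * w))); apply: (Wt_TR lt Wb etw) => _; lia.
- split=> //; have e1 : eta (iota b * w * v0) by mem; mem.
  apply/rho_eq0; first by apply: (srB leta) ; mem. rewrite rhoB //; last mem.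
  have ev0' := Re Rv0; by rewrite (rhoM etw) ?ev0 ?rho1 1?mulrC ?r1 ?subrr.
- have -> : f * psi ^+ (p ^ n) = f / t0 ^+ (p ^ n) * (iota b * w) ^+ (p ^ n).
    by rewrite -ew' exprMn; field; rewrite expf_neq0.
  by split=> //; rewrite rhoM ?rhoX ?rv -?exprMn ?r1 ?expr1n //; [mem|exact: (srX leta)].
Qed.

(** * Congruences, the decomposition of Om, the truncated exponential *)

Definition congm (B : set F) (w : K) u v := B ((u - v) / iota w).
Section Cg.
Variable B : set F.
Hypotheses (sB : subring B) (BO : forall a, OK a -> B (iota a)).
Lemma cgR w u : congm B w u u. Proof. by rewrite /congm subrr mul0r; exact: (sr0 sB). Qed.
Lemma cg_sym w u v : congm B w u v -> congm B w v u.
Proof. by move=> /(srN sB); rewrite /congm -mulNr opprB. Qed.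
Lemma cg_trans w x u v : congm B w u x -> congm B w x v -> congm B w u v.
Proof. by move=> H H'; have := srD sB H H'; rewrite /congm -mulrDl addrA subrK. Qed.
Lemma cgD w u v u' v' : congm B w u v -> congm B w u' v' -> congm B w (u + u') (v + v').
Proof. by move=> H H'; have := srD sB H H'; rewrite /congm -mulrDl opprD addrACA. Qed.
Lemma cgM w u v u' v' : B v -> B u' -> congm B w u v -> congm B w u' v' -> congm B w (u * u') (v * v').
Proof.
move=> Bv Bu H H'; have := srD sB (srM sB H Bu) (srM sB Bv H').
by congr B; ring.
Qed.
Lemma cgX w u v n : B u -> B v -> congm B w u v -> congm B w (u ^+ n) (v ^+ n).
Proof.
move=> Bu Bv H; elim: n => [|n IH]; first exact: cgR.
by rewrite !exprS; apply: cgM => //; exact: (srX sB).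
Qed.
Lemma cg_le w w' u v : w != 0 -> w' != 0 -> OK (w' / w) -> congm B w' u v -> congm B w u v.
Proof.
move=> w0 w'0 Ow H; have := srM sB (BO Ow) H; congr B; rewrite fmorph_div; field.
by rewrite !fmorph_eq0 w0.
Qed.
Hypothesis Bpi : forall h, B h -> max_ideal eta h -> exists2 w, B w & h = iota pi * w.
Hypothesis Beta : B `<=` eta.
Lemma inv_mod k u : B u -> rho u = 1 -> exists2 v, B v & rho v = 1 /\ congm B (pi ^+ k) (u * v) 1.
Proof.
move=> Bu ru; have eu := Beta Bu; have B1 : B (1 - u) by mem; mem.
have [|w Bw ew] := Bpi B1.
  by apply/rho_eq0; [mem|rewrite rhoB ?rho1 ?ru ?subrr //; mem].
(* The truncated geometric series, as 1 - u is divisible by pi. *)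
exists (\sum_(i < k.+1) (1 - u) ^+ i).
  by apply: (sr_sum sB) => i _; exact: (srX sB).
split.
  rewrite big_ord_recl expr0 (eq_bigr (fun i : 'I_k => iota pi * (w * (1 - u) ^+ i))); last first.
    by move=> i _; rewrite exprS {1}ew mulrA.
  rewrite -mulr_sumr; set S := \sum_(i < k) _.
  have eS : eta S by apply: Beta; apply: (sr_sum sB) => i _; apply: (srM sB) => //; exact: (srX sB).
  rewrite rhoD ?rhoM ?rho1 //; [|apply: eta_iota; mem|mem|].
    rewrite (_ : rho (iota pi) = 0) ?mul0r ?addr0 //; apply/rho_eq0; last exact: mepi. by mem.
  by mem.
have e1 : u * (\sum_(i < k.+1) (1 - u) ^+ i) = 1 - (1 - u) ^+ k.+1.
  have := subrX1 (1 - u) k.+1; rewrite [1 - u - 1]addrAC subrr add0r mulNr => e. by rewrite -[LHS]opprK -e opprB.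
rewrite /congm e1 addrAC subrr add0r ew exprMn exprS.
have -> : - (iota pi * iota pi ^+ k * w ^+ k.+1) / iota (pi ^+ k) = - (iota pi * w ^+ k.+1).
  by rewrite rmorphXn; field; rewrite expf_neq0 // ipi0.
by apply: (srN sB); apply: (srM sB); [apply: BO; mem|exact: (srX sB)].
Qed.
End Cg.

Let s0 : s != 0 := s_neq0.
Let sOm : subring Om := Om_sub.
Lemma Om_iota a : OK a -> Om (iota a).
Proof. by move=> Oa; apply: R_Om; exact: Ri. Qed.
Lemma A0_iota a : OK a -> A0 (iota a).
Proof. by move=> Oa; split; [move=> x cx _; exact: XK|exact: eta_iota]. Qed.
Lemma A0_pi h : A0 h -> max_ideal eta h -> exists2 w, A0 w & h = iota pi * w.
Proof.
move=> [Ah eh] /max_eta_div [w ew e]; exists w => //; split=> // x cx xo.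
have -> : w = iota pi^-1 * h by rewrite e fmorphV mulKf // ipi0.
by apply: (srM (Xd cx)); [mem|exact: Ah].
Qed.
Lemma A0_Om : A0 `<=` Om.
Proof. by move=> h [Ah eh]; exists (absz (dgX h)); apply: (A_TR Ah eh) => _; lia. Qed.
Lemma A0_eta : A0 `<=` eta. Proof. by move=> h []. Qed.

Lemma gap_w : exists w : nat -> F, w 0%N = 1 /\ forall n, ~ gap n -> A (w n) /\ monic_at n (w n).
Proof.
have [w wP] : {w : nat -> F & forall n, ~ gap n -> A (w n) /\ monic_at n (w n)}.
  apply: (@choice _ _ (fun n v => ~ gap n -> A v /\ monic_at n v)) => n. have [gn|ng] := pselect (gap n); first by exists 0.
  by have [v Av mv] := good_basis A_good ng; exists v.
exists (fun n => if n is 0 then 1 else w n); split=> // -[|n] ng; last exact: wP.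
split; first mem.
split; rewrite /TR /= mulr1; first mem.
by rewrite -(rmorph1 iota) (EC HE).
Qed.

(** Leading coefficients are removed one after the other, by the monic functions at non-gaps and by
    powers of tau at gaps. With [Om_uniq] this says that H^1 of the structure sheaf of the model has
    the OK-basis T^(mu i). *)
Lemma Om_decomp h : Om h -> exists a b (k : 'I_g -> K), [/\ A0 a, R b, forall i, OK (k i) &
  h = a + b + \sum_i iota (k i) * tau ^+ mu i].
Proof.
have [w [_ wP]] := gap_w; case=> N; elim: N h => [|N IH] h Th.
  exists 0, h, (fun=> 0); split; [mem|by move: Th; rewrite /TR /= mulr1|mem; exact: (sr0 dO)|].
  by rewrite big1 ?add0r ?addr0 // => i _; rewrite rmorph0 mul0r.
have Oe := E_int 0 Th; set e := E _ 0 in Oe.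
have step v : TR N.+1 v -> E (v * s ^+ N.+1) 0 = 1 -> exists a b (k : 'I_g -> K), [/\ A0 a, R b, forall i, OK (k i) &
    h - iota e * v = a + b + \sum_i iota (k i) * tau ^+ mu i].
  move=> Tv v1; apply: IH; apply: TR_drop.
    by rewrite /TR /= mulrBl -mulrA; apply: (srB lR) => //; apply: (srM lR) ; mem.
  by rewrite mulrBl -mulrA (EB HE) (EZ HE) v1 mulr1 subrr.
have [[i0 _ ei]|ng] := pselect (gap N.+1); last first.
  have [Aw [Tw w1]] := wP _ ng; have [a [b [k [Aa Rb Ok eh]]]] := step _ Tw w1.
  exists (iota e * w N.+1 + a), b, k; split=> //; last by rewrite -[h](subrK (iota e * w N.+1)) eh; ring.
  apply: (srD (A0_sub)) => //; apply: (srM (A0_sub)); first exact: A0_iota. by split=> //; exact: TR_eta Tw.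
have e1 : tau ^+ N.+1 * s ^+ N.+1 = 1 by rewrite -exprMn mulVf // expr1n.
have [||a [b [k [Aa Rb Ok eh]]]] := step (tau ^+ N.+1).
- by rewrite /TR /= e1; mem.
- by rewrite e1 -(rmorph1 iota) (EC HE).
exists a, b, (fun i => k i + (if i == i0 then e else 0)); split=> //.
  by move=> i; apply: (srD dO) => //; case: eqP => _; mem.
rewrite (eq_bigr (fun i => iota (k i) * tau ^+ mu i + (if i == i0 then iota e * tau ^+ N.+1 else 0))).
  by rewrite big_split -big_mkcond big_pred1_eq addrA -eh subrK.
by move=> i _; rewrite rmorphD mulrDl; case: eqP => [->|_]; rewrite ?ei // rmorph0 mul0r.
Qed.

(** The pole order of a nonzero sum of the T^(mu i) terms is a gap and positive; elements of R
    cannot cancel it, and functions regular off oo do not have it. *)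
Lemma Om_uniq a b (k : 'I_g -> K) : A a -> R b -> a + b + \sum_i iota (k i) * tau ^+ mu i = 0 -> forall i, k i = 0.
Proof.
move=> Aa Rb s00; suff H : ~ exists i, k i != 0.
  by move=> i; apply/eqP; apply: contrapT => /negP ki; apply: H; exists i.
move=> [i ki].
have t0 : tau != 0 by rewrite invr_eq0.
pose u (j : nat) := if insub j is Some i then iota (k i) * tau ^+ mu i else 0.
have uE (j : 'I_g) : u j = iota (k j) * tau ^+ mu j by rewrite /u valK.
have u0 (j : 'I_g) : u j != 0 -> k j != 0 by rewrite uE; apply: contraNneq => ->; rewrite rmorph0 mul0r.
have du (j : 'I_g) : u j != 0 -> dgX (u j) = (mu j)%:Z.
  move=> uj; have kj := u0 _ uj; rewrite uE (dgM doo) ?fmorph_eq0 ?expf_neq0 // (dgXn doo) //.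
  rewrite (dgV doo) // (@dg_unit _ _ doo (iota (k j))); first by rewrite /dg sord; lia.
  by split; rewrite ?fmorph_eq0 -?fmorphV //; exact: XK.
have [mono _] := Hmu.
have [||S0 [j [jg uj dj]]] := distinct_sum doo pr (n := g) (a := u).
- move=> j l /andP[jl lg] uj ul; have jg := ltn_trans jl lg.
  have := du (Ordinal jg) uj; have := du (Ordinal lg) ul; rewrite /= => -> ->.
  by have := mono (Ordinal jg) (Ordinal lg) jl; lia.
- by exists i => //; rewrite uE mulf_neq0 ?fmorph_eq0 ?expf_neq0.
have muj := du (Ordinal jg) uj; rewrite /= in muj.
have eS : \sum_i iota (k i) * tau ^+ mu i = \sum_(i < g) u i by apply: eq_bigr => l _; rewrite uE.
rewrite eS in s00; have mu0 : (0 < mu (Ordinal jg))%N.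
  rewrite lt0n; apply/eqP => m0; have := (degA 0).1; case; last by exists (Ordinal jg).
  by exists 1; split; [mem|exact: oner_neq0|exact: (dg_unit doo (unit1 doo))].
have db : dle oo (dgX (\sum_(i < g) u i) - 1) b.
  by rewrite dj; apply: dle_le _ ((dle0_O doo b).2 (Rx Rb)); lia.
have [n0 dS] := dgD doo S0 db.
have ea : a = - (\sum_(i < g) u i + b) by apply/eqP; rewrite -addr_eq0; apply/eqP; rewrite -[RHS]s00; ring.
have : degs oo A (mu (Ordinal jg))%:Z.
  have e2 : dgX a = (mu (Ordinal jg))%:Z by rewrite ea -muj -dj -dS; exact: dgN.
  by exists a; split=> //; rewrite ea oppr_eq0.
by move/degA; apply; exists (Ordinal jg).
Qed.

(** The exponential series is truncated below p, where it is integral. *)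
Definition pexp (x : K) : {poly K} := \poly_(i < 2 * g) (x ^+ i / i`!%:R).
Definition ex (x : K) : F := (map_poly iota (pexp x)).[tau].
Lemma g2p : (2 * g < p)%N.
Proof.
have := dg1; have /eqP := p_mod_d; have p1 := prime_gt1 pr.
rewrite eqn_mod_dvd ?(ltnW p1) // => /dvdn_leq; rewrite subn_gt0 p1 => /(_ isT); lia.
Qed.
Lemma nat_unit (k : nat) : (0 < k < p)%N -> unit_in OK k%:R.
Proof.
move=> /andP[k0 kp]; have Ok (i : nat) : OK i%:R by mem; rewrite -pmulrn.
have [//|m] := @unit_or_max _ OK _ (Ok k).
have co : coprime k p by rewrite coprime_sym prime_coprime ?pr // gtnNdvd.
case: (egcdnP p k0) => u v e _; move: e; rewrite (eqP co) => e.
case: (unit_not_max (unit1 dO)).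
have -> : 1 = u%:R * k%:R - v%:R * p%:R :> K by rewrite -!natrM e natrD addrAC subrr add0r.
by apply: (maxB dO); apply: (maxMl dO) => //; exact: pm.
Qed.
Lemma fact_unit i : (i < 2 * g)%N -> unit_in OK i`!%:R.
Proof.
elim: i => [|i IH] lt; first exact: unit1 dO.
rewrite natrM; apply: (unitM dO); last exact: IH (ltnW lt).
by apply: nat_unit; have := g2p; lia.
Qed.
Lemma fact_n0 i : (i < 2 * g)%N -> i`!%:R != 0 :> K.
Proof. by move=> /fact_unit[]. Qed.
Lemma pexpE x i : (pexp x)`_i = if (i < 2 * g)%N then x ^+ i / i`!%:R else 0.
Proof. exact: coef_poly. Qed.
Lemma pexp_OK x i : OK x -> OK (pexp x)`_i.
Proof.
move=> Ox; rewrite pexpE; case: ifP => [lt|_]; last mem.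
by apply: (srM dO); [exact: (srX dO)|case: (fact_unit lt)].
Qed.
Lemma poly_Om (q : {poly K}) w : w != 0 -> (forall i, OK (q`_i / w)) -> Om ((map_poly iota q).[tau] / iota w).
Proof.
move=> w0 Hq; rewrite horner_coef mulr_suml; apply: (sr_sum sOm) => i _; rewrite coef_map.
have -> : iota q`_i * tau ^+ i / iota w = iota (q`_i / w) * tau ^+ i by rewrite fmorph_div; ring.
by apply: (srM sOm); [exact: Om_iota|apply: (srX sOm); exact: Om_tau].
Qed.
Lemma ex_Om x : OK x -> Om (ex x).
Proof.
move=> Ox; have := @poly_Om (pexp x) 1 (oner_neq0 _); rewrite rmorph1 divr1; apply => i.
by rewrite divr1; exact: pexp_OK.
Qed.
Lemma ex_cong x y w : w != 0 -> OK x -> OK y -> OK ((x - y) / w) -> congm Om w (ex x) (ex y).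
Proof.
move=> w0 Ox Oy H; rewrite /congm -hornerN -hornerD -!rmorphN -rmorphD; apply: poly_Om => // i.
rewrite coefB !pexpE; case: ifP => lt; last by rewrite subrr mul0r; mem.
rewrite -mulrBl subrXX mulrAC [_ * _ / w]mulrAC -mulrA; apply: (srM dO) => //; apply: (srM dO).
  by apply: (sr_sum dO) => j _; apply: (srM dO); exact: (srX dO).
by case: (fact_unit lt).
Qed.
(** Below degree 2g the coefficients agree by the binomial formula; a product coefficient of degree
    k >= 2g is homogeneous of degree k in x and y, hence divisible by z^k. *)
Lemma ex_mul z x y : z != 0 -> OK z -> OK (x / z) -> OK (y / z) ->
  congm Om (z ^+ (2 * g)) (ex x * ex y) (ex (x + y)).
Proof.
move=> z0 Oz Ox Oy; rewrite /congm -hornerM -hornerN -hornerD -!rmorphM -!rmorphN -rmorphD.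
apply: poly_Om => [|k]; first by rewrite expf_neq0.
rewrite coefB coefM pexpE; case: ltnP => [lt|ge]; last first.
  rewrite subr0 mulr_suml; apply: (sr_sum dO) => j _; rewrite !pexpE. have jk : (j <= k)%N by rewrite -ltnS.
  case: ifP => lj; last by rewrite !mul0r; mem. case: ifP => lkj; last by rewrite mulr0 !mul0r; mem.
  have -> : x ^+ j / j`!%:R * (y ^+ (k - j) / (k - j)`!%:R) / z ^+ (2 * g) =
     (x / z) ^+ j * (y / z) ^+ (k - j) * j`!%:R^-1 * (k - j)`!%:R^-1 * z ^+ (k - 2 * g).
    have ez : z ^+ k = z ^+ j * z ^+ (k - j) by rewrite -exprD subnKC.
    have ez' : z ^+ k = z ^+ (2 * g) * z ^+ (k - 2 * g) by rewrite -exprD subnKC.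
    rewrite !expr_div_n; apply: (mulIf (expf_neq0 (2 * g) z0)); rewrite divfK ?expf_neq0 //.
    by rewrite -[RHS]mulrA [z ^+ (k - 2 * g) * _]mulrC -ez' ez; field; rewrite !fact_n0 // !expf_neq0.
  by do !(apply: (srM dO)); try exact: (srX dO); [case: (fact_unit lj)|case: (fact_unit lkj)].
rewrite (_ : _ - _ = 0) ?mul0r; first mem.
apply/eqP; rewrite subr_eq0; apply/eqP; rewrite [x + y]addrC exprDn mulr_suml; apply: eq_bigr => j _.
have jk : (j <= k)%N by rewrite -ltnS.
have lj := leq_ltn_trans jk lt; have lkj := leq_ltn_trans (leq_subr j k) lt.
rewrite !pexpE lj lkj -mulr_natr.
have -> : k`!%:R = 'C(k, j)%:R * j`!%:R * (k - j)`!%:R :> K by rewrite -!natrM -mulnA bin_fact.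
have C0 : 'C(k, j)%:R != 0 :> K.
  by have := fact_n0 lt; rewrite -(bin_fact jk) natrM mulf_eq0 negb_or => /andP[].
by field; rewrite !fact_n0.
Qed.
Lemma exE x : ex x = \sum_(i < 2 * g) iota (x ^+ i / i`!%:R) * tau ^+ i.
Proof.
rewrite /ex (@horner_coef_wide _ (2 * g)) ?size_map_poly ?size_poly //.
by apply: eq_bigr => i _; rewrite coef_map pexpE ltn_ord.
Qed.
Lemma ex0 : ex 0 = 1.
Proof.
rewrite /ex (_ : pexp 0 = 1) ?rmorph1 ?hornerC //; apply/polyP => i; rewrite pexpE coef1.
have g2 := g_ge2; case: i => [|i]; rewrite ?divr1 ?expr0n /= ?mul0r; last by case: ifP.
by rewrite muln_gt0 (ltnW g2).
Qed.
Lemma ex_sigma x : sigma (ex x) = ex (zeta * x).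
Proof.
rewrite !exE rmorph_sum; apply: eq_bigr => i _.
rewrite rmorphM sK rmorphXn fmorphV sig_s invfM exprMn fmorphV invrK -rmorphXn mulrA -rmorphM exprMn.
ring.
Qed.
Lemma ex_pow x z : x != 0 -> OK x -> congm Om (x ^+ (2 * g)) (ex x ^+ z) (ex (z%:R * x)).
Proof.
move=> x0 Ox; have On (i : nat) : OK i%:R by mem; rewrite -pmulrn.
elim: z => [|z IH]; first by rewrite mul0r ex0; exact: (cgR sOm).
have Ozx : OK (z%:R * x) by mem.
rewrite exprSr -natr1 mulrDl mul1r; apply: (cg_trans sOm (x := ex (z%:R * x) * ex x)).
  by apply: (cgM sOm) => //; [exact: ex_Om|exact: ex_Om|exact: (cgR sOm)].
by apply: ex_mul => //; rewrite ?mulfK ?mulfV; mem.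
Qed.
(** In degrees at least 2 the difference has, besides pi^j, a factor which is a form of positive
    degree in two non-units. *)
Lemma ex_shift x j y : max_ideal OK x -> (0 < j)%N -> OK y ->
  congm Om (pi ^+ j.+1) (ex (x + pi ^+ j * y)) (ex x + iota (pi ^+ j * y) * tau).
Proof.
move=> mx j0 Oy; have [Ox _] := mx; have pj0 : pi ^+ j != 0 by rewrite expf_neq0 ?pi0.
have Opj : OK (pi ^+ j) by apply: (srX dO); mem.
have -> : iota (pi ^+ j * y) * tau = (map_poly iota ((pi ^+ j * y) *: 'X)).[tau].
  by rewrite map_polyZ map_polyX hornerZ hornerX.
rewrite /congm -!hornerD -hornerN -hornerD -!rmorphD -rmorphN -rmorphD; apply: poly_Om => [|i].
  by rewrite expf_neq0 ?pi0.
rewrite !coefB coefD coefZ coefX !pexpE; set u := pi ^+ j * y.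
case: ltnP => [lt|ge]; last first.
  have -> : (i == 1%N) = false by have := g_ge2; lia. by rewrite mulr0 addr0 subr0 mul0r; mem.
case: i lt => [|[|i]] lt /=.
- by rewrite !expr0 mulr0 addr0 subrr mul0r; mem.
- by rewrite !divr1 mulr1 subrr mul0r; mem.
rewrite mulr0 addr0 -mulrBl subrXX addrAC subrr add0r; set S := \sum_(_ < _) _.
have mxu : max_ideal OK (x + u).
  apply: (maxD dO) => //; apply: (maxMr dO) => //; rewrite -(prednK j0) exprS.
  by apply: (maxMr dO); [mem|apply: (srX dO); mem].
have mS : max_ideal OK S.
  apply: (max_sum dO) => l _; case: (l : nat) => [|l'].
    by rewrite expr0 mulr1 exprS; apply: (maxMr dO) => //; apply: (srX dO); case: mxu.
  rewrite exprS mulrCA; apply: (maxMr dO) => //; apply: (srM dO); last exact: (srX dO). by apply: (srX dO); case: mxu.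
have [S' OS' eS] := OK_max_div mS.
have -> : u * S / i.+2`!%:R / pi ^+ j.+1 = y * S' * i.+2`!%:R^-1.
  by rewrite /u eS exprS; field; rewrite pi0 pj0 fact_n0.
by apply: (srM dO); [mem|case: (fact_unit lt)].
Qed.
Lemma ex_one x : max_ideal OK x -> rho (ex x) = 1.
Proof.
move=> mx; have [Ox _] := mx; have := @ex_cong x 0 pi pi0 Ox (sr0 dO).
rewrite ex0 subr0 => /(_ _)-H; have [y Oy ey] := OK_max_div mx.
have e1 := Om_eta (ex_Om Ox); have [] : Om ((ex x - 1) / iota pi).
  by apply: H; rewrite ey mulrC mulKf ?pi0.
move=> n /TR_eta ew; apply/eqP; rewrite -subr_eq0 -rho1 -rhoB //; last mem.
apply/eqP/rho_eq0; first by apply: (srB leta) ; mem.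
rewrite -[_ - 1](divfK (ipi0)); apply: (maxMl leta) ; mem.
Qed.
Local Notation cg := (congm Om).
Let OmO a (Oa : OK a) : Om (iota a) := Om_iota Oa.
Let pn0 k : pi ^+ k != 0. Proof. by rewrite expf_neq0. Qed.
Let ipn0 k : iota (pi ^+ k) != 0. Proof. by rewrite fmorph_eq0. Qed.
Let Opk k : OK (pi ^+ k). Proof. exact: (srX dO). Qed.
Let AO : A0 `<=` Om. Proof. exact: A0_Om. Qed.
Let RO : R `<=` Om. Proof. exact: R_Om. Qed.
Ltac mem_leaf ::= (exact: Opi) + (exact: mpi) + (exact: mepi) + (apply: OmO) + (apply: eta_iota) + (apply: AO) + (apply: RO)
  + (apply: Re) + (apply: Ri) + (apply: Om_eta) + (apply: A0_eta) + (apply: A0_iota) + (apply: XK) + (apply: (cgR sOm))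
  + (exact: Om_tau) + solve [apply: (cg_sym sOm) => //] + match goal with
    | |- congm Om _ (_ + _) (_ + _) => apply: (cgD sOm)
    | |- congm Om _ (_ * _) (_ * _) => apply: (cgM sOm) end.
Lemma A0_inv k u : A0 u -> rho u = 1 -> exists2 v, A0 v & rho v = 1 /\ cg (pi ^+ k) (u * v) 1.
Proof.
move=> Au ru; have [v Av [rv cv]] := inv_mod A0_sub A0_iota A0_pi A0_eta k Au ru.
by exists v => //; split; mem.
Qed.

(** * Successive approximation of the class by an exponential *)

Section Approximation.

(** If n is in [gp] and i <= n is not a gap of A, then n - i is in [gp]. So at most g of the n + 1
    integers up to n are non-gaps of A, and at most g are gaps. *)
Lemma gaps_small (gp : set nat) (L : seq nat) (n : nat) : (size L <= g)%N -> (forall i, gp i -> i \in L) ->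
  (forall i j, ~ gap i -> ~ gp j -> ~ gp (i + j)%N) -> gp n -> (n < 2 * g)%N.
Proof.
move=> sL HL add gn; pose M := [seq (n - i)%N | i <- [seq i <- seq.iota 0 n.+1 | ~~ `[< gap i >]]].
have uM : uniq M.
  rewrite map_inj_in_uniq ?filter_uniq ?iota_uniq // => i j.
  by rewrite !mem_filter !mem_iota => /andP[_ /andP[_ i1]] /andP[_ /andP[_ j1]]; lia.
have sub : {subset M <= L}.
  move=> l /mapP[i]; rewrite mem_filter mem_iota => /andP[/asboolP ng /andP[_ i1]] ->; apply: HL.
  by apply: contrapT => nj; apply: (add _ _ ng nj); rewrite subnKC //; lia.
have lM := uniq_leq_size uM sub; rewrite size_map size_filter in lM.
have e := count_predC (fun i => `[< gap i >]) (seq.iota 0 n.+1); rewrite size_iota in e.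
have le : (count (fun i => `[< gap i >]) (seq.iota 0 n.+1) <= g)%N.
  have eg : size [seq mu x | x : 'I_g] = g by rewrite size_map -cardE card_ord.
  rewrite -size_filter; apply: leq_trans (eq_leq eg); apply: uniq_leq_size; first by rewrite filter_uniq ?iota_uniq.
  by move=> i; rewrite mem_filter => /andP[/asboolP [j _ <-] _]; rewrite map_f ?mem_enum.
have l1 := leq_trans lM sL; rewrite (eq_count (a2 := predC (fun i => `[< gap i >]))) // in l1.
lia.
Qed.
Lemma ordvXn (G : fieldType) (O : set G) (x : G) (k : nat) : dvr O -> x != 0 -> ordv O (x ^+ k) = k%:Z * ordv O x.
Proof. by move=> dG; exact: (@ordvXz G O dG x k%:Z). Qed.
Lemma mu_small i : (mu i < 2 * g)%N.
Proof.
apply: (@gaps_small gap [seq mu x | x : 'I_g]); [by rewrite size_map -cardE card_ord| | |by exists i].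
  by move=> j [k _ <-]; rewrite map_f ?mem_enum.
move=> k j /degA [u [Au u0 du]] /degA [v [Av v0 dv]]; apply/degA.
by exists (u * v); split; [mem|rewrite mulf_neq0|rewrite (dgM doo) // du dv].
Qed.
Lemma gap1 : exists i, mu i = 1%N.
Proof.
have : gap 1.
  apply: contrapT => /degA; apply: (degsA_n1 Xd coo Hmu g0).
by move=> [i _ e]; exists i.
Qed.

Lemma sigma_oo_ne x : x <> oo -> sigma @^-1` x <> oo.
Proof.
move=> xo e; apply: xo; have [tau' st ts] := sbij; apply/seteqP; split=> v; rewrite -[v]ts => xv.
  by have : (sigma @^-1` x) (tau' v) by []; rewrite e -{1}soo.
by have : (sigma @^-1` oo) (tau' v) by []; rewrite soo -e.
Qed.
Lemma sigma_A0 h : A0 h -> A0 (sigma h).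
Proof.
move=> [Ah eh]; split; last by case: (sigma_eta eh).
move=> x cx xo; exact: Ah _ ((sigma_closed x).1 cx) (sigma_oo_ne xo).
Qed.
Lemma sigma_Om h : Om h -> Om (sigma h).
Proof.
move=> [n Th]; exists n; have [z0 Oz _] := zeta_unit; rewrite /TR /=.
have -> : sigma h * s ^+ n = sigma (h * s ^+ n) * iota (zeta ^+ n).
  rewrite rmorphM rmorphXn sig_s exprMn fmorphV rmorphXn -mulrA; congr (_ * _).
  by rewrite mulrAC -exprMn mulVf ?expr1n ?mul1r // fmorph_eq0.
by apply: (srM lR); [exact: (sigma_R _).1|apply: Ri; exact: (srX dO)].
Qed.
Lemma sigma_rho1 h : eta h -> rho h = 1 -> rho (sigma h) = 1.
Proof.
move=> eh rh; have e1 := sr1 leta; have ed := srB leta eh e1; have [es _] := sigma_eta eh.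
have /(sigma_eta ed).2 : max_ideal eta (h - 1) by apply/(rho_eq0 ed); rewrite rhoB // rh rho1 subrr.
rewrite rmorphB rmorph1 => /(rho_eq0 (srB leta es e1)); rewrite rhoB // rho1.
by move/eqP; rewrite subr_eq0 => /eqP.
Qed.
(** By [Om_uniq] the coordinates pi^j l i must be cancelled by those of a multiple of pi^(j+1). *)
Lemma coef_max j (l : 'I_g -> K) r1 a1 : R r1 -> A0 a1 -> (forall i, OK (l i)) ->
  cg (pi ^+ j.+1) (r1 + iota (pi ^+ j) * \sum_i iota (l i) * tau ^+ mu i) a1 -> forall i, max_ideal OK (l i).
Proof.
move=> Rr [Aa _] Ol /Om_decomp [al [be [k [[Aal _] Rbe Ok e]]]] i.
have Apq : A (iota (pi ^+ j.+1)) by move=> x cx _; exact: XK.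
have := Om_uniq (a := - a1 - iota (pi ^+ j.+1) * al) (b := r1 - iota (pi ^+ j.+1) * be)
  (k := fun i => pi ^+ j * l i - pi ^+ j.+1 * k i).
move=> /(_ _ _ _ i) H; have : pi ^+ j * l i - pi ^+ j.+1 * k i = 0.
  apply: H.
  - by mem.
  - by mem.
  have e' : r1 + iota (pi ^+ j) * \sum_i iota (l i) * tau ^+ mu i - a1 =
      iota (pi ^+ j.+1) * (al + be + \sum_i iota (k i) * tau ^+ mu i).
    by rewrite -e [RHS]mulrC divfK //.
  rewrite (eq_bigr (fun i => iota (pi ^+ j) * (iota (l i) * tau ^+ mu i) - iota (pi ^+ j.+1) * (iota (k i) * tau ^+ mu i))).
    rewrite sumrB -!mulr_sumr; move: e'; set S1 := \sum_i _; set S2 := \sum_i _ => e'.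
    by rewrite -[a1](subKr (r1 + iota (pi ^+ j) * S1)) e'; ring.
  by move=> i' _; rewrite rmorphB; ring.
rewrite exprSr -mulrA -mulrBr => /eqP; rewrite mulf_eq0 (negbTE (pn0 j)) subr_eq0 => /eqP ->.
by mem.
Qed.

Variables (P : set F -> int) (m : nat) (f t : F) (N : nat).
Hypotheses (m0 : (0 < m)%N) (P0 : forall x, cl x -> x <> oo -> 0 <= P x) (lt : loceq P t) (Tt : TR N t).
Hypotheses (Af : A0 f) (rf : rho f = 1) (of_ : forall x, cl x -> ordv x f = m%:Z * P x).
Hypothesis Heig : forall M, exists (z : nat) h, [/\ h != 0, OK ((zeta - z%:R) / pi ^+ M) &
  forall x, cl x -> ordv x h = P (sigma @^-1` x) - z%:Z * P x].

Lemma eig M : exists (z : nat) chi r, [/\ OK ((zeta - z%:R) / pi ^+ M), A0 chi, unit_in R r &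
  sigma t * f ^+ z = t ^+ z * chi * r].
Proof.
have [z [h [h0 zz oh]]] := Heig M; have [k uh] := scale_eta h0; exists z.
pose h1 := iota (pi ^ k) * h; have [h10 eh1 _] := uh; have [ut Ht] := lt; have [t0 et _] := ut.
have f0 : f != 0.
  by apply/eqP => f0; move: rf; rewrite f0 rho0 => /eqP; rewrite eq_sym oner_eq0.
have oh1 x : cl x -> ordv x h1 = P (sigma @^-1` x) - z%:Z * P x.
  move=> cx; have ck0 : pi ^ k != 0 by rewrite expfz_neq0.
  rewrite (ordvM (Xd cx)) ?fmorph_eq0 // oh // (ordv_unit (Xd cx)) ?add0r //.
  by split; rewrite ?fmorph_eq0 -?fmorphV //; exact: XK.
have ust : unit_in eta (sigma t).
  have [est mst] := sigma_eta et; have [//|mm] := @unit_or_max _ eta _ est. case: (unit_not_max ut); exact/mst.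
have [st0 _ _] := ust.
have h1n : h1 != 0 := h10.
have ur : unit_in eta (sigma t / (t ^+ z * h1)).
  by mem.
have [r0 er er'] := ur.
have rx x : cl x -> R `<=` x -> unit_in x (sigma t / (t ^+ z * h1)).
  move=> cx Rsx; have dx := Xd cx; apply: (unit_ordv dx) => //.
  have Rs' : R `<=` (sigma @^-1` x) by move=> v Rv; apply: Rsx; exact: (sigma_R v).1.
  have n1 := expf_neq0 z t0; rewrite (ordv_div dx st0 (mulf_neq0 n1 h1n)) (ordvM dx n1 h1n) (ordvXn _ dx t0).
  rewrite sigma_ord // !Ht //; last exact: (sigma_closed x).1. by rewrite oh1 //; lia.
exists (f ^+ z * h1), (sigma t / (t ^+ z * h1)); split=> //.
- split; last by apply: (srM leta) => //; apply: (srX leta); case: Af.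
  move=> x cx xo; have dx := Xd cx; apply/(ordv_ge0 dx) => _.
  rewrite (ordvM dx) ?expf_neq0 // (ordvXn _ dx) // of_ // oh1 //.
  by have := P0 cx xo; have := P0 ((sigma_closed x).1 cx) (sigma_oo_ne xo); nia.
- split=> //; apply: (normality R_csp) => // x cx Rsx; by have [] := rx x cx Rsx.
- have e1 (a1 a2 a3 a4 : F) : a2 != 0 -> a4 != 0 -> a1 * a3 = a2 * (a3 * a4) * (a1 / (a2 * a4)).
    by move=> n2 n4; field; rewrite n4.
  by apply: e1 => //; exact: expf_neq0.
Qed.

(** Terms of higher order contain q^2, with q divisible by pi, and in the linear term the powers of
    u may be replaced by 1. *)
Lemma pow_shift q u w z : Om q -> Om u -> Om w -> cg pi u 1 -> cg pi q 0 ->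
  Om (((u + q * w) ^+ z - (u ^+ z + q * (z%:R * w))) / (q * iota pi)).
Proof.
move=> Oq Ou Ow c1 cq; have ip := ipi0.
have [->|q0] := eqVneq q 0; first by rewrite !mul0r invr0 mulr0; mem.
have On (n : nat) : Om n%:R by mem; rewrite -pmulrn.
elim: z => [|z IH]; first by rewrite mul0r mulr0 addr0 subrr mul0r; mem.
have Oq' : Om (q / iota pi) by move: cq; rewrite /congm subr0.
have Ouz : Om ((u ^+ z - 1) / iota pi).
  have := cgX sOm z Ou (sr1 sOm) c1; by rewrite expr1n.
have := srD sOm (srM sOm (srD sOm Ou (srM sOm Oq Ow)) IH) (srD sOm (srM sOm Ow Ouz)
  (srD sOm (srM sOm (srM sOm (On z) Ow) c1) (srM sOm (srM sOm Oq' Ow) (srM sOm (On z) Ow)))).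
congr Om; rewrite !exprS; field; by rewrite q0 ip.
Qed.
(** At precision pi^j the class of t, up to factors from [A0] and R, is exp (x T). *)
Definition state j x a v := [/\ max_ideal OK x, A0 a /\ rho a = 1, unit_in R v & cg (pi ^+ j) (t * a * v) (ex x)].

Let rho1mod h : Om h -> cg pi h 1 <-> rho h = 1.
Proof.
move=> Oh; have e1 : eta (h - 1) by mem; mem.
have r1 : rho (h - 1) = rho h - 1 by rewrite rhoB ?rho1; mem.
split=> [/Om_eta ew|r].
  apply/eqP; rewrite -subr_eq0 -r1; apply/eqP/rho_eq0 => //. by rewrite -[_ - 1](divfK (ipi0)); apply: (maxMl leta) ; mem.
have [|w Ow ew] := Om_pi (srB sOm Oh (sr1 sOm)); first by apply/rho_eq0; rewrite // r1 r subrr.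
by rewrite /congm ew mulrC mulKf // ipi0.
Qed.

(** The error divided by pi^j is decomposed by [Om_decomp]. Its parts in [A0] and R are absorbed by
    a and v. Comparing the action of sigma with the z-th power shows that modulo pi only the
    coordinate at T can be nonzero, and that one is absorbed by x. *)
Lemma improve j x a v : (0 < j)%N -> state j x a v -> OK (x ^+ (2 * g) / pi ^+ j.+1) ->
  exists x' a' v', state j.+1 x' a' v'.
Proof.
move=> j0 [mx [Aa ra] uv cgT] Ox2; have [Ox _] := mx.
have Ot : Om t by exists N.
set T := t * a * v in cgT; have OT : Om T by do 2 ?apply: (srM sOm) ; mem.
pose q := iota (pi ^+ j); have q0 : q != 0 by rewrite fmorph_eq0.
have Oq : Om q by mem.
set w := (T - ex x) / q in cgT *; have Ow : Om w by [].
have eT : T = ex x + q * w by rewrite /w mulrC divfK // addrC subrK.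
have [al [be [k [Aal Rbe Ok ew]]]] := Om_decomp Ow.
pose Sg := \sum_i iota (k i) * tau ^+ mu i.
have Ok' i : Om (iota (k i)) by mem.
have OS : Om Sg by apply: (sr_sum sOm) => i _; apply: (srM sOm) => //; apply: (srX sOm); mem.
have Oal := AO Aal; have Obe : Om be by mem.
have Oex := ex_Om Ox; have rex := ex_one mx.
(* To first order in q these factors cancel the parts of the error in [A0] and in R. *)
pose a' := a * (1 - q * al); pose v' := v * (1 - q * be).
have Aq : A0 q by apply: A0_iota.
have mq : max_ideal R q.
  rewrite /q -(prednK j0) exprS rmorphM; apply: (maxMr lR); last mem.
  split; [mem|move/(R_unit (Ri Opi)); rewrite (EC HE) eqxx => uu; exact: (unit_not_max uu (mpi))].
have Aa' : A0 a' by apply: (srM (A0_sub)) => //; apply: (srB (A0_sub)); [mem|mem].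
have uv' : unit_in R v' by apply: (unitM lR) => //; apply: (unit1B lR); mem.
have [_ Rv' Rv'V] := uv'.
have eq_ : rho q = 0.
  apply/rho_eq0; first by case: Aq. rewrite /q -(prednK j0) exprS rmorphM; apply: (maxMr leta); [mem|exact: eta_iota].
have ra' : rho a' = 1.
  have e1 := sr1 leta. by rewrite rhoM ?rhoB ?rhoM ?eq_ ?mul0r ?subr0 ?rho1 ?ra ?mulr1 //; mem.
pose T' := t * a' * v'; have OT' : Om T'.
  by apply: (srM sOm); [apply: (srM sOm) => //; mem|exact: R_Om].
have cT1 : cg pi T 1.
  apply: (cg_trans sOm (x := ex x)); last by apply/rho1mod.
  by apply: (cg_le sOm OmO _ _ _ cgT) => //; rewrite -(prednK j0) exprSr mulfK.
have pq : iota (pi ^+ j.+1) = q * iota pi by rewrite exprSr rmorphM.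
have cT' : cg (pi ^+ j.+1) T' (ex x + q * Sg).
  have -> : T' = T * (1 - q * al) * (1 - q * be) by rewrite /T' /a' /v' /T; ring.
  have [q' Oq' eq'] : exists2 q', Om q' & q = iota pi * q'.
    by exists (iota (pi ^+ j.-1)); [mem|rewrite -rmorphM -exprS prednK].
  have O1 : Om ((T - 1) / iota pi) by [].
  have := srD sOm (srN sOm (srM sOm (srD sOm Oal Obe) O1)) (srM sOm Oq' (srM sOm OT (srM sOm Oal Obe))).
  have eE : ex x + q * Sg = T - q * (al + be) by rewrite [in RHS]eT ew -/Sg; ring.
  have eq2 : q' = q / iota pi by rewrite eq' mulrC mulKf // ipi0. rewrite /congm pq eE eq2; congr Om; field.
  by rewrite q0 ipi0.
have [z [chi [r [zz Achi ur est]]]] := eig j.+1.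
have [v'0 _ _] := uv'.
have On (i : nat) : OK i%:R by mem; rewrite -pmulrn.
pose S' := \sum_i iota (k i * zeta ^+ mu i) * tau ^+ mu i.
have sSg : sigma Sg = S'.
  rewrite rmorph_sum; apply: eq_bigr => i _; rewrite rmorphM sK rmorphXn fmorphV sig_s.
  by rewrite invfM -fmorphV invrK exprMn -rmorphXn mulrA -rmorphM.
have OS' : Om S' by rewrite -sSg; exact: sigma_Om.
have rT' : rho T' = 1.
  apply/rho1mod => //; apply: (cg_trans sOm (x := ex x + q * Sg)).
    by apply: (cg_le sOm OmO _ _ _ cT') => //; rewrite exprSr mulfK.
  apply/rho1mod; first by apply: (srD sOm) => //; mem.
  by rewrite rhoD ?rhoM ?eq_ ?mul0r ?addr0 //; try mem; apply: (srM leta); exact: Om_eta.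
have csT : cg (pi ^+ j.+1) (sigma T') (ex (zeta * x) + q * S').
  have e : sigma (ex x + q * Sg) = ex (zeta * x) + q * S' by rewrite rmorphD rmorphM sK ex_sigma sSg.
  by have := sigma_Om cT'; rewrite fmorph_div sK rmorphB e.
have cq0 : cg pi q 0.
  by rewrite /congm subr0 -fmorph_div; apply: OmO; rewrite -(prednK j0) exprSr mulfK.
have OTz : Om (T' ^+ z) by exact: (srX sOm).
have cTz : cg (pi ^+ j.+1) (T' ^+ z) (ex (zeta * x) + q * (iota zeta * Sg)).
  have Ozt : OK zeta by case: zeta_unit. have O1 : Om (ex x + q * Sg) by mem; exact: (srM sOm).
  apply: (cg_trans sOm (cgX sOm z OT' O1 cT')). apply: (cg_trans sOm (x := ex x ^+ z + q * (z%:R * Sg))).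
    by rewrite /congm pq; apply: pow_shift => //; apply/rho1mod.
  apply: (cgD sOm).
    (* Here the hypothesis on x enters: the truncated exponential is multiplicative modulo x^(2g),
       which is divisible by pi^(j+1). *)
    apply: (cg_trans sOm (x := ex (z%:R * x))).
      have [x00|x0] := eqVneq x 0; first by rewrite x00 mulr0 !ex0 expr1n; mem.
      by apply: (cg_le sOm OmO _ _ Ox2 (ex_pow z x0 Ox)) => //; exact: expf_neq0.
    apply: ex_cong => //; try mem. rewrite -mulrBl mulrAC -opprB mulNr; apply: (srM dO) => //; mem.
  apply: (cgM sOm) => //; try exact: (cgR sOm).
    by mem.
  rewrite /congm -mulrBl mulrAC -(rmorph_nat iota) -rmorphB -fmorph_div; apply: (srM sOm) => //.
  by apply: OmO; rewrite -opprB mulNr; mem.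
pose A1 := f ^+ z * a' ^+ z; pose A2 := chi * sigma a'; pose r' := r * sigma v' / v' ^+ z.
have e1 : sigma T' * A1 = T' ^+ z * A2 * r'.
  rewrite /T' /A1 /A2 /r' (rmorphM sigma (t * a') v') (rmorphM sigma t a'). rewrite (exprMn _ (t * a') v') (exprMn _ t a').
  have -> : sigma t * sigma a' * sigma v' * (f ^+ z * a' ^+ z) = (sigma t * f ^+ z) * (sigma a' * sigma v' * a' ^+ z) by ring.
  by rewrite est; field; exact: expf_neq0.
have AA1 : A0 A1 by apply: (srM (A0_sub)); exact: (srX (A0_sub)).
have AA2 : A0 A2 by apply: (srM (A0_sub)) => //; exact: sigma_A0.
have ef := A0_eta Af; have ea' := A0_eta Aa'; have eT' := Om_eta OT'.
have rA1 : rho A1 = 1.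
  by rewrite rhoM ?rhoX ?rf ?ra' ?expr1n ?mulr1 //; exact: (srX leta).
have Rr'1 : unit_in R r'.
  have Rsv := (sigma_R _).1 Rv'; have Rsv' := (sigma_R _).1 Rv'V.
  have usv : unit_in R (sigma v') by split; rewrite ?fmorph_eq0 // -fmorphV.
  exact: (unitM lR (unitM lR ur usv) (unitV (unitX lR z uv'))).
have [r'0 Rr'' Rr'''] := Rr'1; have er' := Re Rr''; have OsT := sigma_Om OT'.
have rr : rho A2 * rho r' = 1.
  have eA2 := A0_eta AA2; have eTz := Om_eta OTz; have esT := Om_eta OsT.
  have := congr1 rho e1; rewrite (rhoM esT (A0_eta AA1)) rA1 mulr1 (sigma_rho1 eT' rT').
  by rewrite (rhoM (srM leta eTz eA2) er') (rhoM eTz eA2) (rhoX z eT') rT' expr1n mul1r => <-.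
have rr' : rho r'^-1 = rho A2.
  have uu : unit_in eta r' by split; mem. have [_ n0] := (rho_neq0 _).1 uu.
  by rewrite rhoV //; apply: (mulIf n0); rewrite mulVf.
(* The reduction of A2 is regular off the section and, as the inverse of that of the unit r', also
   at the section; hence it is constant. *)
have [_ [b Ob <-] eb] : CY (rho A2).
  apply: AY_const; first exact: rhoA. by apply/(dle0_O dYo); rewrite -rr'; exists r'^-1.
have rTz : rho (T' ^+ z) = 1 by rewrite rhoX // rT' expr1n.
have [Ys OYs [rYs cYs]] := inv_mod sOm OmO Om_pi Om_eta j.+1 OTz rTz.
have [As AAs [rAs cAs]] := A0_inv j.+1 AA1 rA1.
(* The deviation of the error term from being an eigenvector for zeta: modulo pi^(j+1), sigma T' is
   T'^z + q [dl]. *)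
pose dl := S' - iota zeta * Sg.
have Ozt : OK zeta by case: zeta_unit.
have Odl : Om dl by apply: (srB sOm) => //; apply: (srM sOm) ; mem.
have mulq w1 u1 u2 : Om w1 -> cg pi u1 u2 -> cg (pi ^+ j.+1) (q * w1 * u1) (q * w1 * u2).
  move=> Ow1 H; have := srM sOm Ow1 H; rewrite /congm pq; congr Om; field. by rewrite q0 ipi0.
have OA1 := AO AA1; have OA2 := AO AA2; have OAs := AO AAs; have Or' : Om r' by mem.
have OYA : Om (A1 * (Ys * As)) := srM sOm OA1 (srM sOm OYs OAs).
have OAr : Om (A2 * As * r') := srM sOm (srM sOm OA2 OAs) Or'.
have eYs := Om_eta OYs; have eA1 := Om_eta OA1; have eAs := Om_eta OAs.
have rYA : rho (A1 * (Ys * As)) = 1.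
  by rewrite (rhoM eA1 (srM leta eYs eAs)) (rhoM eYs eAs) rA1 rYs rAs !mulr1.
have c1 : cg (pi ^+ j.+1) (sigma T') (T' ^+ z + q * dl).
  apply: (cg_trans sOm csT); apply: (cg_sym sOm).
  have -> : ex (zeta * x) + q * S' = ex (zeta * x) + q * (iota zeta * Sg) + q * dl by rewrite /dl; ring. by mem.
have c2 : cg (pi ^+ j.+1) (1 + q * dl) (A2 * As * r').
  apply: (cg_trans sOm (x := sigma T' * (A1 * (Ys * As)))).
    apply: (cg_sym sOm); apply: (cg_trans sOm (x := (T' ^+ z + q * dl) * (A1 * (Ys * As)))).
      by mem.
    rewrite mulrDl; apply: (cgD sOm).
      have -> : T' ^+ z * (A1 * (Ys * As)) = (T' ^+ z * Ys) * (A1 * As) by ring.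
      rewrite -[1]mulr1; apply: (cgM sOm) => //; [mem|exact: (srM sOm)].
    by rewrite -[X in cg _ _ X]mulr1; apply: mulq => //; apply/rho1mod.
  have -> : sigma T' * (A1 * (Ys * As)) = (T' ^+ z * Ys) * (A2 * As * r').
    by rewrite mulrA e1; ring.
  rewrite -[X in cg _ _ X]mul1r; apply: (cgM sOm) => //; [mem|exact: (cgR sOm)].
pose l i := k i * (zeta ^+ mu i - zeta) * b.
have Ol i : OK (l i).
  by apply: (srM dO) => //; apply: (srM dO) => //; apply: (srB dO) => //; exact: (srX dO).
have el : iota b * dl = \sum_i iota (l i) * tau ^+ mu i.
  rewrite /dl /S' /Sg mulr_sumr -sumrB mulr_sumr; apply: eq_bigr => i _. by rewrite /l !rmorphM rmorphB !rmorphXn; ring.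
have c3 : cg (pi ^+ j.+1) (r'^-1 + q * \sum_i iota (l i) * tau ^+ mu i) (A2 * As).
  rewrite -el; apply: (cg_trans sOm (x := (1 + q * dl) * r'^-1)).
    rewrite mulrDl mul1r [iota b * dl]mulrC mulrA; apply: (cgD sOm); first mem.
    apply: mulq => //; have Od : Om (iota b - r'^-1) by mem; exact: OmO. have [|w1 Ow1 e] := Om_pi Od.
      apply/rho_eq0; first mem. by rewrite rhoB ?eb ?rr' ?subrr //; [mem|exact: Re].
    by rewrite /congm e mulrC mulKf // ipi0.
  have -> : A2 * As = A2 * As * r' * r'^-1 by rewrite mulfK. by mem.
have lmax := coef_max Rr''' (srM A0_sub AA2 AAs) Ol c3.
have ub : unit_in OK b.
  have [//|mb] := @unit_or_max _ OK _ Ob; have := rr; rewrite -eb.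
  rewrite (_ : rho (iota b) = 0) ?mul0r => [/eqP|]; first by rewrite eq_sym oner_eq0. by apply/rho_eq0; [mem|apply/iota_max].
(* zeta^(mu i) - zeta is a unit, because mu i - 1 lies strictly between 0 and d. *)
have kmax i : mu i != 1%N -> max_ideal OK (k i).
  move=> ne; have mi : (0 < mu i)%N.
    rewrite lt0n; apply/eqP => e0; have := (degA 0).1; case; last by exists i.
    by exists 1; split; [mem|exact: oner_neq0|exact: (dg_unit doo (unit1 doo))].
  have uz : unit_in OK (zeta ^+ mu i - zeta).
    have -> : zeta ^+ mu i - zeta = zeta * (zeta ^+ (mu i).-1 - 1) by rewrite mulrBr -exprS prednK ?mulr1.
    apply: (unitM dO); first exact: zeta_unit.
    have Oz1 : OK (zeta ^+ (mu i).-1 - 1) by apply: (srB dO); [exact: (srX dO)|mem].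
    have [//|/zeta_unity] := @unit_or_max _ OK _ Oz1. have lt1 : (0 < (mu i).-1)%N by move: mi ne; case: (mu i) => [|[]].
    by move/(dvdn_leq lt1); have := mu_small i; have := dg1; clear -mi ne; lia.
  by have := lmax i; rewrite /l => /(max_unit_mul dO ub) /(max_unit_mul dO uz).
have [i1 mi1] := gap1.
exists (x + pi ^+ j * k i1), a', v'; split=> //.
  apply: (maxD dO) => //; apply: (maxMr dO) => //; rewrite -(prednK j0) exprS. by mem.
apply: (cg_trans sOm cT'); apply: (cg_sym sOm); apply: (cg_trans sOm (ex_shift mx j0 (Ok i1))).
apply: (cgD sOm); first mem.
have Hk i : exists y, i != i1 -> OK y /\ k i = pi * y.
  have [->|ne] := eqVneq i i1; first by exists 0. have [|y Oy e] := OK_max_div (kmax i _); last by exists y.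
  by apply: contraNneq ne => e; apply/eqP/(mu_inj Hmu); rewrite e mi1.
have [k' kP] := choice Hk.
rewrite /congm pq /Sg (bigD1 i1) //= mi1 expr1 rmorphM mulrDr mulrA opprD addNKr.
have -> : \sum_(i | i != i1) iota (k i) * tau ^+ mu i = iota pi * \sum_(i | i != i1) iota (k' i) * tau ^+ mu i.
  by rewrite mulr_sumr; apply: eq_bigr => i /kP[_ ->]; rewrite rmorphM mulrA.
rewrite mulrA -mulrN mulrC mulKf ?mulf_neq0 ?ipi0 //; apply: (srN sOm); apply: (sr_sum sOm) => i /kP[Oi _].
by apply: (srM sOm); [mem|apply: (srX sOm); exact: Om_tau].
Qed.

(** Either the coordinate x of P is large, or P is trivial to every order. *)
Lemma dichotomy v0 : unit_in R v0 -> max_ideal eta (t * v0 - 1) ->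
  (exists x a v, [/\ x != 0, max_ideal OK x, A0 a /\ rho a = 1, unit_in R v & cg (x ^+ (2 * g)) (t * a * v) (ex x)]) \/
  forall k, exists a v, [/\ A0 a, rho a = 1, unit_in R v & cg (pi ^+ k) (t * a * v) 1].
Proof.
move=> uv0 mt; have [A|nA] := EM (exists x a v, [/\ x != 0, max_ideal OK x, A0 a /\ rho a = 1, unit_in R v & cg (x ^+ (2 * g)) (t * a * v) (ex x)]); [by left|right].
have Ot : Om t by exists N.
have base : state 1 0 1 v0.
  split=> //; first mem.
    by split; [mem|exact: rho1].
  rewrite mulr1 ex0 expr1; have [|w Ow e] := Om_pi _ mt.
    by mem.
  by rewrite /congm e mulrC mulKf // ipi0.
(* If pi^(j+2) does not divide x^(2g), then x^(2g) divides pi^(j+1) and the state already gives the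
   first alternative. *)
have small j x a v : state j.+1 x a v -> OK (x ^+ (2 * g) / pi ^+ j.+2).
  move=> [mx Aa uv cT]; have [x0|x0] := eqVneq x 0.
    by rewrite x0 expr0n gtn_eqF ?mul0r; [mem|have := g_ge2; lia].
  have xg0 : x ^+ (2 * g) != 0 by rewrite expf_neq0. apply: contrapT => nO; apply: nA; exists x, a, v; split=> //.
  apply: (cg_le sOm OmO _ _ _ cT) => //; apply/(ordv_ge0 dO) => n0.
  have : ~ vge OK 0 (x ^+ (2 * g) / pi ^+ j.+2) by move/(ordv_ge0 dO).
  rewrite (ordv_div dO) //; move=> H; have : ~ 0 <= ordv OK (x ^+ (2 * g)) - ordv OK (pi ^+ j.+2).
    by move=> H'; apply: H => _; rewrite (ordv_div dO).
  by rewrite !(ordvXn _ dO) // (ordv_unif dO upi); lia.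
have all j : exists x a v, state j.+1 x a v.
  elim: j => [|j [x [a [v st]]]]; first by exists 0, 1, v0. exact: improve (ltn0Sn j) st (small _ _ _ _ st).
(* At this precision x^(2g) is divisible by pi^(2 g k), so x is divisible by pi^k and ex x is 1
   modulo pi^k. *)
move=> k; pose k1 := (2 * g * k)%N; have [x [a [v st]]] := all k1.
have O2 := small _ _ _ _ st; have [mx [Aa ra] uv cT] := st; exists a, v; split=> //.
have Ox : OK x by case: mx.
apply: (cg_trans sOm (x := ex x)).
  apply: (cg_le sOm OmO _ _ _ cT) => //. have kK : (k <= k1.+1)%N by rewrite /k1; have := g_ge2; nia.
  by rewrite -(subnK kK) exprD mulfK.
rewrite -ex0; apply: ex_cong => //; first mem.
rewrite subr0; apply: (dvr_integral dO (n := 2 * g)); first by have := g_ge2; lia.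
have -> : (x / pi ^+ k) ^+ (2 * g) = x ^+ (2 * g) / pi ^+ k1.+2 * pi ^+ 2.
  have -> : pi ^+ k1.+2 = pi ^+ k ^+ (2 * g) * pi ^+ 2 by rewrite -exprM -exprD /k1 addn2 [(k * _)%N]mulnC.
  by rewrite expr_div_n; field; rewrite ?pi0 ?pn0 ?expf_neq0 ?pn0.
by mem.
Qed.
End Approximation.

(** * Passage to the limit when the class is trivial to every order *)

Section Limit.

Lemma Om_TR n h : Om h -> dle oo n%:Z h -> TR n h.
Proof.
move=> [M Th] dh; apply: TR_norm => //; first exact: TR_eta Th.
move=> x cx Rsx xo; have [_ _ sx'] := unitX (Xd cx) M (sx cx Rsx xo).
by rewrite -[h](mulfK (expf_neq0 M (s_neq0))); apply: (srM (Xd cx)) => //; exact: Rsx.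
Qed.
Lemma A0_div k h : A h -> Om (h / iota (pi ^+ k)) -> A0 (h / iota (pi ^+ k)).
Proof.
move=> Ah Oh; split; last mem.
by move=> x cx xo; apply: (srM (Xd cx)); [exact: Ah|rewrite -fmorphV; mem].
Qed.
(** Global functions modulo pi^k are constants: the T^(mu i) part of (a - r) / pi^k vanishes by
    [Om_uniq], so a and r can be corrected by multiples of pi^k to a function regular everywhere. *)
Lemma const_mod k a r : A0 a -> R r -> cg (pi ^+ k) a r -> exists2 e, OK e & cg (pi ^+ k) a (iota e).
Proof.
move=> Aa Rr H; have [al [be [l [Aal Rbe Ol e]]]] := Om_decomp H; have Oal := AO Aal.
have Apk : A (iota (pi ^+ k)) by move=> x cx _; exact: XK.
have [[Aa' ea] [Aal' eal]] : A0 a /\ A0 al by [].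
have e' : a - r = iota (pi ^+ k) * (al + be + \sum_i iota (l i) * s^-1 ^+ mu i) by rewrite -e [RHS]mulrC divfK.
have l0 : forall i, pi ^+ k * - l i = 0.
  apply: (Om_uniq (a := a - iota (pi ^+ k) * al) (b := - r - iota (pi ^+ k) * be)).
  - by mem.
  - by mem.
  rewrite (eq_bigr (fun i => - iota (pi ^+ k) * (iota (l i) * s^-1 ^+ mu i))); last first.
    by move=> i _; rewrite rmorphM rmorphN; ring.
  by rewrite -mulr_sumr; move: e'; set S := \sum_i _ => e'; rewrite -[a](subrK r) e'; ring.
have er : a - iota (pi ^+ k) * al = r + iota (pi ^+ k) * be.
  rewrite big1 in e' => [|i _]; first by rewrite -[a](subrK r) e'; ring.
  by have /eqP := l0 i; rewrite mulf_eq0 (negbTE (pn0 k)) oppr_eq0 => /eqP ->; rewrite rmorph0 mul0r.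
have [e1 _ ee] : CX (a - iota (pi ^+ k) * al).
  apply: A_const; first by apply: (srB (A_subring)) => //; mem.
  apply/(dle0_O doo); rewrite er; apply: Rx; apply: (srD lR) => //; apply: (srM lR) => //; mem.
exists e1; last first.
  by rewrite /congm ee opprB addrC subrK mulrC mulKf.
apply: eta_OK; rewrite ee; apply: (srB leta) => //; apply: (srM leta) => //; mem.
Qed.

Section Basis.
Variable w : nat -> F.
Hypotheses (w0 : w 0%N = 1) (wP : forall n, ~ gp n -> A (w n) /\ monic_at n (w n)).
Lemma w_indep N (k : nat -> K) : (forall n, gp n -> k n = 0) ->
  \sum_(n < N) iota (k n) * w n = 0 -> forall n, (n < N)%N -> k n = 0.
Proof.
move=> gk S0 n nN; apply/eqP; apply: contraT => kn.
have wn i : k i != 0 -> w i != 0 /\ dgX (iota (k i) * w i) = i%:Z.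
  move=> ki; have ng : ~ gp i by move=> /gk e; rewrite e eqxx in ki.
  have [Aw mw] := wP ng; have [[wi _ _] _ dw] := monic_atE mw; split=> //.
  rewrite (dgM doo) ?fmorph_eq0 // dw (@dg_unit _ _ doo (iota (k i))) ?add0r //.
  by split; rewrite ?fmorph_eq0 -?fmorphV //; exact: XK.
have [||] := distinct_sum doo pr (n := N) (a := fun n => iota (k n) * w n); last by rewrite S0 eqxx.
  move=> i j /andP[ij jN]; rewrite !mulf_eq0 !negb_or !fmorph_eq0 => /andP[ki _] /andP[kj _].
  by have [_ ->] := wn i ki; have [_ ->] := wn j kj; lia.
by exists n => //; rewrite mulf_neq0 ?fmorph_eq0 //; have [] := wn n kn.
Qed.
Lemma expand N h : A h -> TR N h -> exists k : nat -> K, [/\ forall n, OK (k n), forall n, gp n -> k n = 0 &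
  h = \sum_(n < N.+1) iota (k n) * w n].
Proof. by move=> Ah Th; have := good_expand A_good wP Ah Th. Qed.
Lemma TR_iota n a h : OK a -> TR n h -> TR n (iota a * h).
Proof. by move=> Oa Th; rewrite /TR /= -mulrA; apply: (srM lR) => //; exact: Ri. Qed.
Lemma w_A0 n a : OK a -> (gp n -> a = 0) -> A0 (iota a * w n) /\ TR n (iota a * w n).
Proof.
move=> Oa ga; have [/ga ->|/wP[Aw [Tw _]]] := pselect (gp n).
  by rewrite rmorph0 mul0r; split; [mem|rewrite /TR /= mul0r; exact: (sr0 lR)].
split; last exact: TR_iota.
by apply: (srM (A0_sub)); [mem|split=> //; exact: (TR_eta Tw)].
Qed.
Lemma sum_A0 N (k : nat -> K) : (forall n, OK (k n)) -> (forall n, gp n -> k n = 0) ->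
  A0 (\sum_(n < N.+1) iota (k n) * w n) /\ TR N (\sum_(n < N.+1) iota (k n) * w n).
Proof.
move=> Ok gk; split; first by apply: (sr_sum (A0_sub)) => n _; case: (w_A0 (Ok n) (@gk n)).
rewrite /TR /= mulr_suml; apply: (sr_sum lR) => n _.
have nN : (n <= N)%N by rewrite -ltnS.
by have [_ T] := w_A0 (Ok n) (@gk n); exact: TR_le nN T.
Qed.
Lemma E_low M h : TR M h -> E (h * s ^+ M.+1) 0 = 0.
Proof.
move=> Th; apply/eqP; apply: contraT => e0.
have ms : max_ideal oo s by apply/(ordv_max doo) => _; rewrite sord.
have T' : TR M.+1 h := TR_le (leqnSn M) Th.
have mh : max_ideal oo (h * s ^+ M.+1) by rewrite exprSr mulrA; apply: (maxMl doo) => //; exact: Rx.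
case: (unit_not_max _ (maxB doo mh (R_ev T'))); rewrite opprB addrC subrK.
by split; rewrite ?fmorph_eq0 -?fmorphV //; exact: XK.
Qed.
Lemma trunc N k u a : TR N u -> A0 a -> cg (pi ^+ k) u a -> exists b, [/\ A0 b, TR N b & cg (pi ^+ k) u b].
Proof.
move=> Tu Aa; have [M Ta] := AO Aa; elim: M a Aa Ta => [|M IH] a Aa Ta H.
  by exists a; split=> //; exact: TR_le _ Ta.
have [le|lt] := leqP M.+1 N; first by exists a; split=> //; exact: TR_le le Ta.
have [kk [Ok gk ea]] := expand (proj1 Aa) Ta; rewrite big_ord_recr /= in ea.
have [Ae Te] := sum_A0 M Ok gk; set a' := \sum_(n < M.+1) _ in ea Ae Te.
have Tu' : TR M u by apply: TR_le _ Tu; rewrite -ltnS.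
have [e0|ng] := eqVneq (kk M.+1) 0.
  by rewrite e0 rmorph0 mul0r addr0 in ea; apply: (IH a') => //; rewrite -ea.
have [Aw [Tw w1]] : A (w M.+1) /\ monic_at M.+1 (w M.+1) by apply: wP => /gk; apply/eqP.
have ed : (u - a) / iota (pi ^+ k) = iota (pi ^+ k)^-1 * (u - a' - iota (kk M.+1) * w M.+1).
  by rewrite fmorphV mulrC {1}ea; ring.
have T1 : TR M.+1 ((u - a) / iota (pi ^+ k)).
  apply: Om_TR => //; rewrite ed; apply: (dleZ doo CX_V (CX_oo)); first by exists (pi ^+ k)^-1.
  apply: (dleB doo); last exact: TR_dgX (TR_iota (Ok _) Tw). by apply: (dleB doo); apply: TR_dgX; exact: (TR_le (leqnSn M)).
have OE := E_int 0 T1.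
have E1 : E ((u - a) / iota (pi ^+ k) * s ^+ M.+1) 0 = - (kk M.+1 / pi ^+ k).
  rewrite ed -mulrA (EZ HE) !mulrBl -mulrA (EB HE) (EB HE) (EZ HE) w1 !E_low //. by rewrite subrr sub0r mulr1 mulrN mulrC.
rewrite E1 in OE; apply: (IH a') => //.
have := srD sOm H (srM sOm (OmO (srN dO OE)) (ex_intro _ M.+1 Tw : Om (w M.+1))).
rewrite /congm opprK ea fmorph_div; congr Om; ring.
Qed.

Variables (P : set F -> int) (m : nat) (f t : F) (N : nat).
Hypotheses (m0 : (0 < m)%N) (lt : loceq P t) (Tt : TR N t).
Hypotheses (Af : A0 f) (rf : rho f = 1) (of_ : forall x, cl x -> ordv x f = m%:Z * P x).
Hypothesis B : forall k, exists a v, [/\ A0 a, rho a = 1, unit_in R v & cg (pi ^+ k) (t * a * v) 1].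
Let Ot : Om t. Proof. by exists N. Qed.

(** The approximate solutions are determined only up to constants; the normalization l 0 = 1 makes
    those of successive precisions congruent. The bound N, the same for all k, leaves finitely many
    coefficients. *)
Lemma approx_b k : exists (l : nat -> K) v, [/\ (forall n, OK (l n)) /\ (forall n, gp n -> l n = 0), l 0%N = 1,
  unit_in R v, rho (\sum_(n < N.+1) iota (l n) * w n) = 1 &
  cg (pi ^+ k.+1) (t * v) (\sum_(n < N.+1) iota (l n) * w n)].
Proof.
have [a [v [Aa ra uv H]]] := B k.+1; have [v0 Rv _] := uv.
have [b Ab [rb cb]] := A0_inv k.+1 Aa ra.
have Ob := AO Ab; have Ov := RO Rv.
have c1 : cg (pi ^+ k.+1) (t * v) b.
  apply: (cg_trans sOm (x := t * v * (a * b))).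
    rewrite -[X in cg _ X _]mulr1; apply: (cgM sOm); rewrite ?mulr1; try exact: (srM sOm).
    - by mem.
    - by mem.
    - by mem.
  rewrite (_ : t * v * (a * b) = t * a * v * b); last by ring.
  rewrite -[X in cg _ _ X]mul1r; apply: (cgM sOm) => //; first mem. by mem.
have Ttv : TR N (t * v) by rewrite /TR /= mulrAC; mem.
have [b1 [Ab1 Tb1 cb1]] := trunc Ttv Ab c1.
have rb1 : rho b1 = 1.
  have e : rho (b1 - b) = 0.
    have Oq : Om ((b1 - b) / iota (pi ^+ k.+1)) by exact: (cg_trans sOm (cg_sym sOm cb1) c1).
    apply/(rho_eq0 (srB leta (proj2 Ab1) (proj2 Ab))). rewrite -[b1 - b](divfK (ipn0 k.+1)); apply: (maxMl leta); first mem.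
    by rewrite exprS rmorphM; apply: (maxMr leta); [mem|apply: eta_iota; apply: (srX dO); exact: Opi].
  have eb := proj2 Ab; by rewrite -(subrK b b1) (rhoD (srB leta (proj2 Ab1) eb) eb) e add0r.
have [|q Aq eq] := A0_pi (srB A0_sub Ab1 (sr1 (A0_sub))).
  have e1 := sr1 leta; have eb := proj2 Ab1. by apply/(rho_eq0 (srB leta eb e1)); rewrite (rhoB eb e1) rho1 rb1 subrr.
have Tq : TR N q.
  have [Aq' eq'] := Aq; apply: (A_TR Aq' eq'). have -> : q = iota pi^-1 * (b1 - 1) by rewrite eq fmorphV mulKf // ipi0.
  apply: (dleZ doo CX_V (CX_oo)); first by exists pi^-1. apply: (dleB doo); first exact: (TR_dgX Tb1).
  by apply: TR_dgX; rewrite /TR /= mul1r; exact: (srX lR).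
have [kk [Ok gk eq2]] := expand (proj1 Aq) Tq.
pose l n := (n == 0%N)%:R + pi * kk n.
have ng0 : ~ gp 0%N.
  by apply/degA; exists 1; split; [mem|exact: oner_neq0|exact: (dg_unit doo (unit1 doo))].
have el : b1 = \sum_(n < N.+1) iota (l n) * w n.
  rewrite (eq_bigr (fun n : 'I_N.+1 => iota (val n == 0%N)%:R * w n + iota pi * (iota (kk n) * w n))); last first.
    by move=> n _; rewrite /l rmorphD rmorphM; ring.
  rewrite big_split -mulr_sumr -eq2 -eq big_ord_recl /= rmorph1 w0 mulr1.
  by rewrite big1 ?addr0 ?[1 + _]addrC ?subrK // => i _; rewrite rmorph0 mul0r.
have ul : unit_in OK (l 0%N).
  by rewrite /l eqxx; apply: (unitDmax dO (unit1 dO)); apply: (maxMr dO) => //; mem.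
have [l0 Ol0 Ol0'] := ul; have Ol n : OK (l n).
  apply: (srD dO); first by case: eqP => _; [mem|exact: (sr0 dO)]. by mem.
have rl : rho (iota (l 0%N)) = 1.
  rewrite /l eqxx rmorphD rmorph1 rmorphM rhoD ?rho1 ?rhoM ?((rho_eq0 _).2 (mepi)) ?mul0r ?addr0 //.
  all: rewrite -?rmorphM; try apply: eta_iota => //; try exact: Opi; try exact: (sr1 leta). by mem.
have eb2 : \sum_(n < N.+1) iota (l n / l 0%N) * w n = iota (l 0%N)^-1 * b1.
  by rewrite el mulr_sumr; apply: eq_bigr => n _; rewrite rmorphM; ring.
exists (fun n => l n / l 0%N), (iota (l 0%N)^-1 * v); rewrite eb2; split.
- split=> [n|]; first mem.
  by case=> [//|n] gn; rewrite /l /= add0r gk // mulr0 mul0r.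
- by rewrite mulfV.
- apply: (unitM lR) => //; split; rewrite ?fmorph_eq0 ?invr_eq0 //; first mem.
  by rewrite -fmorphV invrK; mem.
- have ei := eta_iota Ol0'; rewrite (rhoM ei (A0_eta Ab1)) rb1 fmorphV rhoV ?rl ?mulr1 ?invr1 //.
  exact: rho_iota_unit.
- by have := srM sOm (OmO Ol0') cb1; rewrite /congm; congr Om; ring.
Qed.

(** The coefficients converge to those of a function b0, and b0^m is a constant times f. As div f =
    m P, dividing orders by m gives div b0 = P. *)
Lemma limit_b : exists2 b, b != 0 & forall x, cl x -> ordv x b = P x.
Proof.
have [l0 H0] := choice approx_b; have [v0 Hv] := choice H0.
pose b k := \sum_(n < N.+1) iota (l0 k n) * w n.
have Ab k : A0 (b k) by have [[Ol gl] _ _ _ _] := Hv k; case: (sum_A0 N Ol gl).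
have Ob k : Om (b k) := AO (Ab k).
have [t0 et et'] := lt.1.
have step k : cg (pi ^+ k.+1) (t * v0 k.+1) (b k.+1).
  have [_ _ _ _ H] := Hv k.+1; apply: (cg_le sOm OmO _ _ _ H) => //. by rewrite exprS mulfK //; exact: Opi.
have to_const k u r : A0 u -> R r -> cg (pi ^+ k.+1) (u * v0 k) (b k * r) ->
    exists2 e, OK e & cg (pi ^+ k.+1) u (iota e * b k).
  move=> Au Rr H; have [_ _ uv rb _] := Hv k; have [vn Rv Rv'] := uv; have Ou := AO Au.
  have [b' Ab' [_ cb]] := A0_inv k.+1 (Ab k) rb. have Or' : Om (r / v0 k) by mem; exact: (srM lR).
  have H1 : cg (pi ^+ k.+1) u (b k * (r / v0 k)).
    have := srM sOm H (RO Rv'); rewrite /congm; congr Om; field; rewrite vn ?andbT; mem.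
  have [] := @const_mod k.+1 (u * b') (r / v0 k).
  - by mem.
  - by mem.
  - apply: (cg_trans sOm (x := b k * (r / v0 k) * b')).
      by mem.
    rewrite mulrAC -[X in cg _ _ X]mul1r; apply: (cgM sOm) => //; [mem|exact: (cgR sOm)].
  move=> e Oe ce; exists e => //. apply: (cg_trans sOm (x := u * (b k * b'))).
    rewrite -[X in cg _ X _]mulr1; apply: (cgM sOm) => //; [mem|exact: (cgR sOm)|exact: (cg_sym sOm)].
  rewrite mulrCA mulrC; apply: (cgM sOm) => //; mem.
have cauchy k n : (n < N.+1)%N -> OK ((l0 k.+1 n - l0 k n) / pi ^+ k.+1).
  move=> nN; have [[Ol gl] l1 uv rb H] := Hv k; have [[Ol' gl'] l1' uv' rb' _] := Hv k.+1.
  have [vn Rv _] := uv; have [vn' Rv' _] := uv'; have Ov' := RO Rv'. have [] := @to_const k (b k.+1) (v0 k.+1) => //.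
    apply: (cg_trans sOm (x := t * v0 k.+1 * v0 k)).
      by mem.
    by rewrite mulrAC; apply: (cgM sOm) => //; [mem].
  move=> e Oe ce; have Ad : A (b k.+1 - iota e * b k).
    by apply: (srB (A_subring)); [case: (Ab k.+1)|apply: (srM (A_subring)); [move=> x cx _; mem|case: (Ab k)]].
  have Aq := A0_div Ad ce. have Tq : TR N ((b k.+1 - iota e * b k) / iota (pi ^+ k.+1)).
    apply: Om_TR => //; rewrite mulrC -fmorphV; apply: (dleZ doo CX_V (CX_oo)); first by exists (pi ^+ k.+1)^-1.
    have [_ T1] := sum_A0 N Ol gl; have [_ T2] := sum_A0 N Ol' gl'.
    by apply: (dleB doo); apply: TR_dgX => //; exact: TR_iota.
  have [kk [Ok gk eq]] := expand (proj1 Aq) Tq. have key i : (i < N.+1)%N -> l0 k.+1 i - e * l0 k i = pi ^+ k.+1 * kk i.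
    move=> iN; apply/eqP; rewrite -subr_eq0; apply/eqP.
    apply: (w_indep (k := fun i => l0 k.+1 i - e * l0 k i - pi ^+ k.+1 * kk i)) iN.
      by move=> j gj; rewrite gl // gl' // gk // !mulr0 !subr0.
    have := congr1 (fun z => z * iota (pi ^+ k.+1)) eq; rewrite /= divfK // => eq'.
    rewrite (eq_bigr (fun i : 'I_N.+1 => iota (l0 k.+1 i) * w i - iota e * (iota (l0 k i) * w i)
       - iota (kk i) * w i * iota (pi ^+ k.+1))); last first.
      by move=> j _; rewrite !rmorphB !rmorphM; ring.
    by rewrite !sumrB -mulr_sumr -mulr_suml -eq' subrr.
  have k0 := key 0%N isT; rewrite l1 l1' mulr1 in k0. have -> : (l0 k.+1 n - l0 k n) / pi ^+ k.+1 = kk n - kk 0%N * l0 k n.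
    apply: (mulIf (pn0 k.+1)); rewrite divfK // mulrBl [kk n * _]mulrC -key // mulrAC [kk 0%N * _]mulrC -k0; ring.
  by mem.
have lim n : exists l, (n < N.+1)%N -> forall k, OK ((l - l0 k n) / pi ^+ k.+1).
  have [nN|] := ltnP n N.+1; last by exists 0. have [|l lP] := Ocompl (x := fun k => if k is k'.+1 then l0 k' n else 0).
    case=> [|k]; last exact: cauchy. by have [[Ol _] _ _ _ _] := Hv 0%N; rewrite subr0 expr0 divr1.
  by exists l => _ k; have := lP k.+1.
have [l lP] := choice lim.
pose b0 := \sum_(n < N.+1) iota (l n) * w n.
have ng_w (n : 'I_N.+1) : gp n -> l n = 0.
  move=> gn; suff : iota (l n) = 0 by move/eqP; rewrite fmorph_eq0 => /eqP.
  apply: eta_sep => -[|k]; first rewrite expr0 rmorph1 divr1.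
    have := lP n (ltn_ord n) 0%N; have [[_ gl] _ _ _ _] := Hv 0%N; rewrite gl // subr0 expr1 => O1.
    by rewrite -[l n](divfK pi0); apply: eta_iota; apply: (srM dO) => //; mem.
  have := lP n (ltn_ord n) k; have [[_ gl] _ _ _ _] := Hv k; rewrite gl // subr0 => O1. by rewrite -fmorph_div; mem.
have cb k : cg (pi ^+ k.+1) b0 (b k).
  rewrite /congm /b0 /b -sumrB mulr_suml; apply: (sr_sum sOm) => n _.
  have -> : (iota (l n) * w n - iota (l0 k n) * w n) / iota (pi ^+ k.+1) = iota ((l n - l0 k n) / pi ^+ k.+1) * w n.
    by rewrite fmorph_div rmorphB; ring.
  have [gn|ng] := pselect (gp n).
    by rewrite (ng_w _ gn); have [[_ gl] _ _ _ _] := Hv k; rewrite gl // subrr mul0r rmorph0 mul0r; mem.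
  apply: (srM sOm); first by apply: OmO; exact: lP. by have [_ [Tw _]] := wP ng; exists n.
have Ob0 : Om b0.
  have := srD sOm (srM sOm (cb 0%N) (OmO (Opi))) (Ob 0%N). by rewrite expr1 divfK ?ipi0 // subrK.
have rb0 : rho b0 = 1.
  have [_ _ _ rb _] := Hv 0%N; have H : Om ((b0 - b 0%N) / iota (pi ^+ 1)) := cb 0%N; rewrite expr1 in H.
  rewrite -[b0](subrK (b 0%N)) -[b0 - _](divfK (ipi0)).
  have e1 := Om_eta H; have [_ e2] := mepi; have e3 := mepi.1; have e4 := Om_eta (Ob 0%N).
  by rewrite (rhoD (srM leta e1 e3) e4) (rhoM e1 e3) ((rho_eq0 e3).2 (mepi)) mulr0 add0r.
have b00 : b0 != 0.
  by apply/eqP => e; move: rb0; rewrite e rho0 => /eqP; rewrite eq_sym oner_eq0.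
have f0 : f != 0.
  by apply/eqP => e; move: rf; rewrite e rho0 => /eqP; rewrite eq_sym oner_eq0.
have ef := A0_eta Af; have ef' : eta f^-1.
  have [_ _ //] : unit_in eta f by apply/rho_neq0; split=> //; rewrite rf oner_neq0.
have ur : unit_in R (f / t ^+ m).
  have u1 : f / t ^+ m != 0 by rewrite mulf_neq0 // invr_eq0 expf_neq0.
  have ox x : cl x -> R `<=` x -> unit_in x (f / t ^+ m).
    move=> cx Rsx; have dx := Xd cx; apply: (unit_ordv dx) => //.
    by rewrite (ordv_div dx) ?expf_neq0 // (ordvXn _ dx) // of_ // (lt.2 x cx Rsx) subrr.
  have ue1 : unit_in eta (f / t ^+ m) by mem.
  have [_ e1 e2] := ue1; split=> //; apply: (normality R_csp) => // x cx Rsx; by have [] := ox x cx Rsx.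
(* At each precision b0^m is f times a unit of R; multiplied by an approximate inverse of f in [A0]
   it falls under [const_mod]. *)
have const k : exists2 e, OK e & cg (pi ^+ k.+1) (b0 ^+ m) (iota e * f).
  have [_ _ uv _ H] := Hv k; have [vn Rv Rv'] := uv; have [rn Rr Rr'] := ur. have [f1 Af1 [_ cf]] := A0_inv k.+1 Af rf.
  have cbm : cg (pi ^+ k.+1) (b0 ^+ m) ((t * v0 k) ^+ m).
    apply: (cgX sOm) => //; first mem. exact: (cg_trans sOm (cb k) (cg_sym sOm H)).
  pose r1 := v0 k ^+ m / (f / t ^+ m). have Rr1 : R r1 by apply: (srM lR) => //; exact: (srX lR).
  have etv : (t * v0 k) ^+ m = f * r1 by rewrite /r1 exprMn; field; rewrite f0 expf_neq0.
  have Or1 := RO Rr1; rewrite etv in cbm.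
  have Ab0 : A0 (b k ^+ m * f1) by apply: (srM (A0_sub)) => //; exact: (srX (A0_sub)).
  have cbk : cg (pi ^+ k.+1) (b k ^+ m) (f * r1).
    apply: (cg_trans sOm _ cbm); apply: (cgX sOm) => //; mem.
  have Obk := srX sOm m (Ob k). have [] := const_mod Ab0 Rr1 (k := k.+1).
    apply: (cg_trans sOm (x := f * r1 * f1)).
      by mem.
    by rewrite mulrAC -[X in cg _ _ X]mul1r; apply: (cgM sOm) => //; [mem|exact: (cgR sOm)].
  move=> e Oe ce; exists e => //. apply: (cg_trans sOm (x := b k ^+ m)); first by apply: (cgX sOm).
  apply: (cg_trans sOm (x := b k ^+ m * (f * f1))).
    rewrite -[X in cg _ X _]mulr1; apply: (cgM sOm) => //; [mem|exact: (cgR sOm)|exact: (cg_sym sOm)].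
  by rewrite mulrCA mulrC; apply: (cgM sOm) => //; mem.
have [e0 [Oe ce]] : exists e : nat -> K, (forall k, OK (e k)) /\ forall k, cg (pi ^+ k.+1) (b0 ^+ m) (iota (e k) * f).
  have C k : exists e, OK e /\ cg (pi ^+ k.+1) (b0 ^+ m) (iota e * f) by have [e ? ?] := const k; exists e.
  by have [e eP] := choice C; exists e; split=> k; case: (eP k).
have cmp k e' : cg (pi ^+ k.+1) (b0 ^+ m) (iota e' * f) -> OK ((e' - e0 k) / pi ^+ k.+1).
  move=> H; apply: eta_OK; have H1 := Om_eta (cg_trans sOm (cg_sym sOm H) (ce k)).
  have := srM leta H1 ef'; congr eta; rewrite fmorph_div rmorphB; field; rewrite f0 ?andbT; mem.
have [|e eP] := Ocompl (x := fun k => if k is k'.+1 then e0 k' else 0).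
  case=> [|k]; first by rewrite subr0 expr0 divr1. apply: cmp; apply: (cg_le sOm OmO _ _ _ (ce k.+1)) => //.
  by rewrite [pi ^+ k.+2]exprS mulfK //; exact: Opi.
have eb : b0 ^+ m = iota e * f.
  apply/eqP; rewrite -subr_eq0; apply/eqP; apply: eta_sep => -[|k].
    rewrite expr0 rmorph1 divr1; apply: (srB leta); first exact: (Om_eta (srX sOm m Ob0)).
    apply: (srM leta) => //; apply: eta_iota. by have := eP 0%N; rewrite subr0 expr0 divr1.
  apply: Om_eta; apply: (cg_trans sOm (ce k)); rewrite /congm -mulrBl mulrAC -rmorphB -fmorph_div.
  apply: (srM sOm); last mem. by apply: OmO; have := srN dO (eP k.+1); rewrite -mulNr opprB.
exists b0 => // x cx; have dx := Xd cx.
have e00 : e != 0 by apply: contraNneq (expf_neq0 m b00); rewrite eb => ->; rewrite rmorph0 mul0r.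
have := congr1 (ordv x) eb; rewrite (ordvXn _ dx) // (ordvM dx) ?fmorph_eq0 // of_ //.
rewrite (ordv_unit dx (h := iota e)); last by split; rewrite ?fmorph_eq0 -?fmorphV //; exact: XK.
by rewrite add0r; nia.
Qed.
End Basis.
End Limit.

(** * Coordinates along the section, powers of zeta *)

Section Special.

Lemma idx_gaps (S : set int) (k : nat) : hasidx S k%:Z -> (forall n, S n -> 0 <= n) ->
  exists L : seq nat, [/\ uniq L, size L = k & forall i : nat, (i \in L) <-> ~ S i%:Z].
Proof.
move=> iS S0; have [N1 top] := hasidx_top iS; have [N0 [_ HN]] := iS.
pose N := maxn N0 N1; have := HN N (leq_maxl _ _).
rewrite /cnt iotaD count_cat [count _ (seq.iota 0 N)](_ : _ = 0%N); last first.
  apply/eqP; rewrite -leqn0 leqNgt -has_count; apply/hasP => -[i]. by rewrite mem_iota => /andP[_ im] /asboolW /S0; lia.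
rewrite add0n add0n -[X in seq.iota X]addn0 iotaDl count_map.
rewrite (eq_count (a2 := fun i : nat => `[< S i%:Z >])); last by move=> i /=; congr `[< S _ >]; lia.
have := count_predC (fun i : nat => `[< S i%:Z >]) (seq.iota 0 N); rewrite size_iota => e e'.
exists [seq i <- seq.iota 0 N | ~~ `[< S i%:Z >]]; split; first by rewrite filter_uniq ?iota_uniq.
  by rewrite size_filter -[count _ _]/(count (predC (fun i : nat => `[< S i%:Z >])) _); lia.
move=> i; rewrite mem_filter mem_iota add0n; split=> [/andP[/asboolP]|nS] //.
by apply/andP; split; [exact/asboolP|rewrite /= ltnNge; apply/negP => le; apply: nS; apply: top; rewrite /N in le; lia].
Qed.

(** the coordinate of z at T^k *)
Local Notation Cf k z := (E (z * s ^+ k) 0).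
Lemma E_div h n : degT_le (E (h * s)) n -> (forall i, OK (E (h * s) i)) ->
  degT_le (E h) (n + 1) /\ forall i, OK (E h i).
Proof.
move=> Hd HO; have ds : degT_le (E s) (- 1).
  move=> i i1; have [->|ne] := eqVneq i 0; first exact: Es0. by apply: (E_le0 Rs); lia.
have dh : degT_le (E h) (n + 1).
  have [->|h0] := eqVneq h 0; first by move=> i _; exact: (E0 HE).
  have [m [m0 dm]] := E_top HE h0; have := EM_top HE dm ds; rewrite Es1 mulr1 => em.
  have mn : m - 1 <= n by rewrite leNgt; apply/negP => /Hd; rewrite em; apply/eqP. by apply: degT_leW _ dm; lia.
split=> //; suff H j : forall i, (i <= j)%N -> OK (E h (n + 1 - i%:Z)).
  move=> i; have [ni|] := leP i (n + 1); last by move/dh => ->; mem.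
  by have := H _ (absz (n + 1 - i)%R) (leqnn _); congr (OK (E h _)); lia.
elim: j => [|j IH] i; last first.
  rewrite leq_eqVlt => /orP[/eqP ->|]; last exact: IH.
  have := E_mul HE j.+1 dh ds; rewrite big_ord_recr /= subnn subr0 Es1 mulr1.
  move/eqP; rewrite addrC -subr_eq => /eqP <-; apply: (srB dO); first mem.
  apply: (sr_sum dO) => l _; apply: (srM dO); last exact: E_int. by apply: IH; rewrite -ltnS.
rewrite leqn0 => /eqP ->; have := E_mul HE 0 dh ds; rewrite big_ord1 !subr0 Es1 mulr1 => <-; exact: HO.
Qed.
Lemma E_TR n h : TR n h -> forall i, OK (E h i).
Proof.
suff H : forall h, TR n h -> degT_le (E h) n%:Z /\ forall i, OK (E h i) by move=> /H[].
elim: n => [|n IH] {}h; rewrite /TR /= => Th.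
  by rewrite mulr1 in Th; split; [exact: E_le0|move=> i; exact: E_int].
have [|d1 O1] := IH (h * s); first by rewrite /TR /= -mulrA -exprS.
by have := E_div d1 O1; rewrite -addn1 PoszD.
Qed.
Lemma C_int k z : Om z -> OK (Cf k z).
Proof. by move=> Oz; have [n T] := srM sOm Oz (srX sOm k (RO Rs)); exact: (E_TR T). Qed.
Lemma C_cong k q u v : cg q u v -> q != 0 -> OK ((Cf k u - Cf k v) / q).
Proof.
move=> /(C_int k) H q0; move: H; congr OK.
have -> : (u - v) / iota q * s ^+ k = iota q^-1 * (u * s ^+ k - v * s ^+ k) by rewrite fmorphV; ring.
by rewrite (EZ HE) (EB HE) mulrC.
Qed.
Lemma C_low n k z : TR n z -> (n < k)%N -> Cf k z = 0.
Proof. by case: k => // k Tz nk; apply: E_low; exact: (TR_le (ltnSE nk) Tz). Qed.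
Lemma C_tau n k z : (n <= k)%N -> Cf k (tau ^+ n * z) = Cf (k - n) z.
Proof.
move=> nk; have e : tau ^+ n * s ^+ n = 1 by rewrite -exprMn mulVf ?expr1n.
by congr (E _ 0); rewrite -[RHS]mul1r -e -{1}(subnK nk) exprD; ring.
Qed.
Lemma Om_tauX n : Om (tau ^+ n). Proof. by apply: (srX sOm); exact: Om_tau. Qed.

(** A top coordinate that is not a unit can be removed without changing the reduction; in the end an
    element of R with unit reduction is left. *)
Lemma unit_coord N u : TR N u -> rho u != 0 -> 0 <= dgY (rho u) -> exists2 i, (i <= N)%N & unit_in OK (Cf i u).
Proof.
elim: N u => [|N IH] u Tu r0 d0; have Ou := E_int 0 Tu.
  exists 0%N => //; apply/(R_unit Tu); move: Tu; rewrite /TR /= expr0 mulr1 => Ru.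
  have [uu|mu0] := @unit_or_max _ _ (rho u) (ex_intro2 _ _ u Ru erefl : (rho @` R) (rho u)).
    exact/(R_rho_unit Ru).
  by have := (ordv_max dYo _).1 mu0 r0; move: d0; rewrite /dg; lia.
have [uu|mm] := @unit_or_max _ _ _ Ou; first by exists N.+1.
pose e := Cf N.+1 u; pose u1 := u - iota e * tau ^+ N.+1.
have TtN : TR N.+1 (tau ^+ N.+1) by rewrite /TR /= -exprMn mulVf // expr1n; mem.
have T1 : TR N u1.
  apply: TR_drop; first by apply: TR_csub => //; exact: TR_iota.
  by rewrite mulrBl -mulrA -exprMn mulVf // expr1n (EB HE) (EZ HE) (E1 HE) eqxx mulr1 subrr.
have eu := TR_eta Tu; have et := TR_eta TtN; have ee := eta_iota Ou.
have ru : rho u1 = rho u.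
  rewrite /u1 (rhoB eu (srM leta ee et)) (rhoM ee et) (_ : rho (iota e) = 0) ?mul0r ?subr0 //.
  by apply/(rho_eq0 ee)/(iota_max Ou).
have [||i iN ui] := IH u1 T1; rewrite ?ru //; exists i; first exact: leqW.
apply: (unit_congr dO ui); rewrite /u1 mulrBl (EB HE) addrAC subrr sub0r -mulrA (EZ HE).
by apply: (maxN dO); apply: (maxMr dO) => //; apply: C_int; exact: Om_tauX.
Qed.

(** The sum of the b j X(X-1)...(X-j+1) has degree less than g and g distinct roots, the elements of
    L being less than p. Its Newton coefficients then vanish one by one, by evaluation at 0, 1, 2,
    ... *)
Lemma newton_zero (b : nat -> FY) (L : seq nat) : uniq L -> size L = g -> (forall i, i \in L -> (i < p)%N) ->
  (forall i, i \in L -> \sum_(j < g) b j * (i ^_ j)%:R = 0) -> forall j, (j < g)%N -> b j = 0.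
Proof.
move=> uL sL HL H; have nz i : (0 < i < p)%N -> (i%:R : FY) != 0.
  move=> /nat_unit /rho_iota_unit /rho_neq0[_]; by rewrite rmorph_nat rho_nat.
pose Q : {poly FY} := \sum_(j < g) b j *: \prod_(i < j) ('X - i%:R%:P).
have Qe m : Q.[m%:R] = \sum_(j < g) b j * (m ^_ j)%:R.
  rewrite horner_sum; apply: eq_bigr => j _; rewrite hornerZ; congr (_ * _).
  elim: (val j) => [|i IH]; first by rewrite big_ord0 hornerC. rewrite big_ord_recr hornerM /= IH ffactnSr natrM hornerXsubC.
  have [im|mi] := leqP i m; first by rewrite natrB. by rewrite ffact_small // !mul0r.
have Q0 : Q = 0.
  apply: (@roots_geq_poly_eq0 _ Q [seq i%:R | i <- L]).
  - by apply/allP => _ /mapP[i iL ->]; rewrite /root Qe H.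
  - rewrite map_inj_in_uniq //.
    suff H2 i j : (i < p)%N -> (j <= i)%N -> (i%:R : FY) = j%:R -> i = j.
      move=> i j iL jL e; have [le|/ltnW le] := leqP j i; first exact: H2 (HL _ iL) le e.
      by apply/esym; exact: H2 (HL _ jL) le (esym e).
    move=> ip ji e; apply/eqP; rewrite eqn_leq ji andbT -subn_eq0 -leqn0 leqNgt; apply/negP => lt.
    have := nz (i - j)%N; rewrite lt natrB // e subrr eqxx => /(_ _)/negP; apply=> //=; lia.
  - rewrite size_map sL; apply: (leq_trans (size_sum _ _ _)); apply/bigmax_leqP => j _.
    have sz : size (index_enum 'I_j) = j by rewrite /index_enum unlock -enumT size_enum_ord.
    by apply: (leq_trans (size_scale_leq _ _)); rewrite size_prod_XsubC sz.
move=> j; elim/ltn_ind: j => j IH jg; have := Qe j; rewrite Q0 horner0 (bigD1 (Ordinal jg)) //= ffactnn.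
rewrite big1 ?addr0 => [/esym/eqP|i]; last first.
  move=> ne; have [lt|ge] := ltnP i j; first by rewrite IH ?mul0r.
  by rewrite ffact_small ?mulr0 // ltn_neqAle ge andbT eq_sym; apply: contraNneq ne => e; apply/eqP/val_inj.
rewrite mulf_eq0 => /orP[/eqP //|]; rewrite -[_%:R]rho_nat -(rmorph_nat iota).
by have [|_ /negP] := (rho_neq0 _).1 (rho_iota_unit (fact_unit (i := j) _)); first by lia.
Qed.

Hypothesis Kp0 : p%:R != 0 :> K.
Let pK k : p%:R ^+ k != 0 :> K. Proof. exact: expf_neq0. Qed.

Lemma int_dvd n (l : int) : OK (l%:~R / p%:R ^+ n) -> exists l' : int, l = (p ^ n)%N%:Z * l'.
Proof.
elim: n l => [|n IH] l Ol; first by exists l; rewrite mul1r.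
have [/dvdzP[l1 el]|ndv] := boolP (p%:Z %| l)%Z.
  have [|l2 el2] := IH l1.
    by move: Ol; rewrite el rmorphM /= -pmulrn exprSr; congr OK; field; rewrite Kp0 pK.
  by exists l2; rewrite el el2 expnS PoszM; ring.
have cop : coprimez p%:Z l by rewrite coprimezE /= prime_coprime.
have [[u v] /= e] := coprimezP _ _ cop; case: (not_max1 dO).
rewrite -[1]/(1%:~R) -e rmorphD !rmorphM /=; apply: (maxD dO).
  by apply: (maxMl dO); [exact: (sr_int dO)|exact: pm].
rewrite -[X in _ * X](divfK (pK n.+1)) exprS mulrA mulrC -mulrA; apply: (maxMr dO); first exact: pm.
apply: (srM dO); first by apply: (srX dO); case: pm.
by apply: (srM dO); [exact: (sr_int dO)|rewrite -exprS].
Qed.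
Lemma zeta_p : zeta ^+ p = zeta.
Proof.
have d1 : (1 < d)%N by have := dg1; have := g_ge2; lia.
have e1 : (p %% d)%N = 1%N by rewrite p_mod_d modn_small.
by rewrite {1}(divn_eq p d) e1 exprD mulnC exprM zeta_d expr1n mul1r.
Qed.
(** Teichmueller's iteration: zeta^p = zeta because p = 1 modulo d, and taking p-th powers improves
    a congruence by a factor p. *)
Lemma zeta_step z N : (0 < N)%N -> OK ((zeta - z%:R) / p%:R ^+ N) ->
  OK ((zeta - (z ^ p)%N%:R) / p%:R ^+ N.+1).
Proof.
move=> N0 H; have Oz : OK zeta by case: zeta_unit.
set w := (zeta - _) / _ in H; have ez : zeta = z%:R + p%:R ^+ N * w.
  by rewrite /w [_ * (_ / _)]mulrC divfK // addrC subrK.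
have Op : OK p%:R := sr_nat dO p.
have On := sr_nat dO z.
have -> : (zeta - (z ^ p)%N%:R) / p%:R ^+ N.+1 =
    w * ((\sum_(i < p) zeta ^+ (p.-1 - i) * z%:R ^+ i) / p%:R).
  rewrite natrX -[in LHS]zeta_p subrXX {1}ez addrAC subrr add0r. by rewrite exprS; field; rewrite Kp0 pK.
apply: (srM dO) => //.
have cgi n : exists2 b, OK b & zeta ^+ n = z%:R ^+ n + p%:R * b.
  exists (p%:R ^+ N.-1 * w * \sum_(i < n) zeta ^+ (n.-1 - i) * z%:R ^+ i).
    apply: (srM dO); first by apply: (srM dO) => //; exact: (srX dO).
    by apply: (sr_sum dO) => i _; apply: (srM dO); exact: (srX dO).
  have e2 : zeta - z%:R = p%:R * (p%:R ^+ N.-1 * w) by rewrite mulrA -exprS prednK // {1}ez addrAC subrr add0r.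
  by rewrite mulrA -e2; apply/eqP; rewrite addrC -subr_eq subrXX.
pose T := \sum_(i < p) zeta ^+ (p.-1 - i) * z%:R ^+ i.
have [b Ob eb] : exists2 b, OK b & T = p%:R * b.
  have Cb (i : 'I_p) : exists b, OK b /\ zeta ^+ (p.-1 - i) = z%:R ^+ (p.-1 - i) + p%:R * b.
    by have [b ? ?] := cgi (p.-1 - i)%N; exists b.
  have [b bP] := choice Cb. exists (z%:R ^+ p.-1 + \sum_i b i * z%:R ^+ i).
    apply: (srD dO); first exact: (srX dO). by apply: (sr_sum dO) => i _; apply: (srM dO); [case: (bP i)|exact: (srX dO)].
  rewrite mulrDr mulr_sumr mulr_natl -[X in _ *+ X]card_ord -sumr_const -big_split; apply: eq_bigr => i _ /=.
  have ip : (i <= p.-1)%N by rewrite -ltnS prednK ?prime_gt0. by have [_ ->] := bP i; rewrite mulrDl -exprD subnK // mulrA.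
by rewrite -/T eb mulrAC divff // mul1r.
Qed.
Lemma zeta_nat n (z0 : int) : (0 < n)%N -> OK ((zeta - z0%:~R) / p%:R ^+ n) ->
  forall N, exists z : nat, OK ((zeta - z%:R) / p%:R ^+ N).
Proof.
move=> n0 H; have Op : OK p%:R := sr_nat dO p.
have base : exists z : nat, OK ((zeta - z%:R) / p%:R ^+ 1).
  (* A non-negative representative of z0 modulo p. *)
  exists (absz (z0 + p%:Z * `|z0|)); rewrite expr1. have e0 : (absz (z0 + p%:Z * `|z0|))%:Z = z0 + p%:Z * `|z0|.
    by rewrite gez0_abs //; have := prime_gt1 pr; nia.
  have -> : (absz (z0 + p%:Z * `|z0|))%:R = z0%:~R + p%:R * (`|z0|)%:~R :> K.
    by rewrite -[_%:R]/((absz (z0 + p%:Z * `|z0|))%:Z%:~R) e0 rmorphD rmorphM.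
  rewrite opprD addrA mulrBl; apply: (srB dO).
    have := srM dO H (srX dO n.-1 Op); congr OK. by rewrite -[in X in _ / X](prednK n0) exprSr; field; rewrite Kp0 pK.
  by rewrite mulrC mulKf //; exact: (sr_int dO).
have [z1 H1] := base; move=> N.
suff [z Hz] : exists z : nat, OK ((zeta - z%:R) / p%:R ^+ N.+1).
  exists z; have := srM dO Hz Op; congr OK; by rewrite exprSr; field; rewrite Kp0 pK.
elim: N => [|N [z IH]]; first by exists z1.
by exists (z ^ p)%N; exact: zeta_step.
Qed.

(** * Sections and gaps of D *)

Section Theta.
Variables (D : set F -> int) (DY : set FY -> int).
Hypotheses (HD : is_divisor X D) (dD : degree iota D = 0).
Hypothesis DR : forall x, cl x -> x <> oo -> R `<=` x -> D x = 0.
Hypothesis HDY : forall y, csp y -> exists h, [/\ unit_in eta h,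
  forall x, cl x -> y `<=` x -> has_order x h (D x) & has_order (rho @` y) (rho h) (DY (rho @` y))].
Hypothesis HWGL : gap_sequence X D oo = gap_sequence Y DY (rho @` R).
Local Notation gpD := (gap_sequence X D oo).
Local Notation tD := (s ^ D oo).
Lemma D_loceq : loceq D tD.
Proof.
split=> [|x cx Rsx]; first exact: (unitXz leta).
have dx := Xd cx; rewrite (ordvXz dx) //; have [->|xo] := pselect (x = oo); first by rewrite sord mulr1.
by rewrite (ordv_unit dx) ?mulr0 ?DR //; exact: sx.
Qed.
(** Both s^(D oo) and the equation h supplied by [HDY] cut out the closure of D near the section, so
    by normality they differ by a unit of R. *)
Lemma DY_oo : DY (rho @` R) = D oo.
Proof.
have [h [uh oh oY]] := HDY R_csp; have [ut Ht] := D_loceq.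
have uu : unit_in R (h / tD).
  have u := unitM leta uh (unitV ut); have [u0 e1 e2] := u; have [h0 _ _] := uh; have [t0 _ _] := ut.
  have ox x : cl x -> R `<=` x -> unit_in x (h / tD).
    move=> cx Rsx; have dx := Xd cx; apply: (unit_ordv dx) => //.
    by rewrite (ordv_div dx) // (ordvE dx (oh _ cx Rsx)) Ht // subrr.
  by split=> //; apply: (normality R_csp) => // x cx Rsx; have [] := ox x cx Rsx.
have [_ Ru _] := uu; have [eu eh] : eta (h / tD) /\ eta tD by split; [mem|case: ut].
have [_ r0] := (rho_neq0 _).1 ut; have uY := (R_rho_unit Ru).2 uu.
rewrite -(ordvE dYo oY); have [t0 _ _] := ut; rewrite -{1}(divfK t0 h) (rhoM eu eh).
have [u0 _ _] := uY; rewrite (ordvM dYo) // (ordv_unit dYo uY) add0r rhoXz // (ordvXz dYo) ?rho_s0 //.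
by rewrite ordY_s mulr1.
Qed.
Lemma D_rdegs n : rdegs (Wt D tD) n -> exists2 k : nat, n = k%:Z & ~ gpD k.
Proof.
move=> rn; have n0 := rdegs_ge0 D_loceq HD dD rn; exists (absz n); first by lia.
rewrite HWGL => /(gapE Yd YR); apply; rewrite DY_oo.
have [_ [[v Mv <-] ew r0 dn]] := rn; have [ut _] := D_loceq; have [t0 et et'] := ut.
have ev : eta v by rewrite -[v](mulKf t0); mem.
rewrite (rhoM et ev) in r0 dn; have [rt rv] : rho tD != 0 /\ rho v != 0.
  by move: r0; rewrite mulf_eq0 negb_or => /andP[].
exists (rho v); split=> //; last first.
  move: dn; rewrite (dgM dYo) // rhoXz // /dg (ordvXz dYo) ?rho_s0 // ordY_s; lia.
move=> z cz zR _; have [y cy ez] := Y_closed cz; have [h [uh oh oY]] := HDY cy; have [h0 eh _] := uh.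
have yvh : y (v * h).
  apply: (normality cy (srM leta ev eh)) => x cx yx; have dx := Xd cx; apply/(ordv_ge0 dx).
  have xo : x <> oo by move=> xo; apply: zR; rewrite ez (csp_oo cy) // -xo.
  rewrite /vge mulf_eq0 negb_or => /andP[v0 _]; rewrite (ordvM dx) // (ordvE dx (oh _ cx yx)). by have := Mv x cx xo v0; lia.
have dz := Yd cz; have [_ rh] := (rho_neq0 _).1 uh; rewrite ez in dz *.
have := (ordv_ge0 dz (rho v * rho h)).1; rewrite -(rhoM ev eh) => /(_ (ex_intro2 _ _ _ yvh erefl)).
by rewrite (rhoM ev eh) /vge mulf_neq0 // => /(_ isT); rewrite (ordvM dz) // (ordvE dz oY); lia.
Qed.
Lemma D_good : good_lattice (Wt D tD) gpD.
Proof.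
have [t0 et _] := D_loceq.1; split; [exact: Wt_csub D_loceq|by move=> h N; exact: Wt_TR D_loceq| | |exact: D_rdegs].
  move=> n; rewrite (gapE Xd coo) notK (degs_scale Xd coo mu) //.
  rewrite /= /dg (D_loceq.2 oo coo Rx); split; by congr degs; lia.
(* A section of negative degree, scaled to a unit at eta, is divisible by s in R, so its reduction
   would have negative degree too, against [rdegs_ge0]. *)
move=> n [h [Wh h0 dh]]; rewrite leNgt; apply/negP => n0; have [k uk] := scale_eta h0.
pose h1 := iota (pi ^ k) * h; have Ck : CX (iota (pi ^ k)) by exists (pi ^ k).
have W1 : Wt D tD h1 by exact: (csZ (Wt_csub D_loceq)).
have d1 : dle oo (-1) h1.
  by apply: (dleZ doo CX_V (CX_oo)) => // _; rewrite dh; lia.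
have [h10 e1 _] := uk; have T0 : TR 0 h1.
  by apply: (Wt_TR D_loceq W1 e1) => h1n; have := d1 h1n; lia.
rewrite /TR /= mulr1 in T0; have Rq : R (h1 / s).
  by apply: (sgen T0); apply/(ordv_max doo) => h1n; have := d1 h1n; rewrite /dg; lia.
have [_ r0] := (rho_neq0 _).1 uk; have : 0 <= dgY (rho h1).
  by apply: (rdegs_ge0 D_loceq HD dD); exists h1.
have : max_ideal (rho @` R) (rho h1).
  rewrite -[h1](divfK s0) (rhoM (Re Rq)); last mem. by apply: (maxMl dYo); [exists (h1 / s)|exact: unif_max dYo rho_s].
by move/(ordv_max dYo) => /(_ r0); rewrite /dg; lia.
Qed.
Lemma D_gaps : exists L : seq nat, [/\ uniq L, size L = g & forall i, i \in L <-> gpD i].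
Proof.
have [L [uL sL HL]] := idx_gaps (Wt_idx D_loceq HD dD) (gl_ge0 D_good).
exists L; split=> // i; rewrite HL; split=> [n|G /(gl_degs D_good)]; last by [].
by apply: contrapT => /(gl_degs D_good).
Qed.
Lemma D_gaps_small i : gpD i -> (i < 2 * g)%N.
Proof.
have [L [_ sL HL]] := D_gaps; apply: (gaps_small (L := L)); [by rewrite sL|by move=> j /HL|].
move=> j k /degA [a [Aa a0 da]] /(gl_degs D_good) [v [Wv v0 dv]]; apply/(gl_degs D_good).
exists (a * v); split; [exact: Wt_AM|by rewrite mulf_neq0|by rewrite (dgM doo) // da dv].
Qed.

(** Downward induction on the degree: w l contributes to the coordinate at n only if l >= n. At a
    gap there is no term with l = n, so the coordinate comes from higher terms and gains a factor
    a. *)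
Lemma coord_bound (w : nat -> F) (kk : nat -> K) (N : nat) (a B : K) Z : OK a -> a != 0 -> B != 0 -> (2 * g <= N)%N ->
  (forall n, ~ gpD n -> monic_at n (w n)) ->
  (forall n, OK (kk n)) -> (forall n, gpD n -> kk n = 0) -> Z = \sum_(n < N.+1) iota (kk n) * w n ->
  (forall n, OK (Cf n Z / (a ^+ minn n (2 * g) * B))) ->
  forall n, gpD n -> OK (Cf n Z / (a ^+ n.+1 * B)).
Proof.
move=> Oa an0 Bn0 gN wP Ok gk eZ CZ.
have le i j y : (i <= j)%N -> OK (y / (a ^+ j * B)) -> OK (y / (a ^+ i * B)).
  move=> ij H; have := srM dO (srX dO (j - i) Oa) H; congr OK.
  by rewrite -[in a ^+ j](subnK ij) exprD; field; rewrite Bn0 !expf_neq0.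
have step n : (n <= N)%N -> (forall l, (n < l <= N)%N -> OK (kk l / (a ^+ minn l (2 * g) * B))) ->
    OK ((Cf n Z - kk n) / (a ^+ minn n.+1 (2 * g) * B)).
  move=> nN H; rewrite -ltnS in nN; rewrite {1}eZ mulr_suml (E_sum HE).
  rewrite (eq_bigr (fun i : 'I_N.+1 => kk i * Cf n (w i))); last by move=> i _; rewrite -mulrA (EZ HE).
  have kn : kk n * Cf n (w n) = kk n.
    by have [/gk ->|/wP[_ ->]] := pselect (gpD n); rewrite ?mul0r ?mulr1.
  rewrite (bigD1 (Ordinal nN)) //= kn addrAC subrr add0r mulr_suml; apply: (sr_sum dO) => i ne.
  have [/gk ->|/wP[Tw _]] := pselect (gpD i); first by rewrite !mul0r; mem.
  case: (ltngtP i n) => [lt|lt|e]; first by rewrite (C_low Tw lt) mulr0 mul0r; mem.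
    rewrite mulrAC; apply: (srM dO); last by apply: C_int; exists i.
    by apply: (le _ (minn i (2 * g))); [lia|apply: H; rewrite lt -ltnS /=].
  by case/eqP: ne; apply/val_inj.
have bd j : forall n, (n <= N)%N -> (N - n < j)%N -> OK (kk n / (a ^+ minn n (2 * g) * B)).
  elim: j => // j IH n nN lt; rewrite -[kk n](subKr (Cf n Z)) mulrBl; apply: (srB dO) => //.
  apply: (le _ (minn n.+1 (2 * g))); [lia|apply: step => // l /andP[nl lN]]. by apply: IH => //; lia.
move=> n gn; have n2 := D_gaps_small gn; have := step n (ltnW (leq_trans n2 gN)).
rewrite gk // subr0 (minn_idPl n2); apply=> l /andP[_ lN]; exact: (bd (N - l).+1).
Qed.

(** * The case of a nontrivial exponential *)

Section Large.
Variables (P Q : set F -> int) (m : nat) (f t h0 psi a0 v0 : F) (x : K).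
Hypotheses (HQ : is_divisor X Q) (dQ : degree iota Q = 0) (psi0 : psi != 0).
Hypothesis eQ : forall y, cl y -> P y + D y = Q y + ordv y psi.
Hypotheses (h00 : h0 != 0) (Hh0 : H0 X (twist Q (g%:Z - 1) oo) h0).
Hypotheses (m0 : (0 < m)%N) (P0 : forall y, cl y -> y <> oo -> 0 <= P y) (lt : loceq P t) (Ot : Om t).
Hypotheses (Af : A0 f) (rf : rho f = 1) (of_ : forall y, cl y -> ordv y f = m%:Z * P y).
Hypotheses (x0 : x != 0) (mx : max_ideal OK x) (Aa0 : A0 a0) (ra0 : rho a0 = 1) (uv0 : unit_in R v0).
Hypothesis cx : cg (x ^+ (2 * g)) (t * a0 * v0) (ex x).
Local Notation q := (x ^+ (2 * g)).
Let Ox : OK x. Proof. by case: mx. Qed.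
Let q0 : q != 0. Proof. by rewrite expf_neq0. Qed.

(** h0 / psi is a section of P + D with bounded pole at oo. The factor f, of divisor m P with P >= 0
    off oo, makes it a section of D, and f1 and a1, inverse to f and a0 modulo q, undo the change.
    In local terms, division by t becomes multiplication by exp (- x T). *)
Lemma section_w : exists u Z, [/\ TR g.-1 u, exists2 i, (i < g)%N & unit_in OK (Cf i u), Wt D tD Z, eta Z & cg q Z (ex (- x) * u)].
Proof.
have [[t0 et et'] Ht] := lt; have [[tD0 etD etD'] HtD] := D_loceq.
have n1 : t * tD / psi != 0 by rewrite !mulf_neq0 ?invr_eq0.
have [j ut1] := scale_eta n1; pose t1 := iota (pi ^ j) * (t * tD / psi).
have cu i y : cl y -> ordv y (iota (pi ^ i)) = 0 /\ iota (pi ^ i) != 0.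
  move=> cy; have p0 : iota (pi ^ i) != 0 by rewrite fmorph_eq0 expfz_neq0 // pi0.
  by split=> //; apply: (ordv_unit (Xd cy)); split; rewrite -?fmorphV //; exact: XK.
have lQ : loceq Q t1.
  split=> // y cy Rsy; have dy := Xd cy; have [oj oj0] := cu j y cy.
  rewrite (ordvM dy) // oj (ordv_div dy) ?mulf_neq0 // (ordvM dy) // Ht // HtD //. by rewrite eQ // add0r addrK.
have h2n : t1 * h0 != 0 by rewrite mulf_neq0 //; case: ut1.
have [MQ dh0] := (H0_twist Xd coo _ _ _).1 Hh0.
have [k uw] := scale_eta h2n; pose w := iota (pi ^ k) * (t1 * h0).
have [w0 ew _] := uw; have Cp i : CX (iota (pi ^ i)) by exists (pi ^ i).
have Ww : Wt Q t1 w by apply: (csZ (Wt_csub lQ)) => //; exists h0.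
have dw : dle oo g.-1%:Z w.
  apply: (dleZ doo CX_V (CX_oo)) => // _; have [t10 _ _] := ut1; move: (dh0 h00).
  by rewrite (dgM doo t10 h00) {2}/dg (lQ.2 oo coo Rx); clear -g0; lia.
have Tw := Wt_TR lQ Ww ew dw; have [_ Rv0 _] := uv0.
have [_ rw] := (rho_neq0 _).1 uw; have uY := (R_rho_unit Rv0).2 uv0; have [rv _ _] := uY.
have ev := Re Rv0; pose u := w * v0.
have Tu : TR g.-1 u by rewrite /u /TR /= mulrAC; mem.
have du : 0 <= dgY (rho u).
  rewrite (rhoM ew ev) (dgM dYo rw rv) (dg_unit dYo uY) addr0. by apply: (rdegs_ge0 lQ HQ dQ); exists w.
have ru : rho u != 0 by rewrite (rhoM ew ev) mulf_neq0.
pose n := absz (ordv OK q).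
have Opq : OK (pi ^+ n / q).
  apply/(ordv_ge0 dO) => _. rewrite (ordv_div dO) // (ordvXn _ dO (pi0)) (ordv_unif dO upi) /n.
  by rewrite mulr1 gez0_abs ?subrr //; exact: (ordv_ge0 dO q).1 (srX dO _ Ox) q0.
have inv h : A0 h -> rho h = 1 -> exists h', A0 h' /\ cg q (h * h') 1.
  move=> Ah rh; have [h' Ah' [_ H]] := A0_inv n Ah rh.
  by exists h'; split=> //; apply: (cg_le sOm OmO q0 _ Opq); [rewrite expf_neq0 ?pi0|mem].
have [f1 [Af1 cf]] := inv f Af rf; have [a1 [Aa1 ca]] := inv a0 Aa0 ra0.
pose Z := f1 * (a1 * (iota (pi ^ k) * (iota (pi ^ j) * (tD * (f * h0 / psi))))).
have eZ : t * Z = f * f1 * (a1 * w) by rewrite /Z /w /t1; ring.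
have WZ : Wt D tD Z.
  apply: (Wt_AM (proj1 Af1)); apply: (Wt_AM (proj1 Aa1)); do 2 apply: (csZ (Wt_csub D_loceq)) => //.
  exists (f * h0 / psi) => // y cy yo; have dy := Xd cy; rewrite /vge mulf_eq0 invr_eq0 negb_or psi0 andbT => fh.
  rewrite (ordv_div dy) //; move: fh; rewrite mulf_eq0 negb_or => /andP[f0 _]; rewrite (ordvM dy) // of_ //.
  by move: (MQ y cy yo h00) (eQ cy) (P0 cy yo); clear -m0; nia.
have eZ' : eta Z.
  have -> : Z = t^-1 * (f * f1 * (a1 * w)) by rewrite -eZ mulKf. by mem.
have OZ : Om Z.
  by exists (absz (dgX Z)); apply: (Wt_TR D_loceq WZ eZ') => _; rewrite lez_abs.
have [Of1 Oa1 Ou] : [/\ Om f1, Om a1 & Om u] by split; [mem|mem|exists g.-1].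
have [Of Oa0 Ov0] : [/\ Om f, Om a0 & Om v0] by split; [mem|mem|mem].
have Oxn : OK (- x) by mem.
have [Oe Oen] : Om (ex x) /\ Om (ex (- x)) by split; exact: ex_Om.
have O1 := sr1 sOm; have H1 : cg q (ex x * Z) u.
  apply: (cg_trans sOm (x := t * a0 * v0 * Z)).
    by mem.
  have -> : t * a0 * v0 * Z = (f * f1) * (a0 * a1) * u by rewrite (_ : _ * Z = t * Z * (a0 * v0)); [rewrite eZ /u; ring|ring].
  rewrite -[X in cg _ _ X]mul1r; apply: (cgM sOm) => //; last mem.
  by rewrite -[X in cg _ _ X]mul1r; apply: (cgM sOm) => //; mem.
exists u, Z; split=> //.
  by have [i iN ui] := unit_coord Tu ru du; exists i => //; rewrite -(prednK g0) ltnS.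
apply: (cg_trans sOm (x := ex (- x) * (ex x * Z))).
  rewrite mulrA -{1}[Z]mul1r; apply: (cgM sOm) => //; [mem| |exact: (cgR sOm)].
  have Ox1 : OK (x / x) by rewrite mulfV //; mem.
  by have := ex_mul x0 Ox (_ : OK (- x / x)) Ox1; rewrite addNr ex0 mulNr => H; apply: (cg_sym sOm); apply: H; mem.
by mem.
Qed.

(** A section of D has no free coordinates at the gaps of D, which imposes g conditions on the g
    coordinates of u. Scaling T by a = - x extracts their leading part modulo a: the values at the
    gaps of a polynomial of degree less than g. *)
Lemma large_torsion : False.
Proof.
have [u [Z [Tu [i1 i1g ui1] WZ eZ cZ]]] := section_w.
have [w wP] : {w : nat -> F & forall n, ~ gpD n -> Wt D tD (w n) /\ monic_at n (w n)}.
  apply: (@choice _ _ (fun n v => ~ gpD n -> Wt D tD v /\ monic_at n v)) => n.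
  have [gn|/(good_basis D_good) [v Wv mv]] := pselect (gpD n); first by exists 0. by exists v.
pose N := maxn (absz (dgX Z)) (2 * g); have gN : (2 * g <= N)%N by exact: leq_maxr.
have TZ : TR N Z.
  by apply: (TR_le (leq_maxl _ _)); apply: (Wt_TR D_loceq WZ eZ) => _; rewrite lez_abs.
have [kk [Ok gk ek]] := good_expand D_good wP WZ TZ.
pose a := - x; have Oa : OK a by exact: (srN dO). have an0 : a != 0 by rewrite oppr_eq0.
have an k : a ^+ k != 0 by exact: expf_neq0.
have Ou : Om u by exists g.-1.
(* The coordinates of u after scaling T by a. Division by B, the one of least valuation, makes them
   integral with one entry equal to 1. *)
pose b j := Cf j u / a ^+ j.
have bi1 : b i1 != 0 by rewrite mulf_neq0 ?invr_eq0 //; case: ui1.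
have [i0 bi0 Hi0] : exists2 i0, b i0 != 0 & forall j, OK (b j / b i0).
  have [i bi Hi] := @arg_minP _ _ _ (Ordinal i1g) (fun i : 'I_g => b i != 0) (fun i : 'I_g => ordv OK (b i)) bi1.
  exists i => // j; have [->|bj] := eqVneq (b j) 0; first by rewrite mul0r; mem. have [jg|gj] := ltnP j g; last first.
    by move: bj; rewrite /b (C_low Tu) ?mul0r ?eqxx // prednK.
  apply/(ordv_ge0 dO) => _; rewrite (ordv_div dO) // subr_ge0; exact: (Hi (Ordinal jg)).
pose B := b i0; have B0 : B != 0 := bi0.
have OB : OK B^-1.
  have -> : B^-1 = b i1 / B * (a ^+ i1 / Cf i1 u).
    by have [c0 _ _] := ui1; rewrite mulrAC /b mulrA divfK // mulfV // mul1r.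
  by apply: (srM dO) => //; apply: (srM dO); [exact: (srX dO)|case: ui1].
have Of i : (i < 2 * g)%N -> OK (i`!%:R)^-1 by move=> /fact_unit[].
(* The coordinate of exp (a T) u at T^n is a^n times a convolution of b with the 1 / l!. The terms
   with l > n contain a^(n+1), and the congruence for Z costs a^(2g). *)
have main n : OK ((Cf n Z - a ^+ n * \sum_(l < 2 * g | (l <= n)%N) b (n - l)%N / l`!%:R) / (a ^+ minn n.+1 (2 * g) * B)).
  have pw l y : (minn n.+1 (2 * g) <= l)%N -> OK y -> OK (a ^+ l * y / (a ^+ minn n.+1 (2 * g) * B)).
    move=> le Oy; have := srM dO (srM dO (srX dO (l - minn n.+1 (2 * g)) Oa) Oy) OB; congr OK.
    by rewrite -[in a ^+ l](subnK le) exprD; field; rewrite B0 an.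
  have H := C_cong n cZ q0.
  have -> : Cf n Z = q * ((Cf n Z - Cf n (ex a * u)) / q) + Cf n (ex a * u) by rewrite [q * _]mulrC divfK // subrK.
  rewrite -addrA mulrDl; apply: (srD dO).
    by move: H; rewrite (_ : q = a ^+ (2 * g)) => [H|]; [exact: pw (geq_minr _ _) H|rewrite /a !exprM sqrrN].
  rewrite exE mulr_suml mulr_suml (E_sum HE) [X in a ^+ n * X]big_mkcond mulr_sumr -sumrB mulr_suml; apply: (sr_sum dO) => l _.
  rewrite -(mulrA (iota _) _ u) -(mulrA (iota _)) (EZ HE); case: ifP => [le|/negbT]; last first.
    rewrite -ltnNge => nl; rewrite mulr0 subr0 -(mulrA (a ^+ l)); apply: pw; first by rewrite geq_min nl.
    by apply: (srM dO); [exact: Of|apply: C_int; exact: (srM sOm (Om_tauX l))].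
  rewrite (C_tau _ le) /b -{2}(subnK le) exprD.
  have -> : forall k1 k2 k3 k4 k5 : K, k2 != 0 -> k1 * k3 * k4 - k2 * k1 * (k4 / k2 * k3) = 0.
    by move=> k1 k2 k3 k4 k5 n0; field.
  - by rewrite mul0r; mem.
  - exact: 0.
  exact: an.
have Ob n : OK (\sum_(l < 2 * g | (l <= n)%N) b (n - l)%N / l`!%:R / B).
  apply: (sr_sum dO) => l _; rewrite mulrAC; apply: (srM dO) => //; exact: Of.
have CZ n : OK (Cf n Z / (a ^+ minn n (2 * g) * B)).
  have le : (minn n (2 * g) <= minn n.+1 (2 * g))%N by clear; lia.
  have := srD dO (srM dO (main n) (srX dO (minn n.+1 (2 * g) - minn n (2 * g)) Oa))
                 (srM dO (Ob n) (srX dO (n - minn n (2 * g)) Oa)).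
  rewrite -mulr_suml; set S := \sum_(_ < _ | _) _; congr OK.
  rewrite -[in a ^+ minn n.+1 _](subnK le) -[in a ^+ n * S](subnK (geq_minl n (2 * g))) !exprD. by field; rewrite B0 !an.
have fin := coord_bound Oa an0 B0 gN (fun n ng => proj2 (wP n ng)) Ok gk ek CZ.
have [L [uL sL HL]] := D_gaps; pose beta j := b j / B.
have Obt j : OK (beta j) by exact: Hi0.
have bg j : (g <= j)%N -> beta j = 0 by move=> gj; rewrite /beta /b (C_low Tu) ?mul0r // prednK.
suff H0 : forall j, (j < g)%N -> rho (iota (beta j)) = 0.
  have i0g : (i0 < g)%N.
    by rewrite ltnNge; apply/negP => /bg /eqP; rewrite /beta mulf_eq0 invr_eq0 (negbTE B0).
  have := H0 i0 i0g; rewrite /beta mulfV // rmorph1 rho1 => /eqP; by rewrite oner_eq0.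
have pL i : i \in L -> (i < p)%N by move=> /HL /D_gaps_small lt2; exact: ltn_trans lt2 g2p.
apply: (newton_zero uL sL pL) => n nL; have gn := (HL n).1 nL; have n2 := D_gaps_small gn.
(* With j = n - l, the quotient n! / l! is a falling factorial of n, so the convolution is a
   polynomial in n in Newton form. *)
have e1 : \sum_(j < g) beta j * (n ^_ j)%:R = n`!%:R * \sum_(l < 2 * g | (l <= n)%N) b (n - l)%N / l`!%:R / B.
  rewrite -(big_ord_widen _ (fun l => b (n - l)%N / l`!%:R / B) n2) [in RHS](reindex_inj rev_ord_inj) /= mulr_sumr.
  rewrite (big_ord_widen _ (fun j => beta j * (n ^_ j)%:R) (_ : g <= 2 * g)%N); last by rewrite leq_pmull.
  rewrite [RHS](eq_bigr (fun j : 'I_n.+1 => beta j * (n ^_ j)%:R)); last first.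
    move=> j _; have jn : (j <= n)%N by rewrite -ltnS. rewrite subSS (subKn jn).
    have f0 : ((n - j)%N)`!%:R != 0 :> K by have [] := fact_unit (leq_ltn_trans (leq_subr j n) n2).
    by rewrite -(ffact_fact jn) natrM /beta; field; rewrite B0 f0.
  rewrite (big_ord_widen _ (fun j => beta j * (n ^_ j)%:R) n2) big_mkcond [RHS]big_mkcond; apply: eq_bigr => j _.
  by have [jg|/bg ->] := ltnP j g; have [//|jn] := ltnP j n.+1; rewrite ?mul0r // ffact_small ?mulr0.
have eiO i : eta (iota (beta i)) := eta_iota (Obt i).
(* As n < 2g, both estimates hold modulo a^(n+1) B; their difference shows that the convolution is
   divisible by a B. *)
have := main n; have := fin n gn; rewrite (minn_idPl n2) => F1 F2.
have F3 := srB dO F1 F2; have mS : max_ideal OK (\sum_(j < g) beta j * (n ^_ j)%:R).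
  rewrite e1; apply: (maxMl dO); first mem. have ma : max_ideal OK a by exact: (maxN dO).
  apply: (eq_rect _ (max_ideal OK) (maxMl dO F3 ma)); rewrite -mulr_suml exprS; field. by rewrite B0 an0 an.
have OS : OK (\sum_(j < g) beta j * (n ^_ j)%:R) by case: mS.
have := (rho_eq0 (eta_iota OS)).2 ((iota_max OS).1 mS); rewrite rmorph_sum.
rewrite (rf_sum Hrho leta) => [e2|i _].
  by rewrite -[RHS]e2; apply: eq_bigr => i _; rewrite rmorphM rmorph_nat (rhoM (eiO i) (sr_nat leta _)) rho_nat.
by mem.
Qed.
End Large.

Lemma torsion_theta n P : (0 < n)%N -> Jac_ptorsion1 iota X OK p n sigma zeta P ->
  Theta iota X g oo (fun x => P x + D x) -> lin_equiv X P (@zero_divisor F).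
Proof.
move=> n0 [HP dP [u u0 ou] [z0 Oz0 [h0 h00 oh0]]] [HQ dQ [t0 t00 Ht0]].
have Oz : OK zeta by case: zeta_unit.
have ordX x k : cl x -> k != 0 -> ordv x (iota k) = 0.
  by move=> cx k0; apply: (ordv_unit (Xd cx)); split; rewrite ?fmorph_eq0 -?fmorphV //; exact: XK.
have scale v : v != 0 -> exists w, [/\ unit_in eta w & forall x, cl x -> ordv x w = ordv x v].
  move=> v0; have [k uk] := scale_eta v0; exists (iota (pi ^ k) * v); split=> // x cx.
  have k0 : pi ^ k != 0 by rewrite expfz_neq0 // pi0. by rewrite (ordvM (Xd cx)) ?fmorph_eq0 // ordX // add0r.
have [f [uf of1]] := scale _ u0; have [f0 ef _] := uf.
have of_ x : cl x -> ordv x f = (p ^ n)%N%:Z * P x.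
  by move=> cx; rewrite of1 // (ordvE (Xd cx) (ou x cx)) subr0.
have oh x : cl x -> ordv x h0 = P (sigma @^-1` x) - z0 * P x.
  by move=> cx; rewrite (ordvE (Xd cx) (oh0 x cx)).
(* The integer z0, which approximates zeta modulo p^n, is replaced by natural numbers z
   approximating it to any precision. As p^n divides z - z0, the function h0 is corrected by a power
   of f. *)
have eigP N : exists (z : nat) h, [/\ h != 0, OK ((zeta - z%:R) / p%:R ^+ N) &
    forall x, cl x -> ordv x h = P (sigma @^-1` x) - z%:Z * P x].
  have Op : OK p%:R := sr_nat dO p. have [z Hz] := zeta_nat n0 Oz0 (N + n); exists z.
  have [l el] : exists l : int, z%:Z - z0 = (p ^ n)%N%:Z * l.
    apply: int_dvd; have := srB dO Oz0 (srM dO Hz (srX dO N Op)); congr OK.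
    by rewrite rmorphB /= -pmulrn exprD; field; rewrite !pK.
  exists (h0 / f ^ l); split; first by rewrite mulf_neq0 // invr_eq0 expfz_neq0.
    by have := srM dO Hz (srX dO n Op); congr OK; rewrite exprD; field; rewrite !pK.
  move=> x cx; have dx := Xd cx; rewrite (ordv_div dx) ?expfz_neq0 // (ordvXz dx) // of_ // oh //.
  by have -> : z%:Z = z0 + (p ^ n)%N%:Z * l by [rewrite -el; ring]; ring.
have [z [h1 [h10 zz oh1]]] := eigP 1%N; have [h [uh oh2]] := scale _ h10.
have [hn0 _ _] := uh.
(* This quotient has neither zeros nor poles, so it is a constant; being a unit at eta, it is a unit
   of OK. *)
pose q := sigma f / (f ^+ z * h ^+ (p ^ n)).
have sf0 : sigma f != 0 by rewrite fmorph_eq0.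
have d0 : f ^+ z * h ^+ (p ^ n) != 0 by rewrite mulf_neq0 // expf_neq0.
have q0 : q != 0 by rewrite mulf_neq0 // invr_eq0.
have oq x : cl x -> ordv x q = 0.
  move=> cx; have dx := Xd cx; have cx' := (sigma_closed x).1 cx.
  rewrite (ordv_div dx) // (ordvM dx) ?expf_neq0 // !(ordvXn _ dx) // sigma_ord // !of_ // oh2 // oh1 //. by ring.
have uq : unit_in eta q.
  apply: (unitM leta); last exact: (unitV (unitM leta (unitX leta z uf) (unitX leta _ uh))).
  have [es ms] := sigma_eta ef; have [//|m] := @unit_or_max _ eta _ es. by case: (unit_not_max uf); apply/ms.
have [a _ ea] : CX q.
  apply: A_const => [x cx _|]; first by apply/(ordv_ge0 (Xd cx)) => _; rewrite oq. by move=> _; rewrite /dg oq.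
have ua : unit_in OK a.
  have [_ e1 e2] := uq; split; first by apply: contraNneq q0 => e; rewrite -ea e rmorph0.
    by apply: eta_OK; rewrite ea.
  by apply: eta_OK; rewrite fmorphV ea.
have sf : sigma f = iota a * f ^+ z * h ^+ (p ^ n) by rewrite ea -mulrA divfK.
have mzz : max_ideal OK (z%:R - zeta).
  have -> : z%:R - zeta = - ((zeta - z%:R) / p%:R ^+ 1 * p%:R) by rewrite expr1 divfK // opprB.
  by apply: (maxN dO); apply: (maxMl dO) => //; exact: pm.
have [psi [t [v0 [[psi0 P0] [lt [N Tt]] [uv0 tv] [Af rf]]]]] := trivialize HP dP uf of_ uh ua sf mzz.
pose P' x := P x + ordv x psi.
have m0 : (0 < p ^ n)%N by rewrite expn_gt0 prime_gt0.
have of' x : cl x -> ordv x (f * psi ^+ (p ^ n)) = (p ^ n)%N%:Z * P' x.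
  by move=> cx; have dx := Xd cx; rewrite (ordvM dx) ?expf_neq0 // (ordvXn _ dx) // of_ // /P'; ring.
have eig' M : exists (z : nat) h, [/\ h != 0, OK ((zeta - z%:R) / pi ^+ M) &
    forall x, cl x -> ordv x h = P' (sigma @^-1` x) - z%:Z * P' x].
  have [z' [h' [h'0 Hz' oh']]] := eigP M; exists z', (h' * (sigma psi / psi ^+ z')).
  have sp0 : sigma psi != 0 by rewrite fmorph_eq0. split; first by rewrite !mulf_neq0 // invr_eq0 expf_neq0.
    have [b Ob eb] := OK_max_div pm; have := srM dO Hz' (srX dO M Ob); congr OK.
    have b0 : b != 0 by apply: contraNneq Kp0 => b0; rewrite eb b0 mulr0.
    by rewrite eb exprMn; field; rewrite !expf_neq0 // pi0.
  move=> x cx; have dx := Xd cx.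
  rewrite (ordvM dx) // ?mulf_neq0 ?invr_eq0 ?expf_neq0 // (ordv_div dx) ?expf_neq0 // (ordvXn _ dx) //.
  by rewrite sigma_ord // oh' // /P'; ring.
have [[x [a0 [v [x0 mx [Aa ra] uv cx]]]]|B] := dichotomy m0 P0 lt Tt Af rf of' eig' uv0 tv.
  have Ot : Om t by exists N. case: (large_torsion (P := P') HQ dQ psi0 _ t00 Ht0 m0 P0 lt Ot Af rf of' x0 mx Aa ra uv cx).
  by move=> y cy; rewrite /P'; ring.
have [w [w0 wP]] := gap_w; have [b b0 ob] := limit_b w0 wP m0 lt Tt Af rf of' B.
exists (b / psi) => [|x cx]; first by rewrite mulf_neq0 // invr_eq0.
have dx := Xd cx; have bp0 : b / psi != 0 by rewrite mulf_neq0 // invr_eq0.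
have := ordvP dx bp0; rewrite (ordv_div dx) // ob // /P' addrK; by rewrite /zero_divisor subr0.
Qed.
End Theta.
End Special.
End Surface.

(** * Completeness for a uniformizer; proof of the theorem *)

Lemma completeW (K : fieldType) (OK : set K) (pi a : K) : dvr OK -> uniformizer OK pi ->
  a != 0 -> max_ideal OK a ->
  (forall x : nat -> K, (forall N, OK ((x N.+1 - x N) / a ^+ N)) ->
    exists l, forall N, OK ((l - x N) / a ^+ N)) ->
  forall x : nat -> K, (forall N, OK ((x N.+1 - x N) / pi ^+ N)) ->
    exists l, forall N, OK ((l - x N) / pi ^+ N).
Proof.
move=> dO upi a0 ma H x Hx; have [pi0 _] := upi; have [Oa _] := ma.
have mpi := unif_max dO upi; have [Opi _] := mpi.
have le_pi M N y : (N <= M)%N -> OK (y / pi ^+ M) -> OK (y / pi ^+ N).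
  move=> NM Oy; have := srM dO Oy (srX dO (M - N) Opi); congr OK. by rewrite -{1}(subnK NM) exprD; field; rewrite !expf_neq0.
have xN M N : (N <= M)%N -> OK ((x M - x N) / pi ^+ N).
  move=> /subnK <-; elim: (M - N)%N => [|k IH]; first by rewrite subrr mul0r; exact: (sr0 dO).
  rewrite addSn -[x _](subrK (x (k + N)%N)) -addrA mulrDl; apply: (srD dO) => //.
  by apply: le_pi (Hx (k + N)%N); exact: leq_addl.
have [e ae] : exists e : nat, unit_in OK (a / pi ^+ e).
  have [k hk] := dvr_ord dO a0; have := has_orderE dO upi hk.
  have k0 : 0 <= k by rewrite -(ordvE dO hk); exact: (ordv_ge0 dO a).1 Oa a0. by exists (absz k); rewrite exprnP gez0_abs.
have e0 : (0 < e)%N.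
  by rewrite lt0n; apply/eqP => e0; move: ae; rewrite e0 divr1 => /(unit_not_max)/(_ ma).
have [_ Ou Ou'] := ae.
have aN N : OK (a ^+ N / pi ^+ (e * N)) /\ OK (pi ^+ (e * N) / a ^+ N).
  by rewrite exprM -!expr_div_n; split; [exact: (srX dO)|rewrite -invf_div; exact: (srX dO)].
(* With e the order of a, the powers a^N and pi^(e N) differ by units, so this subsequence satisfies
   the hypothesis for a. *)
have [N|l Hl] := H (fun N => x (e * N)%N).
  have := srM dO (xN (e * N.+1)%N (e * N)%N (leq_mul (leqnn e) (leqnSn N))) (aN N).2; congr OK.
  by rewrite mulrA divfK // expf_neq0.
exists l => N; have NeN : (N <= e * N)%N by rewrite leq_pmull.
rewrite -(subrK (x (e * N)%N) l) -addrA mulrDl; apply: (srD dO); last exact: xN.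
apply: (le_pi _ _ _ NeN); have := srM dO (Hl N) (aN N).1; congr OK.
by rewrite mulrA divfK // expf_neq0.
Qed.

Theorem theorem4p11
  (p : nat) (p_prime : prime p)
  (Qp : fieldType) (absp : Qp -> rat) (HQp : is_padic_field p absp)
  (K : fieldExtType Qp)
  (OK : set K) (HOK : OK = OK_of absp K)
  (* the model XX, its generic fibre X and its special fibre Y *)
  (F : fieldType) (iota : {rmorphism K -> F})
  (r : nat) (f : 'I_r.+1 -> F)
  (HXX : is_smooth_projective_curve OK iota f)
  (X : set (set F)) (HX : X = generic_fiber OK iota f)
  (eta : set F) (Heta : is_special_generic_point OK iota f eta)
  (FY : fieldType) (rho : F -> FY) (Hrho : is_residue_field eta rho)
  (Y : set (set FY)) (HY : Y = special_fiber OK iota f rho)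
  (g : nat) (g_ge2 : (2 <= g)%N) (Hg : has_genus iota X g)
  (* the section at infinity *)
  (ooX ooY : set F) (Hoo : is_section OK iota f ooX ooY)
  (* sigma = delta^* *)
  (sigma : {rmorphism F -> F}) (Hsigma : is_automorphism iota X sigma)
  (d : nat) (Hd : has_order_aut sigma d)
  (sigma_oo : sigma @^-1` ooX = ooX)
  (zeta : K)
  (Hzeta : forall t, uniformizer ooX t -> max_ideal ooX (t / sigma t - iota zeta))
  (* the trivialization and the matrix e^(1) *)
  (E : F -> int -> K) (HE : is_trivialization OK iota ooX ooY sigma zeta E)
  (mu : 'I_g -> nat)
  (Hmu : enumerates (gap_sequence X (@zero_divisor F) ooX) mu)
  (e : 'M[K]_g) (He : is_e1_matrix (affine_ring OK iota f ooX) E p mu e)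
  (* the divisor D and its specialization *)
  (D : set F -> int) (HD : is_divisor X D)
  (sigma_D : pullback_divisor sigma D = D)
  (deg_D : degree iota D = 0)
  (supp_D : [set x | D x != 0] `&` residue_disk OK iota f ooX ooY = set0)
  (DY : set FY -> int) (HDY : specializes OK iota f eta rho D DY)
  (* hypotheses on the gap sequences, on e^(1)_11, and on p and d *)
  (HWG : gap_sequence X (@zero_divisor F) ooX =
         gap_sequence Y (@zero_divisor FY) (rho @` ooY))
  (HWGL : gap_sequence X D ooX = gap_sequence Y DY (rho @` ooY))
  (He11 : let i1 := Ordinal (ltnW g_ge2) in unit_in OK (e i1 i1))
  (p_mod_d : p = 1 %[mod d])
  (d_ge : (2 * g + 1 <= d)%N) :
  forall n : nat, (0 < n)%N ->
    [set P | Jac_ptorsion1 iota X OK p n sigma zeta P] `&`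
    [set P | Theta iota X g ooX (fun x => P x + D x)]
    `<=` [set P | lin_equiv X P (@zero_divisor F)].
Proof.
move=> n n0 P [HP HT].
have [Hfun HS _] := HXX; have [_ RS Rx _ _] := Hoo.
have [HE1 HE2 HE3 HE4] := HE; have [sb sK sX] := Hsigma.
subst OK.
(* The closed point of the section is the special point from which locality of OK is deduced. *)
have lO := special_OK_local (OK_sub p_prime HQp K) RS.
have dO := OK_dvr p_prime HQp lO; have nO := OK_noeth p_prime HQp lO.
have pm := OK_p_max p_prime HQp lO; have Hq := OK_residue p_prime HQp lO.
have Hp0 : p%:R != 0 :> K := Kp0 p_prime HQp K.
have [pi upi] := dvr_unif dO.
have Hcompl := completeW dO upi Hp0 pm (OK_complete p_prime HQp (K := K)).
have d1 : (1 < d)%N by lia.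
have [s [Rs s0 s1 ss]] := R_s dO p_prime pm Hoo HE1 HE2 sK HE4 Hd p_mod_d d1.
have gapX := Hmu.2; subst X Y; rewrite -gapX in HWG.
apply: (torsion_theta dO nO Hfun HS upi p_prime pm Hq Heta Hrho Hoo (esym gapX) (esym HWG)
  HE1 HE2 HE3 sK sX HE4 Hd p_mod_d d1 Rs s0 s1 sb sigma_oo ss Hmu Hg g_ge2 d_ge Hcompl Hp0 HD deg_D _ _
  HWGL n0 HP HT) => [x cx xo Rsx|y cy]. apply/eqP; apply: contraT => Dx.
  have : ([set x | D x != 0] `&` residue_disk (OK_of absp K) iota f ooX ooY) x by []. by rewrite supp_D.
have [_ H] := HDY; apply: H; first by case: cy.
exact: (Y_closed_sp dO Heta Hrho cy).
Qed.
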